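(* Let $R$ be a root system in $\mathbb{R}^n$ with positive subsystem $R_+$ and Weyl group $W$, let $E=\mathbb{R}^n\setminus\bigcup_{\alpha\in R}H_\alpha$, let $C$ be a Weyl chamber and $\pi$ the projection onto $\overline C$. Let $\lambda>0$ and $\alpha\in R_+$. Let $\mathcal{A}$ be a linear operator whose domain $\mathcal{D}(\mathcal{A})$ (a linear subspace) satisfies $\mathcal{D}(\mathcal{A})\subset\mathbf{C}_K^\infty(E)$ and whose range satisfies $\mathcal{R}(\mathcal{A})\subset\mathbf{C}_K^\infty(E)$. Suppose that for every Borel probability measure $\nu$ on $E$ there exists a solution $X$ of the $\mathbf{D}^\pi_E[0,\infty)$ martingale problem $(\mathcal{A},\nu)$. Then for every Borel probability measure $\nu$ on $E$ there exists a Poisson process $N$ with parameter $\lambda$ such that $Y=X*_\alpha N$ is a solution of the $\mathbf{D}^\pi_E[0,\infty)$ martingale problem $(\mathcal{A}_{\lambda,\alpha},\nu)$, where for $u\in\mathcal{D}(\mathcal{A})$ and $x\in E$ $$\mathcal{A}_{\lambda,\alpha}u(x)=\mathcal{A}u(x)+\lambda\,(u(\sigma_\alpha x)-u(x)).$$ Furthermore, if for all $u\in\mathcal{D}(\mathcal{A})$ and $x\in E$ one has (with $u\circ\sigma_\alpha\in\mathcal{D}(\mathcal{A})$) $$\mathcal{A}(u\circ\sigma_\alpha)(x)=\mathcal{A}u(\sigma_\alpha(x)),$$ then there exists a solution of the $\mathbf{D}^\pi_E[0,\infty)$ martingale problem $(\mathcal{A}_{\lambda,\alpha},\nu)$ given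 by $$(Y_t)_{t\ge0}:=(\sigma_\alpha^{N_t}X_t)_{t\ge0},$$ where $X$ is a solution of the $\mathbf{D}^\pi_E[0,\infty)$ martingale problem $(\mathcal{A},\nu)$ and $N$ is a Poisson process with parameter $\lambda$ independent of $X$.
   Context: A root system is a finite set $R\subset\mathbb{R}^n\setminus\{0\}$ with $R\cap\mathbb{R}\alpha=\{\pm\alpha\}$ and $\sigma_\alpha(R)=R$ for all $\alpha\in R$, where $\sigma_\alpha$ is the orthogonal reflection in the hyperplane $H_\alpha=\alpha^\perp$. Roots are normalized by $\alpha\cdot\alpha=2$, so $\sigma_\alpha(x)=x-(\alpha\cdot x)\alpha$. The (finite) Weyl group $W$ is generated by $\{\sigma_\alpha:\alpha\in R\}$. A positive subsystem is $R_+=\{\alpha\in R:\alpha\cdot\beta>0\}$ for some $\beta\notin\bigcup_{\alpha\in R}H_\alpha$. A Weyl chamber is a connected component of $E$, and $\pi$ sends $x$ to the unique point of $Wx\cap\overline C$. $\mathbf{C}^\infty_K(E)$ is the space of compactly supported $C^\infty$ functions on $E$. $\mathbf{D}^\pi_E[0,\infty)$ is the set of right-continuous functions $\omega:[0,\infty)\to E$ with left limits in $E$ such that $\pi\circ\omega$ is continuous with values in $C$. A process $Z$ is a solution of the $\mathbf{D}^\pi_E[0,\infty)$ martingale problem $(\mathcal{A},\nu)$ if $Z$ has sample paths in $\mathbf{D}^\pi_E[0,\infty)$, $Z_0$ has law $\nu$, and for every $u\in\mathcal{D}(\mathcal{A})$ the process $u(Z_t)-u(Z_0)-\int_0^t\mathcal{A}u(Z_s)\,ds$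 is a martingale with respect to the natural filtration of $Z$; it is a solution for $\mathcal{A}$ if this holds with $\nu$ the law of $Z_0$. The notation $X*_\alpha N$: take random variables $(X_k,\Delta_k)_{k\ge1}$ with values in $\mathbf{D}^\pi_E[0,\infty)\times[0,\infty)$ such that each $X_k$ is a solution of the $\mathbf{D}^\pi_E[0,\infty)$ martingale problem for $\mathcal{A}$; $X_1(0)$ has law $\nu$; $\Delta_k$ is exponentially distributed with parameter $\lambda$ and independent of $(X_1,\dots,X_k,\Delta_1,\dots,\Delta_{k-1})$; and for all $A_1\in\mathcal{F}(X_l,\Delta_l:l\le k)$ and $A_2\in\mathcal{F}(X_l,\Delta_l:l\ge k+1)$, $$\mathbb{P}(A_1\cap A_2)=\mathbb{E}\big(\mathbb{I}_{A_1}\,\mathbb{P}[A_2\mid X_{k+1}(0)=\sigma_\alpha(X_k(\Delta_k))]\big)$$ (so $X_{k+1}(0)=\sigma_\alpha(X_k(\Delta_k))$ a.s., and given $X_{k+1}(0)$ the variables with index $\ge k+1$ are independent of those with index $\le k$). Put $\tau_0=0$, $\tau_k=\sum_{i=1}^k\Delta_i$, and $N_t=k$ for $\tau_k\le t<\tau_{k+1}$; $N$ is a Poisson process with parameter $\lambda$. Then $X*_\alpha N$ denotes the process $Y(t)=X_{k+1}(t-\tau_k)$ for $\tau_k\le t<\tau_{k+1}$. Thus the first assertion says that such a family $(X_k,\Delta_k)_{k\geq 1}$ exists and the resulting $Y$ solves the stated martingale problem. *)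

(* Defs.v *)
From HB Require Import structures.
From mathcomp Require Import all_boot all_order all_algebra.
From mathcomp Require Import all_classical all_reals all_analysis.

Set Implicit Arguments.
Unset Strict Implicit.
Unset Printing Implicit Defensive.

Import Order.TTheory GRing.Theory Num.Theory.
Import numFieldNormedType.Exports.

Local Open Scope classical_set_scope.
Local Open Scope ring_scope.

(* R^n is 'rV[R]_n; the library's sup norm on it induces the usual topology.
   A Borel probability measure on an open set E of R^n is a probability on
   borel_rV R n giving mass 1 to E. *)
Notation borel_rV R n := (g_sigma_algebraType (@open 'rV[R]_n)).

Section RootSystems.
Context {R : realType} {n : nat}.
Local Notation V := 'rV[R]_n.
Implicit Types (Phi C : set V) (a x : V).

Definition dotp (x y : V) : R := \sum_(i < n) x ord0 i * y ord0 i.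

Definition hyperplane a : set V := [set x | dotp a x = 0].

(* For roots, normalized by dotp a a = 2, this is x - (dotp a x) *: a. *)
Definition reflection a x : V := x - (2 * dotp a x / dotp a a) *: a.

Record root_system Phi : Prop := RootSystem {
  root_finite : finite_set Phi ;
  root_neq0 : forall a, Phi a -> a != 0 ;
  root_line : forall a, Phi a -> Phi `&` [set c *: a | c in [set: R]] = [set a; - a] ;
  root_reflection : forall a, Phi a -> reflection a @` Phi = Phi ;
  root_normalized : forall a, Phi a -> dotp a a = 2
}.

Inductive weyl_group Phi : set (V -> V) :=
| weyl_refl a : Phi a -> weyl_group Phi (reflection a)
| weyl_id : weyl_group Phi idfun
| weyl_comp g h : weyl_group Phi g -> weyl_group Phi h -> weyl_group Phi (g \o h)
| weyl_inv g h : weyl_group Phi g -> cancel g h -> cancel h g -> weyl_group Phi h.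

Definition regular_set Phi : set V := ~` \bigcup_(a in Phi) hyperplane a.

Definition positive_subsystem Phi (Rp : set V) : Prop :=
  exists2 b, regular_set Phi b & Rp = [set a | Phi a /\ 0 < dotp a b].

Definition weyl_chamber Phi C : Prop :=
  exists2 x, regular_set Phi x & C = connected_component (regular_set Phi) x.

Definition weyl_orbit Phi x : set V := [set g x | g in weyl_group Phi].

(* The point of the intersection of the orbit of x with the closed chamber,
   which is a singleton when Phi is a root system and C a Weyl chamber. *)
Definition chamber_proj Phi C x : V := get (weyl_orbit Phi x `&` closure C).

End RootSystems.

Section TestFunctions.
Context {R : realType} {n : nat}.
Local Notation V := 'rV[R]_n.

Fixpoint Ck (k : nat) (f : V -> R) : Prop :=
  continuous f /\
  if k is k'.+1 then
    forall i : 'I_n, (forall x, derivable f x (delta_mx ord0 i)) /\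
                     Ck k' ('D_(delta_mx ord0 i) f)
  else True.

Definition smooth (f : V -> R) : Prop := forall k, Ck k f.

Definition supp (f : V -> R) : set V := closure [set x | f x != 0].

(* C_K^oo(E) for an open set E, each function on E being identified with its
   extension by 0 to R^n. *)
Definition CKoo (E : set V) (f : V -> R) : Prop :=
  [/\ smooth f, compact (supp f) & supp f `<=` E].

(* A is a linear operator with domain dom and with domain and range contained
   in C_K^oo(E); the values of A outside dom are irrelevant. *)
Record linear_operator (E : set V) (dom : set (V -> R))
    (A : (V -> R) -> (V -> R)) : Prop := LinearOperator {
  dom_CKoo : forall u, dom u -> CKoo E u ;
  dom_zero : dom (fun=> 0) ;
  dom_linear : forall (c : R) u v, dom u -> dom v ->
    dom (fun x => c * u x + v x) ;
  range_CKoo : forall u, dom u -> CKoo E (A u) ;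
  operator_linear : forall (c : R) u v, dom u -> dom v ->
    A (fun x => c * u x + v x) = (fun x => c * A u x + A v x)
}.

Definition jump_operator (A : (V -> R) -> (V -> R)) (lam : R) (a : V) :
    (V -> R) -> (V -> R) :=
  fun u x => A u x + lam * (u (reflection a x) - u x).

End TestFunctions.

(* Paths and processes are functions of a real time; only their values at
   nonnegative times are ever constrained or used. *)
Section MartingaleProblem.
Context {R : realType} {n : nat}.
Local Notation V := 'rV[R]_n.

Definition Dpi_path (Phi C : set V) (w : R -> V) : Prop :=
  [/\ forall t, 0 <= t -> regular_set Phi (w t),
      forall t, 0 <= t -> w s @[s --> t^'+] --> w t,
      forall t, 0 < t ->
        exists2 l, regular_set Phi l & w s @[s --> t^'-] --> l,
      {within [set t | 0 <= t], continuous (chamber_proj Phi C \o w)} &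
      forall t, 0 <= t -> C (chamber_proj Phi C (w t))].

Definition natural_filtration {T : Type} (Z : R -> T -> V) (t : R) :
    set (set T) :=
  <<s [set S | exists s (B : set (borel_rV R n)),
        [/\ 0 <= s <= t, measurable B & S = Z s @^-1` B]] >>.

(* The last clause says that M s is a version of the conditional expectation
   of M t given F s. *)
Definition martingale d (T : measurableType d) (P : probability T R)
    (F : R -> set (set T)) (M : R -> T -> R) : Prop :=
  [/\ forall t, 0 <= t -> forall B : set R, measurable B -> F t (M t @^-1` B),
      forall t, 0 <= t -> P.-integrable [set: T] (EFin \o M t) &
      forall s t, 0 <= s -> s <= t -> forall S, F s S ->
        (\int[P]_(w in S) (M t w)%:E = \int[P]_(w in S) (M s w)%:E)%E].

(* Measurability of all the coordinates Z t is measurability of the random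
   path for the sigma-algebra generated by the evaluations. *)
Definition Dpi_solution (Phi C : set V) (dom : set (V -> R))
    (A : (V -> R) -> (V -> R)) d (T : measurableType d)
    (P : probability T R) (Z : R -> T -> V) : Prop :=
  [/\ forall t, 0 <= t -> measurable_fun [set: T] (Z t : T -> borel_rV R n),
      forall w, Dpi_path Phi C (Z^~ w) &
      forall u, dom u -> martingale P (natural_filtration Z)
        (fun t w => u (Z t w) - u (Z 0 w)
           - \int[lebesgue_measure]_(s in `[0, t]) A u (Z s w))].

Definition has_law d (T : measurableType d) (P : probability T R)
    (Z : T -> V) (nu : probability (borel_rV R n) R) : Prop :=
  forall B : set (borel_rV R n), measurable B -> P (Z @^-1` B) = nu B.

Definition Dpi_solution_from (Phi C : set V) (dom : set (V -> R))
    (A : (V -> R) -> (V -> R)) (nu : probability (borel_rV R n) R)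
    d (T : measurableType d) (P : probability T R) (Z : R -> T -> V) : Prop :=
  Dpi_solution Phi C dom A P Z /\ has_law P (Z 0) nu.

End MartingaleProblem.

Section PoissonProcesses.
Context {R : realType} d (T : measurableType d) (P : probability T R).

Definition independent (F G : set (set T)) : Prop :=
  forall S1 S2, F S1 -> G S2 -> (P (S1 `&` S2) = P S1 * P S2)%E.

Definition exponential_rv (lam : R) (D : T -> R) : Prop :=
  [/\ measurable_fun [set: T] D, forall w, 0 <= D w &
      forall B : set R, measurable B ->
        P (D @^-1` B) = exponential_prob lam B].

(* The waiting times are indexed from 0: D k is Delta_{k+1},
   so that arrival D k is tau_k = Delta_1 + ... + Delta_k. *)
Definition arrival (D : nat -> T -> R) (k : nat) (w : T) : R :=
  \sum_(i < k) D i w.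

(* N t w = k iff tau_k <= t < tau_{k+1}; in particular tau_k tends to +oo. *)
Definition counting_process (D : nat -> T -> R) (N : R -> T -> nat) : Prop :=
  forall t w, 0 <= t -> arrival D (N t w) w <= t < arrival D (N t w).+1 w.

Definition poisson_process (lam : R) (N : R -> T -> nat) : Prop :=
  exists D : nat -> T -> R,
  [/\ forall k, exponential_rv lam (D k),
      forall (K : seq nat) (B : nat -> set R), uniq K ->
        (forall k, measurable (B k)) ->
        P (\bigcap_(k in [set` K]) D k @^-1` B k)
          = (\prod_(k <- K) P (D k @^-1` B k))%E &
      counting_process D N].

End PoissonProcesses.

Section Concatenation.
Context {R : realType} {n : nat} d (T : measurableType d) (P : probability T R).
Local Notation V := 'rV[R]_n.

Definition sigma_process (Z : R -> T -> V) : set (set T) :=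
  <<s [set S | exists t (B : set (borel_rV R n)),
        [/\ 0 <= t, measurable B & S = Z t @^-1` B]] >>.

Definition sigma_counting (N : R -> T -> nat) : set (set T) :=
  <<s [set S | exists t (B : set nat), 0 <= t /\ S = N t @^-1` B] >>.

Definition sigma_family (X : nat -> R -> T -> V) (D : nat -> T -> R)
    (I J : set nat) : set (set T) :=
  <<s [set S | exists l t (B : set (borel_rV R n)),
         [/\ I l, 0 <= t, measurable B & S = X l t @^-1` B]] `|`
      [set S | exists l (B : set R),
         [/\ J l, measurable B & S = D l @^-1` B]] >>.

(* h is a version of the factorized conditional probability
   x |-> P[S | U = x]. *)
Definition cond_prob_version (S : set T) (U : T -> V) (h : V -> R) : Prop :=
  [/\ measurable_fun [set: borel_rV R n] (h : borel_rV R n -> R),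
      P.-integrable [set: T] (fun w => (h (U w))%:E) &
      forall B : set (borel_rV R n), measurable B ->
        (\int[P]_(w in U @^-1` B) (h (U w))%:E = P (S `&` U @^-1` B))%E].

(* X k and D k stand for X_{k+1} and Delta_{k+1}. In the last clause
   P[S2 | X_{k+1}(0) = x] is evaluated at x = sigma_a(X_k(Delta_k)); the
   identity is required of every version of it, which forces
   X_{k+1}(0) = sigma_a(X_k(Delta_k)) almost surely. (With the identity
   required of one version only this would fail, versions being arbitrary off
   the law of X_{k+1}(0).) *)
Record concatenable (Phi C : set V) (dom : set (V -> R))
    (A : (V -> R) -> (V -> R)) (nu : probability (borel_rV R n) R)
    (lam : R) (a : V) (X : nat -> R -> T -> V) (D : nat -> T -> R) : Prop :=
  Concatenable {
    cat_solution : forall k, Dpi_solution Phi C dom A P (X k) ;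
    cat_init : has_law P (X 0%N 0) nu ;
    cat_exponential : forall k, exponential_rv P lam (D k) ;
    cat_independent : forall k,
      independent P (sigma_family X D set0 [set k])
                    (sigma_family X D [set l | (l <= k)%N]
                                      [set l | (l < k)%N]) ;
    cat_markov : forall k S1 S2 h,
      sigma_family X D [set l | (l <= k)%N] [set l | (l <= k)%N] S1 ->
      sigma_family X D [set l | (k < l)%N] [set l | (k < l)%N] S2 ->
      cond_prob_version S2 (X k.+1 0) h ->
      P (S1 `&` S2)
        = (\int[P]_(w in S1) (h (reflection a (X k (D k w) w)))%:E)%E
  }.

Definition concatenation (X : nat -> R -> T -> V) (D : nat -> T -> R)
    (N : R -> T -> nat) : R -> T -> V :=
  fun t w => X (N t w) (t - arrival D (N t w) w) w.

End Concatenation.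

(* Main.v *)
Require Import Defs.
From HB Require Import structures.
From mathcomp Require Import all_boot all_order all_algebra.
From mathcomp Require Import ring lra zify.
From mathcomp Require Import all_classical all_reals all_analysis.
From mathcomp Require Import measurable_realfun.

Set Implicit Arguments.
Unset Strict Implicit.
Unset Printing Implicit Defensive.

Import Order.TTheory GRing.Theory Num.Theory.
Import numFieldNormedType.Exports.

Local Open Scope classical_set_scope.
Local Open Scope ring_scope.

(** Everything lives on one probability space carrying independent uniform variables [W i]. The
    variable of index 0 produces the initial point, the one of index 2k+1 the k-th waiting time, the
    one of index 2k+2 drives the k-th path. A path with values in E is coded by one real number, by
    interleaving binary digits of its values at dyadic times. Disintegrating the law of a given
    solution with respect to its initial value ([disintegration]) then writes the code as a
    measurable function of the starting point and one uniform variable. Solvability is applied to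
    the law of the k-th starting point itself, so each step has its own kernel and no selection of
    solutions measurable in the starting point is made. For almost every starting point the kernel
    is again a solution for a given u, because the martingale property reduces to countably many
    equations, indexed by dyadic times and rational rays of the code ([mg_test_martingale],
    [kernel_exists]).

    Conditioning is replaced by resampling: redrawing some of the [W i] from an independent copy
    leaves the law unchanged ([mixing]), so an expectation becomes a double integral in which all
    other coordinates are frozen. The jump times not depending on the redrawn coordinate then become
    plain numbers.

    For the martingale property of Y, the interval [s, t] is cut at the jump times. The k-th piece
    contributes the increment of the martingale of the k-th path over an interval which is fixed
    once the other coordinates are frozen; its mean on an event of the past is zero
    ([motion_mean0]). The jump that ends it contributes u(sigma x) - u(x), compensated by lambda
    times the integral of this quantity along the piece. Its mean is zero because the exponential
    density at r is lambda times the probability of waiting at least r ([exponential_identity]); an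
    event of the past of s does not depend on the waiting time as long as the jump comes after s,
    and otherwise both terms vanish ([jump_part_mean0]). Summation over k with dominated convergence
    gives [glued_martingale_step].

    The second assertion uses the same gluing lemma, on a product space, with pieces sigma^k X. For
    a fixed Poisson path the k-th piece is handled by the martingale of X for the test function u
    composed with sigma^k, as A commutes with sigma ([reflected_motion]).

    Paths of Y stay admissible because pi is invariant under reflections, so a jump is invisible to
    pi. Decoding reals into admissible paths requires a Borel description of the codes ([good]) and
    continuity of pi on E. The latter comes from the free action of the Weyl group on chambers,
    obtained from the exchange condition ([exchange], [weyl_cone_inj], [proj_locally]). That pi maps
    E into C is read off a solution started at the given point. *)

Section SigmaAlgebras.

(** * Sigma-algebras given by generators, and measurable sets *)

Lemma gen_ind T (G : set (set T)) (Q : set (set T)) :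
  Q set0 -> (forall A, Q A -> Q (~` A)) ->
  (forall A : (set T)^nat, (forall i, Q (A i)) -> Q (\bigcup_i A i)) ->
  G `<=` Q -> <<s G >> `<=` Q.
Proof.
move=> h0 hC hU hG; apply: smallest_sub => //; split => // A QA.
by rewrite setTD; exact: hC.
Qed.

(** Generators that do not separate two points generate nothing that does. This shows that an event
    of the past keeps its truth value when coordinates that it does not see are resampled. *)
Lemma gen_agree T (G : set (set T)) (w1 w2 : T) :
  (forall A, G A -> A w1 <-> A w2) ->
  forall S, <<s G >> S -> S w1 <-> S w2.
Proof.
move=> hG; apply: (gen_ind (Q := [set S | S w1 <-> S w2])) => //=.
- by move=> A [h1 h2]; split=> h hA; apply: h; [exact: h2|exact: h1].
- move=> A hA; split=> -[i _ h]; exists i => //; first exact/(hA i).1.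
  exact/(hA i).2.
Qed.

(** [F] is any family forming a sigma-algebra, so the conclusion may also be structural, such as
    being the preimage of an event of another filtration. *)
Lemma gen_preimage T T' (G : set (set T)) (F : set (set T')) (f : T' -> T) :
  sigma_algebra setT F -> (forall A, G A -> F (f @^-1` A)) ->
  forall S, <<s G >> S -> F (f @^-1` S).
Proof.
move=> [F0 FC FU] hG; apply: (gen_ind (Q := [set S | F (f @^-1` S)])) => //=.
- by move=> A hA; rewrite preimage_setC -setTD; exact: FC.
- by move=> A hA; rewrite preimage_bigcup; exact: FU.
Qed.

Lemma gen_measurable d (T : measurableType d) (G : set (set T)) :
  G `<=` measurable -> <<s G >> `<=` measurable.
Proof.
move=> hG; apply: gen_ind => //; first by move=> A; exact: measurableC.
by move=> A hA; exact: bigcupT_measurable.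
Qed.

Lemma gen_mono T (G G' : set (set T)) : G `<=` <<s G' >> -> <<s G >> `<=` <<s G' >>.
Proof.
move=> h; apply: smallest_sub => //; exact: smallest_sigma_algebra.
Qed.

Lemma measurable_sigma d (T : measurableType d) : sigma_algebra setT (@measurable d T).
Proof.
split=> //; first by move=> A mA; rewrite setTD; exact: measurableC.
by move=> A mA; exact: bigcupT_measurable.
Qed.

Lemma measurable_fun_select d (T : measurableType d) d' (U : measurableType d')
    (N : T -> nat) (f : nat -> T -> U) :
  (forall i, measurable [set w | N w = i]) ->
  (forall i, measurable_fun setT (f i)) ->
  measurable_fun setT (fun w => f (N w) w).
Proof.
move=> mN mf _ B mB; rewrite setTI.
have -> : (fun w => f (N w) w) @^-1` B =
    \bigcup_i ([set w | N w = i] `&` (f i @^-1` B)).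
  apply/seteqP; split=> [w Bw|w [i _ [/= <-]]//]; by exists (N w).
apply: bigcupT_measurable => i; apply: measurableI => //.
by rewrite -[X in measurable X]setTI; exact: mf.
Qed.

Lemma measurable_fun_lt d (T : measurableType d) (R : realType) (f : T -> R) :
  (forall r, measurable [set w | f w < r]) -> measurable_fun setT f.
Proof.
move=> h; apply: (measurability (@RGenInftyO.G R)).
  exact: RGenInftyO.measurableE.
move=> _ [_ [a ->] <-]; rewrite setTI.
by rewrite (_ : _ @^-1` _ = [set w | f w < a]) //; apply/seteqP; split=> w /=; rewrite in_itv.
Qed.

Lemma set_lt_measurable d (T : measurableType d) (R : realType) (f g : T -> R) :
  measurable_fun setT f -> measurable_fun setT g -> measurable [set w | f w < g w].
Proof.
move=> mf mg; rewrite -[X in measurable X]setTI.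
exact: (measurable_fun_ltr mf mg measurableT (Y := [set true])).
Qed.

Lemma set_le_measurable d (T : measurableType d) (R : realType) (f g : T -> R) :
  measurable_fun setT f -> measurable_fun setT g -> measurable [set w | f w <= g w].
Proof.
move=> mf mg; rewrite -[X in measurable X]setTI.
exact: (measurable_fun_ler mf mg measurableT (Y := [set true])).
Qed.

Lemma set_eq_measurable d (T : measurableType d) (R : realType) (f g : T -> R) :
  measurable_fun setT f -> measurable_fun setT g -> measurable [set w | f w = g w].
Proof.
move=> mf mg.
have -> : [set w | f w = g w] = [set w | f w <= g w] `&` [set w | g w <= f w].
  apply/seteqP; split=> [w /= ->|w [/= h1 h2]]; first by rewrite lexx.
  by apply/eqP; rewrite eq_le h1.
by apply: measurableI; exact: set_le_measurable.
Qed.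

Lemma fun_preimage_measurable d (T : measurableType d) d' (U : measurableType d')
    (f : T -> U) (B : set U) :
  measurable_fun setT f -> measurable B -> measurable (f @^-1` B).
Proof. by move=> mf mB; rewrite -[X in measurable X]setTI; exact: mf. Qed.

Lemma measurable_fun_norm d (T : measurableType d) (R : realType) (f : T -> R) :
  measurable_fun setT f -> measurable_fun setT (fun w => `|f w|).
Proof. by move=> mf; apply: (measurableT_comp (@normr_measurable R setT) mf). Qed.

Lemma set_forall_measurable d (T : measurableType d) (I : countType) (P : I -> set T) :
  (forall i, measurable (P i)) -> measurable [set w | forall i, P i w].
Proof.
move=> h; rewrite (_ : [set w | _] = \bigcap_i P i); last first.
  by apply/seteqP; split=> [w hw i _|w hw i]; [exact: hw|exact: hw].
rewrite -(setCK (\bigcap_i _)) setC_bigcap; apply: measurableC.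
by apply: countable_bigcupT_measurable => // i; exact: measurableC.
Qed.

Lemma set_exists_measurable d (T : measurableType d) (I : countType) (P : I -> set T) :
  (forall i, measurable (P i)) -> measurable [set w | exists i, P i w].
Proof.
move=> h; rewrite (_ : [set w | _] = \bigcup_i P i); last first.
  by apply/seteqP; split=> [w [i hw]|w [i _ hw]]; exists i.
by apply: countable_bigcupT_measurable.
Qed.

End SigmaAlgebras.

(** * Borel measurability of vector-valued functions *)

Section Borel.
Context {R : realType} {n : nat}.
Local Notation V := 'rV[R]_n.

Lemma borel_measurable_fun d (T : measurableType d) (f : T -> borel_rV R n) :
  (forall O : set V, open O -> measurable (f @^-1` O)) -> measurable_fun setT f.
Proof.
move=> h _ B mB; rewrite setTI; move: B mB.
by apply: gen_preimage => //; exact: measurable_sigma.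
Qed.

Lemma borel_open (O : set V) : open O -> measurable (O : set (borel_rV R n)).
Proof. by move=> oO; exact: sub_sigma_algebra. Qed.

Lemma borel_closed (O : set V) : closed O -> measurable (O : set (borel_rV R n)).
Proof.
move=> oO; rewrite -(setCK O); apply: measurableC; apply: borel_open.
exact: closed_openC.
Qed.

Lemma continuous_borel (f : V -> R) : continuous f ->
  measurable_fun setT (f : borel_rV R n -> R).
Proof.
move=> cf; apply: measurable_fun_lt => r; apply: borel_open.
by apply: (@open_comp _ _ f [set y | y < r]) => [x _|]; [exact: cf|exact: open_lt].
Qed.

Lemma continuous_borelV (f : V -> V) : continuous f ->
  measurable_fun setT (f : borel_rV R n -> borel_rV R n).
Proof.
move=> cf; apply: borel_measurable_fun => O oO; apply: borel_open.
by apply: open_comp => [x _|//]; exact: cf.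
Qed.

Lemma mx_ballP (x y : V) (e : R) : 0 < e ->
  ball x e y <-> forall i, `|x ord0 i - y ord0 i| < e.
Proof.
move=> e0; split=> [[_ h] i|h]; first exact: (h ord0 i).
by split=> // i j; rewrite (ord1 i); exact: h.
Qed.

(** An open set is the union of the countably many boxes with rational centre and rational radius
    that it contains, and lying in a box is a condition on the coordinates. *)
Lemma borel_coord d (T : measurableType d) (f : T -> V) :
  (forall i, measurable_fun setT (fun w => f w ord0 i)) ->
  measurable_fun setT (f : T -> borel_rV R n).
Proof.
move=> mf; apply: borel_measurable_fun => O oO.
pose c (p : 'rV[rat]_n * rat) : V := \row_i ratr (p.1 ord0 i).
pose bx (p : 'rV[rat]_n * rat) : set V :=
  [set y | forall i, `|c p ord0 i - y ord0 i| < ratr p.2].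
have -> : f @^-1` O =
    [set w | exists p, bx p `<=` O /\ bx p (f w)].
  apply/seteqP; split=> [w Ow|w [p [/[apply] //]]].
  have /nbhs_ballP[e /= e0 he] : nbhs (f w) O by exact: open_nbhs_nbhs.
  have [r hr] : exists r : rat, (0 < (ratr r : R)) /\ ((ratr r : R) < e / 2).
    have [r] := @rat_in_itvoo R 0 (e / 2) ltac:(lra).
    by rewrite in_itv /= => /andP[? ?]; exists r.
  have /choice[q hq] : forall i, exists q : rat, `|(ratr q : R) - f w ord0 i| < ratr r.
    move=> i; have [q] := @rat_in_itvoo R (f w ord0 i - ratr r) (f w ord0 i + ratr r) ltac:(lra).
    rewrite in_itv /= => hq; exists q; rewrite ltr_norml; lra.
  exists ((\row_i q i, r)); split; last by move=> i; rewrite !mxE.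
  move=> y hy; apply: he; apply/mx_ballP => // i.
  have := hy i; have := hq i; rewrite !mxE !ltr_norml; lra.
apply: set_exists_measurable => p.
have [bO|nbO] := pselect (bx p `<=` O); last first.
  rewrite (_ : (fun w => _) = set0) //.
  by apply/seteqP; split=> w // [].
rewrite (_ : (fun w => _) = [set w | forall i, `|c p ord0 i - f w ord0 i| < ratr p.2]).
  apply: set_forall_measurable => i; apply: set_lt_measurable => //.
  by apply: measurable_fun_norm; apply: measurable_funB.
by apply/seteqP; split=> [w []|w].
Qed.

Lemma coord_borel i : measurable_fun setT ((fun x : V => x ord0 i) : borel_rV R n -> R).
Proof. by apply: continuous_borel; exact: coord_continuous. Qed.

Lemma borel_coordE d (T : measurableType d) (f : T -> V) i :
  measurable_fun setT (f : T -> borel_rV R n) ->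
  measurable_fun setT (fun w => f w ord0 i).
Proof. by move=> mf; apply: (measurableT_comp (coord_borel i) mf). Qed.

Lemma borel_cvg d (T : measurableType d) (f : nat -> T -> V) (g : T -> V) :
  (forall k, measurable_fun setT (f k : T -> borel_rV R n)) ->
  (forall w, f k w @[k --> \oo] --> g w) ->
  measurable_fun setT (g : T -> borel_rV R n).
Proof.
move=> mf fg; apply: borel_coord => i.
apply: (measurable_fun_cvg (h := fun k w => f k w ord0 i)).
  by move=> k; exact: borel_coordE.
move=> w _; apply: (cvg_comp (fun k => f k w) (fun x : V => x ord0 i)).
  exact: fg.
exact: coord_continuous.
Qed.

Lemma set_eqV_measurable d (T : measurableType d) (f g : T -> V) :
  measurable_fun setT (f : T -> borel_rV R n) ->
  measurable_fun setT (g : T -> borel_rV R n) -> measurable [set w | f w = g w].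
Proof.
move=> mf mg.
have -> : [set w | f w = g w] = [set w | forall i, f w ord0 i = g w ord0 i].
  apply/seteqP; split=> [w /= -> //|w /= h].
  by apply/matrixP => i j; rewrite (ord1 i).
by apply: set_forall_measurable => i; apply: set_eq_measurable; exact: borel_coordE.
Qed.

End Borel.

(** * One-sided limits and approximation by later dyadic times *)

Section OneSided.
Context {R : realType} {U : pseudoMetricType R}.
Implicit Types (w : R -> U) (t : R) (l : U).

Lemma right_epsP w t l : w s @[s --> t^'+] --> l <->
  forall e, 0 < e -> exists2 d, 0 < d & forall s, t < s < t + d -> ball l e (w s).
Proof.
split=> [/cvg_ballP h e e0|h].
  have := h e e0; rewrite /at_right /within /=.
  move=> /nbhs_ballP[d /= d0 hd]; exists d => // s /andP[s1 s2].
  by apply: hd => //; rewrite /ball /= ltr_norml; lra.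
apply/cvg_ballP => e /h[d d0 hd].
rewrite /at_right /within /=; apply/nbhs_ballP; exists d => //= s.
by rewrite /ball /= ltr_norml => s1 s2; apply: hd; lra.
Qed.

Lemma left_epsP w t l : w s @[s --> t^'-] --> l <->
  forall e, 0 < e -> exists2 d, 0 < d & forall s, t - d < s < t -> ball l e (w s).
Proof.
split=> [/cvg_ballP h e e0|h].
  have := h e e0; rewrite /at_left /within /=.
  move=> /nbhs_ballP[d /= d0 hd]; exists d => // s /andP[s1 s2].
  by apply: hd => //; rewrite /ball /= ltr_norml; lra.
apply/cvg_ballP => e /h[d d0 hd].
rewrite /at_left /within /=; apply/nbhs_ballP; exists d => //= s.
by rewrite /ball /= ltr_norml => s1 s2; apply: hd; lra.
Qed.

End OneSided.

Section NextDyadic.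
Context {R : realType}.

(** The successor makes the dyadic time strictly later than t, so that right limits apply at every
    t, dyadic or not. *)
Definition next_index (k : nat) (t : R) : nat := (Num.truncn (Num.max t 0 * 2 ^+ k)).+1.
Definition dyadic (i k : nat) : R := i%:R / 2 ^+ k.
Definition next_dyadic k t := dyadic (next_index k t) k.

Lemma dyadic_ge0 i k : 0 <= dyadic i k.
Proof. by rewrite divr_ge0 // exprn_ge0. Qed.

Lemma next_dyadicP k t : 0 <= t -> t < next_dyadic k t <= t + (2 ^+ k)^-1.
Proof.
move=> t0; rewrite /next_dyadic /dyadic /next_index (max_l t0).
have k0 : 0 < 2 ^+ k :> R by rewrite exprn_gt0.
have h0 : 0 <= t * 2 ^+ k by rewrite mulr_ge0 // ltW.
have /andP[h1 h2] := truncn_itv h0.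
rewrite ltr_pdivlMr // h2 /= ler_pdivrMr // mulrDl mulVf ?gt_eqF //.
by rewrite -natr1 lerD2r.
Qed.

Lemma exp2_small (e : R) : 0 < e -> exists k0 : nat, forall k, (k0 <= k)%N -> (2 ^+ k)^-1 < e.
Proof.
move=> e0; have /cvgrPdist_lt /(_ e e0) := @cvg_geometric R 1 2^-1 ltac:(by rewrite ger0_norm; lra).
case=> k0 _ hk; exists k0 => k hk0; have := hk k hk0.
rewrite sub0r normrN /geometric /= mul1r exprVn ger0_norm //.
Qed.

Lemma next_dyadic_cvg (U : pseudoMetricType R) (w : R -> U) t : 0 <= t ->
  w s @[s --> t^'+] --> w t -> w (next_dyadic k t) @[k --> \oo] --> w t.
Proof.
move=> t0 /right_epsP h; apply/cvg_ballP => e /h[d d0 hd].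
have [k0 hk0] := exp2_small d0; exists k0 => // k /hk0 hk.
by apply: hd; have := next_dyadicP k t0; lra.
Qed.

Lemma next_index_measurable k i : measurable [set t : R | next_index k t = i].
Proof.
case: i => [|i]; first by rewrite (_ : [set _ | _] = set0) //; apply/seteqP; split.
have mf : measurable_fun setT (fun t : R => Num.max t 0 * 2 ^+ k).
  apply: measurable_funM => //; apply: measurable_maxr => //.
rewrite (_ : [set _ | _] = [set t : R | i%:R <= Num.max t 0 * 2 ^+ k] `&`
   [set t : R | Num.max t 0 * 2 ^+ k < i.+1%:R]).
  apply: measurableI; first exact: set_le_measurable.
  exact: set_lt_measurable.
have h t : 0 <= Num.max t 0 * 2 ^+ k :> R.
  by rewrite mulr_ge0 ?exprn_ge0 // le_max lexx orbT.
apply/seteqP; split=> t /=; rewrite /next_index.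
  by move=> [<-]; have /andP[] := truncn_itv (h t).
by move=> [h1 h2]; congr S; apply/eqP; rewrite truncn_eq // h1.
Qed.

End NextDyadic.

(** * Joint measurability of right-continuous processes *)

Section JointMeasurability.
Context {R : realType} {n : nat}.
Local Notation V := 'rV[R]_n.

(** By right-continuity the process is the pointwise limit of its values at the next dyadic time of
    level k, and each approximation selects among countably many measurable coordinates. *)
Lemma joint_measurable d (T : measurableType d) (Z : R -> T -> V) :
  (forall t, 0 <= t -> measurable_fun setT (Z t : T -> borel_rV R n)) ->
  (forall w t, 0 <= t -> Z s w @[s --> t^'+] --> Z t w) ->
  measurable_fun setT ((fun p : R * T => Z (Num.max p.1 0) p.2) : R * T -> borel_rV R n).
Proof.
move=> mZ rZ.
apply: (borel_cvg (f := fun k (p : R * T) => Z (next_dyadic k (Num.max p.1 0)) p.2)).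
  move=> k; apply: (measurable_fun_select
    (N := fun p : R * T => next_index k (Num.max p.1 0))
    (f := fun i (p : R * T) => Z (dyadic i k) p.2 : borel_rV R n)).
    move=> i; apply: (fun_preimage_measurable (f := fun p : R * T => Num.max p.1 0)
      (B := [set t | next_index k t = i])).
      exact: (measurable_maxr (f := fst) (g := cst 0) measurable_fst).
    exact: next_index_measurable.
  move=> i; apply: (measurableT_comp (mZ _ (dyadic_ge0 i k))).
  exact: measurable_snd.
move=> w; apply: (next_dyadic_cvg (w := Z^~ w.2)); first by rewrite le_max lexx orbT.
by apply: rZ; rewrite le_max lexx orbT.
Qed.

End JointMeasurability.

(** * Bounded measurable functions and their real-valued integrals *)

Section BoundedMeasurable.
Context d (T : measurableType d) (R : realType).
Implicit Types f g : T -> R.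

(** All integrands of the proof are in this class. It is stable under the operations used, and on
    sets of finite measure it makes the integral a real number that is linear without further
    integrability conditions. *)
Definition bmf f := measurable_fun setT f /\ exists c, forall w, `|f w| <= c.

Lemma bmf_cst c : bmf (fun=> c).
Proof. by split; [exact: measurable_cst|exists `|c|]. Qed.

Lemma bmfD f g : bmf f -> bmf g -> bmf (fun w => f w + g w).
Proof.
move=> [mf [c hc]] [mg [e he]]; split; first exact: measurable_funD.
by exists (c + e) => w; apply: le_trans (ler_normD _ _) _; exact: lerD.
Qed.

Lemma bmfM f g : bmf f -> bmf g -> bmf (fun w => f w * g w).
Proof.
move=> [mf [c hc]] [mg [e he]]; split; first exact: measurable_funM.
by exists (c * e) => w; rewrite normrM; apply: ler_pM.
Qed.

Lemma bmfZ k f : bmf f -> bmf (fun w => k * f w).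
Proof. by move=> hf; apply: bmfM => //; exact: bmf_cst. Qed.

Lemma bmfN f : bmf f -> bmf (fun w => - f w).
Proof.
move=> [mf [c hc]]; split; first exact: (measurableT_comp (@oppr_measurable R setT) mf).
by exists c => w; rewrite normrN.
Qed.

Lemma bmfB f g : bmf f -> bmf g -> bmf (fun w => f w - g w).
Proof. by move=> hf hg; apply: bmfD => //; exact: bmfN. Qed.

Lemma bmf_indic (S : set T) : measurable S -> bmf (\1_S).
Proof.
move=> mS; split; first exact: measurable_indic.
by exists 1 => w; rewrite indicE; case: (_ \in _); rewrite ?normr1 ?normr0.
Qed.

End BoundedMeasurable.

Lemma bmf_comp d (T : measurableType d) d' (U : measurableType d') (R : realType)
  (f : U -> R) (g : T -> U) : bmf f -> measurable_fun setT g -> bmf (f \o g).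
Proof.
move=> [mf [c hc]] mg; split; first exact: measurableT_comp.
by exists c => w; exact: hc.
Qed.

Section FiniteIntegral.
Context d (T : measurableType d) (R : realType).
Variables (m : {measure set T -> \bar R}) (D : set T).
Hypotheses (mD : measurable D) (foo : (m D < +oo)%E).
Implicit Types f g : T -> R.

Lemma bmf_integrable f : bmf f -> m.-integrable D (EFin \o f).
Proof.
move=> [mf [c hc]]; apply: measurable_bounded_integrable => //.
  exact: measurable_funTS.
exists c; split; first exact: num_real.
by move=> x cx w _ /=; apply: le_trans (hc w) _; exact: ltW.
Qed.

Lemma Rint_EFin f : bmf f ->
  (\int[m]_(w in D) (f w)%:E = (\int[m]_(w in D) f w)%R%:E)%E.
Proof.
move=> hf; rewrite fineK //; apply: integrable_fin_num => //.
exact: bmf_integrable.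
Qed.

Lemma RintD f g : bmf f -> bmf g ->
  \int[m]_(w in D) (f w + g w) = \int[m]_(w in D) f w + \int[m]_(w in D) g w.
Proof. by move=> hf hg; rewrite RintegralD //; exact: bmf_integrable. Qed.

Lemma RintB f g : bmf f -> bmf g ->
  \int[m]_(w in D) (f w - g w) = \int[m]_(w in D) f w - \int[m]_(w in D) g w.
Proof. by move=> hf hg; rewrite RintegralB //; exact: bmf_integrable. Qed.

Lemma RintZ k f : bmf f ->
  \int[m]_(w in D) (k * f w) = k * \int[m]_(w in D) f w.
Proof. by move=> hf; rewrite RintegralZl //; exact: bmf_integrable. Qed.

Lemma Rint_cst c : \int[m]_(w in D) c = c * fine (m D).
Proof. by rewrite Rintegral_cst. Qed.

Lemma Rint_bound f c : bmf f -> (forall w, `|f w| <= c) ->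
  `|\int[m]_(w in D) f w| <= c * fine (m D).
Proof.
move=> hf hc; apply: le_trans (le_normr_Rintegral mD (bmf_integrable hf)) _.
have hn : bmf (fun w => `|f w|).
  by case: hf => mf _; split; [exact: measurable_fun_norm|exists c => w; rewrite normr_id].
rewrite -Rint_cst; apply: (le_Rintegral mD (bmf_integrable hn) _ _).
  exact: (bmf_integrable (bmf_cst T c)).
by move=> w _; exact: hc.
Qed.

Lemma Rint_indic S f : measurable S -> bmf f ->
  \int[m]_(w in D) (\1_S w * f w) = \int[m]_(w in D `&` S) f w.
Proof.
move=> mS hf; rewrite Rintegral_mkcondr; apply: eq_Rintegral => w _.
by rewrite patchE indicE; case: ifPn => _; rewrite ?mul1r ?mul0r.
Qed.

Lemma Rint_cvg (f : nat -> T -> R) g c : (forall k, measurable_fun setT (f k)) ->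
  (forall k w, `|f k w| <= c) -> (forall w, f k w @[k --> \oo] --> g w) ->
  \int[m]_(w in D) f k w @[k --> \oo] --> \int[m]_(w in D) g w.
Proof.
move=> mf hc fg; apply: fine_cvg.
have bf k : bmf (f k) by split=> //; exists c.
have mg : measurable_fun setT g by apply: measurable_fun_cvg => // w _; exact: fg.
have bg : bmf g.
  split=> //; exists c => w.
  have h : `|f k w| @[k --> \oo] --> `|g w| by apply: cvg_norm; exact: fg.
  rewrite -(cvg_lim _ h) //; apply: limr_le; first by apply/cvg_ex; exists `|g w|.
  by near=> k; exact: hc.
rewrite -Rint_EFin //.
apply: (@dominated_cvg _ _ _ m D mD (fun k w => (f k w)%:E) (fun w => (g w)%:E) (fun=> c%:E)) => //.
- by move=> k; apply/measurable_EFinP; exact: measurable_funTS.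
- by move=> w _; apply: cvg_EFin; [by near=> k|exact: fg].
- exact: (bmf_integrable (bmf_cst T c)).
- by move=> k w _; rewrite lee_fin.
Unshelve. all: by end_near. Qed.

Lemma Rint_ae f g : measurable_fun setT f -> measurable_fun setT g ->
  (exists2 N, measurable N & m N = 0 /\ forall w, D w -> ~ N w -> f w = g w) ->
  \int[m]_(w in D) f w = \int[m]_(w in D) g w.
Proof.
move=> mf mg [N mN [N0 h]]; congr fine; apply: ae_eq_integral => //.
- by apply/measurable_EFinP; exact: measurable_funTS.
- by apply/measurable_EFinP; exact: measurable_funTS.
exists N; split => // w /=; apply: contra_notP => nN Dw.
by rewrite h.
Qed.

End FiniteIntegral.

(** With c a bound of |h|, the integrand on the left is nonnegative. This is how Tonelli's theorem,
    stated for nonnegative functions, is brought to bear on bounded signed ones. *)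
Lemma int_shift (R : realType) d (T : measurableType d) (m : {measure set T -> \bar R}) (D : set T)
    (h : T -> R) c : measurable D -> (m D < +oo)%E -> bmf h ->
  (\int[m]_y (\1_D y * (h y + c))%:E = (\int[m]_(y in D) h y + c * fine (m D))%R%:E)%E.
Proof.
move=> mD oo bh.
have -> : (\int[m]_y (\1_D y * (h y + c))%:E = \int[m]_(y in D) (h y + c)%:E)%E.
  rewrite [RHS]integral_mkcond; apply: eq_integral => y _.
  by rewrite patchE indicE /=; case: ifPn => _; rewrite ?mul1r ?mul0r.
have bc := bmf_cst T c.
by rewrite Rint_EFin ?RintD ?Rint_cst //; exact: bmfD.
Qed.

(** * Fubini's theorem for bounded functions on sets of finite measure *)

Section FubiniBounded.
Context d1 (T1 : measurableType d1) d2 (T2 : measurableType d2) (R : realType).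
Variables (m1 : {sigma_finite_measure set T1 -> \bar R})
  (m2 : {sigma_finite_measure set T2 -> \bar R}) (D1 : set T1) (D2 : set T2).
Hypotheses (mD1 : measurable D1) (mD2 : measurable D2).
Hypotheses (foo1 : (m1 D1 < +oo)%E) (foo2 : (m2 D2 < +oo)%E).
Variable f : T1 * T2 -> R.
Hypothesis bf : bmf f.

Lemma bmf_xsection x : bmf (fun y => f (x, y)).
Proof.
case: bf => mf [c hc]; split; last by exists c.
by apply: (measurableT_comp mf); exact: pair1_measurable.
Qed.

Lemma bmf_ysection y : bmf (fun x => f (x, y)).
Proof.
case: bf => mf [c hc]; split; last by exists c.
by apply: (measurableT_comp mf); exact: pair2_measurable.
Qed.

Let mind2 : measurable_fun setT (fun z : T1 * T2 => \1_D2 z.2 : R).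
Proof. by have [] := bmf_comp (bmf_indic R mD2) (@measurable_snd _ _ T1 T2). Qed.

Let mind1 : measurable_fun setT (fun z : T1 * T2 => \1_D1 z.1 : R).
Proof. by have [] := bmf_comp (bmf_indic R mD1) (@measurable_fst _ _ T1 T2). Qed.

Lemma bmf_Rint : bmf (fun x => \int[m2]_(y in D2) f (x, y)).
Proof.
case: (bf) => mf [c hc]; split; last first.
  exists (c * fine (m2 D2)) => x; apply: Rint_bound => //.
  exact: bmf_xsection.
pose g z := ((\1_D2 z.2 * (f z + c))%:E : \bar R).
have g0 z : (0 <= g z)%E.
  rewrite lee_fin mulr_ge0 // -lerBlDr sub0r; have := hc z; rewrite ler_norml; by case/andP.
have mg : measurable_fun setT g.
  apply/measurable_EFinP; apply: measurable_funM => //.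
  by apply: measurable_funD.
have h : measurable_fun setT (fun x => (\int[m2]_y g (x, y))%E).
  by apply: (measurable_fun_fubini_tonelli_F g).
have -> : (fun x => \int[m2]_(y in D2) f (x, y)) =
    (fun x => fine (\int[m2]_y g (x, y))%E - c * fine (m2 D2)).
  apply/funext => x; have bx := bmf_xsection x.
  by rewrite /g /= int_shift //= addrK.
apply: measurable_funB => //.
by apply: (measurableT_comp (fine_measurable _) h).
Qed.

End FubiniBounded.

Section FubiniSwap.
Context d1 (T1 : measurableType d1) d2 (T2 : measurableType d2) (R : realType).
Variables (m1 : {sigma_finite_measure set T1 -> \bar R})
  (m2 : {sigma_finite_measure set T2 -> \bar R}) (D1 : set T1) (D2 : set T2).
Hypotheses (mD1 : measurable D1) (mD2 : measurable D2).
Hypotheses (foo1 : (m1 D1 < +oo)%E) (foo2 : (m2 D2 < +oo)%E).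
Variable f : T1 * T2 -> R.
Hypothesis bf : bmf f.

Lemma bmf_swap : bmf (fun z : T2 * T1 => f (z.2, z.1)).
Proof.
apply: (bmf_comp (g := fun z : T2 * T1 => (z.2, z.1)) bf).
by apply: measurable_fun_pair; [exact: measurable_snd|exact: measurable_fst].
Qed.

Lemma Rint_fubini :
  \int[m1]_(x in D1) (\int[m2]_(y in D2) f (x, y)) =
  \int[m2]_(y in D2) (\int[m1]_(x in D1) f (x, y)).
Proof.
case: (bf) => mf [c hc].
pose g z := ((\1_D1 z.1 * (\1_D2 z.2 * (f z + c)))%:E : \bar R).
have g0 z : (0 <= g z)%E.
  rewrite lee_fin !mulr_ge0 // -lerBlDr sub0r; have := hc z; rewrite ler_norml; by case/andP.
have mg : measurable_fun setT g.
  apply/measurable_EFinP; apply: measurable_funM.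
    by have [] := bmf_comp (bmf_indic R mD1) (@measurable_fst _ _ T1 T2).
  apply: measurable_funM; last exact: measurable_funD.
  by have [] := bmf_comp (bmf_indic R mD2) (@measurable_snd _ _ T1 T2).
have := @fubini_tonelli _ _ T1 T2 R m1 m2 g mg g0.
have -> : (\int[m1]_x \int[m2]_y g (x, y) =
    \int[m1]_x (\1_D1 x * ((\int[m2]_(y in D2) f (x, y))%R + c * fine (m2 D2)))%:E)%E.
  apply: eq_integral => x _.
  have bx := bmf_xsection bf x.
  rewrite /g /= indicE; case: (_ \in _) => /=.
    by under eq_integral do rewrite mul1r; rewrite int_shift // mul1r.
  by under eq_integral do rewrite mul0r; rewrite integral0 mul0r.
have -> : (\int[m2]_y \int[m1]_x g (x, y) =
    \int[m2]_y (\1_D2 y * ((\int[m1]_(x in D1) f (x, y))%R + c * fine (m1 D1)))%:E)%E.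
  apply: eq_integral => y _.
  have bx := bmf_ysection bf y.
  rewrite /g /= [\1_D2 y]indicE; case: (_ \in _) => /=.
    by under eq_integral do rewrite mul1r; rewrite int_shift // mul1r.
  by under eq_integral do rewrite mul0r mulr0; rewrite integral0 mul0r.
rewrite !int_shift //.
(* Both iterated integrals carry the same extra constant, c times the product of the two total
   masses, which cancels. *)
- by move=> [] /eqP; rewrite -!mulrA [in X in _ + _ * X == _]mulrC => /eqP /addIr.
- exact: (bmf_Rint mD1 foo1 bmf_swap).
- exact: bmf_Rint.
Qed.

End FubiniSwap.

(** * Product and image probabilities, and Dynkin's uniqueness argument *)

Section ProductProbability.
Context d1 (T1 : measurableType d1) d2 (T2 : measurableType d2) (R : realType).
Variables (P1 : probability T1 R) (P2 : probability T2 R).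

Lemma prob_lty d (T : measurableType d) (P : probability T R) (D : set T) :
  measurable D -> (P D < +oo)%E.
Proof. by move=> mD; apply: le_lt_trans (probability_le1 P mD) _; rewrite ltry. Qed.

Lemma Rint_prod (f : T1 * T2 -> R) : bmf f ->
  \int[(P1 \x P2)%E]_z f z = \int[P1]_x (\int[P2]_y f (x, y)).
Proof.
move=> bf; rewrite [LHS]/Rintegral -integral12_prod_meas1; last first.
  by apply: bmf_integrable => //; exact: prob_lty.
congr fine; apply: eq_integral => x _; rewrite /fubini_F /=.
by rewrite Rint_EFin //; [exact: prob_lty|exact: bmf_xsection].
Qed.

Lemma image_prob (g : T1 -> T2) : measurable_fun setT g ->
  exists Q : probability T2 R, forall B, measurable B -> Q B = P1 (g @^-1` B).
Proof.
move=> mg; pose g' : {mfun T1 >-> T2} := HB.pack g (isMeasurableFun.Build _ _ _ _ g mg).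
by exists (distribution P1 g').
Qed.

Definition has_image (g : T1 -> T2) := measurable_fun setT g /\
  forall B, measurable B -> P1 (g @^-1` B) = P2 B.

Lemma Rint_image (g : T1 -> T2) (f : T2 -> R) : has_image g -> bmf f ->
  \int[P2]_y f y = \int[P1]_x f (g x).
Proof.
move=> [mg hg] bf; pose g' : {mfun T1 >-> T2} := HB.pack g (isMeasurableFun.Build _ _ _ _ g mg).
congr fine; transitivity (\int[pushforward P1 g']_y (f y)%:E)%E.
  apply: eq_measure_integral => B mB _. exact: esym (hg B mB).
rewrite integral_pushforward //.
- by apply/measurable_EFinP; case: bf.
- rewrite preimage_setT.
  exact: (bmf_integrable measurableT (prob_lty P1 measurableT) (bmf_comp bf mg)).
Qed.

End ProductProbability.

Section EventUniqueness.
Context {R : realType} d1 (T1 : measurableType d1) d2 (T2 : measurableType d2).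
Variables (P1 : probability T1 R) (P2 : probability T2 R).

Lemma prob_fin d (T : measurableType d) (P : probability T R) (S : set T) :
  measurable S -> P S \is a fin_num.
Proof. by move=> mS; exact: fin_num_measure. Qed.

(** The sets on which the two restricted laws agree form a lambda-system. Restricting to events [S1]
    and [S2] allows joint laws to be identified one coordinate at a time; measurability of the
    preimages is carried along because it is proved by the same induction. *)
Lemma prob_eq_gen U (G : set (set U)) (f1 : T1 -> U) (f2 : T2 -> U)
    (S1 : set T1) (S2 : set T2) :
  setI_closed G -> measurable S1 -> measurable S2 -> P1 S1 = P2 S2 ->
  (forall A, G A -> [/\ measurable (f1 @^-1` A), measurable (f2 @^-1` A) &
    P1 (S1 `&` f1 @^-1` A) = P2 (S2 `&` f2 @^-1` A)]) ->
  forall A, <<s G >> A -> [/\ measurable (f1 @^-1` A), measurable (f2 @^-1` A) &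
    P1 (S1 `&` f1 @^-1` A) = P2 (S2 `&` f2 @^-1` A)].
Proof.
move=> GI m1 m2 e12 hG.
pose H := [set A | [/\ measurable (f1 @^-1` A), measurable (f2 @^-1` A) &
    P1 (S1 `&` f1 @^-1` A) = P2 (S2 `&` f2 @^-1` A)]].
have lH : lambda_system setT H.
  split=> //.
  - by rewrite /H /= !preimage_setT !setIT; split.
  - move=> A B BA [a1 a2 a3] [b1 b2 b3]; rewrite /H /=.
    have h d (T : measurableType d) (P : probability T R) (f : T -> U) (S : set T) :
        measurable S -> measurable (f @^-1` A) -> measurable (f @^-1` B) ->
        P (S `&` f @^-1` (A `\` B)) = (P (S `&` f @^-1` A) - P (S `&` f @^-1` B))%E.
      move=> mS mA mB.
      have -> : S `&` f @^-1` B = (S `&` f @^-1` A) `&` (S `&` f @^-1` B).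
        apply/seteqP; split=> w /=; last by move=> [].
        by move=> [Sw Bw]; split=> //; split=> //; exact: BA.
      rewrite -measureD; [|exact: measurableI|exact: measurableI|by apply: prob_lty; exact: measurableI].
      congr (P _); apply/seteqP; split=> w /=.
        by move=> [Sw [Aw nB]]; split=> // -[].
      by move=> [[Sw Aw] nB]; split=> //; split=> // Bw; apply: nB.
    by split; [exact: measurableD|exact: measurableD|rewrite !h // a3 b3].
  - move=> F ndF hF; rewrite /H /=.
    have m1F : measurable (f1 @^-1` (\bigcup_i F i)).
      by rewrite preimage_bigcup; apply: bigcupT_measurable => i; case: (hF i).
    have m2F : measurable (f2 @^-1` (\bigcup_i F i)).
      by rewrite preimage_bigcup; apply: bigcupT_measurable => i; case: (hF i).
    split=> //.
    have h d (T : measurableType d) (P : probability T R) (f : T -> U) (S : set T) :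
        measurable S -> (forall i, measurable (f @^-1` F i)) ->
        P (S `&` f @^-1` F i) @[i --> \oo] --> P (S `&` f @^-1` (\bigcup_i F i)).
      move=> mS mF; rewrite preimage_bigcup setI_bigcupr.
      apply: (@nondecreasing_cvg_mu _ _ _ P (fun i => S `&` f @^-1` F i)).
      - by move=> i; exact: measurableI.
      - by apply: bigcupT_measurable => i; exact: measurableI.
      - move=> i j ij; apply/subsetPset => w [Sw Fw]; split=> //.
        by have /subsetPset := ndF _ _ ij; exact.
    have h1 := h _ _ P1 f1 S1 m1 (fun i => let: And3 a _ _ := hF i in a).
    have h2 := h _ _ P2 f2 S2 m2 (fun i => let: And3 _ a _ := hF i in a).
    have e : (fun i => P1 (S1 `&` f1 @^-1` F i)) = (fun i => P2 (S2 `&` f2 @^-1` F i)).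
      by apply/funext => i; case: (hF i).
    rewrite e in h1; exact: (cvg_unique (@ereal_hausdorff R) h1 h2).
have := lambda_system_subset GI lH hG.
by apply.
Qed.

End EventUniqueness.

(** * Null sets and conditional densities *)

Section Null.
Context {R : realType} d (T : measurableType d) (P : {measure set T -> \bar R}).

Definition null (N : set T) := measurable N /\ P N = 0%E.

Lemma null_set0 : null set0.
Proof. by split => //; rewrite measure0. Qed.

Lemma null_bigcup (N : nat -> set T) : (forall i, null (N i)) -> null (\bigcup_i N i).
Proof.
move=> h; have mU : measurable (\bigcup_i N i) by apply: bigcupT_measurable => i; case: (h i).
split=> //; apply/eqP; rewrite eq_le measure_ge0 andbT.
have := @measure_sigma_subadditive _ _ _ P _ _ (fun i => (h i).1) mU (@subset_refl _ _).
move=> /le_trans; apply.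
by rewrite eseries0 // => i _ _; rewrite /= (h i).2.
Qed.

Lemma null_countable (I : countType) (p : I -> T -> Prop) :
  (forall i, exists2 N, null N & forall x, ~ N x -> p i x) ->
  exists2 N, null N & forall x, ~ N x -> forall i, p i x.
Proof.
move=> h; have /choice[N hN] : forall i, exists N, null N /\ forall x, ~ N x -> p i x.
  by move=> i; have [N h1 h2] := h i; exists N.
pose M (k : nat) := if unpickle k is Some i then N i else set0.
exists (\bigcup_k M k).
  apply: null_bigcup => k; rewrite /M; case: unpickle => [i|]; last exact: null_set0.
  by case: (hN i).
move=> x nM i; apply: (hN i).2 => Nx; apply: nM; exists (pickle i) => //.
by rewrite /M pickleK.
Qed.

Lemma null_ae (p : T -> Prop) : {ae P, forall x, p x} ->
  exists2 N, null N & forall x, ~ N x -> p x.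
Proof.
by move=> [N [mN PN h]]; exists N => // x nN; apply: contrapT => np; apply: nN; exact: h.
Qed.

End Null.

Section ConditionalDensity.
Context {R : realType} d (T : measurableType d) dD (D : measurableType dD).
Variables (P : probability T R) (G : T -> D) (Q : probability D R).
Hypothesis hG : has_image P Q G.

(** The measure sending B to the probability that [G] is in B and S occurs is dominated by the law
    of [G]; h is its Radon-Nikodym derivative, a version of the conditional probability of S given
    [G]. *)
Lemma cond_density (S : set T) : measurable S -> exists h : D -> R,
  [/\ measurable_fun setT h, forall x, 0 <= h x, Q.-integrable setT (EFin \o h) &
    forall B, measurable B -> (P (G @^-1` B `&` S) = \int[Q]_(x in B) (h x)%:E)%E].
Proof.
move=> mS; case: hG => mG eG.
pose G' : {mfun T >-> D} := HB.pack G (isMeasurableFun.Build _ _ _ _ G mG).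
have [nu hnu] : exists nu : {finite_measure set D -> \bar R},
    forall B, nu B = P (G @^-1` B `&` S).
  pose nu : {measure set D -> \bar R} :=
    measure_function_pushforward__canonical__measure_function_Measure
      (mfrestr mS (prob_lty P mS)) mG.
  have fnu : fin_num_fun nu.
    move=> B mB; apply: (@fin_num_measure _ _ _ (mfrestr mS (prob_lty P mS))).
    exact: fun_preimage_measurable.
  pose nu' : {finite_measure set D -> \bar R} :=
    HB.pack (Measure.sort nu) (Measure_isFinite.Build _ _ _ (Measure.sort nu) fnu).
  by exists nu'.
have dom : nu `<< Q.
  apply/null_content_dominatesP => B mB QB.
  rewrite hnu; apply: (@subset_measure0 _ _ _ P _ (G @^-1` B)) => //.
  - by apply: measurableI => //; exact: fun_preimage_measurable.
  - exact: fun_preimage_measurable.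
  - exact: etrans (eG _ mB) QB.
have [f [f0 ffin fint fE]] := radon_nikodym_sigma_finite dom.
have fK x : (fine (f x))%:E = f x by exact: fineK.
have eint : EFin \o (fine \o f) = f by apply/funext => x; exact: fK.
exists (fine \o f); split.
- by apply: (measurableT_comp (fine_measurable _) (measurable_int _ fint)).
- by move=> x; rewrite /= fine_ge0.
- by rewrite eint.
- by move=> B mB; rewrite -hnu fE //; apply: eq_integral => x _; rewrite /= fK.
Qed.

(* The density of S2 is a.e. the sum of those of S1 and S2 `\` S1. *)
Lemma cond_density_mono (S1 S2 : set T) (h1 h2 : D -> R) :
  measurable S1 -> measurable S2 -> S1 `<=` S2 ->
  measurable_fun setT h1 -> Q.-integrable setT (EFin \o h1) ->
  measurable_fun setT h2 -> Q.-integrable setT (EFin \o h2) ->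
  (forall B, measurable B -> (P (G @^-1` B `&` S1) = \int[Q]_(x in B) (h1 x)%:E)%E) ->
  (forall B, measurable B -> (P (G @^-1` B `&` S2) = \int[Q]_(x in B) (h2 x)%:E)%E) ->
  exists2 N, null Q N & forall x, ~ N x -> h1 x <= h2 x.
Proof.
move=> mS1 mS2 S12 mh1 ih1 mh2 ih2 e1 e2; have [mG eG] := hG.
have [k [mk k0 ik ek]] := cond_density (measurableD mS2 mS1).
have : ae_eq Q setT (EFin \o h2) (fun x => (h1 x)%:E + (k x)%:E)%E.
  apply: integral_ae_eq => //.
    by apply: emeasurable_funD; exact/measurable_EFinP.
  move=> B _ mB.
  have mGB : measurable (G @^-1` B) by exact: fun_preimage_measurable.
  have iB h : Q.-integrable setT (EFin \o h) -> Q.-integrable B (EFin \o h).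
    exact: integrableS.
  rewrite integralD //; [|exact: iB|exact: iB].
  rewrite -[LHS]/(\int[Q]_(x in B) (h2 x)%:E)%E -e2 // -e1 // -ek //.
  rewrite -measureU; [|exact: measurableI|by apply: measurableI => //; exact: measurableD|].
    congr (P _); apply/seteqP; split=> w.
      move=> [GB S2w]; have [S1w|nS1] := pselect (S1 w); first by left.
      by right.
    by move=> [[GB /S12]|[GB []]].
  by apply/seteqP; split=> w //= [[_ h] [_ [_]]].
move=> /null_ae [N nN h]; exists N => // x /h /(_ I) /=.
by rewrite -EFinD => -[->]; rewrite lerDl.
Qed.

Lemma cond_density_le1 (S : set T) (h : D -> R) : measurable S ->
  measurable_fun setT h -> Q.-integrable setT (EFin \o h) ->
  (forall B, measurable B -> (P (G @^-1` B `&` S) = \int[Q]_(x in B) (h x)%:E)%E) ->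
  exists2 N, null Q N & forall x, ~ N x -> h x <= 1.
Proof.
move=> mS mh ih eh; have [mG eG] := hG.
apply: (cond_density_mono mS measurableT (@subsetT _ S) mh ih _ _ eh).
- exact: measurable_cst.
- exact: (bmf_integrable measurableT (prob_lty Q measurableT) (bmf_cst D 1)).
- by move=> B mB; rewrite setIT eG // integral_cst // mul1e.
Qed.

End ConditionalDensity.

(** * Disintegration by the conditional quantile function *)

Definition uniform01 {R : realType} (U : probability R R) :=
  forall c : R, 0 <= c <= 1 -> U [set v | v < c] = c%:E.

Section Disintegration.
Context {R : realType} d (T : measurableType d) dD (D : measurableType dD).
Variables (P : probability T R) (G : T -> D) (Q : probability D R) (xi : T -> R).
Variable U : probability R R.
Hypothesis hG : has_image P Q G.
Hypotheses (mxi : measurable_fun setT xi) (xi01 : forall w, 0 <= xi w <= 1).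
Hypothesis hU : uniform01 U.

Let thr (q : rat) : set T := [set w | xi w <= ratr q].

Let mthr q : measurable (thr q).
Proof. by apply: set_le_measurable. Qed.

Let densities : exists h : rat -> D -> R, forall q,
  [/\ measurable_fun setT (h q), Q.-integrable setT (EFin \o h q) &
    forall B, measurable B -> (P (G @^-1` B `&` thr q) = \int[Q]_(x in B) (h q x)%:E)%E] /\
  forall x, 0 <= h q x.
Proof.
have /choice[h hh] := fun q => cond_density hG (mthr q).
by exists h => q; have [h1 h2 h3 h4] := hh q.
Qed.

Section WithDensities.
Variable h : rat -> D -> R.
Hypothesis hh : forall q,
  [/\ measurable_fun setT (h q), Q.-integrable setT (EFin \o h q) &
    forall B, measurable B -> (P (G @^-1` B `&` thr q) = \int[Q]_(x in B) (h q x)%:E)%E] /\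
  forall x, 0 <= h q x.

Let mh q : measurable_fun setT (h q). Proof. by case: (hh q) => -[]. Qed.

(** Each comparison of two conditional probabilities holds off its own null set; only rational
    thresholds are used so that one null set serves for all of them. *)
Let good : exists2 N, null Q N & forall x, ~ N x -> forall p : rat * rat,
  h p.1 x <= 1 /\ (p.1 <= p.2 -> h p.1 x <= h p.2 x).
Proof.
apply: null_countable => -[p q] /=.
have [[mp ip ep] _] := hh p; have [[mq iq eq] _] := hh q.
have [N1 n1 h1] := cond_density_le1 hG (mthr p) mp ip ep.
have [pq|npq] := boolP (p <= q); last first.
  by exists N1 => // x /h1; split.
have [|N2 n2 h2] := cond_density_mono hG (mthr p) (mthr q) _ mp ip mq iq ep eq.
  by move=> w /le_trans; apply; rewrite ler_rat.
exists (N1 `|` N2); first by rewrite -bigcup2E; apply: null_bigcup => -[|[|i]] //=; exact: null_set0.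
by move=> x nN; split=> [|_]; [apply: h1|apply: h2] => hN; apply: nN; [left|right].
Qed.

(** The infimum of this set is the conditional quantile of [xi] given [G] at level [z.2]. The point
    1 keeps the set nonempty. The strict inequality makes the event that the quantile lies below r,
    for r at most 1, a union over rationals q below r of the events v < h q x, whose probability in
    v is h q x. *)
Definition quantile_set (z : D * R) : set R :=
  [set s | s = 1 \/ exists q : rat, [/\ 0 <= q <= 1, s = ratr q & z.2 < h q z.1]].
Definition quantile (z : D * R) : R := inf (quantile_set z).

Let UT : U setT = 1%E.
Proof. exact: (@probability_setT _ _ _ U). Qed.

Let QBT B : measurable B -> ((Q \x U) (B `*` setT) = Q B)%E.
Proof.
move=> mB; rewrite product_measure1E // -[RHS]mule1; congr (_ * _)%E.
exact: UT.
Qed.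

Let has_lb z : has_lbound (quantile_set z).
Proof.
by exists 0 => s [->//|[q [/andP[q0 _] -> _]]]; rewrite ler0q.
Qed.

Let quantile_lt z r : quantile z < r <-> exists2 s, quantile_set z s & s < r.
Proof.
split=> [hq|[s hs]]; last by apply: le_lt_trans; apply: ge_inf.
have r0 : 0 < r - quantile z by lra.
have [|s hs hlt] := inf_adherent r0 (E := quantile_set z); first by split=> //; exists 1; left.
by exists s => //; apply: (lt_le_trans hlt); rewrite /quantile; lra.
Qed.

Let mquantile : measurable_fun setT quantile.
Proof.
apply: measurable_fun_lt => r.
have -> : [set z | quantile z < r] = [set z | 1 < r] `|`
    [set z | exists q : rat, (0 <= q <= 1 /\ ratr q < r) /\ z.2 < h q z.1].
  apply/seteqP; split=> z /=.
    move=> /quantile_lt[s [-> ?|[q [q01 -> hz]] qr]]; first by left.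
    by right; exists q.
  move=> hz; apply/quantile_lt; case: hz => [r1|[q [[q01 qr] hz]]].
    by exists 1 => //; left.
  by exists (ratr q) => //; right; exists q.
apply: measurableU.
  by have [r1|r1] := pselect (1 < r); [rewrite (_ : mkset _ = setT)|rewrite (_ : mkset _ = set0)] => //;
    apply/seteqP; split.
apply: set_exists_measurable => q.
have [h0|h0] := pselect (0 <= q <= 1 /\ ratr q < r); last first.
  by rewrite (_ : (fun z => _) = set0) //; apply/seteqP; split=> z // [].
rewrite (_ : (fun z => _) = [set z | z.2 < h q z.1]); last first.
  by apply/seteqP; split=> [z []|z].
apply: set_lt_measurable; first exact: measurable_snd.
exact: (measurableT_comp (mh q) measurable_fst).
Qed.

(** For rationals increasing to r, the events v < h q x increase, off the null set, to the event
    that the quantile is below r. Their measure over B is the probability that [G] is in B and [xi]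
    is at most q, which increases to the right-hand side. *)
Let rect (B : set D) (r : R) : measurable B ->
  ((Q \x U) [set z | B z.1 /\ (quantile z < r)%R] = P (G @^-1` B `&` [set w | (xi w < r)%R]))%E.
Proof.
move=> mB; have [mG eG] := hG.
have mGB : measurable (G @^-1` B) by exact: fun_preimage_measurable.
have [r0|r0] := leP r 0.
  rewrite (_ : mkset _ = set0) ?measure0; last first.
    apply/seteqP; split=> z // [_ /quantile_lt[s [->|[q [/andP[q0 _] -> _]]]]]; first by lra.
    have : 0 <= ratr q :> R by rewrite ler0q.
    by lra.
  rewrite (_ : _ `&` _ = set0) ?measure0 //.
  by apply/seteqP; split=> w // [_] /=; have := xi01 w; lra.
have [r1|r1] := ltP 1 r.
  rewrite (_ : mkset _ = B `*` setT); last first.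
    apply/seteqP; split=> z /= [Bz] //; split=> //; apply/quantile_lt.
    by exists 1 => //; left.
  rewrite QBT // -eG //; congr (P _).
  by apply/seteqP; split=> [w Bw|w []//]; split=> //=; have := xi01 w; lra.
have [N [mN QN] gN] := good.
(* [e] enumerates the rationals of [0, r), other rationals being sent to 0, and [m] is its running
   maximum: a nondecreasing sequence cofinal among these rationals. *)
pose clip (q : rat) : rat := if (0 <= q) && ((ratr q : R) < r) then q else 0.
pose e (i : nat) : rat := oapp clip 0 (unpickle i).
have e0 i : 0 <= e i /\ (ratr (e i) : R) < r.
  rewrite /e; case: unpickle => [q|] /=; last by rewrite rmorph0.
  by rewrite /clip; case: ifPn => [/andP[]//|_]; rewrite rmorph0.
pose fix m (i : nat) : rat := if i is j.+1 then Num.max (m j) (e i) else e 0%N.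
have m0 i : 0 <= m i /\ (ratr (m i) : R) < r.
  elim: i => [|i [IH1 IH2]] /=; first exact: e0.
  by rewrite /Num.max; case: ifP => // _; exact: e0.
have mS i j : (i <= j)%N -> m i <= m j.
  move=> ij; rewrite -(subnK ij); elim: (j - i)%N => // k IH.
  by rewrite addSn /= le_max IH.
have em i : e i <= m i by case: i => [|i] //=; rewrite le_max lexx orbT.
have mle1 i : m i <= 1.
  have [_ h1] := m0 i; have : (ratr (m i) : R) <= ratr 1 by rewrite rmorph1; lra.
  by rewrite ler_rat.
pose A i := [set z : D * R | (B z.1 /\ ~ N z.1) /\ z.2 < h (m i) z.1].
have mA i : measurable (A i).
  rewrite (_ : A i = ((B `&` ~` N) `*` setT) `&` [set z | z.2 < h (m i) z.1]).
    apply: measurableI.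
      by apply: measurableX => //; apply: measurableI => //; exact: measurableC.
    apply: set_lt_measurable; first exact: measurable_snd.
    exact: (measurableT_comp (mh _) measurable_fst).
  by apply/seteqP; split=> z /= => [[[? ?] ?]|[[[? ?] _] ?]].
(* Integrating over v first: for x outside N the section is the ray below h, of measure h because h
   takes its value in [0, 1] there. *)
have QA i : ((Q \x U) (A i) = P (G @^-1` B `&` thr (m i)))%E.
  transitivity (\int[Q]_(x in B `&` ~` N) (h (m i) x)%:E)%E.
    rewrite /product_measure1 [RHS]integral_mkcond; apply: eq_integral => x _ /=.
    rewrite patchE; case: ifPn => hx.
      have [Bx Nx] : (B `&` ~` N) x by rewrite inE in hx.
      rewrite (_ : xsection _ _ = [set v | v < h (m i) x]).
        by rewrite hU //; case: (hh (m i)) => _ ->; have [-> _] := gN _ Nx (m i, m i).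
      by apply/seteqP; split=> v; rewrite /xsection /= inE // => -[].
    rewrite (_ : xsection _ _ = set0) ?measure0 //.
    apply/seteqP; split=> v //; rewrite /xsection /= inE => -[BN _].
    by move: hx; rewrite notin_setE; apply.
  have [[_ _ eh] _] := hh (m i).
  have mBN : measurable (B `&` ~` N) by apply: measurableI => //; exact: measurableC.
  have mBN' : measurable (B `&` N) by exact: measurableI.
  rewrite -eh //.
  have -> : G @^-1` B `&` thr (m i) = (G @^-1` (B `&` ~` N) `&` thr (m i)) `|`
     (G @^-1` (B `&` N) `&` thr (m i)).
    apply/seteqP; split=> [w [Bw tw]|w [[[Bw _] tw]|[[Bw _] tw]]] //.
    by have [Nw|Nw] := pselect (N (G w)); [right|left].
  have m1 := fun_preimage_measurable mG mBN; have m2 := fun_preimage_measurable mG mBN'.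
  rewrite measureU; [|exact: measurableI|exact: measurableI|].
    rewrite [X in (_ + X)%E](_ : _ = 0%E) ?adde0 //.
    apply: (@subset_measure0 _ _ _ P _ (G @^-1` N)) => //.
    - exact: measurableI.
    - exact: fun_preimage_measurable.
    - by move=> w [[]].
    - exact: etrans (eG _ mN) QN.
  by apply/seteqP; split=> w //= [[[_ nN] _] [[_ Nw] _]].
have ndA : nondecreasing_seq A.
  move=> i j ij; apply/subsetPset => z [[Bz Nz] hz]; split=> //.
  by apply: (lt_le_trans hz); have [_ ] := gN _ Nz (m i, m j); apply; exact: mS.
have ndT : nondecreasing_seq (fun i => G @^-1` B `&` thr (m i)).
  move=> i j ij; apply/subsetPset => w [Bw tw]; split=> //.
  by apply: (le_trans tw); rewrite ler_rat mS.
have eUT : \bigcup_i (G @^-1` B `&` thr (m i)) = G @^-1` B `&` [set w | xi w < r].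
  apply/seteqP; split=> w.
    by move=> [i _ [Bw tw]]; split=> //=; apply: (le_lt_trans tw); case: (m0 i).
  move=> [Bw /= xr]; have [q] := @rat_in_itvoo R _ _ xr.
  rewrite in_itv /= => /andP[xq qr]; exists (pickle q) => //; split=> //.
  apply: (le_trans (ltW xq)); rewrite ler_rat; apply: le_trans (em _).
  rewrite /e pickleK /= /clip qr andbT; case: ifPn => // /negP nq0.
  have : 0 <= (ratr q : R) by apply: le_trans (ltW xq); have := xi01 w; lra.
  by rewrite ler0q.
have eUA : \bigcup_i A i = [set z | (B z.1 /\ ~ N z.1) /\ quantile z < r].
  apply/seteqP; split=> z.
    move=> [i _ [BN hz]]; split=> //; apply/quantile_lt.
    have [m1 m2] := m0 i; exists (ratr (m i)) => //; right; exists (m i); split=> //.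
    by rewrite m1 mle1.
  move=> [[Bz Nz] /quantile_lt[s [->|[q [/andP[q0 q1] -> hz]]]]]; first by lra.
  move=> qr; exists (pickle q) => //; split=> //; apply: (lt_le_trans hz).
  have [_ ] := gN _ Nz (q, m (pickle q)); apply; apply: le_trans (em _).
  by rewrite /e pickleK /= /clip q0 qr.
have mUA : measurable (\bigcup_i A i) by exact: bigcupT_measurable.
have cA := @nondecreasing_cvg_mu _ _ _ (Q \x U)%E A mA mUA ndA.
have mTi i : measurable (G @^-1` B `&` thr (m i)) by exact: measurableI.
have cT := @nondecreasing_cvg_mu _ _ _ P _ mTi (bigcupT_measurable _ mTi) ndT.
rewrite eUT in cT.
have eA : ((Q \x U)%E \o A) = P \o (fun i => G @^-1` B `&` thr (m i)).
  by apply/funext => i; exact: QA.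
rewrite eA in cA.
(* Both sides are limits of the same sequence; what remains is to put back the null set N. *)
rewrite -(cvg_unique (@ereal_hausdorff R) cA cT) eUA.
have mNz : measurable (N `*` (setT : set R)) by exact: measurableX.
have mC : measurable [set z | B z.1 /\ quantile z < r].
  rewrite (_ : mkset _ = (B `*` setT) `&` [set z | quantile z < r]).
    by apply: measurableI; [exact: measurableX|exact: set_lt_measurable].
  by apply/seteqP; split=> z /= => [[? ?]|[[? _] ?]].
have -> : [set z | B z.1 /\ quantile z < r] = (\bigcup_i A i) `|`
    ([set z | B z.1 /\ quantile z < r] `&` (N `*` setT)).
  rewrite eUA; apply/seteqP; split=> [z [Bz zr]|z [[[Bz _] zr]|[]]] //.
  by have [Nz|Nz] := pselect (N z.1); [right|left].
rewrite measureU //; [|exact: measurableI|].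
  rewrite [X in (_ + X)%E](_ : _ = 0%E) ?adde0 ?eUA //.
  apply: (@subset_measure0 _ _ _ (Q \x U)%E _ (N `*` setT)) => //.
  - exact: measurableI.
  - by have [] := QBT mN; rewrite QN.
by rewrite eUA; apply/seteqP; split=> z //= [[[_ nN] _] [_ [Nz _]]].
Qed.

(** The rectangles with a ray as second factor are settled by [rect]. Dynkin's argument is applied
    twice: to pass from rays to Borel sets with the first factor fixed, then from rectangles to the
    product sigma-algebra. *)
Lemma quantile_coupling : measurable_fun setT quantile /\
  forall A, measurable A ->
  (Q \x U)%E ((fun z => (z.1, quantile z)) @^-1` A) = P ((fun w => (G w, xi w)) @^-1` A).
Proof.
split=> // A mA; have [mG eG] := hG.
have mf2 : measurable_fun setT (fun w => (G w, xi w)) by exact: measurable_fun_pair.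
have mf1 : measurable_fun setT (fun z : D * R => (z.1, quantile z)).
  by apply: measurable_fun_pair => //; exact: measurable_fst.
have step (B : set D) : measurable B -> forall C : set R, measurable C ->
    (Q \x U)%E ((B `*` setT) `&` quantile @^-1` C) = P (G @^-1` B `&` xi @^-1` C).
  move=> mB C mC; have mGB : measurable (G @^-1` B) by exact: fun_preimage_measurable.
  have GI : setI_closed (@RGenInftyO.G R).
    move=> _ _ [a ->] [b ->]; exists (Num.min a b).
    apply/seteqP; split=> x /=; rewrite !in_itv /= lt_min; first by move=> [-> ->].
    by move=> /andP[].
  have mBT : measurable (B `*` (setT : set R)) by exact: measurableX.
  have eBT : (Q \x U)%E (B `*` setT) = P (G @^-1` B) by rewrite QBT // -eG.
  have hrays (A' : set R) : RGenInftyO.G A' -> [/\ measurable (quantile @^-1` A'),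
      measurable (xi @^-1` A') & (Q \x U)%E ((B `*` setT) `&` quantile @^-1` A') =
      P (G @^-1` B `&` xi @^-1` A')].
    move=> [a ->]; split.
    + by apply: fun_preimage_measurable => //; exact: measurable_itv.
    + by apply: fun_preimage_measurable => //; exact: measurable_itv.
    + have -> : (B `*` setT) `&` quantile @^-1` `]-oo, a[ = [set z | B z.1 /\ quantile z < a].
        by apply/seteqP; split=> z /=; rewrite in_itv /=; tauto.
      by rewrite rect //; congr (P (_ `&` _)); apply/seteqP; split=> z /=; rewrite in_itv.
  have mC' : <<s @RGenInftyO.G R >> C.
    by have h0 : (@ocitv R).-sigma.-measurable C := mC; rewrite RGenInftyO.measurableE in h0.
  by have [_ _ //] := prob_eq_gen GI mBT mGB eBT hrays mC'.
have mA' := mA; rewrite measurable_prod_measurableType in mA'.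
have GI : setI_closed [set B `*` C | B in @measurable _ D & C in @measurable _ R].
  move=> _ _ [B1 mB1 [C1 mC1 <-]] [B2 mB2 [C2 mC2 <-]].
  exists (B1 `&` B2); first exact: measurableI.
  exists (C1 `&` C2); first exact: measurableI.
  by rewrite setXI.
have eT : (Q \x U)%E setT = P setT by rewrite !probability_setT.
have hrect (E : set (D * R)) : [set B `*` C | B in @measurable _ D & C in @measurable _ R] E ->
    [/\ measurable ((fun z : D * R => (z.1, quantile z)) @^-1` E),
     measurable ((fun w => (G w, xi w)) @^-1` E) &
     (Q \x U)%E (setT `&` (fun z : D * R => (z.1, quantile z)) @^-1` E) =
     P (setT `&` (fun w => (G w, xi w)) @^-1` E)].
  move=> [B mB [C mC <-]].
  have mBC : measurable (B `*` C) by exact: measurableX.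
  split; [exact: fun_preimage_measurable|exact: fun_preimage_measurable|].
  rewrite !setTI (_ : _ @^-1` _ = (B `*` setT) `&` quantile @^-1` C) ?step //.
  by apply/seteqP; split=> z /= => [[? ?]|[[? _] ?]].
by have [_ _] := prob_eq_gen GI measurableT measurableT eT hrect mA'; rewrite !setTI.
Qed.

End WithDensities.

(** Used with [G] the initial value and [xi] the code of the path: the path is resampled from its
    initial value and one independent uniform variable. *)
Lemma disintegration : exists2 f : D * R -> R, measurable_fun setT f &
  forall A, measurable A ->
  (Q \x U)%E ((fun z => (z.1, f z)) @^-1` A) = P ((fun w => (G w, xi w)) @^-1` A).
Proof.
have [h hh] := densities.
by have [h1 h2] := quantile_coupling hh; exists (quantile h).
Qed.

End Disintegration.

(** * The uniform law and its binary digits *)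

Section Uniform.
Context {R : realType}.

Lemma uniform01_exists : exists U : probability R R, uniform01 U.
Proof.
have mid : measurable_fun setT (id : measurableTypeR R -> R) by [].
have [U hU] := image_prob (uniform_prob (@ltr01 R)) mid.
exists U => c /andP[c0 c1]; rewrite hU; last exact: set_lt_measurable.
transitivity (\int[lebesgue_measure]_(x in [set v : R | (v < c)%R]) (uniform_pdf 0 1 x)%:E)%E => //.
rewrite (integral_uniform_pdf 0 1 [set v : R | v < c]).
rewrite (eq_integral (fun=> 1%:E)); last first.
  move=> x; rewrite inE => -[_ /=]; rewrite in_itv /= /uniform_pdf => ->.
  by rewrite subr0 invr1.
rewrite integral_cst //=; last first.
  by apply: measurableI; [exact: set_lt_measurable|exact: measurable_itv].
rewrite mul1e (_ : _ `&` _ = `[0, c[%classic).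
  by rewrite lebesgue_measure_itv /= lte_fin; case: ltP => h; rewrite ?sube0 //; congr (_%:E); lra.
by apply/seteqP; split=> x /=; rewrite !in_itv /=; lra.
Qed.

Variable U : probability R R.
Hypothesis hU : uniform01 U.

Lemma uniform01_itv (a b : R) : 0 <= a -> a <= b -> b <= 1 ->
  U [set v | a <= v < b] = (b - a)%:E.
Proof.
move=> a0 ab b1.
have mlt c : measurable [set v : R | v < c] by exact: set_lt_measurable.
have -> : [set v | a <= v < b] = [set v | v < b] `\` [set v | v < a].
  apply/seteqP; split=> v /=; first by move=> /andP[h1 ->]; split=> //; lra.
  by move=> [-> /negP]; rewrite -leNgt => ->.
have ha : U [set v | v < a] = a%:E by apply: hU; lra.
have hb : U [set v | v < b] = b%:E by apply: hU; lra.
rewrite measureD //; last by apply: prob_lty.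
rewrite setIidr; last by move=> v /=; lra.
by rewrite EFinB; congr (_ - _)%E; [exact: hb|exact: ha].
Qed.

Definition bit (m : nat) (x : R) : bool := odd (Num.truncn (x * 2 ^+ m.+1)).

Lemma truncn_double (x : R) : 0 <= x ->
  Num.truncn (x * 2) = ((Num.truncn x).*2 + odd (Num.truncn (x * 2)))%N.
Proof.
move=> x0; have x20 : 0 <= x * 2 by lra.
have /andP[h1 h2] := truncn_itv x0; have /andP[h3 h4] := truncn_itv x20.
rewrite -[LHS]odd_double_half addnC; congr (_ + _)%N; congr _.*2.
set t := Num.truncn x in h1 h2 *; set t2 := Num.truncn (x * 2) in h3 h4 *.
have l1 : (t2 < t.+1.*2)%N.
  rewrite -(ltr_nat R) -muln2 natrM; apply: (le_lt_trans h3).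
  by rewrite ltr_pM2r.
have l2 : (t.*2 < t2.+1)%N.
  rewrite -(ltr_nat R) -muln2 natrM; apply: le_lt_trans h4.
  by rewrite ler_pM2r.
by apply/eqP; rewrite eqn_leq -ltnS -[X in (X < _)%N]doubleK; lia.
Qed.

Lemma truncn_bits (k : nat) (x : R) : 0 <= x ->
  Num.truncn (x * 2 ^+ k.+1) = ((Num.truncn (x * 2 ^+ k)).*2 + bit k x)%N.
Proof.
move=> x0; rewrite /bit exprSr mulrA; apply: truncn_double.
by rewrite mulr_ge0 // exprn_ge0.
Qed.

(** Prescribing M digits amounts to prescribing the integer part of x times 2^M, since each new
    digit is the parity added when that integer part is doubled ([truncn_bits]). *)
Lemma bits_itv (M : nat) (b : nat -> bool) : exists2 k : nat, (k < 2 ^ M)%N &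
  [set x : R | 0 <= x < 1 /\ forall m, (m < M)%N -> bit m x = b m] =
  [set x | k%:R / 2 ^+ M <= x < k.+1%:R / 2 ^+ M].
Proof.
suff [k kM hk] : exists2 k : nat, (k < 2 ^ M)%N & forall x : R, 0 <= x ->
    (x < 1 /\ forall m, (m < M)%N -> bit m x = b m) <-> Num.truncn (x * 2 ^+ M) = k.
  have p0 : 0 < 2 ^+ M :> R by rewrite exprn_gt0.
  exists k => //; apply/seteqP; split=> x /=.
    move=> [/andP[x0 x1] hb]; have := (hk x x0).1 (conj x1 hb).
    have x0' : 0 <= x * 2 ^+ M by rewrite mulr_ge0 // ltW.
    by have := truncn_itv x0' => /[swap] ->; rewrite ler_pdivrMr // ltr_pdivlMr.
  move=> /andP[h1 h2]; have x0 : 0 <= x by apply: le_trans h1; rewrite divr_ge0 // ltW.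
  have [|x1 hb] := (hk x x0).2; last by rewrite x0 x1.
  have x0' : 0 <= x * 2 ^+ M by rewrite mulr_ge0 // ltW.
  by apply/eqP; rewrite truncn_eq // -ler_pdivrMr // h1 -ltr_pdivlMr.
elim: M => [|M [k kM hk]].
  exists 0%N => // x x0; rewrite expr0 mulr1; split.
    by move=> [x1 _]; apply/eqP; rewrite truncn_eq // x0.
  by move/eqP; rewrite truncn_eq // => /andP[_ ->].
exists (k.*2 + b M)%N.
  by rewrite expnS mul2n -(@ltn_pmul2l 1) // !mul1n; case: (b M); lia.
move=> x x0; rewrite truncn_bits //; split.
  move=> [x1 hb]; rewrite (hb M) //; congr (_.*2 + _)%N.
  by apply/(hk x x0); split=> // m mM; apply: hb; rewrite ltnS ltnW.
move=> e; have [e1 e2] : Num.truncn (x * 2 ^+ M) = k /\ bit M x = b M.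
  by move: e; case: (bit M x); case: (b M) => e; split=> //; lia.
have [x1 hb] := (hk x x0).2 e1; split=> // m; rewrite ltnS leq_eqVlt => /orP[/eqP ->//|].
exact: hb.
Qed.

Lemma bits_measure (M : nat) (b : nat -> bool) :
  U [set x : R | 0 <= x < 1 /\ forall m, (m < M)%N -> bit m x = b m] =
  ((2^-1) ^+ M)%:E.
Proof.
have [k kM ->] := bits_itv M b.
have p0 : 0 < 2 ^+ M :> R by rewrite exprn_gt0.
rewrite uniform01_itv.
- by congr (_%:E); rewrite -mulrBl -natr1 addrAC subrr add0r mul1r exprVn.
- by rewrite divr_ge0 // ltW.
- by rewrite ler_pM2r ?invr_gt0 // ler_nat.
- by rewrite ler_pdivrMr // mul1r -natrX ler_nat.
Qed.

Lemma bit_measurable m : measurable [set x : R | bit m x].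
Proof.
have mf : measurable_fun setT (fun x : R => x * 2 ^+ m.+1) by exact: measurable_funM.
rewrite (_ : [set _ | _] = [set x | exists k : nat, odd k.+1 /\
    (k.+1%:R <= x * 2 ^+ m.+1 /\ x * 2 ^+ m.+1 < k.+2%:R)]).
  apply: set_exists_measurable => k; case: (boolP (odd k.+1)) => ok; last first.
    by rewrite (_ : (fun x => _) = set0) //; apply/seteqP; split=> x // [].
  rewrite (_ : (fun x => _) = [set x : R | k.+1%:R <= x * 2 ^+ m.+1] `&`
      [set x : R | x * 2 ^+ m.+1 < k.+2%:R]).
    by apply: measurableI; [exact: set_le_measurable|exact: set_lt_measurable].
  by apply/seteqP; split=> [x []|x].
apply/seteqP; split=> x /=; rewrite /bit.
  case e : (Num.truncn (x * 2 ^+ m.+1)) => [//|k] ok; exists k; split=> //.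
  by rewrite -truncn_gt_nat -truncn_le_nat e.
move=> [k [ok [h1 h2]]]; suff -> : Num.truncn (x * 2 ^+ m.+1) = k.+1 by [].
by apply/eqP; rewrite eqn_leq truncn_le_nat h2 truncn_gt_nat.
Qed.

End Uniform.

(** * The space of infinite coin tossing *)

Definition coin_gen : set (set (nat -> bool)) := [set S | exists m, S = [set w : nat -> bool | w m]].
Notation coins := (g_sigma_algebraType coin_gen).

Lemma measure_eq_off_null {R : realType} d (T : measurableType d)
    (P : {measure set T -> \bar R}) (N A B : set T) :
  null P N -> measurable A -> measurable B ->
  (forall x, ~ N x -> A x <-> B x) -> P A = P B.
Proof.
move=> [mN PN] mA mB h.
have hN (C : set T) : measurable C -> P C = P (C `\` N).
  move=> mC; have {1}-> : C = (C `\` N) `|` (C `&` N).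
    apply/seteqP; split=> [x Cx|x [[]|[]] //].
    by have [Nx|Nx] := pselect (N x); [right|left].
  rewrite measureU; [|exact: measurableD|exact: measurableI|].
    rewrite [X in (_ + X)%E](_ : _ = 0%E) ?adde0 //.
    by apply: (@subset_measure0 _ _ _ P _ N) => //; exact: measurableI.
  by apply/seteqP; split=> x // [[_ nN] [_ Nx]].
rewrite (hN A mA) (hN B mB); congr (P _).
by apply/seteqP; split=> x [hx nN]; split=> //; apply/(h x nN).
Qed.

Section Coins.
Context {R : realType}.
Variable U : probability R R.
Hypothesis hU : uniform01 U.

Lemma coin_measurable m (b : bool) : measurable ([set w | w m = b] : set coins).
Proof.
have h : measurable ([set w | w m] : set coins) by apply: sub_sigma_algebra; exists m.
case: b => //; rewrite (_ : mkset _ = ~` [set w : nat -> bool | w m]); first exact: measurableC.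
by apply/seteqP; split=> w /=; case: (w m).
Qed.

Lemma coins_measurable_fun d (T : measurableType d) (f : T -> nat -> bool) :
  (forall m, measurable [set w | f w m]) -> measurable_fun setT (f : T -> coins).
Proof.
move=> h _ B mB; rewrite setTI; move: B mB.
apply: gen_preimage; first exact: measurable_sigma.
by move=> _ [m ->]; exact: h.
Qed.

Definition cylinder (s : seq (nat * bool)) : set coins :=
  [set w | forall p, p \in s -> w p.1 = p.2].

Lemma cylinder_measurable s : measurable (cylinder s).
Proof.
elim: s => [|p s IH].
  by rewrite (_ : cylinder _ = setT) //; apply/seteqP; split.
rewrite (_ : cylinder _ = [set w | w p.1 = p.2] `&` cylinder s).
  by apply: measurableI => //; exact: coin_measurable.
apply/seteqP; split=> w.
  by move=> h; split=> [|q qs]; apply: h; rewrite inE ?eqxx // qs orbT.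
by move=> [h1 h2] q; rewrite inE => /orP[/eqP ->//|]; exact: h2.
Qed.

Definition prefix_seq (M : nat) (b : nat -> bool) := [seq (m, b m) | m <- iota 0 M].

Lemma prefix_cylinderE M b : cylinder (prefix_seq M b) =
  [set w | forall m, (m < M)%N -> w m = b m].
Proof.
apply/seteqP; split=> w h.
  move=> m mM; apply: (h (m, b m)); apply: (map_f (fun m => (m, b m))).
  by rewrite mem_iota.
by move=> p /mapP[m]; rewrite mem_iota /= => mM ->; exact: h.
Qed.

(** Two prefix cylinders are nested or disjoint; with the empty set added they are stable under
    intersection, so Dynkin's argument applies to them. *)
Definition prefix_gen : set (set coins) :=
  [set S | S = set0 \/ exists M b, S = cylinder (prefix_seq M b)].

Lemma prefix_gen_setI : setI_closed prefix_gen.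
Proof.
move=> A B [->|[M [b ->]]]; first by rewrite set0I; left.
move=> [->|[M' [b' ->]]]; first by rewrite setI0; left.
wlog MM : M b M' b' / (M <= M')%N.
  by move=> h; case: (leqP M M') => [|/ltnW] /h // h'; rewrite setIC; exact: h'.
have [bb|nbb] := pselect (forall m, (m < M)%N -> b m = b' m); last first.
  left; apply/seteqP; split=> w //; rewrite !prefix_cylinderE => -[h1 h2].
  by apply: nbb => m mM; rewrite -(h1 m mM) (h2 m (leq_trans mM MM)).
right; exists M', b'; rewrite setIidr // !prefix_cylinderE => w h m mM.
by rewrite bb // h // (leq_trans mM).
Qed.

Lemma prefix_gen_measurable A : measurable (A : set coins) -> <<s prefix_gen >> A.
Proof.
move: A; apply: gen_mono => _ [m ->].
have sg : sigma_algebra setT <<s prefix_gen >> by exact: smallest_sigma_algebra.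
(* The toss m being fixed to true, the union runs over all outcomes of the m tosses before it. *)
rewrite (_ : [set w : nat -> bool | w m] = \bigcup_(t in [set: m.-tuple bool])
   cylinder (prefix_seq m.+1 (fun i => if (i < m)%N then nth false t i else true))).
  apply: (@countable_bigcupT_measurable _ (g_sigma_algebraType prefix_gen)) => // t.
  by apply: sub_sigma_algebra; right; do 2 eexists.
apply/seteqP; split=> w /=; last first.
  by move=> [t _]; rewrite prefix_cylinderE => /(_ m (ltnSn m)) ->; rewrite ltnn.
move=> wm; exists (mktuple (fun i : 'I_m => w i)) => //; rewrite prefix_cylinderE => i im.
case: ifPn => [im'|]; last by rewrite -leqNgt => mi; rewrite (_ : i = m) //; lia.
by rewrite (nth_map (Ordinal im')) ?size_enum_ord // nth_enum_ord.
Qed.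

(* Two random bit sequences giving each cylinder probability 2^-(length) have
   the same law. *)
Definition coin_law d (T : measurableType d) (P : probability T R) (f : T -> nat -> bool) :=
  measurable_fun setT (f : T -> coins) /\
  forall M b, P (f @^-1` cylinder (prefix_seq M b)) = ((2^-1) ^+ M)%:E.

Lemma coin_law_eq d1 (T1 : measurableType d1) d2 (T2 : measurableType d2)
    (P1 : probability T1 R) (P2 : probability T2 R) f1 f2 :
  coin_law P1 f1 -> coin_law P2 f2 ->
  forall A, measurable (A : set coins) -> P1 (f1 @^-1` A) = P2 (f2 @^-1` A).
Proof.
move=> [m1 h1] [m2 h2] A mA.
have e : P1 setT = P2 setT by rewrite !probability_setT.
have hg B : prefix_gen B -> [/\ measurable (f1 @^-1` B), measurable (f2 @^-1` B) &
    P1 (setT `&` f1 @^-1` B) = P2 (setT `&` f2 @^-1` B)].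
  rewrite !setTI => -[->|[M [b ->]]].
    by rewrite !preimage_set0 !measure0.
  have mc := cylinder_measurable (prefix_seq M b).
  by split; [exact: (fun_preimage_measurable m1 mc)|exact: (fun_preimage_measurable m2 mc)|rewrite h1 h2].
have [_ _] := prob_eq_gen prefix_gen_setI measurableT measurableT e hg (prefix_gen_measurable mA).
by rewrite !setTI.
Qed.

Lemma bits_coin_law : coin_law U (fun x m => bit m x).
Proof.
pose f (x : R) : nat -> bool := fun m => bit m x.
have mf : measurable_fun setT (f : R -> coins).
  by apply: coins_measurable_fun => m; exact: bit_measurable.
split=> // M b; rewrite -(bits_measure hU M b) prefix_cylinderE.
have m01 : measurable [set v : R | 0 <= v < 1].
  by rewrite (_ : mkset _ = `[0, 1[%classic) //; apply/seteqP; split=> v /=; rewrite in_itv.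
have mp : measurable (f @^-1` [set w | forall m, (m < M)%N -> w m = b m]).
  by rewrite -prefix_cylinderE; exact: (fun_preimage_measurable mf (cylinder_measurable _)).
(* [U] gives full mass to [0, 1), so restricting the event to that interval, where [bits_measure]
   speaks, changes nothing. *)
have h01 : U [set v : R | 0 <= v < 1] = 1%E by rewrite uniform01_itv ?subr0.
have hc : U (~` [set v : R | 0 <= v < 1]) = 0%E.
  by rewrite probability_setC // h01 subee.
have -> : [set x : R | 0 <= x < 1 /\ forall m, (m < M)%N -> bit m x = b m] =
  [set v | 0 <= v < 1] `&` f @^-1` [set w | forall m, (m < M)%N -> w m = b m] by [].
rewrite -/f.
have {1}-> : f @^-1` [set w | forall m, (m < M)%N -> w m = b m] =
   ([set v | 0 <= v < 1] `&` f @^-1` [set w | forall m, (m < M)%N -> w m = b m]) `|`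
   (~` [set v | 0 <= v < 1] `&` f @^-1` [set w | forall m, (m < M)%N -> w m = b m]).
  by rewrite -setIUl setUv setTI.
rewrite measureU; [|exact: measurableI|by apply: measurableI => //; exact: measurableC|].
  rewrite [X in (_ + X)%E](_ : _ = 0%E) ?adde0 //.
  apply: (@subset_measure0 _ _ _ U _ (~` [set v | 0 <= v < 1])) => //.
  - by apply: measurableI => //; exact: measurableC.
  - exact: measurableC.
by apply/seteqP; split=> v //= [[h _] [h' _]].
Qed.

Lemma coin_prob_exists : exists P : probability coins R, coin_law P id.
Proof.
have [mf lf] := bits_coin_law.
have [P hP] := image_prob U mf; exists P; split=> // M b.
by rewrite preimage_id hP ?lf //; exact: cylinder_measurable.
Qed.

Variable P : probability coins R.
Hypothesis hP : coin_law P id.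

Lemma unzip1_inj (s : seq (nat * bool)) p q :
  uniq (unzip1 s) -> p \in s -> q \in s -> p.1 = q.1 -> p = q.
Proof.
elim: s => //= r s IH /andP[rs us]; rewrite !inE => /orP[/eqP ->|ps] /orP[/eqP ->|qs] // e.
- by move: rs; rewrite e (map_f fst qs).
- by move: rs; rewrite -e (map_f fst ps).
- exact: IH.
Qed.

(** Induction on the number of positions below M left free by s. If none is free this is a prefix
    cylinder; otherwise a free position m splits the cylinder into two, each of half the expected
    mass. *)
Lemma cylinder_prob (s : seq (nat * bool)) : uniq (unzip1 s) ->
  P (cylinder s) = ((2^-1) ^+ size s)%:E.
Proof.
pose M := (\max_(p <- s) p.1).+1.
suff: forall k M s, uniq (unzip1 s) -> (forall p, p \in s -> (p.1 < M)%N) ->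
    (M - size s < k)%N -> P (cylinder s) = ((2^-1) ^+ size s)%:E.
  move=> /(_ (M - size s).+1 M s) + us; apply=> // p ps.
  by rewrite ltnS /M; exact: (@leq_bigmax_seq _ s xpredT (fun p => p.1)).
clear s M; elim=> // k IH M s us sM hk.
have sub : {subset unzip1 s <= iota 0 M}.
  by move=> m /mapP[p ps ->]; rewrite mem_iota; exact: sM.
have [full|nfull] := pselect (forall m, (m < M)%N -> m \in unzip1 s).
  have sz : size s = M.
    rewrite -(size_map fst) -(size_iota 0 M); apply: perm_size.
    apply: uniq_perm => //; first exact: iota_uniq.
    move=> m; apply/idP/idP; first exact: sub.
    by rewrite mem_iota; exact: full.
  pose b m := (nth (0%N, false) s (index m (unzip1 s))).2.
  have bE p : p \in s -> b p.1 = p.2.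
    move=> ps; rewrite /b nth_index_map // => x y xs ys.
    exact: (unzip1_inj us xs ys).
  have -> : cylinder s = id @^-1` cylinder (prefix_seq M b).
    rewrite preimage_id prefix_cylinderE; apply/seteqP; split=> w h.
      by move=> m /full /mapP[p ps ->]; rewrite h // bE.
    by move=> p ps; rewrite h ?bE //; exact: sM.
  by case: hP => _ ->; rewrite sz.
have [m [mM ms]] : exists m, (m < M)%N /\ m \notin unzip1 s.
  apply: contrapT => h; apply: nfull => m mM; apply: contrapT => /negP ms.
  by apply: h; exists m.
have szM : (size s < M)%N.
  rewrite -(size_map fst) -[X in (_ <= X)%N](size_iota 0 M).
  apply: (@uniq_leq_size _ (m :: unzip1 s)); first by rewrite /= ms us.
  move=> i; rewrite inE => /orP[/eqP ->|]; last exact: sub.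
  by rewrite mem_iota.
have step c : P (cylinder ((m, c) :: s)) = ((2^-1) ^+ (size s).+1)%:E.
  apply: (IH M) => //=; first by rewrite ms us.
    by move=> p; rewrite inE => /orP[/eqP ->//|]; exact: sM.
  by rewrite subnS -ltnS prednK ?subn_gt0.
have -> : cylinder s = cylinder ((m, true) :: s) `|` cylinder ((m, false) :: s).
  apply/seteqP; split=> w.
    move=> h; case e : (w m); [left|right] => p; rewrite inE => /orP[/eqP ->//|]; exact: h.
  by move=> [|] h p ps; apply: h; rewrite inE ps orbT.
rewrite measureU; [|exact: cylinder_measurable|exact: cylinder_measurable|].
  transitivity (((2^-1 : R) ^+ (size s).+1)%:E + ((2^-1 : R) ^+ (size s).+1)%:E)%E.
    by congr (_ + _)%E; exact: step.
  by rewrite -EFinD exprS; congr (_%:E); field.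
apply/seteqP; split=> w // [h1 h2].
have := h1 (m, true); have := h2 (m, false); rewrite !inE !eqxx /= => /(_ isT) -> /(_ isT).
by [].
Qed.

(** Disjoint subsequences of one coin sequence thus provide many coin sequences, hence many uniform
    variables. *)
Lemma reindex_coin_law (e : nat -> nat) : injective e ->
  coin_law P (fun w : coins => w \o e).
Proof.
move=> ie; split.
  apply: coins_measurable_fun => m /=; exact: (coin_measurable (e m) true).
move=> M b; pose s := [seq (e m, b m) | m <- iota 0 M].
have -> : (fun w : coins => w \o e) @^-1` cylinder (prefix_seq M b) = cylinder s.
  rewrite prefix_cylinderE; apply/seteqP; split=> w /= h.
    by move=> p /mapP[m]; rewrite mem_iota /= => mM ->; exact: h.
  by move=> m mM; apply: (h (e m, b m)); apply: (map_f (fun m => (e m, b m))); rewrite mem_iota.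
rewrite cylinder_prob ?size_map ?size_iota //.
by rewrite /unzip1 -map_comp map_inj_uniq ?iota_uniq.
Qed.

Definition bitmix (K : pred nat) (w w' : nat -> bool) : nat -> bool :=
  fun m => if K m then w m else w' m.

(** A prefix cylinder pulls back to a product of two cylinders, on the positions inside and outside
    K, whose lengths add up. *)
Lemma bitmix_coin_law (K : pred nat) :
  coin_law (P \x P)%E (fun z : coins * coins => bitmix K z.1 z.2).
Proof.
have mm : measurable_fun setT ((fun z : coins * coins => bitmix K z.1 z.2) : _ -> coins).
  apply: coins_measurable_fun => m; rewrite /bitmix; case: (K m).
    apply: (fun_preimage_measurable (f := fst) (B := [set w : coins | w m])) => //.
    exact: (coin_measurable m true).
  apply: (fun_preimage_measurable (f := snd) (B := [set w : coins | w m])) => //.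
  exact: (coin_measurable m true).
split=> // M b.
pose s1 := [seq p <- prefix_seq M b | K p.1].
pose s2 := [seq p <- prefix_seq M b | ~~ K p.1].
have us : uniq (unzip1 (prefix_seq M b)).
  by rewrite /unzip1 -map_comp map_id iota_uniq.
have uf (Q : pred (nat * bool)) : uniq (unzip1 [seq p <- prefix_seq M b | Q p]).
  by apply: subseq_uniq us; apply: map_subseq; exact: filter_subseq.
have -> : (fun z : coins * coins => bitmix K z.1 z.2) @^-1` cylinder (prefix_seq M b) =
    cylinder s1 `*` cylinder s2.
  apply/seteqP; split=> -[w w'] /=.
    move=> h; split=> p; rewrite mem_filter => /andP[Kp ps].
      by have := h p ps; rewrite /bitmix /= Kp.
    by have := h p ps; rewrite /bitmix /= (negbTE Kp).
  move=> [h1 h2] p ps; rewrite /bitmix /=; case: ifPn => Kp.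
    by apply: h1; rewrite mem_filter Kp.
  by apply: h2; rewrite mem_filter Kp.
apply: (etrans (product_measure1E P P (cylinder_measurable s1) (cylinder_measurable s2))).
transitivity (((2^-1 : R) ^+ size s1)%:E * ((2^-1 : R) ^+ size s2)%:E)%E.
  by congr (_ * _)%E; apply: cylinder_prob; exact: uf.
rewrite -EFinM -exprD; congr ((_ ^+ _)%:E).
rewrite -size_cat -[RHS](size_iota 0 M) -[RHS](size_map (fun m => (m, b m))).
by apply: perm_size; rewrite -/(prefix_seq M b); apply/permEl; exact: perm_filterC.
Qed.

Definition binary_sum (w : nat -> bool) : nat -> R := fun k =>
  \sum_(m < k) (w m)%:R / 2 ^+ m.+1.
Definition binary_value (w : nat -> bool) : R := limn (binary_sum w).

Lemma binary_sum_bits (x : R) k : 0 <= x < 1 ->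
  binary_sum (bit^~ x) k = (Num.truncn (x * 2 ^+ k))%:R / 2 ^+ k.
Proof.
move=> /andP[x0 x1]; rewrite /binary_sum; elim: k => [|k IH].
  by rewrite big_ord0 expr0 mulr1 (truncn_def (n := 0%N)) ?mul0r // x0 x1.
rewrite big_ord_recr /= IH truncn_bits // natrD -muln2 natrM mulrDl; congr (_ + _).
by rewrite exprS; field; rewrite expf_neq0.
Qed.

Lemma binary_value_bits (x : R) : 0 <= x < 1 -> binary_value (bit^~ x) = x.
Proof.
move=> x01; apply/cvg_lim => //; apply/cvgrPdist_lt => e e0.
have [k0 hk0] := exp2_small e0; exists k0 => // k /hk0 hk /=.
rewrite binary_sum_bits //; move: x01 => /andP[x0 x1].
have p0 : 0 < 2 ^+ k :> R by rewrite exprn_gt0.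
have h : 0 <= x * 2 ^+ k by rewrite mulr_ge0 // ltW.
have /andP[h1 h2] := truncn_itv h.
apply: le_lt_trans hk; rewrite ler_norml.
have i0 : 0 < (2 ^+ k)^-1 :> R by rewrite invr_gt0.
have h3 : (Num.truncn (x * 2 ^+ k))%:R / 2 ^+ k <= x by rewrite ler_pdivrMr.
have h4 : x < ((Num.truncn (x * 2 ^+ k))%:R + 1) / 2 ^+ k by rewrite ltr_pdivlMr // natr1.
by rewrite mulrDl mul1r in h4; apply/andP; split; lra.
Qed.

Lemma binary_sum_nd (w : nat -> bool) : nondecreasing_seq (binary_sum w).
Proof.
apply/nondecreasing_seqP => k; rewrite /binary_sum big_ord_recr /= lerDl.
by rewrite divr_ge0 // exprn_ge0.
Qed.

Lemma binary_sum_le1 (w : nat -> bool) k : 0 <= binary_sum w k <= 1 - (2 ^+ k)^-1.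
Proof.
elim: k => [|k /andP[IH1 IH2]]; rewrite /binary_sum ?big_ord0 ?expr0 ?invr1 ?subrr ?lexx //.
rewrite big_ord_recr /=; have p0 : 0 < 2 ^+ k :> R by rewrite exprn_gt0.
have i0 : 0 < (2 ^+ k)^-1 :> R by rewrite invr_gt0.
rewrite exprS invfM; move: IH1 IH2; rewrite /binary_sum; set s := \sum_(_ < k) _ => IH1 IH2.
by case: (w k) => /=; lra.
Qed.

Lemma binary_value_cvg w : binary_sum w @ \oo --> binary_value w.
Proof.
have : cvgn (binary_sum w).
  apply: nondecreasing_is_cvgn; first exact: binary_sum_nd.
  exists 1 => _ [k _ <-]; have := binary_sum_le1 w k.
  have : 0 < (2 ^+ k)^-1 :> R by rewrite invr_gt0 exprn_gt0.
  lra.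
by [].
Qed.

Lemma binary_value_itv w : 0 <= binary_value w <= 1.
Proof.
have c := @binary_value_cvg w.
apply/andP; split.
  by apply: (limr_ge c); near=> k; have := binary_sum_le1 w k; lra.
apply: (limr_le c); near=> k; have := binary_sum_le1 w k.
have : 0 < (2 ^+ k)^-1 :> R by rewrite invr_gt0 exprn_gt0.
lra.
Unshelve. all: by end_near. Qed.

Lemma binary_value_measurable d (T : measurableType d) (f : T -> nat -> bool) :
  (forall m, measurable [set w | f w m]) ->
  measurable_fun setT (fun w => binary_value (f w)).
Proof.
move=> mf; apply: (measurable_fun_cvg (h := fun k w => binary_sum (f w) k)); last first.
  by move=> w _; exact: binary_value_cvg.
move=> k; rewrite /binary_sum; apply: measurable_sum => m.
apply: measurable_funM => //.
rewrite (_ : (fun w => _) = \1_[set w | f w m]); first exact: measurable_indic.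
by apply/funext => w; rewrite indicE; case: (boolP (f w m)) => h; [rewrite mem_set|rewrite memNset //; apply/negP].
Qed.

(** All coin sequences have the law of the digits of a uniform variable ([coin_law_eq]), and there
    the binary value gives back the variable on [0, 1), which has full mass. *)
Lemma binary_value_law d (T : measurableType d) (Q : probability T R) f :
  coin_law Q f -> has_image Q U (fun w => binary_value (f w)).
Proof.
move=> lf; have [mf _] := lf.
have mv : measurable_fun setT (binary_value : coins -> R).
  by apply: binary_value_measurable => m; exact: (coin_measurable m true).
split; first exact: (measurableT_comp mv mf).
move=> B mB.
have mvB : measurable ((binary_value : coins -> R) @^-1` B) by exact: fun_preimage_measurable.
have [mg _] := bits_coin_law.
transitivity (U ((fun x m => bit m x) @^-1` ((binary_value : coins -> R) @^-1` B))).
  exact: (coin_law_eq lf bits_coin_law mvB).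
have m01 : measurable [set v : R | 0 <= v < 1].
  by rewrite (_ : mkset _ = `[0, 1[%classic) //; apply/seteqP; split=> v /=; rewrite in_itv.
have h01 : U [set v : R | 0 <= v < 1] = 1%E by rewrite uniform01_itv ?subr0.
have hc : U (~` [set v : R | 0 <= v < 1]) = 0%E.
  by rewrite probability_setC // h01 subee.
have n01 : null U (~` [set v : R | 0 <= v < 1]) by split; [exact: measurableC|].
apply: (measure_eq_off_null n01 _ mB) => //.
  exact: (fun_preimage_measurable mg mvB).
by move=> x /contrapT x01 /=; rewrite binary_value_bits.
Qed.

End Coins.

(** * Sampling the exponential law *)

Section ExponentialSampler.
Context {R : realType}.
Variables (U : probability R R) (lam : R).
Hypotheses (hU : uniform01 U) (lam0 : 0 < lam).

(** The inverse of the exponential distribution function. The default 1 makes it positive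
    everywhere, so that the jump times are strictly increasing for every outcome and not only almost
    surely. *)
Definition expo (v : R) : R := if (0 < v) && (v < 1) then - ln (1 - v) / lam else 1.

Lemma expo_gt0 v : 0 < expo v.
Proof.
rewrite /expo; case: ifPn => // /andP[v0 v1].
by rewrite divr_gt0 // oppr_gt0 ln_lt0 //; lra.
Qed.

Lemma expo_lt v a : 0 < v -> v < 1 -> (expo v < a) = (v < 1 - expR (- (lam * a))).
Proof.
move=> v0 v1; rewrite /expo v0 v1 /= ltr_pdivrMr // ltrNl (mulrC a).
have h : 1 - v \in Num.pos by rewrite posrE; lra.
rewrite -(ltr_expR (- (lam * a))) lnK //.
by apply/idP/idP => ?; lra.
Qed.

Lemma expo_measurable : measurable_fun setT expo.
Proof.
rewrite /expo; apply: measurable_fun_ifT => //.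
  apply: measurable_and; first exact: measurable_fun_ltr.
  exact: measurable_fun_ltr.
apply: measurable_funM => //; apply: (measurableT_comp (@oppr_measurable R setT)).
apply: (measurableT_comp (@measurable_ln R)).
exact: measurable_funB.
Qed.

Lemma uniform01_null : null U [set v | ~ (0 < v < 1)].
Proof.
have m01 : measurable [set v : R | ~ (0 < v < 1)].
  rewrite (_ : mkset _ = ~` `]0, 1[%classic); first exact: measurableC.
  by apply/seteqP; split=> v /=; rewrite in_itv.
split=> //; apply/eqP; rewrite eq_le measure_ge0 andbT; apply/lee_addgt0Pr => e e0.
rewrite add0e; have [e1|e1] := leP 1 e.
  apply: (@le_trans _ _ 1%E); first exact: probability_le1.
  by rewrite lee_fin.
have mlt c : measurable [set v : R | v < c] by exact: set_lt_measurable.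
have -> : e%:E = U ([set v | v < e] `|` ~` [set v | v < 1]).
  rewrite measureU //; [|exact: measurableC|].
    have h1 : U [set v | v < e] = e%:E by apply: hU; lra.
    have h2 : U (~` [set v | v < 1]) = 0%E.
      by rewrite probability_setC // hU ?subee //; lra.
    transitivity (e%:E + 0)%E; first by rewrite adde0.
    by congr (_ + _)%E; [exact/esym/h1|exact/esym/h2].
  by apply/seteqP; split=> v //= [h1 h2]; apply: h2; lra.
apply: le_measure; rewrite ?inE //; first by apply: measurableU => //; exact: measurableC.
move=> v /= /negP; rewrite negb_and -!leNgt => /orP[h|h]; [left=> /=|right=> /=]; first by lra.
by apply/negP; rewrite -leNgt.
Qed.

Lemma exponential_prob_ray (a : R) : 0 < a ->
  exponential_prob lam `]-oo, a[%classic = (1 - expR (- (lam * a)))%:E.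
Proof.
move=> a0; transitivity (exponential_prob lam `[0, a]%classic); last first.
  by rewrite exponential_prob_itv0c // mulNr EFinB.
rewrite /exponential_prob -integral_itv_bndo_bndc; last first.
  by apply/measurable_funTS/measurable_EFinP; exact: measurable_exponential_pdf.
rewrite integral_mkcond [RHS]integral_mkcond; apply: eq_integral => x _.
rewrite !patchE !mem_setE !in_itv /=; case: (ltP x a) => xa; last by rewrite andbF.
by rewrite andbT; case: leP => // x0; rewrite lt0_exponential_pdf.
Qed.

Lemma exponential_prob_ray0 (a : R) : a <= 0 ->
  exponential_prob lam `]-oo, a[%classic = 0%E.
Proof.
move=> a0; rewrite /exponential_prob integral0_eq // => x /=; rewrite in_itv /= => xa.
by rewrite lt0_exponential_pdf //; lra.
Qed.

Lemma expo_law B : measurable B -> U (expo @^-1` B) = exponential_prob lam B.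
Proof.
move=> mB.
pose Q : probability (measurableTypeR R) R :=
  exponential_distribution_exponential_prob__canonical__probability_measure_Probability lam0.
have GI : setI_closed (@RGenInftyO.G R).
  move=> _ _ [a ->] [b ->]; exists (Num.min a b).
  apply/seteqP; split=> x /=; rewrite !in_itv /= lt_min; first by move=> [-> ->].
  by move=> /andP[].
have eT : U setT = Q setT by rewrite !probability_setT.
have hrays (A : set R) : RGenInftyO.G A -> [/\ measurable (expo @^-1` A),
      measurable ((id : measurableTypeR R -> R) @^-1` A) &
      U (setT `&` expo @^-1` A) = Q (setT `&` (id : measurableTypeR R -> R) @^-1` A)].
  move=> [a ->]; rewrite preimage_id !setTI; split.
  - exact: fun_preimage_measurable expo_measurable (measurable_itv _).
  - exact: measurable_itv.
  - have [a0|a0] := ltP 0 a; last first.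
      transitivity (U set0); last by rewrite measure0; exact/esym/exponential_prob_ray0.
      congr (U _); apply/seteqP; split=> v //=; rewrite in_itv /=.
      by have := expo_gt0 v; lra.
    transitivity (1 - expR (- (lam * a)))%:E; last exact/esym/exponential_prob_ray.
    have e01 : 0 < expR (- (lam * a)) <= 1.
      by rewrite expR_gt0 /= -expR0 ler_expR oppr_le0 mulr_ge0 // ltW.
    transitivity (U [set v | v < 1 - expR (- (lam * a))]); last by apply: hU; lra.
    apply: (measure_eq_off_null uniform01_null).
    + exact: fun_preimage_measurable expo_measurable (measurable_itv _).
    + exact: set_lt_measurable.
    + by move=> v /= /contrapT /andP[v0 v1]; rewrite in_itv /= expo_lt.
have mC' : <<s @RGenInftyO.G R >> B.
  by have h0 : (@ocitv R).-sigma.-measurable B := mB; rewrite RGenInftyO.measurableE in h0.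
by have [_ _] := prob_eq_gen GI measurableT measurableT eT hrays mC'; rewrite !setTI.
Qed.

End ExponentialSampler.

(** * Resampling of coordinates and an independent uniform sequence *)

Section Mixing.
Context {R : realType} d (T : measurableType d) (P : probability T R).

(* Under P \x P, mix w w' has law P: it replaces some independent components of
   w by those of an independent copy w'. *)
Definition mixing d' (T' : measurableType d') (P' : probability T' R) (mix : T -> T' -> T) :=
  has_image (P \x P')%E P (fun z => mix z.1 z.2).

(** [S1] sees only the coordinates that are kept and [S2] only those that are redrawn, so under the
    product measure their intersection is a rectangle. *)
Lemma mixing_indep (mix : T -> T -> T) (S1 S2 : set T) : mixing P mix ->
  measurable S1 -> measurable S2 ->
  (forall w w', S1 (mix w w') <-> S1 w) -> (forall w w', S2 (mix w w') <-> S2 w') ->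
  P (S1 `&` S2) = (P S1 * P S2)%E.
Proof.
move=> [_ hmix] m1 m2 h1 h2; rewrite -hmix; last exact: measurableI.
rewrite -[RHS](product_measure1E P P m1 m2); congr (_ _).
by apply/seteqP; split=> z /= [/h1 ? /h2].
Qed.

End Mixing.

(** For such K a mixed sequence has the same tail as one of its two sources. Divergence of the sum
    of waiting times, a tail property, therefore survives the mixing. *)
Definition eventually_const (K : pred nat) := exists m, forall i, (m <= i)%N -> K i = K m.

Section IidSequence.
Context {R : realType}.
Variables (U : probability R R) (lam : R).
Hypotheses (hU : uniform01 U) (lam0 : 0 < lam).

(** The tosses at the positions pairing i with j, for all j, form a separate coin sequence for each
    i, read here as a binary expansion; [block] recovers i from the position. *)
Definition block_value (i : nat) (w : nat -> bool) : R :=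
  binary_value (fun j => w (pickle (i, j))).
Definition block (m : nat) : nat := if unpickle m is Some p then (p : nat * nat).1 else 0%N.

Lemma block_bitmix (K : pred nat) w w' i :
  block_value i (bitmix (K \o block) w w') = if K i then block_value i w else block_value i w'.
Proof.
rewrite /block_value /bitmix /=.
by case: ifPn => Ki; congr binary_value; apply/funext => j; rewrite /block pickleK /= ?Ki ?(negbTE Ki).
Qed.

Variable P : probability coins R.
Hypothesis hP : coin_law P id.

Lemma block_law i : has_image P U (block_value i).
Proof.
have ie : injective (fun j : nat => pickle (i, j)).
  by move=> j j' h; have [] := pcan_inj pickleK h.
exact: (binary_value_law hU (reindex_coin_law hP ie)).
Qed.

Lemma bitmix_mixing K : mixing P P (bitmix K : coins -> coins -> coins).
Proof.
have hm := bitmix_coin_law hP K; split; first by case: hm.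
by move=> B mB; have := coin_law_eq hm hP mB; rewrite preimage_id.
Qed.

Definition time_sum (w : nat -> bool) (k : nat) : R :=
  \sum_(i < k) expo lam (block_value i.*2.+1 w).

Lemma time_sum_measurable k : measurable_fun setT (time_sum^~ k : coins -> R).
Proof.
apply: measurable_sum => i; apply: (measurableT_comp (@expo_measurable R lam)).
by case: (block_law i.*2.+1).
Qed.

Lemma short_steps (c : R) k : 0 < c ->
  P [set w | forall i, (i < k)%N -> expo lam (block_value i.*2.+1 w) < c] =
  ((1 - expR (- (lam * c))) ^+ k)%:E.
Proof.
move=> c0; have mS i : measurable ([set w | expo lam (block_value i.*2.+1 w) < c] : set coins).
  apply: set_lt_measurable => //; apply: (measurableT_comp (@expo_measurable R lam)).
  by case: (block_law i.*2.+1).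
have PS i : P [set w | expo lam (block_value i.*2.+1 w) < c] = (1 - expR (- (lam * c)))%:E.
  have [_ h] := block_law i.*2.+1.
  rewrite -exponential_prob_ray // -(expo_law hU lam0); last exact: measurable_itv.
  rewrite -h; last exact: (fun_preimage_measurable (@expo_measurable R lam) (measurable_itv _)).
  by congr (P _); apply/seteqP; split=> w /=; rewrite in_itv.
have mA j : measurable ([set w | forall i, (i < j)%N -> expo lam (block_value i.*2.+1 w) < c] : set coins).
  rewrite (_ : mkset _ = \bigcap_(i in [set i | (i < j)%N])
    [set w | expo lam (block_value i.*2.+1 w) < c]); first exact: bigcap_measurableType.
  by apply/seteqP; split=> w h i; exact: h.
elim: k => [|k IH].
  by rewrite (_ : mkset _ = setT) ?probability_setT ?expr0 //; apply/seteqP; split.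
have -> : [set w | forall i, (i < k.+1)%N -> expo lam (block_value i.*2.+1 w) < c] =
  [set w | forall i, (i < k)%N -> expo lam (block_value i.*2.+1 w) < c] `&`
  [set w | expo lam (block_value k.*2.+1 w) < c].
  apply/seteqP; split=> w /=.
    by move=> h; split=> [i ik|]; apply: h => //; rewrite ltnS ltnW.
  by move=> [h1 h2] i; rewrite ltnS leq_eqVlt => /orP[/eqP ->//|]; exact: h1.
rewrite (mixing_indep (bitmix_mixing ((fun i => (i < k.*2)%N) \o block)) (mA k) (mS k)).
- by rewrite IH PS -EFinM exprSr.
- move=> w w' /=; split=> h i ik; have := h i ik; rewrite block_bitmix ifT //; lia.
- by move=> w w' /=; rewrite block_bitmix ifF //; lia.
Qed.

(** The outcomes for which the jump times would accumulate. *)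
Definition fast : set coins := [set w | exists c : nat, forall k, time_sum w k <= c%:R].

(** If all partial sums stay below c then every waiting time is below c+1; the first k of them are
    so with probability q^k for some q < 1. *)
Lemma fast_null : null P fast.
Proof.
rewrite (_ : fast = \bigcup_c [set w | forall k, time_sum w k <= c%:R]); last first.
  by apply/seteqP; split=> [w [c h]|w [c _ h]]; exists c.
apply: null_bigcup => c.
have mS : measurable ([set w | forall k, time_sum w k <= c%:R] : set coins).
  apply: set_forall_measurable => k; apply: set_le_measurable => //.
  exact: time_sum_measurable.
split=> //; apply/eqP; rewrite eq_le measure_ge0 andbT; apply/lee_addgt0Pr => e e0.
rewrite add0e; have c0 : 0 < c.+1%:R :> R by [].
pose q : R := 1 - expR (- (lam * c.+1%:R)).
have q0 : 0 <= q.
  by rewrite subr_ge0 -expR0 ler_expR oppr_le0 mulr_ge0 // ltW.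
have q1 : q < 1 by rewrite ltrBlDr ltrDl expR_gt0.
have /cvgrPdist_lt /(_ e e0) := @cvg_expr R q ltac:(by rewrite ger0_norm).
case=> k _ /(_ k (leqnn k)) /=; rewrite sub0r normrN ger0_norm ?exprn_ge0 // => hk.
apply: (@le_trans _ _ (q ^+ k)%:E); last by rewrite lee_fin ltW.
rewrite -short_steps //; apply: le_measure; rewrite ?inE //.
  rewrite (_ : mkset _ = \bigcap_(i in [set i | (i < k)%N])
    [set w | expo lam (block_value i.*2.+1 w) < c.+1%:R]).
    apply: bigcap_measurableType => i _; apply: set_lt_measurable => //.
    apply: (measurableT_comp (@expo_measurable R lam)).
    by case: (block_law i.*2.+1).
  by apply/seteqP; split=> w h i; exact: h.
move=> w /= h i ik; have := h i.+1; rewrite /time_sum big_ord_recr /= => hi.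
have : 0 <= \sum_(j < i) expo lam (block_value j.*2.+1 w).
  by apply: sumr_ge0 => j _; rewrite ltW // expo_gt0.
by rewrite -natr1; lra.
Qed.

Lemma fast_ex : exists w0, ~ fast w0.
Proof.
apply: contrapT => h; have [mf pf] := fast_null.
have : P setT = 0%E.
  rewrite -pf; congr (P _); apply/seteqP; split=> // w _.
  by apply: contrapT => nf; apply: h; exists w.
by rewrite probability_setT => /eqP; rewrite onee_eq0.
Qed.

Lemma not_fastP w : ~ fast w <-> forall c, exists k, c < time_sum w k.
Proof.
split=> [nf c|h [c hc]]; last by have [k] := h c%:R; have := hc k; lra.
apply: contrapT => nk; apply: nf; exists (Num.truncn c).+1 => k.
rewrite leNgt; apply/negP => hk; apply: nk; exists k; apply: lt_trans hk.
exact: truncnS_gt.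
Qed.

(** From index m on, the waiting times are those of a single source v. Its partial sums exceed c
    plus its sum up to m, so the part after m alone exceeds c. *)
Lemma not_fast_bitmix K w w' : eventually_const K -> ~ fast w -> ~ fast w' ->
  ~ fast (bitmix (K \o block) w w').
Proof.
move=> [m hm] /not_fastP h /not_fastP h'; apply/not_fastP => c.
pose v := if K m then w else w'.
have hv : forall c, exists k, c < time_sum v k by rewrite /v; case: (K m).
have [k hk] := hv (c + time_sum v m).
exists k; have [km|mk] := leqP k m.
  have : time_sum v k <= time_sum v m.
    rewrite /time_sum -(subnKC km) big_split_ord /= lerDl.
    by apply: sumr_ge0 => j _; rewrite ltW // expo_gt0.
  have : 0 <= time_sum (bitmix (K \o block) w w') k.
    by apply: sumr_ge0 => j _; rewrite ltW // expo_gt0.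
  have : 0 <= time_sum v k by apply: sumr_ge0 => j _; rewrite ltW // expo_gt0.
  lra.
have split_sum u : time_sum u k = time_sum u m +
    \sum_(m <= i < k) expo lam (block_value i.*2.+1 u).
  by rewrite /time_sum -!(big_mkord xpredT (fun i => expo lam (block_value i.*2.+1 u)))
    (big_cat_nat (leq0n m) (ltnW mk)).
have : 0 <= time_sum (bitmix (K \o block) w w') m.
  by apply: sumr_ge0 => j _; rewrite ltW // expo_gt0.
rewrite split_sum; move: hk; rewrite split_sum.
suff -> : \sum_(m <= i < k) expo lam (block_value i.*2.+1 (bitmix (K \o block) w w')) =
    \sum_(m <= i < k) expo lam (block_value i.*2.+1 v) by lra.
rewrite big_nat [RHS]big_nat; apply: eq_bigr => i /andP[mi _].
rewrite block_bitmix /v hm; last by lia.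
by case: (K m).
Qed.

End IidSequence.

Section RetractedMixing.
Context {R : realType} d (T : measurableType d) (P : probability T R).
Variables (N : set T) (r : T -> T).
Hypotheses (nN : null P N) (mr : measurable_fun setT r) (hr : forall w, ~ N w -> r w = w).

Lemma retract_image d' (T' : measurableType d') (Q : probability T' R) (f : T -> T') :
  has_image P Q f -> has_image P Q (f \o r).
Proof.
move=> [mf hf]; split; first exact: (measurableT_comp mf mr).
move=> B mB; rewrite -(hf B mB); apply: (measure_eq_off_null nN).
- exact: fun_preimage_measurable (measurableT_comp mf mr) mB.
- exact: fun_preimage_measurable mf mB.
- by move=> w /hr /= ->.
Qed.

Lemma retract_mixing (mix : T -> T -> T) : mixing P P mix ->
  mixing P P (fun w w' => mix (r w) (r w')).
Proof.
move=> [mm hm]; have [mN PN] := nN.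
have mrr : measurable_fun setT (fun z : T * T => (r z.1, r z.2)).
  by apply: measurable_fun_pair; [exact: (measurableT_comp mr measurable_fst)|exact: (measurableT_comp mr measurable_snd)].
have mc : measurable_fun setT (fun z : T * T => mix (r z.1) (r z.2)).
  exact: (measurableT_comp mm mrr).
split=> // B mB; rewrite -(hm B mB).
have n2 : null (P \x P)%E ((N `*` setT) `|` (setT `*` N)).
  rewrite -bigcup2E; apply: null_bigcup => -[|[|i]] /=; last exact: null_set0.
    split; first exact: measurableX.
    by apply: (etrans (product_measure1E P P mN measurableT)); rewrite PN mul0e.
  split; first exact: measurableX.
  by apply: (etrans (product_measure1E P P measurableT mN)); rewrite PN mule0.
apply: (measure_eq_off_null n2).
- exact: fun_preimage_measurable mc mB.
- exact: fun_preimage_measurable mm mB.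
- move=> [w w'] /= h; rewrite !hr //; first by move=> Nw'; apply: h; right.
  by move=> Nw; apply: h; left.
Qed.

End RetractedMixing.

(** The mixing identity and the divergence of the sums of waiting times are wanted for every
    outcome. Hence outcomes in the null set [fast] are first sent to a fixed outcome outside it,
    which changes no law; mixing outcomes outside [fast] then stays outside it. *)
Lemma iid_exists {R : realType} (U : probability R R) (lam : R) :
  uniform01 U -> 0 < lam ->
  exists d (T : measurableType d) (P : probability T R) (W : nat -> T -> R)
    (mix : pred nat -> T -> T -> T),
  [/\ forall i, has_image P U (W i),
      forall K, eventually_const K -> mixing P P (mix K),
      forall K, eventually_const K -> forall w w' i,
        W i (mix K w w') = if K i then W i w else W i w' &
      forall w c, exists k, c < \sum_(i < k) expo lam (W i.*2.+1 w)].
Proof.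
move=> hU lam0; have [P hP] := coin_prob_exists hU.
have [w0 nf0] := fast_ex hU lam0 hP.
have nf := fast_null hU lam0 hP.
pose r (w : coins) : coins := if `[< fast lam w >] then w0 else w.
have rN w : ~ fast lam w -> r w = w.
  by move=> h; rewrite /r asboolF.
have rgood w : ~ fast lam (r w) by rewrite /r; case: asboolP.
have mr : measurable_fun setT r.
  move=> _ B mB; rewrite setTI; have [mf _] := nf.
  rewrite (_ : r @^-1` B = (fast lam `&` [set w | B w0]) `|` (~` fast lam `&` B)).
    apply: measurableU; last by apply: measurableI => //; exact: measurableC.
    apply: measurableI => //; have [Bw0|Bw0] := pselect (B w0).
      by rewrite (_ : mkset _ = setT) //; apply/seteqP; split.
    by rewrite (_ : mkset _ = set0) //; apply/seteqP; split.
  apply/seteqP; split=> w /=; rewrite /r; case: asboolP => hw.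
  - by left.
  - by right.
  - by move=> [[]|[]].
  - by move=> [[]|[]].
exists _, coins, P, (fun i w => block_value i (r w)),
  (fun K w w' => bitmix (K \o block) (r w) (r w')); split.
- by move=> i; apply: (retract_image nf mr rN); exact: block_law.
- by move=> K _; apply: (retract_mixing nf mr rN); exact: bitmix_mixing.
- move=> K hK w w' i; rewrite rN ?block_bitmix //.
  exact: not_fast_bitmix.
- move=> w; apply/not_fastP; exact: rgood.
Qed.

(** * The dot product and vectors in general position *)

Section DotProduct.
Context {R : realType} {n : nat}.
Local Notation V := 'rV[R]_n.
Implicit Types (a b x y : V) (c : R).

Lemma dotpC x y : dotp x y = dotp y x.
Proof. by apply: eq_bigr => i _; rewrite mulrC. Qed.

Lemma dotpDr a x y : dotp a (x + y) = dotp a x + dotp a y.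
Proof.
by rewrite /dotp -big_split /=; apply: eq_bigr => i _; rewrite mxE mulrDr.
Qed.

Lemma dotpZr c a x : dotp a (c *: x) = c * dotp a x.
Proof.
by rewrite /dotp mulr_sumr; apply: eq_bigr => i _; rewrite mxE mulrCA.
Qed.

Lemma dotpNr a x : dotp a (- x) = - dotp a x.
Proof. by rewrite -scaleN1r dotpZr mulN1r. Qed.

Lemma dotpBr a x y : dotp a (x - y) = dotp a x - dotp a y.
Proof. by rewrite dotpDr dotpNr. Qed.

Lemma dotpDl a x y : dotp (x + y) a = dotp x a + dotp y a.
Proof. by rewrite !(dotpC _ a) dotpDr. Qed.

Lemma dotpZl c a x : dotp (c *: x) a = c * dotp x a.
Proof. by rewrite !(dotpC _ a) dotpZr. Qed.

Lemma dotpNl a x : dotp (- x) a = - dotp x a.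
Proof. by rewrite !(dotpC _ a) dotpNr. Qed.

Lemma dotpBl a x y : dotp (x - y) a = dotp x a - dotp y a.
Proof. by rewrite !(dotpC _ a) dotpBr. Qed.

Lemma dotp0r a : dotp a 0 = 0.
Proof. by rewrite -(scale0r (0 : V)) dotpZr mul0r. Qed.

Lemma dotpp_gt0 a : a != 0 -> 0 < dotp a a.
Proof.
move=> a0; rewrite lt_def; apply/andP; split; last first.
  by apply: sumr_ge0 => i _; rewrite -expr2 sqr_ge0.
apply: contra a0 => /eqP /psumr_eq0P h; apply/eqP/matrixP => i j.
rewrite (ord1 i) mxE; apply/eqP; rewrite -sqrf_eq0 expr2.
by rewrite h // => k _; rewrite -expr2 sqr_ge0.
Qed.

Definition dotpE := (dotpDr, dotpZr, dotpNr, dotpDl, dotpZl, dotpNl).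

End DotProduct.

Section FiniteGenericity.
Context {R : realType} {n : nat}.
Local Notation V := 'rV[R]_n.

(** The pairs are values and slopes: finitely many affine functions of e keep their nonzero sign at
    0 for all small e. *)
Lemma small_perturbation (s : seq (R * R)) : exists2 e0 : R, 0 < e0 &
  forall e, 0 < e -> e < e0 -> forall p, p \in s ->
    (0 < p.1 -> 0 < p.1 + e * p.2) /\ (p.1 < 0 -> p.1 + e * p.2 < 0).
Proof.
elim: s => [|p s [e0 e00 IH]]; first by exists 1.
have k0 : 0 < `|p.2| + 1 by rewrite ltr_wpDl.
have [pe|p10] := eqVneq p.1 0.
  exists e0 => // e he he0 q; rewrite inE => /orP[/eqP ->|]; last exact: IH.
  by split; lra.
exists (Num.min e0 (`|p.1| / (`|p.2| + 1))).
  by rewrite lt_min e00 divr_gt0 // normr_gt0.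
move=> e he; rewrite lt_min => /andP[he0 he1] q.
rewrite inE => /orP[/eqP ->|]; last exact: IH.
move: he1; rewrite ltr_pdivlMr // => he1.
have h : `|e * p.2| < `|p.1|.
  by rewrite normrM (gtr0_norm he); nra.
have := ler_norm (e * p.2); have := ler_norm (- (e * p.2)).
rewrite normrN => h1 h2.
split=> hp; [rewrite (gtr0_norm hp) in h|rewrite (ltr0_norm hp) in h]; lra.
Qed.

(** If the direction found for the tail is orthogonal to w, a small multiple of w is added to it;
    the products that were nonzero stay so. *)
Lemma generic_direction (s : seq V) : (forall v, v \in s -> v != 0) ->
  exists d : V, forall v, v \in s -> dotp v d != 0.
Proof.
elim: s => [_|w s IH h]; first by exists 0.
have [d hd] : exists d, forall v, v \in s -> dotp v d != 0.
  by apply: IH => v vs; apply: h; rewrite inE vs orbT.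
have [dw|dw] := eqVneq (dotp w d) 0; last first.
  by exists d => v; rewrite inE => /orP[/eqP ->|/hd].
have [e0 e00 he] := small_perturbation [seq (dotp v d, dotp v w) | v <- s].
exists (d + (e0 / 2) *: w) => v; rewrite inE => /orP[/eqP ->|vs].
  rewrite !dotpE dw add0r mulf_neq0 //; first by lra.
  by rewrite gt_eqF // dotpp_gt0 // h // mem_head.
have e1 : 0 < e0 / 2 by lra.
have e2 : e0 / 2 < e0 by lra.
have [h1 h2] := he _ e1 e2 (dotp v d, dotp v w) (map_f _ vs).
rewrite !dotpE; move: (hd _ vs); rewrite neq_lt => /orP[/h2|/h1] /=.
  by move/lt_eqF => ->.
by move/gt_eqF => ->.
Qed.

Lemma seq_argmax (T : eqType) (f : T -> R) (s : seq T) x : x \in s ->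
  exists2 b, b \in s & forall c, c \in s -> f c <= f b.
Proof.
elim: s x => [x|y s IH x _]; first by rewrite in_nil.
case: s IH => [|z s] IH.
  by exists y => [|c]; rewrite inE // => /eqP ->.
have [b bs hb] := IH z (mem_head _ _).
have [le|/ltW le] := leP (f y) (f b).
  exists b; first by rewrite inE bs orbT.
  by move=> c; rewrite inE => /orP[/eqP ->|/hb].
exists y; first exact: mem_head.
by move=> c; rewrite inE => /orP[/eqP ->//|/hb h]; exact: le_trans h le.
Qed.

End FiniteGenericity.

(** * Root systems: walls of a chamber and the free action of the Weyl group *)

Section Walls.
Context {R : realType} {n : nat}.
Local Notation V := 'rV[R]_n.
Variable Phi : set V.
Hypothesis hPhi : root_system Phi.
Implicit Types (a b c x y z : V) (L : seq V).

Lemma reflE a x : Phi a -> reflection a x = x - dotp a x *: a.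
Proof.
by move=> /(root_normalized hPhi) h; rewrite /reflection h mulrAC mulfV ?mul1r.
Qed.

Lemma reflB a x y : reflection a (x - y) = reflection a x - reflection a y.
Proof.
by rewrite /reflection dotpBr; apply/matrixP => i j; rewrite !mxE; ring.
Qed.

Lemma dotp_refl a x y : Phi a -> dotp (reflection a x) y = dotp x (reflection a y).
Proof. by move=> h; rewrite !reflE // !dotpE (dotpC x a); ring. Qed.

Lemma reflK a : Phi a -> involutive (reflection a).
Proof.
move=> h x; rewrite !reflE // dotpBr dotpZr (root_normalized hPhi h).
have -> : dotp a x - dotp a x * 2 = - dotp a x by ring.
by rewrite scaleNr opprK subrK.
Qed.

Lemma refl_self a : Phi a -> reflection a a = - a.
Proof.
move=> h; rewrite reflE // (root_normalized hPhi h) scaler_nat mulr2n opprD.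
by rewrite addrA subrr add0r.
Qed.

Lemma reflN a x : reflection a (- x) = - reflection a x.
Proof. by rewrite -[- x]sub0r reflB /reflection dotp0r mulr0 mul0r scale0r subr0 sub0r. Qed.

Lemma root_opp a : Phi a -> Phi (- a).
Proof. by move=> h; have := root_line hPhi h => /seteqP[_ /(_ (- a))] []; [right|]. Qed.

Lemma root_refl a b : Phi a -> Phi b -> Phi (reflection a b).
Proof. by move=> ha hb; rewrite -(root_reflection hPhi ha); exists b. Qed.

Lemma root_prop a c (k : R) : Phi a -> Phi c -> c = k *: a -> c = a \/ c = - a.
Proof.
move=> ha hc e; have /seteqP[+ _] := root_line hPhi ha.
by move/(_ c); apply; split => //; exists k.
Qed.

Lemma reg_neq0 b x : Phi b -> regular_set Phi x -> dotp b x != 0.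
Proof. by move=> hb hx; apply/eqP => h; apply: hx; exists b. Qed.

Lemma regP x : (forall b, Phi b -> dotp b x != 0) -> regular_set Phi x.
Proof. by move=> h [b /h /eqP]. Qed.

Lemma reg_refl a x : Phi a -> regular_set Phi x -> regular_set Phi (reflection a x).
Proof.
move=> ha hx; apply: regP => b hb; rewrite -dotp_refl //.
by apply: reg_neq0 => //; apply: root_refl.
Qed.

Definition act L x := foldr reflection x L.
Definition all_roots L := forall b, b \in L -> Phi b.

Lemma act_cat L1 L2 x : act (L1 ++ L2) x = act L1 (act L2 x).
Proof. by rewrite /act foldr_cat. Qed.

Lemma act_rev L x : all_roots L -> act (rev L) (act L x) = x.
Proof.
elim: L => //= b L IH h; rewrite rev_cons -cats1 act_cat /=.
rewrite reflK; last by apply: h; rewrite mem_head.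
by apply: IH => c cL; apply: h; rewrite inE cL orbT.
Qed.

Lemma all_roots_rev L : all_roots L -> all_roots (rev L).
Proof. by move=> h b; rewrite mem_rev; exact: h. Qed.

Lemma act_revK L x : all_roots L -> act L (act (rev L) x) = x.
Proof. by move=> h; rewrite -{1}(revK L) act_rev //; exact: all_roots_rev. Qed.

Lemma dotp_act L x y : all_roots L -> dotp (act L x) y = dotp x (act (rev L) y).
Proof.
elim: L x y => //= b L IH x y h.
rewrite dotp_refl; last by apply: h; rewrite mem_head.
rewrite IH; first by rewrite rev_cons -cats1 act_cat.
by move=> c cL; apply: h; rewrite inE cL orbT.
Qed.

Lemma root_act L b : all_roots L -> Phi b -> Phi (act L b).
Proof.
elim: L => //= c L IH h hb; apply: root_refl.
  by apply: h; rewrite mem_head.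
by apply: IH => // d dL; apply: h; rewrite inE dL orbT.
Qed.

Lemma actN L x : act L (- x) = - act L x.
Proof. by elim: L => //= b L ->; rewrite reflN. Qed.

Lemma actB L x y : act L (x - y) = act L x - act L y.
Proof. by elim: L => //= b L ->; rewrite reflB. Qed.

Lemma act_refl L b x : all_roots L -> Phi b ->
  act L (reflection b x) = reflection (act L b) (act L x).
Proof.
move=> hL hb; rewrite !reflE //; last exact: root_act.
rewrite dotp_act // act_rev // actB; congr (_ - _).
elim: L {hL} => //= c L ->; rewrite /reflection scalerBr dotpZr !scalerA.
by congr (_ - _ *: _); ring.
Qed.

Lemma weyl_act g : weyl_group Phi g -> exists2 L, all_roots L & g =1 act L.
Proof.
elim=> [a ha||f h _ [L1 h1 e1] _ [L2 h2 e2]|f h _ [L1 h1 e1] fh hf].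
- by exists [:: a] => // b; rewrite inE => /eqP ->.
- by exists [::].
- exists (L1 ++ L2); last by move=> x; rewrite act_cat /= e1 e2.
  by move=> b; rewrite mem_cat => /orP[/h1|/h2].
- exists (rev L1); first exact: all_roots_rev.
  by move=> x; rewrite -{2}(hf x) e1 act_rev.
Qed.

Lemma act_weyl L : all_roots L -> weyl_group Phi (act L).
Proof.
elim: L => [_|b L IH h]; first exact: weyl_id.
apply: (weyl_comp (g := reflection b) (h := act L)).
  by apply: weyl_refl; apply: h; rewrite mem_head.
by apply: IH => c cL; apply: h; rewrite inE cL orbT.
Qed.

Variable x0 : V.
Hypothesis hx0 : regular_set Phi x0.

Definition pos b := Phi b /\ 0 < dotp b x0.
Definition cone y := forall b, pos b -> 0 < dotp b y.
(** The witness y is a point in the relative interior of a facet of the cone. Walls play the role of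
    simple roots without a choice of basis. *)
Definition wall b := pos b /\
  exists2 y, dotp b y = 0 & forall c, pos c -> c <> b -> 0 < dotp c y.

Lemma pos_or b : Phi b -> pos b \/ pos (- b).
Proof.
move=> hb; have := reg_neq0 hb hx0; rewrite neq_lt => /orP[h|h].
  by right; split; [exact: root_opp|rewrite dotpNl oppr_gt0].
by left.
Qed.

(** The reflection in b fixes the facet point y, so the image of c takes the same positive value at
    y as c; a negative root other than -b would be negative there, and -b would vanish there. *)
Lemma wall_perm b c : wall b -> pos c -> c <> b -> pos (reflection b c).
Proof.
move=> [[hb hb0] [y by0 hy]] hc cb.
have hr : Phi (reflection b c) by apply: root_refl => //; case: hc.
have h : 0 < dotp (reflection b c) y.
  by rewrite dotp_refl // reflE // by0 scale0r subr0; exact: hy.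
have [//|hn] := pos_or hr.
have [e|ne] := pselect (- reflection b c = b).
  by move: h; rewrite -[reflection b c]opprK e dotpNl by0 oppr0 ltxx.
by have := hy _ hn ne; rewrite dotpNl; lra.
Qed.

Lemma roots_seq : exists2 s : seq V, uniq s & forall b, Phi b <-> b \in s.
Proof.
have /finite_seqP[s hs] := root_finite hPhi.
exists (undup s); first exact: undup_uniq.
by move=> b; rewrite mem_undup hs.
Qed.

Definition separating (s : seq V) y := [seq b <- s | (0 < dotp b x0) && (dotp b y < 0)].

(** By [wall_perm] the reflection in b carries the roots separating the reflected point injectively
    into those separating y, and it misses b itself. *)
Lemma separating_refl s b y : uniq s -> (forall c, Phi c <-> c \in s) ->
  wall b -> dotp b y < 0 ->
  (size (separating s (reflection b y)) < size (separating s y))%N.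
Proof.
move=> us hs wb hby; have hb : Phi b by case: wb => -[].
rewrite -(size_map (reflection b)) -[X in (X <= _)%N]/(size (b :: _)).
apply: uniq_leq_size.
  rewrite /= map_inj_uniq; last exact: (can_inj (reflK hb)).
  rewrite filter_uniq // andbT; apply/mapP => -[c].
  rewrite mem_filter => /andP[/andP[hc _] _] e.
  have ec : c = - b by rewrite -(reflK hb c) -e refl_self.
  by case: wb => -[_ h] _; move: hc; rewrite ec dotpNl; lra.
move=> c; rewrite inE => /orP[/eqP ->|/mapP[e]].
  by rewrite mem_filter hby (hs b).1 // !andbT; case: wb => -[].
rewrite !mem_filter => /andP[/andP[he1 he2] es] ->.
rewrite -dotp_refl // in he2; rewrite he2.
have pe : pos e by split => //; apply/hs.
have neb : e <> b.
  by move=> eb; move: he2; rewrite eb refl_self // dotpNl; lra.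
have [h1 h2] := wall_perm wb pe neb.
by rewrite h2 (iffLR (hs _)).
Qed.

(* The first hyperplane met on the way from y to a generic point of the cone
   is a wall. *)
Lemma exists_wall y b0 : regular_set Phi y -> pos b0 -> dotp b0 y < 0 ->
  exists2 b, wall b & dotp b y < 0.
Proof.
move=> ry pb0 hb0; have [s us hs] := roots_seq.
(* [v b c] is orthogonal to a point x1 of the cone exactly when y + r x1 crosses the hyperplanes of
   b and c at the same r. A generic x1 therefore separates the crossings of non-proportional
   roots. *)
pose v b c := dotp c y *: b - dotp b y *: c.
pose vs := [seq w <- [seq v b c | b <- s, c <- s] | w != 0].
have [|d hd] := generic_direction (s := vs).
  by move=> w; rewrite mem_filter => /andP[].
have [e0 e00 he] := small_perturbation
  ([seq (dotp c x0, dotp c d) | c <- s] ++ [seq (dotp w x0, dotp w d) | w <- vs]).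
have [e1 e1_gt0 hvs] : exists2 e, 0 < e & cone (x0 + e *: d) /\
    forall w, w \in vs -> dotp w (x0 + e *: d) != 0.
  have e1 : 0 < e0 / 2 by lra.
  have e2 : e0 / 2 < e0 by lra.
  exists (e0 / 2) => //; split.
    move=> c [/hs cs hc]; rewrite dotpDr dotpZr.
    have [|h1 _] := he _ e1 e2 (dotp c x0, dotp c d); last exact: h1.
    by rewrite mem_cat map_f.
  move=> w wvs; rewrite dotpDr dotpZr.
  have [|h1 h2] := he _ e1 e2 (dotp w x0, dotp w d).
    by rewrite mem_cat orbC (map_f (fun w => (dotp w x0, dotp w d))).
  have [e|] := eqVneq (dotp w x0) 0.
    by rewrite e add0r mulf_neq0 ?hd //; lra.
  by rewrite neq_lt => /orP[/h2 /lt_eqF|/h1 /gt_eqF] /= ->.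
move: hvs; set x1 := x0 + e1 *: d => -[cx1 gx1].
(* The point y + r x1 crosses the hyperplane of b at r = [r b]. At the largest crossing every other
   positive root is already positive, which provides the facet point. *)
pose r b := - dotp b y / dotp b x1.
have b0s : b0 \in [seq b <- s | 0 < dotp b x0].
  by rewrite mem_filter; case: pb0 => /hs -> ->.
have [b bs hb] := seq_argmax r b0s.
have pb : pos b by move: bs; rewrite mem_filter => /andP[h1 /hs].
have b1 := cx1 _ pb; have rb0 : 0 < r b.
  by apply: lt_le_trans (hb _ b0s); rewrite divr_gt0 ?oppr_gt0 //; exact: cx1.
have hby : dotp b y < 0.
  by move: rb0; rewrite /r pmulr_lgt0 ?invr_gt0 // oppr_gt0.
exists b => //; split => //; exists (r b *: x1 + y).
  by rewrite dotpDr dotpZr /r; field; lra.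
move=> c pc cb; have c1 := cx1 _ pc; rewrite dotpDr dotpZr.
have cs : c \in [seq b <- s | 0 < dotp b x0].
  by rewrite mem_filter; case: pc => /hs -> ->.
have := hb _ cs; rewrite le_eqVlt => /orP[/eqP e|].
  exfalso; have vz : dotp (v b c) x1 = 0.
    rewrite /v dotpBl !dotpZl; move: e; rewrite /r => /eqP.
    rewrite eqr_div ?(gt_eqF b1) ?(gt_eqF c1) // => /eqP ee.
    by rewrite !mulNr in ee; lra.
  have [v0|v0] := eqVneq (v b c) 0; last first.
    have : v b c \in vs.
      rewrite mem_filter v0 /=; apply: allpairs_f; apply/hs.
        by case: pb.
      by case: pc.
    by move/gx1; rewrite vz eqxx.
  have : c = (dotp c y / dotp b y) *: b.
    move/eqP: v0; rewrite /v subr_eq0 => /eqP h.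
    by rewrite mulrC -scalerA h scalerA mulVf ?scale1r // lt_eqF.
  case/root_prop => //; first by case: pb.
  - by case: pc.
  - move=> ecb; case: pc pb => _ h [_ h']; move: h.
    by rewrite ecb dotpNl; lra.
by rewrite {1}/r ltr_pdivrMr // => h; lra.
Qed.

Definition all_walls L := forall b, b \in L -> wall b.

Lemma walls_roots L : all_walls L -> all_roots L.
Proof. by move=> h b /h [[]]. Qed.

Lemma all_walls_cat L1 L2 : all_walls L1 -> all_walls L2 -> all_walls (L1 ++ L2).
Proof. by move=> h1 h2 b; rewrite mem_cat => /orP[/h1|/h2]. Qed.

(** As long as some positive root is negative at y there is a wall with this property, and
    reflecting in it lowers the number of such roots. *)
Lemma to_cone y : regular_set Phi y -> exists2 L, all_walls L & cone (act L y).
Proof.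
have [s us hs] := roots_seq.
have [k] := ubnP (size (separating s y)); elim: k y => // k IH y hk ry.
have [[b pb hb]|h] := pselect (exists2 b, pos b & dotp b y < 0).
  have [c wc hc] := exists_wall ry pb hb.
  have hcP : Phi c by case: wc => -[].
  have [||L hL cL] := IH (reflection c y).
  - by apply: leq_trans (separating_refl us hs wc hc) _; rewrite -ltnS.
  - exact: reg_refl.
  exists (L ++ [:: c]); last by rewrite act_cat.
  by apply: all_walls_cat => // d; rewrite inE => /eqP ->.
exists [::] => // b pb; rewrite lt_neqAle eq_sym reg_neq0 //=; last by case: pb.
by rewrite leNgt; apply/negP => hb; apply: h; exists b.
Qed.

(* Apply [to_cone] to a point next to a generic point p of the hyperplane of
   beta: the image of beta is then a wall. *)
Lemma refl_walls beta : Phi beta ->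
  exists2 L, all_walls L & forall x, act L x = reflection beta x.
Proof.
move=> hbeta; have [s us hs] := roots_seq.
have nb : dotp beta beta = 2 := root_normalized hPhi hbeta.
(* [pr c] is the component of c orthogonal to beta, zero only if c is beta or -beta. Hence the
   projection p of a generic d to the hyperplane of beta lies on no other hyperplane of a root. *)
pose pr c := c - (dotp c beta / 2) *: beta.
pose vs := [seq pr c | c <- [seq c <- s | (c != beta) && (c != - beta)]].
have [|d hd] := generic_direction (s := vs).
  move=> w /mapP[c]; rewrite mem_filter => /andP[/andP[c1 c2] /hs hc] ->.
  apply/eqP => /eqP; rewrite subr_eq0 => /eqP.
  by move=> /(root_prop hbeta hc)[] /eqP; [rewrite (negbTE c1)|rewrite (negbTE c2)].
pose p := d - (dotp beta d / 2) *: beta.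
have pbeta : dotp beta p = 0 by rewrite dotpBr dotpZr nb; field.
have hp c : Phi c -> c <> beta -> c <> - beta -> dotp c p != 0.
  move=> hc c1 c2; have : pr c \in vs.
    by apply: map_f; rewrite mem_filter (hs c).1 // andbT; apply/andP; split; apply/eqP.
  move/hd; congr (_ != 0); rewrite /pr /p dotpBl dotpBr dotpZl dotpZr; ring.
have [e0 e00 he] := small_perturbation [seq (dotp c p, dotp c beta) | c <- s].
have e1 : 0 < e0 / 2 by lra.
have e2 : e0 / 2 < e0 by lra.
pose y := p + (e0 / 2) *: beta.
have hy c : Phi c -> (0 < dotp c p -> 0 < dotp c y) /\ (dotp c p < 0 -> dotp c y < 0).
  move=> /hs cs; rewrite /y dotpDr dotpZr.
  exact: (he _ e1 e2 (dotp c p, dotp c beta) (map_f _ cs)).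
have ybeta : 0 < dotp beta y.
  by rewrite /y dotpDr dotpZr pbeta nb; lra.
have ry : regular_set Phi y.
  apply: regP => c hc; have [->|c1] := pselect (c = beta); first by rewrite gt_eqF.
  have [->|c2] := pselect (c = - beta); first by rewrite dotpNl oppr_eq0 gt_eqF.
  have [h1 h2] := hy _ hc.
  by move: (hp _ hc c1 c2); rewrite neq_lt => /orP[/h2 /lt_eqF|/h1 /gt_eqF] ->.
have [L wL cL] := to_cone ry.
have rL := walls_roots wL.
have hw : forall g, g = act L beta \/ g = - act L beta -> pos g -> wall g.
  move=> g eg pg; split => //; exists (act L p).
    have e : dotp (act L beta) (act L p) = 0 by rewrite dotp_act // act_rev.
    by case: eg => ->; rewrite ?dotpNl e ?oppr0.
  move=> c pc cg.
  have hc' : Phi (act (rev L) c).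
    by apply: root_act; [exact: all_roots_rev|case: pc].
  have e z : dotp c (act L z) = dotp (act (rev L) c) z.
    by rewrite [RHS]dotp_act ?revK //; exact: all_roots_rev.
  have cc : act (rev L) c <> beta /\ act (rev L) c <> - beta.
    split=> ec; have : c = act L (act (rev L) c) by rewrite act_revK.
      rewrite ec => ec'; case: eg => eg; first by apply: cg; rewrite eg.
      case: pc pg => _ h1 [_ h2]; move: h1 h2.
      by rewrite eg ec' dotpNl; lra.
    rewrite ec actN => ec'; case: eg => eg; last by apply: cg; rewrite eg.
    case: pc pg => _ h1 [_ h2]; move: h1 h2.
    by rewrite eg ec' dotpNl; lra.
  have := cL _ pc; rewrite !e; have [h1 h2] := hy _ hc'.
  have := hp _ hc' cc.1 cc.2; rewrite neq_lt => /orP[/h2|//]; lra.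
(* The reflection in beta is the conjugate by L of the reflection in its image g, which is a wall by
   [hw]. *)
have conj g : g = act L beta \/ g = - act L beta -> pos g ->
    exists2 L, all_walls L & forall x, act L x = reflection beta x.
  move=> eg pg; exists (rev L ++ g :: L).
    apply: all_walls_cat; first by move=> b; rewrite mem_rev; exact: wL.
    by move=> b; rewrite inE => /orP[/eqP ->|/wL //]; exact: hw.
  move=> x; rewrite act_cat /=.
  have -> : reflection g (act L x) = reflection (act L beta) (act L x).
    case: eg => -> //; rewrite /reflection !dotpNl dotpNr opprK scalerN -scaleNr.
    by congr (_ + - (_ *: _)); rewrite mulrN mulNr opprK.
  by rewrite -act_refl // act_rev.
have [h|h] := pos_or (root_act rL hbeta).
  by apply: conj h; left.
by apply: conj h; right.
Qed.

Lemma roots_walls L : all_roots L ->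
  exists2 L', all_walls L' & forall x, act L' x = act L x.
Proof.
elim: L => [_|b L IH h]; first by exists [::].
have [|L1 h1 e1] := IH; first by move=> c cL; apply: h; rewrite inE cL orbT.
have [|L2 h2 e2] := @refl_walls b; first by apply: h; rewrite mem_head.
exists (L2 ++ L1); first exact: all_walls_cat.
by move=> x; rewrite act_cat e1 e2.
Qed.

(** Exchange condition. While the word L is applied, the root b turns negative at some letter c; by
    [wall_perm] its image just before is c itself. Conjugating, the reflection in b cancels this
    letter of the word. *)
Lemma exchange L b : all_walls L -> pos b -> ~ pos (act L b) ->
  exists2 L', all_walls L' /\ (size L' < size L)%N &
    forall x, act L (reflection b x) = act L' x.
Proof.
elim: L => [_ //|c L IH] hcL pb /= hn.
have wc : wall c by apply: hcL; rewrite mem_head.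
have hL : all_walls L by move=> d dL; apply: hcL; rewrite inE dL orbT.
have [pL|nL] := pselect (pos (act L b)); last first.
  have [L' [w' s'] e'] := IH hL pb nL.
  exists (c :: L').
    by split => // d; rewrite inE => /orP[/eqP ->|/w'].
  by move=> x /=; rewrite e'.
have [e|ne] := pselect (act L b = c); last by case: hn; exact: wall_perm.
exists L; first by split.
have [hb _] := pb; have rL := walls_roots hL.
move=> x; rewrite act_refl // e reflK //.
by case: wc => -[].
Qed.

(** The last letter b of the word is sent to its opposite first, so the rest of the word makes b
    negative and the exchange condition shortens the word; induction on its length. *)
Lemma act_id L : all_walls L -> (forall b, pos b -> pos (act L b)) ->
  forall x, act L x = x.
Proof.
have [k] := ubnP (size L); elim: k L => // k IH L.
case/lastP: L => [//|L b]; rewrite size_rcons => hk hw hp.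
have wb : wall b by apply: hw; rewrite mem_rcons mem_head.
have [pb _] := wb; have hb : Phi b by case: pb.
have hL : all_walls L by move=> d dL; apply: hw; rewrite mem_rcons inE dL orbT.
have e x : act (rcons L b) x = act L (reflection b x) by rewrite -cats1 act_cat.
have nL : ~ pos (act L b).
  have := hp _ pb; rewrite e refl_self // actN => -[_ h1] [_ h2].
  by move: h1; rewrite dotpNl; lra.
have [L' [w' s'] e'] := exchange hL pb nL.
have ee x : act (rcons L b) x = act L' x by rewrite e e'.
move=> x; rewrite ee; apply: IH => //.
  by apply: (ltn_trans s'); rewrite -ltnS.
by move=> c /hp; rewrite ee.
Qed.

(** An element sending a point of the cone into the cone keeps positive roots positive, and it is a
    word in walls ([roots_walls]), so [act_id] applies. *)
Lemma weyl_cone_inj g y : weyl_group Phi g -> cone y -> cone (g y) ->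
  forall x, g x = x.
Proof.
move=> /weyl_act [L0 r0 e0] cy cgy x.
have [L wL eL] := roots_walls r0.
have rL := walls_roots wL.
rewrite e0 -eL; apply: act_id => // b pb.
have hb : Phi (act L b) by apply: root_act => //; case: pb.
have [//|pn] := pos_or hb.
have := cgy _ pn; rewrite e0 -eL dotpNl dotp_act // act_rev //.
by have := cy _ pb; lra.
Qed.

End Walls.

(** * Continuity of the chamber projection on the regular set *)

Section Chamber.
Context {R : realType} {n : nat}.
Local Notation V := 'rV[R]_n.

Lemma dotp_continuous (a : V) : continuous (dotp a).
Proof.
move=> x; apply: cvg_big; first exact: add_continuous.
  exact: (@nbhs_filter V x).
move=> i _; apply: (@continuousM _ _ (fun=> a ord0 i) (fun y : V => y ord0 i) x).
  exact: cst_continuous.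
exact: coord_continuous.
Qed.

Lemma reflection_continuous (a : V) : continuous (reflection a).
Proof.
move=> x; apply: (@continuousB _ _ _ id (fun x => (2 * dotp a x / dotp a a) *: a)).
  exact: cvg_id.
apply: (@continuousZr_tmp _ _ _ (fun x => 2 * dotp a x / dotp a a)).
apply: (@continuousM _ _ (fun y => 2 * dotp a y) (fun=> (dotp a a)^-1)).
  apply: (@continuousM _ _ (fun=> 2) (dotp a)); first exact: cst_continuous.
  exact: dotp_continuous.
exact: cst_continuous.
Qed.

Variables Phi C : set V.
Hypothesis hPhi : root_system Phi.
Hypothesis hC : weyl_chamber Phi C.
Hypothesis hproj : forall x, regular_set Phi x -> C (chamber_proj Phi C x).
Hypothesis hne : exists a, Phi a.

Lemma act_continuous (L : seq V) : continuous (act L).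
Proof.
elim: L => [|b L IH] x; first exact: cvg_id.
by apply: continuous_comp; [exact: IH|exact: reflection_continuous].
Qed.

Lemma open_regular : open (regular_set Phi).
Proof.
rewrite /regular_set; apply: closed_openC; apply: closed_bigcup.
  exact: root_finite.
move=> a _; apply: (preimage_closed (f := dotp a) (D := [set 0])).
  by move=> x _; exact: dotp_continuous.
exact: closed_eq.
Qed.

Lemma proj_refl a x : Phi a ->
  chamber_proj Phi C (reflection a x) = chamber_proj Phi C x.
Proof.
move=> ha; rewrite /chamber_proj; congr (get (_ `&` _)).
apply/seteqP; split => _ [g hg <-].
  exists (g \o reflection a) => //; apply: weyl_comp => //.
  exact: weyl_refl.
exists (g \o reflection a); last by rewrite /= (reflK hPhi ha).
by apply: weyl_comp => //; exact: weyl_refl.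
Qed.

(** C is connected and avoids the hyperplanes, so by the intermediate value theorem no root changes
    sign on it. *)
Lemma chamber_cone : exists2 x0, regular_set Phi x0 & C `<=` cone Phi x0.
Proof.
have [x0 rx0 eC] := hC; exists x0 => // y Cy b [hb hb0].
have Cc : connected C by rewrite eC; exact: component_connected.
have Cx0 : C x0 by rewrite eC; exact: connected_component_refl.
have CE : C `<=` regular_set Phi by rewrite eC; exact: connected_component_sub.
have : connected (dotp b @` C).
  apply: connected_continuous_connected => //.
  by apply: continuous_subspaceT; exact: dotp_continuous.
move=> /connected_intervalP itv; rewrite ltNge; apply/negP => hby.
have [z Cz hz] : (dotp b @` C) 0.
  apply: (itv (dotp b y) (dotp b x0)); [by exists y|by exists x0|].
  by rewrite hby ltW.
by have := reg_neq0 hb (CE _ Cz); rewrite hz eqxx.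
Qed.

(** If the orbit missed the closed chamber, [get] would return its default 0, which is orthogonal to
    every root; but the projection of x is in C, hence regular. *)
Lemma proj_orbit x : regular_set Phi x -> weyl_orbit Phi x (chamber_proj Phi C x).
Proof.
move=> rx; have [e|/eqP/set0P[y hy]] := pselect (weyl_orbit Phi x `&` closure C = set0).
  have := hproj rx; have -> : chamber_proj Phi C x = 0.
    rewrite /chamber_proj e getPN; last by move=> y [].
    by apply/matrixP => i j; rewrite !mxE.
  have [x0 rx0 eC] := hC; rewrite eC => /connected_component_sub.
  have [a ha] := hne; move=> h; case: h; exists a => //.
  exact: dotp0r.
by have [] : (weyl_orbit Phi x `&` closure C) (chamber_proj Phi C x) by apply: getPex; exists y.
Qed.

(** A Weyl element g takes x to its projection in the open cone, so it takes nearby y into the cone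
    too. Another element takes y to its projection, which is also in the cone; by [weyl_cone_inj]
    the two images of y coincide. *)
Lemma proj_locally x : regular_set Phi x ->
  exists2 g : V -> V, continuous g & \forall y \near x, chamber_proj Phi C y = g y.
Proof.
move=> rx; have [x0 rx0 Ccone] := chamber_cone.
have [g hg egx] := proj_orbit rx.
have [L rL eL] := weyl_act hPhi hg.
exists (act L); first exact: act_continuous.
have hcone : \forall y \near x, cone Phi x0 (act L y).
  have [s us hs] := roots_seq hPhi.
  have cx : cone Phi x0 (act L x) by rewrite -eL egx; apply: Ccone; exact: hproj.
  have : \forall y \near x, forall b, b \in s -> pos Phi x0 b -> 0 < dotp b (act L y).
    elim: s {us hs} => [|b s IH]; first by near=> y.
    have [pb|npb] := pselect (pos Phi x0 b); last first.
      apply: filterS IH => y hy c; rewrite inE => /orP[/eqP -> //|]; exact: hy.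
    have : \forall y \near x, 0 < dotp b (act L y).
      have h : {for x, continuous (dotp b \o act L)}.
        by apply: continuous_comp; [exact: act_continuous|exact: dotp_continuous].
      by apply: (cvgr_gt _ h); exact: cx.
    apply: filterS2 IH => y hy h c; rewrite inE => /orP[/eqP -> //|]; exact: hy.
  by apply: filterS => y hy b pb; apply: hy => //; apply/hs; case: pb.
have hreg : \forall y \near x, regular_set Phi y by apply: open_nbhs_nbhs; split => //; exact: open_regular.
apply: filterS2 hcone hreg => y cy ry.
have [h hh ey] := proj_orbit ry.
have wg : weyl_group Phi (h \o act (rev L)).
  by apply: weyl_comp => //; apply: act_weyl; exact: all_roots_rev.
have := weyl_cone_inj hPhi rx0 wg cy.
rewrite /= (act_rev hPhi) // ey => /(_ (Ccone _ (hproj ry)) (act L y)).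
by rewrite (act_rev hPhi) // ey.
Unshelve. all: by end_near. Qed.

Lemma chamber_proj_continuous x : regular_set Phi x -> {for x, continuous (chamber_proj Phi C)}.
Proof.
move=> rx; have [g cg hg] := proj_locally rx.
have e : chamber_proj Phi C x = g x by exact: nbhs_singleton hg.
rewrite /prop_for /continuous_at e => A /(cg x) hA.
by apply: filterS2 hg hA => y ey; rewrite /= ey.
Qed.

End Chamber.

(** * Admissible paths and their recovery from dyadic values *)

Section OneSidedLimits.
Context {R : realType} {n : nat}.
Local Notation V := 'rV[R]_n.
Implicit Types (w : R -> V) (t : R) (l : V).

Definition rlim w t l := forall e, 0 < e ->
  exists2 d, 0 < d & forall s, t < s < t + d -> `|l - w s| < e.
(** The condition 0 <= s is there because paths are unconstrained at negative times; for t > 0 it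
    does not change the limit. *)
Definition llim w t l := forall e, 0 < e ->
  exists2 d, 0 < d & forall s, 0 <= s -> t - d < s < t -> `|l - w s| < e.

Lemma ballN (x y : V) (e : R) : ball x e y = (`|x - y| < e) :> Prop.
Proof. by rewrite -ball_normE. Qed.

Lemma rlimP w t l : w s @[s --> t^'+] --> l <-> rlim w t l.
Proof.
by split=> [/right_epsP h e /h[d d0 hd]|h]; [|apply/right_epsP => e /h[d d0 hd]];
  exists d => // s /hd; rewrite ballN.
Qed.

Lemma llimP w t l : 0 < t -> w s @[s --> t^'-] --> l <-> llim w t l.
Proof.
move=> t0; split=> [/left_epsP h e /h[d d0 hd]|h].
  by exists d => // s _ /hd; rewrite ballN.
apply/left_epsP => e /h[d d0 hd]; exists (Num.min d t); first by rewrite lt_min d0.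
move=> s /andP[s1 s2]; rewrite ballN; apply: hd; last first.
  by rewrite s2 andbT; apply: le_lt_trans s1; rewrite lerD2l lerN2 ge_min lexx.
by apply/ltW/le_lt_trans/s1; rewrite subr_ge0 ge_min lexx orbT.
Qed.

Lemma normV_lt_eq (x y : V) : (forall e, 0 < e -> `|x - y| < e) -> x = y.
Proof.
move=> h; apply/eqP; rewrite -subr_eq0 -normr_eq0 -[_ == 0]negbK; apply/negP => h0.
have p : 0 < `|x - y| by rewrite lt_def h0 normr_ge0.
by have := h _ p; rewrite ltxx.
Qed.

Lemma dist3 (x y z : V) : `|x - z| <= `|x - y| + `|y - z|.
Proof. by rewrite (le_trans _ (ler_normD _ _)) // addrA subrK. Qed.

End OneSidedLimits.

Section PathsAndCodes.
Context {R : realType} {n : nat}.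
Local Notation V := 'rV[R]_n.
Variables Phi C : set V.
Local Notation E := (regular_set Phi).
Local Notation proj := (chamber_proj Phi C).
Local Notation dyadic := (@dyadic R).
Hypothesis hPhi : root_system Phi.
Hypothesis projC : forall x, E x -> C (proj x).
Hypothesis projc : forall x, E x -> {for x, continuous proj}.

Lemma projN x : E x -> forall e, 0 < e -> exists2 d, 0 < d &
  forall y, `|x - y| < d -> `|proj x - proj y| < e.
Proof.
move=> Ex e e0; have /cvg_ballP /(_ e e0) := projc Ex.
move=> /nbhs_ballP[d /= d0 hd]; exists d => // y xy.
by rewrite -ballN; apply: hd; rewrite ballN.
Qed.

(** Since pi is continuous on E, continuity of the projected path at t amounts to its left limit and
    its value having the same projection. *)
Lemma Dpi_char w : Dpi_path Phi C w <->
  [/\ forall t, 0 <= t -> E (w t), forall t, 0 <= t -> rlim w t (w t) &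
   forall t, 0 < t -> exists l, [/\ E l, llim w t l & proj l = proj (w t)]].
Proof.
split=> [[h1 h2 h3 h4 h5]|[h1 h2 h3]].
  split=> // t t0; first by apply/rlimP; exact: h2.
  have [l El hl] := h3 t t0; exists l; split=> //; first exact/llimP.
  have hc : forall e, 0 < e -> exists2 d, 0 < d &
      forall s, 0 <= s -> `|t - s| < d -> `|proj (w t) - proj (w s)| < e.
    move=> e e0; have /subspace_continuousP /(_ t (ltW t0)) /cvg_ballP /(_ e e0) := h4.
    rewrite /within /= => /nbhs_ballP[d /= d0 hd]; exists d => // s s0 ts.
    by rewrite -ballN; exact: hd.
  apply: normV_lt_eq => e e0; have e2 : 0 < e / 2 by lra.
  have [d1 d10 hd1] := projN El e2.
  have /llimP-/(_ t0) hl' := hl; have [d2 d20 hd2] := hl' _ d10.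
  have [d3 d30 hd3] := hc _ e2.
  pose d := Num.min t (Num.min d2 d3).
  have d0 : 0 < d by rewrite !lt_min t0 d20.
  have dt : d <= t by rewrite ge_min lexx.
  have dd2 : d <= d2 by rewrite !ge_min lexx orbT.
  have dd3 : d <= d3 by rewrite !ge_min lexx !orbT.
  have s0 : 0 <= t - d / 2 by lra.
  have a1 : `|l - w (t - d / 2)| < d1 by apply: hd2 => //; lra.
  have a2 : `|t - (t - d / 2)| < d3 by rewrite ltr_norml; lra.
  have := dist3 (proj l) (proj (w (t - d / 2))) (proj (w t)).
  rewrite (distrC (proj (w (t - d / 2)))).
  by have := hd1 _ a1; have := hd3 _ s0 a2; lra.
split=> //.
- by move=> t t0; apply/rlimP; exact: h2.
- by move=> t t0; have [l [El hl _]] := h3 t t0; exists l => //; exact/llimP.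
- apply/subspace_continuousP => t /= t0; apply/cvg_ballP => e e0; rewrite /within /=.
  have [d1 d10 hd1] := projN (h1 t t0) e0; have [d2 d20 hd2] := h2 t t0 _ d10.
  have [d3 [d30 hd3]] : exists d3, 0 < d3 /\
      forall s, 0 <= s -> t - d3 < s < t -> `|proj (w t) - proj (w s)| < e.
    have [t0'|t0'] := ltP 0 t; last by exists 1; split=> // s s0; lra.
    have [l [El hl <-]] := h3 t t0'; have [d4 d40 hd4] := projN El e0.
    have [d5 d50 hd5] := hl _ d40; exists d5; split=> // s s0 ts.
    by apply: hd4; exact: hd5.
  apply/nbhs_ballP; exists (Num.min d2 d3); first by rewrite /= lt_min d20.
  move=> s ts s0; have {ts} : `|t - s| < Num.min d2 d3 := ts.
  rewrite ballN lt_min !ltr_norml => /andP[a b].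
  have [st|st|->] := ltgtP s t.
  + by apply: hd3 => //; lra.
  + by apply: hd1; apply: hd2; lra.
  + by rewrite subrr normr0.
- by move=> t t0; apply: projC; exact: h1.
Qed.

(** The constant value off E makes the function Borel on the whole space, as the measurability of
    [good] requires. *)
Definition proj_or0 (x : V) : V := if `[< E x >] then proj x else 0.

Definition hpow (j : nat) : R := (2 ^+ j)^-1.

Lemma hpow_gt0 j : 0 < hpow j. Proof. by rewrite invr_gt0 exprn_gt0. Qed.

Lemma hpow_small (e : R) : 0 < e -> exists j, hpow j < e.
Proof. by move=> /exp2_small[j /(_ j (leqnn j))]; exists j. Qed.

Definition away (N : nat) (g : nat -> nat -> V) (m : nat) := forall i k b,
  dyadic i k <= N%:R :> R -> Phi b -> hpow m <= `|dotp b (g i k)|.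
Definition three_point (N : nat) (g : nat -> nat -> V) (p j : nat) :=
  forall i1 k1 i2 k2 i3 k3,
  dyadic i1 k1 <= dyadic i2 k2 <= (dyadic i3 k3 : R) -> dyadic i3 k3 <= N%:R :> R ->
  dyadic i3 k3 - dyadic i1 k1 < hpow j ->
  `|g i1 k1 - g i2 k2| < hpow p \/ `|g i2 k2 - g i3 k3| < hpow p.
Definition proj_unif (N : nat) (g : nat -> nat -> V) (p j : nat) :=
  forall i1 k1 i2 k2, dyadic i1 k1 <= (dyadic i2 k2 : R) -> dyadic i2 k2 <= N%:R :> R ->
  dyadic i2 k2 - dyadic i1 k1 < hpow j -> `|proj_or0 (g i1 k1) - proj_or0 (g i2 k2)| < hpow p.

(* Skorokhod's three-point modulus of continuity, together with a distance to
   the walls and uniform continuity of the projected path, all on [0, N]. *)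
Definition good (g : nat -> nat -> V) := forall N : nat,
  [/\ exists m, away N g m, forall p, exists j, three_point N g p j &
      forall p, exists j, proj_unif N g p j].

(** The entry [g i k] stands for the value at time i/2^k. The path is read off along dyadic times
    strictly after t, as befits a right-continuous path. *)
Definition zlim (g : nat -> nat -> V) (t : R) : V :=
  limn (fun k => g (next_index k t) k).

Lemma dyadic_between (a b : R) : 0 <= a -> a < b ->
  exists k0, forall k, (k0 <= k)%N -> a < dyadic (next_index k a) k < b.
Proof.
move=> a0 ab; have [k0 hk0] := exp2_small (e := b - a) ltac:(lra).
exists k0 => k /hk0 hk; have := next_dyadicP k a0; rewrite /next_dyadic.
lra.
Qed.

Section FromCode.
Variable g : nat -> nat -> V.
Hypothesis gg : good g.

Let bigN (t : R) : exists N : nat, t < N%:R.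
Proof. by exists (Num.truncn t).+1; exact: truncnS_gt. Qed.

Lemma osc_right t e : 0 <= t -> 0 < e -> exists2 d, 0 < d &
  forall i k i' k', t < dyadic i k < t + d -> t < dyadic i' k' < t + d ->
  `|g i k - g i' k'| < e.
Proof.
move=> t0 e0; have [N tN] := bigN t; have [_ h3 _] := gg N.
have [p hp] := hpow_small (e := e / 2) ltac:(lra).
have [j hj] := h3 p; have p0 := hpow_gt0 p; have j0 := hpow_gt0 j.
pose d := Num.min (hpow j) (N%:R - t).
have d0 : 0 < d by rewrite lt_min j0 subr_gt0.
have dj : d <= hpow j by rewrite ge_min lexx.
have dN : d <= N%:R - t by rewrite ge_min lexx orbT.
have [all|nall] := pselect (forall i k i' k', t < dyadic i k < t + d ->
    t < dyadic i' k' < t + d -> `|g i k - g i' k'| < e); first by exists d.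
have [i [k [i' [k' [h1 h2 h3' h4]]]]] : exists i k i' k', [/\ t < dyadic i k < t + d,
    t < dyadic i' k' < t + d, dyadic i k <= (dyadic i' k' : R) & e <= `|g i k - g i' k'|].
  apply: contrapT => h; apply: nall => i k i' k' h1 h2; rewrite ltNge; apply/negP => h4.
  apply: h; have [le|/ltW le] := leP (dyadic i k : R) (dyadic i' k').
    by exists i, k, i', k'.
  by exists i', k', i, k; split=> //; rewrite distrC.
have near1 i1 k1 : t < dyadic i1 k1 < dyadic i k -> `|g i1 k1 - g i k| < hpow p.
  move=> h; have [| | |//|h5] := hj i1 k1 i k i' k'; [lra|lra|lra|lra].
exists (dyadic i k - t); first by lra.
move=> i1 k1 i2 k2 a1 a2; apply: (le_lt_trans (dist3 _ (g i k) _)).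
have := near1 i1 k1; have := near1 i2 k2; rewrite (distrC (g i k)) => b1 b2.
have := b1 ltac:(lra); have := b2 ltac:(lra); lra.
Qed.

Lemma osc_left t e : 0 < t -> 0 < e -> exists2 d, 0 < d &
  forall i k i' k', t - d < dyadic i k < t -> t - d < dyadic i' k' < t ->
  `|g i k - g i' k'| < e.
Proof.
move=> t0 e0; have [N tN] := bigN t; have [_ h3 _] := gg N.
have [p hp] := hpow_small (e := e / 2) ltac:(lra).
have [j hj] := h3 p; have p0 := hpow_gt0 p; have j0 := hpow_gt0 j.
have [all|nall] := pselect (forall i k i' k', t - hpow j < dyadic i k < t ->
    t - hpow j < dyadic i' k' < t -> `|g i k - g i' k'| < e); first by exists (hpow j).
have [i [k [i' [k' [h1 h2 h3' h4]]]]] : exists i k i' k', [/\ t - hpow j < dyadic i k < t,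
    t - hpow j < dyadic i' k' < t, dyadic i' k' <= (dyadic i k : R) & e <= `|g i k - g i' k'|].
  apply: contrapT => h; apply: nall => i k i' k' h1 h2; rewrite ltNge; apply/negP => h4.
  apply: h; have [le|/ltW le] := leP (dyadic i' k' : R) (dyadic i k).
    by exists i, k, i', k'.
  by exists i', k', i, k; split=> //; rewrite distrC.
have near1 i1 k1 : dyadic i k < (dyadic i1 k1 : R) < t -> `|g i1 k1 - g i k| < hpow p.
  move=> h; have [| | |h5|h5] := hj i' k' i k i1 k1; [lra|lra|lra| |by rewrite distrC].
  by exfalso; move: h5; rewrite distrC; lra.
exists (t - dyadic i k); first by lra.
move=> i1 k1 i2 k2 a1 a2; apply: (le_lt_trans (dist3 _ (g i k) _)).
have := near1 i1 k1; have := near1 i2 k2; rewrite (distrC (g i k)) => b1 b2.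
have := b1 ltac:(lra); have := b2 ltac:(lra); lra.
Qed.

Lemma zlim_right t e : 0 <= t -> 0 < e -> exists2 d, 0 < d &
  forall i k, t < dyadic i k < t + d -> `|zlim g t - g i k| < e.
Proof.
move=> t0 e0; pose u k := g (next_index k t) k.
have cu : u @ \oo --> zlim g t.
  suff : cvgn u by [].
  apply/cauchy_cvgP; apply: cauchy_exP => e' e'0.
  have [d d0 hd] := osc_right t0 e'0.
  have [k0 hk0] := dyadic_between t0 (b := t + d) ltac:(lra).
  exists (u k0); exists k0 => // k hk.
  by suff: ball (u k0) e' (u k) by []; rewrite ballN; apply: hd; exact: hk0.
have [d d0 hd] := osc_right t0 (e := e / 2) ltac:(lra).
exists d => // i k hik.
have [k0 hk0] := dyadic_between t0 (b := t + d) ltac:(lra).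
have /cvgrPdist_lt /(_ (e / 2) ltac:(lra)) := cu.
case=> k1 _ hk1; pose m := maxn k0 k1.
have := hk1 m (leq_maxr _ _); rewrite /= => a1.
have := hd _ _ _ _ (hk0 m (leq_maxl _ _)) hik => a2.
by apply: (le_lt_trans (dist3 _ (u m) _)); rewrite /u in a1 a2 *; lra.
Qed.

Lemma zlim_rlim t : 0 <= t -> rlim (zlim g) t (zlim g t).
Proof.
move=> t0 e e0; have [d d0 hd] := zlim_right t0 (e := e / 2) ltac:(lra).
exists d => // s hs; have s0 : 0 <= s by lra.
have [d' d'0 hd'] := zlim_right s0 (e := e / 2) ltac:(lra).
have [k0 hk0] := dyadic_between s0 (b := Num.min (s + d') (t + d)) ltac:(rewrite lt_min; lra).
have := hk0 k0 (leqnn _); rewrite lt_min => /and3P[a1 a2 a3].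
apply: (le_lt_trans (dist3 _ (g (next_index k0 s) k0) _)).
have b1 := hd (next_index k0 s) k0 ltac:(lra).
have b2 := hd' (next_index k0 s) k0 ltac:(lra).
by rewrite distrC in b2; lra.
Qed.

Lemma zlim_left t : 0 < t -> exists l, llim (zlim g) t l /\
  forall e, 0 < e -> exists2 d, 0 < d &
    forall i k, t - d < dyadic i k < t -> `|l - g i k| < e.
Proof.
move=> t0.
have oscZ e : 0 < e -> exists2 d, 0 < d & forall s i k, 0 <= s -> t - d < s < t ->
    t - d < dyadic i k < t -> `|zlim g s - g i k| < e.
  move=> e0; have [d d0 hd] := osc_left t0 (e := e / 2) ltac:(lra).
  exists d => // s i k s0 hs hik.
  have [d' d'0 hd'] := zlim_right s0 (e := e / 2) ltac:(lra).
  have [k0 hk0] := dyadic_between s0 (b := Num.min (s + d') t) ltac:(rewrite lt_min; lra).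
  have := hk0 k0 (leqnn _); rewrite lt_min => /and3P[a1 a2 a3].
  apply: (le_lt_trans (dist3 _ (g (next_index k0 s) k0) _)).
  have b1 := hd (next_index k0 s) k0 i k ltac:(lra) hik.
  have b2 := hd' (next_index k0 s) k0 ltac:(lra).
  by lra.
have dy d : 0 < d -> exists i k, t - d < dyadic i k < t.
  move=> d0; have [k0 hk0] := dyadic_between (a := Num.max 0 (t - d)) (b := t)
    ltac:(by rewrite le_max lexx) ltac:(rewrite gt_max; lra).
  exists (next_index k0 (Num.max 0 (t - d))), k0.
  by have := hk0 k0 (leqnn _); rewrite gt_max => /andP[/andP[_ ->]].
have : cvg (zlim g s @[s --> t^'-]).
  apply/cauchy_cvgP; apply: cauchy_exP => e e0.
  have [d d0 hd] := oscZ e e0; have [i [k hik]] := dy d d0.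
  exists (g i k); rewrite /= /at_left /within /=; apply/nbhs_ballP.
  exists (Num.min d t); first by rewrite /= lt_min d0.
  move=> s ts st; have {ts} : `|t - s| < Num.min d t := ts.
  suff: `|t - s| < Num.min d t -> ball (g i k) e (zlim g s) by [].
  rewrite ballN (distrC (g i k)) lt_min => /andP[]; rewrite !ltr_norml => hs1 hs2.
  by apply: hd => //; lra.
move=> /cvg_ex[l hl]; have /llimP-/(_ t0) hl' := hl.
exists l; split=> // e e0.
have [d d0 hd] := oscZ (e / 2) ltac:(lra); have [d' d'0 hd'] := hl' (e / 2) ltac:(lra).
exists d => // i k hik.
pose s := Num.max 0 (Num.max (t - d / 2) (t - d' / 2)).
have s0 : 0 <= s by rewrite le_max lexx.
have st : s < t by rewrite !gt_max; lra.
have sd : t - d / 2 <= s by rewrite !le_max lexx !orbT.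
have sd' : t - d' / 2 <= s by rewrite !le_max lexx !orbT.
apply: (le_lt_trans (dist3 _ (zlim g s) _)).
have b1 := hd s i k s0 ltac:(lra) hik.
have b2 := hd' s s0 ltac:(lra).
lra.
Qed.

Let dotpN_cont b (x : V) e : 0 < e -> exists2 d, 0 < d &
  forall y, `|x - y| < d -> `|dotp b x - dotp b y| < e.
Proof.
move=> e0; have /cvgrPdist_lt /(_ e e0) := @dotp_continuous R n b x.
move=> /nbhs_ballP[d /= d0 hd]; exists d => // y xy.
by apply: hd; rewrite ballN.
Qed.

Let closed_away m (x : V) :
  (forall d, 0 < d -> exists2 y, `|x - y| < d & forall b, Phi b -> hpow m <= `|dotp b y|) -> E x.
Proof.
move=> h; apply: regP => b hb; apply/eqP => bx0.
have m0 := hpow_gt0 m; have [d d0 hd] := dotpN_cont b x m0.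
have [y xy hy] := h d d0; have := hd y xy; have := hy b hb.
by rewrite bx0 sub0r normrN; lra.
Qed.

Let projE_id x : E x -> proj_or0 x = proj x.
Proof. by move=> Ex; rewrite /proj_or0 asboolT. Qed.

(** The three-point condition gives the one-sided limits, the distance to the hyperplanes keeps
    these limits in E, and the uniform continuity of projected values identifies the projections of
    the left limit and of the value. *)
Lemma good_Dpi : Dpi_path Phi C (zlim g).
Proof.
have Eg i k : E (g i k).
  have [N hN] := bigN (dyadic i k); have [[m hm] _ _] := gg N.
  apply: (@closed_away m) => d d0; exists (g i k); first by rewrite subrr normr0.
  by move=> b hb; apply: hm => //; lra.
have EZ t : 0 <= t -> E (zlim g t).
  move=> t0; have [N hN] := bigN t; have [[m hm] _ _] := gg N.
  apply: (@closed_away m) => d d0; have [d' d'0 hd'] := zlim_right t0 d0.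
  have [k0 hk0] := dyadic_between t0 (b := Num.min (t + d') N%:R) ltac:(rewrite lt_min; lra).
  have := hk0 k0 (leqnn _); rewrite lt_min => /and3P[a1 a2 a3].
  exists (g (next_index k0 t) k0); first by apply: hd'; lra.
  by move=> b hb; apply: hm => //; lra.
apply/Dpi_char; split=> //; first by move=> t t0; exact: zlim_rlim.
move=> t t0; have [l [hl hg]] := zlim_left t0; exists l.
have [N hN] := bigN t; have [[m hm] _ hu] := gg N.
have dy d : 0 < d -> exists i k, t - d < dyadic i k < t.
  move=> d0; have [k0 hk0] := dyadic_between (a := Num.max 0 (t - d)) (b := t)
    ltac:(by rewrite le_max lexx) ltac:(rewrite gt_max; lra).
  exists (next_index k0 (Num.max 0 (t - d))), k0.
  by have := hk0 k0 (leqnn _); rewrite gt_max => /andP[/andP[_ ->]].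
have El : E l.
  apply: (@closed_away m) => d d0; have [d' d'0 hd'] := hg d d0.
  have [i [k hik]] := dy d' d'0; exists (g i k); first exact: hd'.
  by move=> b hb; apply: hm => //; lra.
(* The two projections are compared through one dyadic time just before t and one just after t. *)
split=> //; apply: normV_lt_eq => e e0.
have t0' := ltW t0.
have [p hp] := hpow_small (e := e / 3) ltac:(lra).
have [j hj] := hu p; have j0 := hpow_gt0 j.
have [d1 d10 hd1] := projN El (e := e / 3) ltac:(lra).
have [d2 d20 hd2] := hg d1 d10.
have [i [k hik]] := dy (Num.min d2 (hpow j / 2)) ltac:(rewrite lt_min; lra).
have hik1 : t - d2 < dyadic i k < t.
  move: hik => /andP[a ->]; rewrite andbT; apply: le_lt_trans a.
  by rewrite lerD2l lerN2 ge_min lexx.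
have hik2 : t - hpow j / 2 < dyadic i k < t.
  move: hik => /andP[a ->]; rewrite andbT; apply: le_lt_trans a.
  by rewrite lerD2l lerN2 ge_min lexx orbT.
have [d3 d30 hd3] := projN (EZ _ t0') (e := e / 3) ltac:(lra).
have [d4 d40 hd4] := zlim_right t0' d30.
have [k0 hk0] := dyadic_between t0' (b := Num.min (t + d4) (Num.min N%:R (t + hpow j / 2)))
  ltac:(rewrite !lt_min; lra).
have := hk0 k0 (leqnn _); rewrite !lt_min => /and4P[a1 a2 a3 a4].
have b1 := hd1 _ (hd2 _ _ hik1).
have b2 := hd3 _ (hd4 (next_index k0 t) k0 ltac:(lra)).
have b3 := hj i k (next_index k0 t) k0 ltac:(lra) ltac:(lra) ltac:(lra).
rewrite !projE_id // in b3.
have c1 := dist3 (proj l) (proj (g i k)) (proj (zlim g t)).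
have c2 := dist3 (proj (g i k)) (proj (g (next_index k0 t) k0)) (proj (zlim g t)).
by rewrite distrC in b2; lra.
Qed.

End FromCode.

End PathsAndCodes.

(** * Admissible paths have good codes, and good codes form a measurable set *)

Section CodeOfPath.
Context {R : realType} {n : nat}.
Local Notation V := 'rV[R]_n.
Variables Phi C : set V.
Local Notation E := (regular_set Phi).
Local Notation proj := (chamber_proj Phi C).
Local Notation dyadic := (@dyadic R).
Local Notation hpow := (@hpow R).
Local Notation projE := (proj_or0 Phi C).
Hypothesis hPhi : root_system Phi.
Hypothesis projC : forall x, E x -> C (proj x).
Hypothesis projc : forall x, E x -> {for x, continuous proj}.

Lemma hpow_le j k : (j <= k)%N -> hpow k <= hpow j.
Proof. by move=> jk; rewrite lef_pV2 ?posrE ?exprn_gt0 // ler_eXn2l //; lra. Qed.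

Lemma E_away x : E x -> exists m, exists2 d, 0 < d &
  forall y, `|x - y| < d -> forall b, Phi b -> hpow m <= `|dotp b y|.
Proof.
move=> Ex; have [s us hs] := roots_seq hPhi.
have : exists m, exists2 d, 0 < d & forall y, `|x - y| < d ->
    forall b, b \in s -> Phi b -> hpow m <= `|dotp b y|.
  elim: s {us hs} => [|b s [m [d d0 hd]]]; first by exists 0%N; exists 1.
  have [hb|nb] := pselect (Phi b); last first.
    exists m; exists d => // y xy c; rewrite inE => /orP[/eqP -> //|]; exact: hd.
  have bx : 0 < `|dotp b x| by rewrite normr_gt0 (reg_neq0 hb Ex).
  have [m' hm'] := hpow_small (e := `|dotp b x| / 2) ltac:(lra).
  have m'0 := hpow_gt0 m' (R := R).
  have /cvgrPdist_lt /(_ (hpow m') m'0) := @dotp_continuous R n b x.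
  move=> /nbhs_ballP[d' /= d'0 hd'].
  exists (maxn m m'); exists (Num.min d d'); first by rewrite lt_min d0.
  move=> y; rewrite lt_min => /andP[xy xy'] c; rewrite inE => /orP[/eqP -> _|cs hc].
    have : `|dotp b x - dotp b y| < hpow m' by apply: hd'; rewrite ballN.
    have := hpow_le (leq_maxr m m').
    have := ler_normD (dotp b x - dotp b y) (dotp b y).
    by rewrite subrK; lra.
  exact: le_trans (hpow_le (leq_maxl m m')) (hd y xy c cs hc).
by move=> [m [d d0 hd]]; exists m; exists d => // y xy b hb; apply: hd => //; apply/hs.
Qed.

Section ToCode.
Variable w : R -> V.
Hypothesis hw : Dpi_path Phi C w.

Let wE t : 0 <= t -> E (w t).
Proof. by have /(Dpi_char projC projc)[h _ _] := hw; exact: h. Qed.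

(** Near t the path is close to one of two values with the same projection, l before t and [w t]
    from t on. All three conditions of [good] follow from this local picture by compactness. *)
Lemma Dpi_local t : 0 <= t -> exists l, [/\ E l, proj l = proj (w t) &
  forall e, 0 < e -> exists2 d, 0 < d & (forall s, t <= s < t + d -> `|w t - w s| < e) /\
    (forall s, 0 <= s -> t - d < s < t -> `|l - w s| < e)].
Proof.
move=> t0; have /(Dpi_char projC projc)[h1 h2 h3] := hw.
have right e : 0 < e -> exists2 d, 0 < d & forall s, t <= s < t + d -> `|w t - w s| < e.
  move=> e0; have [d d0 hd] := h2 t t0 e e0; exists d => // s /andP[].
  rewrite le_eqVlt => /orP[/eqP <-|s1 s2]; first by rewrite subrr normr0.
  by apply: hd; rewrite s1.
have [t0'|t0'] := ltP 0 t; last first.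
  exists (w t); split=> //; first exact: h1.
  by move=> e /right[d d0 hd]; exists d => //; split=> // s s0; lra.
have [l [El hl el]] := h3 t t0'; exists l; split=> // e e0.
have [d1 d10 hd1] := right e e0; have [d2 d20 hd2] := hl e e0.
exists (Num.min d1 d2); first by rewrite lt_min d10.
have m1 : Num.min d1 d2 <= d1 by rewrite ge_min lexx.
have m2 : Num.min d1 d2 <= d2 by rewrite ge_min lexx orbT.
by split=> s; [move=> ?; apply: hd1; lra|move=> s0 ?; apply: hd2 => //; lra].
Qed.

(* A property of [s, s + hpow j] that holds near each point holds uniformly
   on [0, N] for j large. *)
Let uniformize (N : nat) (Q : nat -> R -> Prop) :
  (forall t, 0 <= t -> exists j, exists2 d, 0 < d &
     forall s k, 0 <= s -> `|t - s| < d -> (j <= k)%N -> Q k s) ->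
  exists j, forall s, 0 <= s <= N%:R -> Q j s.
Proof.
move=> h; have /compact_near_coveringP/(_ nat \oo
  (fun j s => 0 <= s -> Q j s) _) := @segment_compact R 0 N%:R.
case.
  move=> t; rewrite /= in_itv /= => /andP[t0 _].
  have [j [d d0 hd]] := h t t0.
  exists (ball t d, [set k | (j <= k)%N]).
    by split; [exact: nbhsx_ballx|exists j].
  by move=> [s k] /= [ts jk] s0; apply: hd => //; rewrite -ball_normE in ts.
move=> j _ /(_ j (leqnn j)) hj; exists j => s hs; apply: hj; last by lra.
by rewrite /= in_itv.
Qed.

Lemma Dpi_good : good Phi C (fun i k => w (dyadic i k)).
Proof.
move=> N; split.
- have [|m hm] := @uniformize N (fun m s => forall b, Phi b -> hpow m <= `|dotp b (w s)|).
    move=> t t0; have [l [El _ hl]] := Dpi_local t0.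
    have [m1 [d1 d10 hd1]] := E_away El; have [m2 [d2 d20 hd2]] := E_away (wE t0).
    have [d d0 [ha hb]] := hl (Num.min d1 d2) ltac:(rewrite lt_min; lra).
    exists (maxn m1 m2); exists d => // s k s0; rewrite ltr_norml => ts mk b hPb.
    apply: le_trans (hpow_le mk) _.
    have [st|st] := ltP s t.
      have /andP[h1 _] : (`|l - w s| < d1) && (`|l - w s| < d2) by rewrite -lt_min; apply: hb => //; lra.
      by apply: le_trans (hpow_le (leq_maxl _ _)) _; exact: hd1.
    have /andP[_ h1] : (`|w t - w s| < d1) && (`|w t - w s| < d2) by rewrite -lt_min; apply: ha; lra.
    by apply: le_trans (hpow_le (leq_maxr _ _)) _; exact: hd2.
  by exists m => i k b h hb; apply: hm => //; rewrite dyadic_ge0.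
- move=> p; have p0 := hpow_gt0 p (R := R).
  have [|j hj] := @uniformize N (fun j s => forall s2 s3, s <= s2 <= s3 -> s3 - s < hpow j ->
      `|w s - w s2| < hpow p \/ `|w s2 - w s3| < hpow p).
    move=> t t0; have [l [El _ hl]] := Dpi_local t0.
    have [d d0 [ha hb]] := hl (hpow p / 2) ltac:(lra).
    have [j hj] := hpow_small (e := d / 2) ltac:(lra).
    exists j; exists (d / 2); first lra.
    move=> s k s0; rewrite ltr_norml => ts jk s2 s3 h1 h2.
    (* The middle time is on the same side of t as the first time or as the last one, where the path
       stays close to a single value. *)
    have := hpow_le jk => hk; have [s2t|s2t] := ltP s2 t.
      left; have := hb s s0 ltac:(lra); have := hb s2 ltac:(lra) ltac:(lra) => a1 a2.
      by apply: (le_lt_trans (dist3 _ l _)); rewrite (distrC (w s)); lra.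
    right; have := ha s2 ltac:(lra); have := ha s3 ltac:(lra) => a1 a2.
    by apply: (le_lt_trans (dist3 _ (w t) _)); rewrite (distrC (w s2)); lra.
  exists j => i1 k1 i2 k2 i3 k3 h1 h2 h3; apply: hj => //.
  by rewrite dyadic_ge0 /=; lra.
- move=> p; have p0 := hpow_gt0 p (R := R).
  have [|j hj] := @uniformize N (fun j s => forall s2, s <= s2 -> s2 - s < hpow j ->
      `|proj (w s) - proj (w s2)| < hpow p).
    move=> t t0; have [l [El el hl]] := Dpi_local t0.
    have [d1 d10 hd1] := projN projc El (e := hpow p / 2) ltac:(lra).
    have [d2 d20 hd2] := projN projc (wE t0) (e := hpow p / 2) ltac:(lra).
    have [d d0 [ha hb]] := hl (Num.min d1 d2) ltac:(rewrite lt_min; lra).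
    have close s : 0 <= s -> t - d < s < t + d -> `|proj (w t) - proj (w s)| < hpow p / 2.
      move=> s0 ts; have [st|st] := ltP s t.
        have /andP[h1 _] : (`|l - w s| < d1) && (`|l - w s| < d2) by rewrite -lt_min; apply: hb => //; lra.
        by rewrite -el; exact: hd1.
      have /andP[_ h1] : (`|w t - w s| < d1) && (`|w t - w s| < d2) by rewrite -lt_min; apply: ha; lra.
      exact: hd2.
    have [j hj] := hpow_small (e := d / 2) ltac:(lra).
    exists j; exists (d / 2); first lra.
    move=> s k s0; rewrite ltr_norml => ts jk s2 h1 h2.
    have hk := hpow_le jk; have := close s s0 ltac:(lra); have := close s2 ltac:(lra) ltac:(lra) => a1 a2.
    by apply: (le_lt_trans (dist3 _ (proj (w t)) _)); rewrite (distrC (proj (w s))); lra.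
  exists j => i1 k1 i2 k2 h1 h2 h3.
  rewrite /proj_or0 !asboolT; [|apply: wE; exact: dyadic_ge0|apply: wE; exact: dyadic_ge0].
  by apply: hj => //; rewrite dyadic_ge0 /=; lra.
Qed.

Lemma zlim_path t : 0 <= t -> zlim (fun i k => w (dyadic i k)) t = w t.
Proof.
move=> t0; apply/cvg_lim; first exact: norm_hausdorff.
apply: (next_dyadic_cvg t0); case: hw => _ h _ _ _; exact: h.
Qed.

End ToCode.

Lemma measurable_fun_if_set d (T : measurableType d) d' (T' : measurableType d')
    (A : set T) (f g : T -> T') : measurable A -> measurable_fun setT f ->
  measurable_fun setT g -> measurable_fun setT (fun c => if `[< A c >] then f c else g c).
Proof.
move=> mA mf mg _ B mB; rewrite setTI.
rewrite (_ : _ @^-1` B = (A `&` f @^-1` B) `|` (~` A `&` g @^-1` B)).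
  apply: measurableU; apply: measurableI => //; try exact: measurableC.
    exact: fun_preimage_measurable.
  exact: fun_preimage_measurable.
apply/seteqP; split=> c /=; case: asboolP => Ac; tauto.
Qed.

Lemma borelB d (T : measurableType d) (f g : T -> V) :
  measurable_fun setT (f : T -> borel_rV R n) -> measurable_fun setT (g : T -> borel_rV R n) ->
  measurable_fun setT ((fun c => f c - g c) : T -> borel_rV R n).
Proof.
move=> mf mg; apply: borel_coord => i.
rewrite (_ : (fun c => _) = (fun c => f c ord0 i - g c ord0 i)); last first.
  by apply/funext => c; rewrite !mxE.
by apply: measurable_funB; exact: borel_coordE.
Qed.

Lemma dist_measurable d (T : measurableType d) (f g : T -> V) (e : R) :
  measurable_fun setT (f : T -> borel_rV R n) -> measurable_fun setT (g : T -> borel_rV R n) ->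
  measurable [set c | `|f c - g c| < e].
Proof.
move=> mf mg; apply: set_lt_measurable => //.
apply: (measurableT_comp (f := (fun x : V => `|x|) : borel_rV R n -> R)); last exact: borelB.
by apply: continuous_borel; exact: norm_continuous.
Qed.

Lemma projE_measurable : measurable_fun setT (projE : borel_rV R n -> borel_rV R n).
Proof.
have mE : measurable (E : set (borel_rV R n)) by apply: borel_open; exact: open_regular.
apply: borel_measurable_fun => O oO.
rewrite (_ : projE @^-1` O = (E `&` proj @^-1` O) `|` (~` E `&` [set x | O 0])).
  apply: measurableU.
    apply: borel_open; rewrite openE => x [Ex Ox]; rewrite /interior.
    have h1 : nbhs x E by apply: open_nbhs_nbhs; split=> //; exact: open_regular.
    have h2 : nbhs x (proj @^-1` O) by apply: (projc Ex); exact: open_nbhs_nbhs.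
    by apply: filterS2 h1 h2 => y; split.
  apply: measurableI; first exact: measurableC.
  have [z0|z0] := pselect (O 0).
    by rewrite (_ : mkset _ = setT) //; apply/seteqP; split.
  by rewrite (_ : mkset _ = set0) //; apply/seteqP; split.
apply/seteqP; split=> x /=; rewrite /proj_or0; case: asboolP => Ex; tauto.
Qed.

Lemma set_imply_measurable d (T : measurableType d) (Q : Prop) (A : set T) :
  measurable A -> measurable [set c | Q -> A c].
Proof.
move=> mA; have [q|nq] := pselect Q.
  by rewrite (_ : mkset _ = A) //; apply/seteqP; split=> c /=; tauto.
by rewrite (_ : mkset _ = setT) //; apply/seteqP; split=> c /=; tauto.
Qed.

Lemma set_and3_measurable d (T : measurableType d) (A B D : set T) :
  measurable A -> measurable B -> measurable D -> measurable [set c | [/\ A c, B c & D c]].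
Proof.
move=> mA mB mD; rewrite (_ : mkset _ = A `&` (B `&` D)).
  by apply: measurableI => //; exact: measurableI.
by apply/seteqP; split=> [c [a b e]|c [a [b e]]]; split.
Qed.

(** All quantifiers of [good] range over integers or the finitely many roots; this is why it speaks
    of dyadic times and radii 2^-p only. *)
Lemma good_measurable d (T : measurableType d) (G : T -> nat -> nat -> V) :
  (forall i k, measurable_fun setT ((fun c => G c i k) : T -> borel_rV R n)) ->
  measurable [set c | good Phi C (G c)].
Proof.
move=> mG; apply: set_forall_measurable => N; apply: set_and3_measurable.
- apply: set_exists_measurable => m; have [s us hs] := roots_seq hPhi.
  rewrite (_ : (fun c => _) = [set c | forall i k, forall p : 'I_(size s),
      dyadic i k <= N%:R -> hpow m <= `|dotp (nth 0 s p) (G c i k)|]); last first.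
    apply/seteqP; split=> c h i k; first by move=> p ik; apply: h => //; apply/hs; exact: mem_nth.
    move=> b ik /hs /(nthP 0)[p ps <-]; exact: (h i k (Ordinal ps) ik).
  do 3 (apply: set_forall_measurable => ?); apply: set_imply_measurable.
  apply: set_le_measurable => //; apply: measurable_fun_norm.
  apply: (measurableT_comp _ (mG _ _)); apply: continuous_borel; exact: dotp_continuous.
- apply: set_forall_measurable => p; apply: set_exists_measurable => j.
  do 6 (apply: set_forall_measurable => ?); do 3 apply: set_imply_measurable.
  by apply: measurableU; exact: dist_measurable.
- apply: set_forall_measurable => p; apply: set_exists_measurable => j.
  do 4 (apply: set_forall_measurable => ?); do 3 apply: set_imply_measurable.
  by apply: dist_measurable; apply: (measurableT_comp projE_measurable).
Qed.

Variable p0 : V.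

(** With the constant path at p0 as default, every code yields an admissible path, so that sampled
    processes have admissible paths for all outcomes. *)
Definition path_of (g : nat -> nat -> V) (t : R) : V :=
  if `[< good Phi C g >] then zlim g t else p0.

Lemma path_of_Dpi g : E p0 -> Dpi_path Phi C (path_of g).
Proof.
move=> Ep; rewrite /path_of; case: asboolP => gg; first exact: good_Dpi.
apply/(Dpi_char projC projc); split=> // t t0.
  by move=> e e0; exists 1 => // s _; rewrite subrr normr0.
by exists p0; split=> // e e0; exists 1 => // s _ _; rewrite subrr normr0.
Qed.

Lemma path_of_code w t : Dpi_path Phi C w -> 0 <= t ->
  path_of (fun i k => w (dyadic i k)) t = w t.
Proof. by move=> hw t0; rewrite /path_of asboolT; [exact: zlim_path|exact: Dpi_good]. Qed.

Lemma path_of_measurable d (T : measurableType d) (G : T -> nat -> nat -> V) t :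
  (forall i k, measurable_fun setT ((fun c => G c i k) : T -> borel_rV R n)) -> 0 <= t ->
  measurable_fun setT ((fun c => path_of (G c) t) : T -> borel_rV R n).
Proof.
move=> mG t0; have mgood := good_measurable mG.
apply: (borel_cvg (f := fun k c => if `[< good Phi C (G c) >] then G c (next_index k t) k else p0)).
  move=> k; apply: (measurable_fun_if_set (A := [set c | good Phi C (G c)])
    (f := (fun c => G c (next_index k t) k) : T -> borel_rV R n)
    (g := (fun=> p0) : T -> borel_rV R n)) => //; exact: measurable_cst.
move=> c; rewrite /path_of; case: asboolP => gg; last exact: cvg_cst.
apply/cvgrPdist_lt => e e0; have [d0 d00 hd] := zlim_right gg t0 e0.
have [k0 hk0] := dyadic_between t0 (b := t + d0) ltac:(lra).
by exists k0 => // k hk; apply: hd; exact: hk0.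
Qed.

End CodeOfPath.

(** * Coding a sequence of reals by one real *)

Section Coding.
Context {R : realType}.

Lemma binary_sum_tail (c : nat -> bool) k l : (k <= l)%N ->
  binary_sum c l + (2 ^+ l)^-1 <= binary_sum c k + (2 ^+ k)^-1 :> R.
Proof.
move=> /subnKC <-; elim: (l - k)%N => [|j IH]; first by rewrite addn0.
apply: le_trans IH; rewrite addnS; set m := (k + j)%N.
rewrite /binary_sum big_ord_recr /= exprS invfM -addrA lerD2l.
have i0 : 0 < (2 ^+ m)^-1 :> R by rewrite invr_gt0 exprn_gt0.
by case: (c m) => /=; lra.
Qed.

Lemma binary_sum_nat (c : nat -> bool) k : exists I : nat, exists J : nat,
  [/\ binary_sum c k = I%:R / 2 ^+ k :> R,
      binary_sum c k.+1 = J%:R / 2 ^+ k.+1 :> R & J = (I.*2 + c k)%N].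
Proof.
have p0 j : 2 ^+ j != 0 :> R by rewrite expf_neq0.
have step j I : binary_sum c j = I%:R / 2 ^+ j :> R ->
    binary_sum c j.+1 = (I.*2 + c j)%N%:R / 2 ^+ j.+1 :> R.
  rewrite /binary_sum big_ord_recr /= => ->.
  by rewrite natrD -muln2 natrM exprS; field; exact: p0.
have [I hI] : exists I : nat, binary_sum c k = I%:R / 2 ^+ k :> R.
  elim: k => [|k [I hI]]; first by exists 0%N; rewrite /binary_sum big_ord0 mul0r.
  by exists (I.*2 + c k)%N; exact: step.
by exists I; exists (I.*2 + c k)%N; split=> //; exact: step.
Qed.

(** Infinitely many zero digits exclude the expansions ending in ones, the only ones not recovered
    from their value. *)
Lemma bit_binary_value (c : nat -> bool) m :
  (forall k, exists2 j, (k <= j)%N & c j = false) ->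
  bit m (binary_value c : R) = c m.
Proof.
move=> hc; have [I [J [_ hJ eJ]]] := binary_sum_nat c m.
have cv := @binary_value_cvg R c; set v := binary_value c in cv *.
have lo : binary_sum c m.+1 <= v :> R.
  have h := nondecreasing_cvgn_le (@binary_sum_nd R c) _ m.+1.
  by rewrite -(cvg_lim (@norm_hausdorff _ R^o) cv); apply: h; apply/cvg_ex; exists v.
have [j mj cj] := hc m.+1.
have i0 : 0 < (2 ^+ j.+1)^-1 :> R by rewrite invr_gt0 exprn_gt0.
(* The zero digit at position j leaves a gap of 2^-(j+1), which makes the upper bound for the digit
   block strict. *)
have hi : v <= binary_sum c m.+1 + (2 ^+ m.+1)^-1 - (2 ^+ j.+1)^-1.
  apply: (limr_le cv); exists j.+1 => // l /= jl.
  have h1 := binary_sum_tail c jl; have h2 := binary_sum_tail c mj.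
  have l0 : 0 < (2 ^+ l)^-1 :> R by rewrite invr_gt0 exprn_gt0.
  have e1 : binary_sum c j.+1 = binary_sum c j :> R.
    by rewrite /binary_sum big_ord_recr /= cj mul0r addr0.
  have e2 : (2 ^+ j)^-1 = 2 * (2 ^+ j.+1)^-1 :> R.
    by rewrite exprS invfM mulrA divff // mul1r.
  lra.
have p0 : 0 < 2 ^+ m.+1 :> R by rewrite exprn_gt0.
rewrite /bit (truncn_def (n := J)); first by rewrite eJ oddD odd_double; case: (c m).
rewrite hJ in lo hi; apply/andP; split; first by rewrite -ler_pdivrMr.
rewrite -ltr_pdivlMr // -addn1 natrD mulrDl mul1r; lra.
Qed.

(** The logistic function, with the logit as inverse, brings real coordinates into [0, 1), where
    binary digits determine a number. *)
Definition squash (x : R) : R := (1 + expR (- x))^-1.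
Definition unsquash (y : R) : R := ln y - ln (1 - y).

Lemma squash_itv x : 0 <= squash x < 1.
Proof.
have e0 := expR_gt0 (- x).
apply/andP; split; first by rewrite /squash invr_ge0 addr_ge0 // ltW.
by rewrite /squash invf_lt1; lra.
Qed.

Lemma squashK x : unsquash (squash x) = x.
Proof.
have e0 := expR_gt0 (- x); rewrite /unsquash /squash.
have -> : 1 - (1 + expR (- x))^-1 = expR (- x) * (1 + expR (- x))^-1 by field; lra.
rewrite lnM ?posrE ?invr_gt0 ?addr_gt0 // expRK; lra.
Qed.

Lemma squash_measurable : measurable_fun setT squash.
Proof.
apply: continuous_measurable_fun => x; apply: cvgV.
  by have := expR_gt0 (- x); rewrite gt_eqF //; lra.
apply: cvgD; first exact: cvg_cst.
by have := @continuous_comp R R R (fun x => - x) expR x (@opp_continuous R x) (@continuous_expR R (- x)).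
Qed.

Lemma unsquash_measurable : measurable_fun setT unsquash.
Proof.
apply: measurable_funB; first exact: measurable_ln.
apply: (measurableT_comp (@measurable_ln R)); exact: measurable_funB.
Qed.

(** Odd positions always hold 0, so the hypothesis of [bit_binary_value] is met; even positions
    interleave the digits of all coordinates through the pairing of the naturals. *)
Definition encode (y : nat -> R) : R := binary_value (fun m =>
  if odd m then false else
  if @unpickle (nat * nat)%type m./2 is Some ij then bit ij.2 (squash (y ij.1)) else false).

Definition decode_at (i : nat) (x : R) : R :=
  unsquash (binary_value (fun j => bit (pickle (i, j)).*2 x)).

Lemma decode_encode i y : decode_at i (encode y) = y i.
Proof.
rewrite /decode_at.
rewrite (_ : (fun j => _) = bit^~ (squash (y i))); last first.
  apply/funext => j; rewrite /encode bit_binary_value ?odd_double ?doubleK ?pickleK //.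
  move=> k; exists k.*2.+1; last by rewrite /= odd_double.
  by rewrite -addnn; lia.
by rewrite binary_value_bits ?squash_itv // squashK.
Qed.

Lemma encode_itv y : 0 <= encode y <= 1.
Proof. exact: binary_value_itv. Qed.

Lemma encode_measurable d (T : measurableType d) (Y : nat -> T -> R) :
  (forall i, measurable_fun setT (Y i)) -> measurable_fun setT (fun w => encode (Y^~ w)).
Proof.
move=> mY; apply: binary_value_measurable => m; case: (odd m).
  by rewrite (_ : mkset _ = set0) //; apply/seteqP; split.
case: (unpickle m./2) => [[i j]|]; last by rewrite (_ : mkset _ = set0) //; apply/seteqP; split.
have mS := measurableT_comp squash_measurable (mY i).
exact: (fun_preimage_measurable mS (bit_measurable j)).
Qed.

Lemma decode_at_measurable i : measurable_fun setT (decode_at i).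
Proof.
apply: (measurableT_comp unsquash_measurable).
by apply: binary_value_measurable => j; exact: bit_measurable.
Qed.

End Coding.

(** The events on which the integral vanishes form a lambda-system. It reduces a martingale identity
    to events generating the past. *)
Lemma Rint_gen0 d (T : measurableType d) (R : realType) (P : probability T R)
    (G : set (set T)) (g : T -> R) :
  setI_closed G -> G setT -> G `<=` measurable -> bmf g ->
  (forall S, G S -> \int[P]_(w in S) g w = 0) ->
  forall S, <<s G >> S -> \int[P]_(w in S) g w = 0.
Proof.
move=> GI GT mG bg hG S GS.
have h1 B : measurable B -> \int[P]_(w in B) g w = \int[P]_w (\1_B w * g w).
  by move=> mB; rewrite Rint_indic ?setTI //; exact: prob_lty.
pose H := [set A | measurable A /\ \int[P]_w (\1_A w * g w) = 0].
have bi B : measurable B -> bmf (fun w => \1_B w * g w) by move=> mB; apply: bmfM => //; exact: bmf_indic.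
have lH : lambda_system setT H.
  split=> //; first by split=> //; rewrite -h1 // hG.
  - move=> A B BA [mA a0] [mB b0]; split; first exact: measurableD.
    rewrite (_ : (fun w => _) = (fun w => \1_A w * g w - \1_B w * g w)).
      by rewrite RintB ?a0 ?b0 ?subrr //; [exact: prob_lty|exact: bi|exact: bi].
    apply/funext => w; rewrite -mulrBl; congr (_ * _); rewrite !indicE in_setD.
    have [wB|wB] := boolP (w \in B); last by rewrite andbT subr0.
    by rewrite andbF (_ : w \in A) ?subrr //; move: wB; rewrite !inE; exact: BA.
  - move=> F ndF hF.
    have mU : measurable (\bigcup_i F i) by apply: bigcupT_measurable => i; case: (hF i).
    split=> //; have [mg [c hc]] := bg.
    have cv : \int[P]_w (\1_(F k) w * g w) @[k --> \oo] --> \int[P]_w (\1_(\bigcup_i F i) w * g w).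
      apply: (Rint_cvg measurableT _ (c := c)) => //; first exact: prob_lty.
      - by move=> k; have [mF _] := hF k; have [] := bi _ mF.
      - move=> k w; rewrite indicE; case: (_ \in _); rewrite ?mul1r ?mul0r ?normr0 //.
        exact: le_trans (normr_ge0 _) (hc w).
      - move=> w; have [[k _ Fk]|nF] := pselect ((\bigcup_i F i) w); last first.
          rewrite (_ : (fun k => _) = fun=> \1_(\bigcup_i F i) w * g w); first exact: cvg_cst.
          apply/funext => k; rewrite !indicE !memNset //.
          by move=> Fk; apply: nF; exists k.
        apply: cvg_near_cst; exists k => // j /= kj; rewrite !indicE !mem_set //; first by exists k.
        by have /subsetPset := ndF _ _ kj; exact.
    rewrite (_ : (fun k => _) = (fun=> 0)) in cv.
      apply: (cvg_unique (@norm_hausdorff _ R^o) cv); exact: cvg_cst.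
    by apply/funext => k; case: (hF k).
have [mS e] : H S; last by rewrite h1.
apply: (lambda_system_subset GI lH) GS => A GA; split; first exact: mG.
by rewrite -h1; [exact: hG|exact: mG].
Qed.

Lemma next_dyadic_le (R : realType) k (s t : R) : s <= t -> next_dyadic k s <= next_dyadic k t.
Proof.
move=> st; rewrite /next_dyadic /dyadic ler_pM2r ?invr_gt0 ?exprn_gt0 // ler_nat ltnS.
apply: le_truncn; rewrite ler_pM2r ?exprn_gt0 // ge_max !le_max lexx st orbT //.
Qed.

(** * The martingale functional along a path *)

Section PathIntegral.
Context {R : realType} {n : nat}.
Local Notation V := 'rV[R]_n.
Implicit Types (u f : V -> R) (w : R -> V).
Local Notation mu := (@lebesgue_measure R).

Lemma itv_lty (p q : R) : (mu `[p, q] < +oo)%E.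
Proof. by rewrite lebesgue_measure_itv /=; case: ifP => _; rewrite ltry. Qed.

Lemma fine_itv (p q : R) : p <= q -> fine (mu `[p, q]) = q - p.
Proof.
move=> pq; rewrite lebesgue_measure_itv /= lte_fin; case: (ltP p q) => qp /=; first by [].
by apply/esym/eqP; rewrite subr_eq0 eq_le qp pq.
Qed.

Definition cbound u := continuous u /\ exists c, forall x, `|u x| <= c.

Lemma cbound_bmf u : cbound u -> bmf (u : borel_rV R n -> R).
Proof. by move=> [cu bu]; split=> //; exact: continuous_borel. Qed.

Definition mg u f w (t : R) : R :=
  u (w t) - u (w 0) - \int[mu]_(s in `[0, t]) f (w s).

Lemma rc_measurable w : (forall t, 0 <= t -> w s @[s --> t^'+] --> w t) ->
  measurable_fun setT ((fun r => w (Num.max r 0)) : R -> borel_rV R n).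
Proof.
move=> rw; have h := @joint_measurable R n _ unit (fun s _ => w s).
have := h (fun _ _ => measurable_cst _) (fun _ => rw) => {}h.
exact: (measurableT_comp h (@pair2_measurable _ _ _ _ tt)).
Qed.

Lemma drift_max f w p q : 0 <= p ->
  \int[mu]_(s in `[p, q]) f (w s) = \int[mu]_(s in `[p, q]) f (w (Num.max s 0)).
Proof.
move=> p0; apply: eq_Rintegral => s; rewrite inE /= in_itv /= => /andP[ps _].
by rewrite max_l //; lra.
Qed.

Section Drift.
Variables (f : V -> R) (w : R -> V).
Hypothesis bf : bmf (f : borel_rV R n -> R).
Hypothesis rw : measurable_fun setT ((fun r => w (Num.max r 0)) : R -> borel_rV R n).

Lemma drift_bmf : bmf (fun r : R => f (w (Num.max r 0))).
Proof. exact: (bmf_comp (g := (fun r => w (Num.max r 0)) : R -> borel_rV R n) bf rw). Qed.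

Lemma drift_split p q r : 0 <= p -> p <= q -> q <= r ->
  \int[mu]_(s in `[p, r]) f (w s) =
  \int[mu]_(s in `[p, q]) f (w s) + \int[mu]_(s in `[q, r]) f (w s).
Proof.
move=> p0 pq qr; have q0 := le_trans p0 pq; rewrite (drift_max f w r p0) (drift_max f w q p0) (drift_max f w r q0).
have bd := drift_bmf.
have i2 a b : mu.-integrable `[a, b] (EFin \o (fun r : R => f (w (Num.max r 0)))).
  by apply: bmf_integrable => //; exact: itv_lty.
have h := @Rintegral_itvB R _ (BLeft p) (BRight r) q (i2 p r) ltac:(by rewrite bnd_simp) ltac:(by rewrite bnd_simp).
rewrite -(Rintegral_itv_obnd_cbnd (r := q)).
  by rewrite -h addrC subrK.
apply: integrableS (i2 q r) => //; apply: subset_itvr; by rewrite bnd_simp.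
Qed.

Lemma drift_bound c p q : (forall x, `|f x| <= c) -> 0 <= p -> p <= q ->
  `|\int[mu]_(s in `[p, q]) f (w s)| <= c * (q - p).
Proof.
move=> hc p0 pq; rewrite drift_max // -(fine_itv pq); apply: Rint_bound => //.
  exact: itv_lty.
exact: drift_bmf.
Qed.

Lemma drift_indic p q t : 0 <= p -> p <= q -> q <= t ->
  \int[mu]_(s in `[p, q]) f (w s) =
  \int[mu]_(s in `[0, t]) (\1_`[p, q] s * f (w (Num.max s 0))).
Proof.
move=> p0 pq qt; have md a b : measurable (`[a, b] : set R) by [].
rewrite (Rint_indic mu `[0, t]%classic (md p q) drift_bmf).
rewrite drift_max //; congr (Rintegral _ _ _).
apply/seteqP; split=> s /=; rewrite !in_itv /=; last by move=> [].
by move=> h; split=> //; lra.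
Qed.

End Drift.

End PathIntegral.

Section ProcessIntegral.
Context {R : realType} {n : nat} d (T : measurableType d).
Local Notation V := 'rV[R]_n.
Local Notation mu := (@lebesgue_measure R).
Variable Z : R -> T -> V.
Hypothesis mZ : forall t, 0 <= t -> measurable_fun setT (Z t : T -> borel_rV R n).
Hypothesis rZ : forall w t, 0 <= t -> Z s w @[s --> t^'+] --> Z t w.
Variables u f : V -> R.
Hypothesis bu : bmf (u : borel_rV R n -> R).
Hypothesis bf : bmf (f : borel_rV R n -> R).

Lemma drift_process_bmf t : bmf (fun w => \int[mu]_(s in `[0, t]) f (Z (Num.max s 0) w)).
Proof.
have jZ := joint_measurable mZ rZ.
have b2 : bmf (fun z : T * R => f (Z (Num.max z.2 0) z.1)).
  apply: (bmf_comp (g := (fun z : T * R => Z (Num.max z.2 0) z.1) : _ -> borel_rV R n) bf).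
  apply: (measurableT_comp (f := (fun p : R * T => Z (Num.max p.1 0) p.2) : _ -> borel_rV R n)
    (g := fun z : T * R => (z.2, z.1)) jZ).
  by apply: measurable_fun_pair; [exact: measurable_snd|exact: measurable_fst].
have mI : measurable (`[0, t] : set R) by [].
exact: (@bmf_Rint _ T _ _ R mu _ mI (itv_lty 0 t) _ b2).
Qed.

Lemma mg_bmf t : 0 <= t -> bmf (fun w => mg u f (Z^~ w) t).
Proof.
move=> t0; rewrite /mg; apply: bmfB.
  by apply: bmfB; [exact: (bmf_comp bu (mZ t0))|exact: (bmf_comp bu (mZ (lexx 0)))].
rewrite (_ : (fun w => _) = (fun w => \int[mu]_(s in `[0, t]) f (Z (Num.max s 0) w))).
  exact: drift_process_bmf.
by apply/funext => w; rewrite drift_max.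
Qed.

Lemma process_path_measurable w :
  measurable_fun setT ((fun r : R => Z (Num.max r 0) w) : R -> borel_rV R n).
Proof. exact: (@rc_measurable R n (Z^~ w) (@rZ w)). Qed.

Lemma mg_bound cu cf w t : (forall x, `|u x| <= cu) -> (forall x, `|f x| <= cf) -> 0 <= t ->
  `|mg u f (Z^~ w) t| <= cu + cu + cf * t.
Proof.
move=> hu hf t0; have := drift_bound (w := Z^~ w) bf (process_path_measurable w) hf (lexx 0) t0.
rewrite subr0 /mg; have := hu (Z t w); have := hu (Z 0 w); rewrite !ler_norml.
by move=> h1 h2 h3; lra.
Qed.

Lemma mg_increment w s t : 0 <= s -> s <= t ->
  mg u f (Z^~ w) t - mg u f (Z^~ w) s =
  u (Z t w) - u (Z s w) - \int[mu]_(r in `[s, t]) f (Z r w).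
Proof.
move=> s0 st; rewrite /mg (drift_split (w := Z^~ w) bf (process_path_measurable w) (lexx 0) s0 st).
ring.
Qed.

Lemma mg_next_cvg w t : continuous u -> 0 <= t ->
  mg u f (Z^~ w) (next_dyadic k t) @[k --> \oo] --> mg u f (Z^~ w) t.
Proof.
move=> cu t0; have [cf hf] := bf.2.
have h1 := next_dyadic_cvg (w := Z^~ w) t0 (@rZ w t t0).
have h2 : u (Z (next_dyadic k t) w) @[k --> \oo] --> u (Z t w).
  by apply: (cvg_comp _ u h1); exact: cu.
have cf0 : 0 <= cf by apply: le_trans (normr_ge0 _) (hf 0).
apply/cvgrPdist_lt => e e0.
have /cvgrPdist_lt /(_ (e / 2) ltac:(lra)) [k1 _ hk1] := h2.
have [k2 hk2] := @exp2_small R (e / 2 / (cf + 1)) ltac:(by rewrite !divr_gt0 //; lra).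
exists (maxn k1 k2) => // k /=; rewrite geq_max => /andP[kk1 kk2].
have /andP[d1 d2] := next_dyadicP k t0.
rewrite distrC mg_increment //; last exact: ltW.
have := drift_bound (w := Z^~ w) bf (process_path_measurable w) hf t0 (ltW d1).
have := hk1 k kk1; rewrite /= distrC => h3 h4.
have h5 : cf * (next_dyadic k t - t) < e / 2.
  have h6 := hk2 k kk2; rewrite ltr_pdivlMr in h6; last lra.
  apply: le_lt_trans h6; rewrite mulrC; apply: ler_pM; lra.
by apply: (le_lt_trans (ler_normB _ _)); lra.
Qed.

End ProcessIntegral.

Section Adapted.
Context {R : realType} {n : nat} d (T : measurableType d).
Local Notation V := 'rV[R]_n.
Variable Z : R -> T -> V.
Hypothesis mZ : forall t, 0 <= t -> measurable_fun setT (Z t : T -> borel_rV R n).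
Hypothesis rZ : forall w t, 0 <= t -> Z s w @[s --> t^'+] --> Z t w.
Variables u f : V -> R.
Hypothesis bu : bmf (u : borel_rV R n -> R).
Hypothesis bf : bmf (f : borel_rV R n -> R).

(** The process stopped at t is measurable for the past of t taken as ambient sigma-algebra, and it
    gives the functional at t the same value, so [mg_bmf] applies on that space. *)
Lemma mg_adapted t (B : set R) : 0 <= t -> measurable B ->
  natural_filtration Z t ((fun w => mg u f (Z^~ w) t) @^-1` B).
Proof.
move=> t0 mB; rewrite /natural_filtration; set G := [set S | _].
pose Z' s (w : g_sigma_algebraType G) := Z (Num.min s t) w.
have mZ' s : 0 <= s -> measurable_fun setT (Z' s : _ -> borel_rV R n).
  move=> s0 _ B' mB'; rewrite setTI; apply: sub_sigma_algebra.
  exists (Num.min s t), B'; split=> //.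
  by rewrite ge_min lexx orbT andbT le_min s0.
have rZ' w s : 0 <= s -> Z' r w @[r --> s^'+] --> Z' s w.
  move=> s0; apply/right_epsP => e e0; rewrite /Z'.
  have [st|ts] := ltP s t; last first.
    exists 1 => // r /andP[h1 h2]; have tr : t <= r by apply: le_trans ts _; exact: ltW.
    by rewrite (min_r tr); exact: ballxx.
  have /right_epsP /(_ e e0) [d0 d00 hd] := @rZ w s s0.
  exists (Num.min d0 (t - s)); first by rewrite lt_min d00; lra.
  move=> r /andP[h1]; rewrite -ltrBlDl lt_min => /andP[h2 h3].
  have rt : r <= t by lra.
  by rewrite (min_l rt); apply: hd; lra.
have [m _] := mg_bmf mZ' rZ' bu bf t0.
have := m measurableT B mB; rewrite setTI.
congr (_ _); apply/seteqP; suff e w : mg u f (Z'^~ w) t = mg u f (Z^~ w) t.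
  by split=> w /=; rewrite e.
rewrite /mg /Z' minxx (min_l t0); congr (_ - _).
apply: eq_Rintegral => s; rewrite inE /= in_itv /= => /andP[_ h].
by rewrite min_l.
Qed.

Lemma natural_filtration_measurable t S : natural_filtration Z t S -> measurable S.
Proof.
move: S; apply: gen_measurable => S [s [B [/andP[s0 _] mB ->]]].
exact: fun_preimage_measurable (mZ s0) mB.
Qed.

End Adapted.

(** * Countably many tests for the martingale property *)

Section VectorCode.
Context {R : realType} {n : nat}.
Local Notation V := 'rV[R]_n.
Local Notation key := (nat * nat * 'I_n)%type.

Definition vencode (g : nat -> nat -> V) : R := encode (fun m =>
  if @unpickle key m is Some ikj then g ikj.1.1 ikj.1.2 ord0 ikj.2 else 0).

Definition vdecode (c : R) (i k : nat) : V :=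
  \row_j decode_at (pickle ((i, k, j) : key)) c.

Lemma vencodeK g i k : vdecode (vencode g) i k = g i k.
Proof. by apply/rowP => j; rewrite mxE /vencode decode_encode pickleK. Qed.

Lemma vencode_measurable d (T : measurableType d) (G : T -> nat -> nat -> V) :
  (forall i k, measurable_fun setT ((fun w => G w i k) : T -> borel_rV R n)) ->
  measurable_fun setT (fun w => vencode (G w)).
Proof.
move=> mG; apply: (encode_measurable (Y := fun m w =>
  if @unpickle key m is Some ikj then G w ikj.1.1 ikj.1.2 ord0 ikj.2 else 0)) => m.
case: unpickle => [[[i k] j]|] /=; last exact: measurable_cst.
exact: borel_coordE.
Qed.

Lemma vdecode_measurable i k :
  measurable_fun setT ((fun c => vdecode c i k) : R -> borel_rV R n).
Proof.
apply: borel_coord => j; rewrite (_ : (fun c => _) = decode_at (pickle ((i, k, j) : key))).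
  exact: decode_at_measurable.
by apply/funext => c; rewrite mxE.
Qed.

Definition trunc_path (q : R) (w : R -> V) (i k : nat) : V :=
  if dyadic i k <= q then w (dyadic i k) else 0.

(** The path up to time q is one real, so its rational rays generate its sigma-algebra and are
    countably many. [None] is the sure event, which the generating family must contain. *)
Definition path_test (q : R) (r : option rat) (w : R -> V) : Prop :=
  if r is Some r' then vencode (trunc_path q w) < ratr r' else True.

End VectorCode.

Section MartingaleTests.
Context {R : realType} {n : nat} d (T : measurableType d) (P : probability T R).
Local Notation V := 'rV[R]_n.
Variable Z : R -> T -> V.
Hypothesis mZ : forall t, 0 <= t -> measurable_fun setT (Z t : T -> borel_rV R n).
Hypothesis rZ : forall w t, 0 <= t -> Z s w @[s --> t^'+] --> Z t w.

Lemma trunc_measurable (q : R) i k :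
  measurable_fun setT ((fun w => trunc_path q (Z^~ w) i k) : T -> borel_rV R n).
Proof.
rewrite /trunc_path; case: (dyadic i k <= q); last exact: measurable_cst.
by apply: mZ; exact: dyadic_ge0.
Qed.

Lemma path_test_measurable (q : R) r : measurable [set w | path_test q r (Z^~ w)].
Proof.
case: r => [r|] /=; last first.
  by have -> : [set w : T | True] = setT by apply/seteqP; split.
apply: set_lt_measurable; last exact: measurable_cst.
by apply: vencode_measurable => i k; exact: trunc_measurable.
Qed.

Let tests (q : R) : set (set T) := [set S | exists r, S = [set w | path_test q r (Z^~ w)]].

(** The rays determine the code and the code determines the dyadic values up to q. A value at a time
    r of [0, s] is a limit of such values from the right, which is why s < q is required. *)
Lemma natural_filtration_tests s q : s < q ->
  natural_filtration Z s `<=` <<s tests q >>.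
Proof.
move=> sq; apply: gen_mono => S [r [B [/andP[r0 rs] mB ->]]].
pose T' := g_sigma_algebraType (tests q).
have mcode : measurable_fun setT ((fun w => vencode (trunc_path q (Z^~ w))) : T' -> R).
  apply: measurable_fun_lt => c.
  rewrite (_ : [set w | _] = [set w | exists p : rat, ratr p <= c /\
      vencode (trunc_path q (Z^~ w)) < ratr p]).
    apply: set_exists_measurable => p; have [pc|pc] := boolP (ratr p <= c).
      rewrite (_ : (fun w => _) = [set w | path_test q (Some p) (Z^~ w)]).
        by apply: sub_sigma_algebra; exists (Some p).
      by apply/seteqP; split=> w /=; [move=> []|split].
    by rewrite (_ : (fun w => _) = set0) //; apply/seteqP; split=> w // [].
  apply/seteqP; split=> w /=; last by move=> [p [h1 h2]]; exact: lt_le_trans h1.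
  move=> /rat_in_itvoo[p]; rewrite in_itv /= => /andP[h1 h2].
  by exists p; split=> //; exact: ltW.
have mdy i k : dyadic i k <= q -> measurable_fun setT (Z (dyadic i k) : T' -> borel_rV R n).
  move=> hq; rewrite (_ : Z (dyadic i k) = fun w => vdecode (vencode (trunc_path q (Z^~ w))) i k).
    exact: (measurableT_comp (vdecode_measurable i k) mcode).
  by apply/funext => w; rewrite vencodeK /trunc_path hq.
have mr : measurable_fun setT (Z r : T' -> borel_rV R n).
  have [k0 hk0] := @exp2_small R (q - s) ltac:(lra).
  apply: (borel_cvg (f := fun k => Z (next_dyadic (k0 + k) r) : T' -> V)).
    move=> k; apply: mdy; have /andP[_] := @next_dyadicP R (k0 + k) r r0.
    have := hk0 (k0 + k)%N (leq_addr _ _); rewrite /next_dyadic; lra.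
  move=> w; have h := next_dyadic_cvg (w := Z^~ w) r0 (@rZ w r r0).
  rewrite (_ : (fun k => _) = (fun k => Z (next_dyadic (k + k0) r) w)).
    by rewrite (cvg_shiftn k0 (fun k => Z (next_dyadic k r) w)).
  by apply/funext => k; rewrite addnC.
by have := mr measurableT B mB; rewrite setTI.
Qed.

Variables u f : V -> R.
Hypothesis cu : continuous u.
Hypothesis bu : bmf (u : borel_rV R n -> R).
Hypothesis bf : bmf (f : borel_rV R n -> R).

(** Times s and t are replaced by the next dyadic times, which are strictly later, so the past of s
    is generated by the tests; dominated convergence brings the identity back to s and t. *)
Lemma mg_test_martingale :
  (forall (i k i' k' : nat) r, dyadic i k <= dyadic i' k' :> R ->
     \int[P]_(w in [set w | path_test (dyadic i k) r (Z^~ w)])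
       (mg u f (Z^~ w) (dyadic i' k') - mg u f (Z^~ w) (dyadic i k)) = 0) ->
  forall s t S, 0 <= s -> s <= t -> natural_filtration Z s S ->
  \int[P]_(w in S) mg u f (Z^~ w) t = \int[P]_(w in S) mg u f (Z^~ w) s.
Proof.
move=> ht s t S s0 st FS.
have mS := natural_filtration_measurable mZ FS.
have PS : (P S < +oo)%E by exact: prob_lty.
have bm (r : R) : 0 <= r -> bmf (fun w => mg u f (Z^~ w) r) by exact: mg_bmf.
have ge0 k (r : R) : 0 <= r -> 0 <= next_dyadic k r by move=> _; exact: dyadic_ge0.
have step k : \int[P]_(w in S) mg u f (Z^~ w) (next_dyadic k t) =
              \int[P]_(w in S) mg u f (Z^~ w) (next_dyadic k s).
  apply/eqP; rewrite -subr_eq0 -RintB //; [|by apply: bm; exact: dyadic_ge0..]; apply/eqP.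
  have /andP[sk _] := next_dyadicP k s0.
  apply: (Rint_gen0 (G := tests (next_dyadic k s))).
  - move=> _ _ [[r|] ->] [[r'|] ->]; [|exists (Some r)|exists (Some r')|exists None].
    + exists (Some (Num.min r r')); apply/seteqP; split=> w /=; rewrite minElt; last first.
        by case: ifP => h1 h2; split=> //; apply: lt_le_trans h2 _; rewrite ler_rat; lra.
      by move=> [h1 h2]; case: ifP.
    + by apply/seteqP; split=> w //= [].
    + by apply/seteqP; split=> w //= [].
    + by apply/seteqP; split.
  - by exists None; apply/seteqP; split.
  - by move=> _ [r ->]; exact: path_test_measurable.
  - by apply: bmfB; apply: bm; exact: dyadic_ge0.
  - by move=> _ [r ->]; apply: ht; exact: next_dyadic_le.
  - exact: natural_filtration_tests FS.
have [_ [Cu hu]] := bu; have [_ [Cf hf]] := bf.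
have Cf0 : 0 <= Cf by apply: le_trans (normr_ge0 _) (hf 0).
have lim r : 0 <= r -> \int[P]_(w in S) mg u f (Z^~ w) (next_dyadic k r) @[k --> \oo] -->
    \int[P]_(w in S) mg u f (Z^~ w) r.
  move=> r0; apply: (Rint_cvg mS PS (c := Cu + Cu + Cf * (r + 1))).
  - by move=> k; have [] := bm _ (ge0 k r r0).
  - move=> k w; apply: le_trans (mg_bound rZ bf w hu hf (ge0 k r r0)) _.
    rewrite lerD2l ler_wpM2l //; have /andP[_ h] := next_dyadicP k r0.
    by apply: le_trans h _; rewrite lerD2l invf_le1 ?exprn_gt0 // exprn_ege1 //; lra.
  - by move=> w; exact: mg_next_cvg.
have l1 := lim t (le_trans s0 st); have l2 := lim s s0.
rewrite (funext step) in l1.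
exact: (cvg_unique (@norm_hausdorff _ R^o) l1 l2).
Qed.

End MartingaleTests.

Lemma compact_support_bounded (R : realType) n (u : 'rV[R]_n -> R) :
  continuous u -> compact (supp u) -> cbound u.
Proof.
move=> cu cs; split=> //.
have cK : compact (u @` supp u) by apply: continuous_compact => //; exact: continuous_subspaceT.
have /compact_bounded[M [Mr hM]] := cK.
exists (Num.max 0 (M + 1)) => x; have [ux|ux] := pselect (u x = 0).
  by rewrite ux normr0 le_max lexx.
rewrite le_max; apply/orP; right; apply: (hM (M + 1)); first lra.
by exists x => //; apply: subset_closure; apply/eqP.
Qed.

Lemma Rint0_null d (T : measurableType d) (R : realType) (P : probability T R) (h : T -> R) :
  bmf h -> (forall B, measurable B -> \int[P]_(w in B) h w = 0) ->
  exists2 N, null P N & forall x, ~ N x -> h x = 0.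
Proof.
move=> bh h0; have : ae_eq P setT (EFin \o h) (cst 0%E).
  apply: integral_ae_eq => //.
    by apply: bmf_integrable => //; exact: prob_lty.
  move=> B _ mB; rewrite integral0.
  by rewrite (Rint_EFin mB (prob_lty P mB) bh) h0.
move=> /null_ae[N nN hN]; exists N => // x /hN /= /(_ I).
by move=> [].
Qed.

Lemma joint_law_image d1 (T1 : measurableType d1) d2 (T2 : measurableType d2)
    d (T : measurableType d) (R : realType) (P1 : probability T1 R) (P2 : probability T2 R)
    (g1 : T1 -> T) (g2 : T2 -> T) (F : T -> R) :
  measurable_fun setT g1 -> measurable_fun setT g2 ->
  (forall B, measurable B -> P1 (g1 @^-1` B) = P2 (g2 @^-1` B)) -> bmf F ->
  \int[P1]_x F (g1 x) = \int[P2]_x F (g2 x).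
Proof.
move=> m1 m2 h bF; have [Q hQ] := image_prob P2 m2.
have i1 : has_image P1 Q g1 by split=> // B mB; rewrite hQ // h.
have i2 : has_image P2 Q g2 by split=> // B mB; rewrite hQ.
by rewrite -(Rint_image i1 bF) -(Rint_image i2 bF).
Qed.

(** * A kernel of solutions indexed by the starting point *)

Section Kernel.
Context {R : realType} {n : nat}.
Local Notation V := 'rV[R]_n.
Variables Phi C : set V.
Local Notation E := (regular_set Phi).
Local Notation proj := (chamber_proj Phi C).
Hypothesis hPhi : root_system Phi.
Hypothesis projC : forall x, E x -> C (proj x).
Hypothesis projc : forall x, E x -> {for x, continuous proj}.
Variable p0 : V.
Hypothesis Ep0 : E p0.

(** A code whose path does not start at x is replaced by the constant path, so the start is x for
    every code. *)
Definition start_path (x : V) (c t : R) : V :=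
  if `[< E x /\ path_of Phi C p0 (vdecode c) 0 = x >]
  then path_of Phi C p0 (vdecode c) t else x.

Lemma const_Dpi x : E x -> Dpi_path Phi C (fun=> x).
Proof.
move=> Ex; apply/(Dpi_char projC projc); split=> // t t0.
  by move=> e e0; exists 1 => // s _; rewrite subrr normr0.
by exists x; split=> // e e0; exists 1 => // s _ _; rewrite subrr normr0.
Qed.

Lemma start_Dpi x c : E x -> Dpi_path Phi C (start_path x c).
Proof.
move=> Ex; rewrite /start_path; case: asboolP => h; last exact: const_Dpi.
exact: path_of_Dpi.
Qed.

Lemma start_path0 x c : start_path x c 0 = x.
Proof. by rewrite /start_path; case: asboolP => // -[]. Qed.

Lemma start_rc x c t : 0 <= t -> start_path x c s @[s --> t^'+] --> start_path x c t.
Proof.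
move=> t0; have [Ex|nEx] := pselect (E x).
  by have [_ h _ _ _] := start_Dpi c Ex; exact: h.
rewrite (_ : start_path x c = fun=> x); first exact: cvg_cst.
by apply/funext => s; rewrite /start_path asboolF // => -[].
Qed.

Lemma start_measurable t : 0 <= t ->
  measurable_fun setT ((fun z => start_path z.1 z.2 t) : borel_rV R n * R -> borel_rV R n).
Proof.
move=> t0.
have md s : 0 <= s -> measurable_fun setT
    ((fun z => path_of Phi C p0 (vdecode z.2) s) : borel_rV R n * R -> borel_rV R n).
  move=> s0; apply: (path_of_measurable hPhi projc p0 (G := fun z : borel_rV R n * R => vdecode z.2)) => // i k.
  exact: (measurableT_comp (vdecode_measurable i k) measurable_snd).
apply: (measurable_fun_if_set (A := [set z : borel_rV R n * R |
   E z.1 /\ path_of Phi C p0 (vdecode z.2) 0 = z.1])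
   (f := (fun z => path_of Phi C p0 (vdecode z.2) t) : borel_rV R n * R -> borel_rV R n)
   (g := (fun z => z.1) : borel_rV R n * R -> borel_rV R n)).
- apply: measurableI.
    have mE : measurable (E : set (borel_rV R n)) by apply: borel_open; exact: open_regular.
    exact: (fun_preimage_measurable measurable_fst mE).
  by apply: (set_eqV_measurable (md 0 (lexx 0))); exact: measurable_fst.
- exact: md.
- exact: measurable_fst.
Qed.

Lemma start_code w x t : Dpi_path Phi C w -> w 0 = x -> 0 <= t ->
  start_path x (vencode (fun i k => w (dyadic i k))) t = w t.
Proof.
move=> hw w0 t0; rewrite /start_path.
have -> : vdecode (vencode (fun i k => w (dyadic i k))) = (fun i k => w (dyadic i k)).
  by apply/funext => i; apply/funext => k; rewrite vencodeK.
rewrite !(path_of_code hPhi projC projc) // asboolT // -w0; split=> //.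
by case: hw => h _ _ _ _; exact: h.
Qed.

Lemma mg_eq_path (u f : V -> R) w w' t : (forall s, 0 <= s -> w s = w' s) -> 0 <= t ->
  mg u f w t = mg u f w' t.
Proof.
move=> h t0; rewrite /mg (h t t0) (h 0 (lexx 0)); congr (_ - _); apply: eq_Rintegral => s.
by rewrite inE /= in_itv /= => /andP[s0 _]; rewrite (h s s0).
Qed.

Lemma path_test_eq (q : R) r (w w' : R -> V) : (forall s, 0 <= s <= q -> w s = w' s) ->
  path_test q r w <-> path_test q r w'.
Proof.
move=> h; have e : trunc_path q w = trunc_path q w'.
  apply/funext => i; apply/funext => k; rewrite /trunc_path; case: (boolP (dyadic i k <= q)) => // hq.
  by apply: h; rewrite dyadic_ge0.
by rewrite /path_test e; split=> hr; exact: hr.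
Qed.

Lemma path_test_adapted d (T : measurableType d) (Z : R -> T -> V) q r : 0 <= q ->
  natural_filtration Z q [set w | path_test q r (Z^~ w)].
Proof.
move=> q0; rewrite /natural_filtration; set G := [set S | _].
pose Z' s (w : g_sigma_algebraType G) := Z (Num.min s q) w.
have mZ' s : 0 <= s -> measurable_fun setT (Z' s : _ -> borel_rV R n).
  move=> s0 _ B' mB'; rewrite setTI; apply: sub_sigma_algebra.
  exists (Num.min s q), B'; split=> //.
  by rewrite ge_min lexx orbT andbT le_min s0.
have e w s : 0 <= s <= q -> Z s w = Z' s w by move=> /andP[_ sq]; rewrite /Z' min_l.
have -> : [set w | path_test q r (Z^~ w)] = [set w | path_test q r (Z'^~ w)].
  apply/funext => w; apply/propext; exact: (path_test_eq r (e w)).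
exact: (path_test_measurable mZ' q r).
Qed.

Section Fibers.
Context d (T : measurableType d) (P : probability T R) (X : R -> T -> V).
Variable nu : probability (borel_rV R n) R.
Hypothesis mX : forall t, 0 <= t -> measurable_fun setT (X t : T -> borel_rV R n).
Hypothesis DX : forall w, Dpi_path Phi C (X^~ w).
Hypothesis lawX : has_law P (X 0) nu.
Variable U : probability R R.
Hypothesis hU : uniform01 U.

(** F disintegrates the code of the path over the initial value. The exceptional starting points
    depend on u and f but not on times and events, because the martingale property of a fiber
    reduces to countably many tests. *)
Lemma kernel_exists : exists F : borel_rV R n * R -> R, measurable_fun setT F /\
  forall u f : V -> R, continuous u -> bmf (u : borel_rV R n -> R) -> bmf (f : borel_rV R n -> R) ->
    (forall s t S, 0 <= s -> s <= t -> natural_filtration X s S ->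
      \int[P]_(w in S) mg u f (X^~ w) t = \int[P]_(w in S) mg u f (X^~ w) s) ->
    exists2 N, null nu N & forall x, ~ N x -> forall s t S, 0 <= s -> s <= t ->
      natural_filtration (fun r v => start_path x (F (x, v)) r) s S ->
      \int[U]_(v in S) mg u f (start_path x (F (x, v))) t =
      \int[U]_(v in S) mg u f (start_path x (F (x, v))) s.
Proof.
pose xi w := vencode (fun i k => X (dyadic i k) w).
have mxi : measurable_fun setT xi by apply: vencode_measurable => i k; apply: mX; exact: dyadic_ge0.
have xi01 w : 0 <= xi w <= 1 by exact: encode_itv.
have hG : has_image P nu (X 0) by split; [exact: mX|exact: lawX].
have [F mF hF] := disintegration hG mxi xi01 hU.
exists F; split=> // u f cu bu bf hX.
have jZ w t : 0 <= t -> X s w @[s --> t^'+] --> X t w by move=> t0; case: (DX w) => _ h _ _ _; exact: h.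
pose Z t (z : borel_rV R n * R) := start_path z.1 z.2 t.
have mZ t : 0 <= t -> measurable_fun setT (Z t : _ -> borel_rV R n) by exact: start_measurable.
have rZ z t : 0 <= t -> Z s z @[s --> t^'+] --> Z t z by exact: start_rc.
have mG : measurable_fun setT (fun z : borel_rV R n * R => (z.1, F z) : borel_rV R n * R).
  by apply: measurable_fun_pair => //; exact: measurable_fst.
pose H (i k i' k' : nat) r (z : borel_rV R n * R) : R :=
  \1_[set z | path_test (dyadic i k) r (Z^~ z)] z *
  (mg u f (Z^~ z) (dyadic i' k') - mg u f (Z^~ z) (dyadic i k)).
have bH i k i' k' r : bmf (H i k i' k' r).
  apply: bmfM; first by apply: bmf_indic; exact: path_test_measurable.
  by apply: bmfB; apply: mg_bmf => //; exact: dyadic_ge0.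
have bHF i k i' k' r : bmf (fun z : borel_rV R n * R => H i k i' k' r (z.1, F z)).
  exact: (bmf_comp (bH i k i' k' r) mG).
(* Integrated over starting points in B, the test equation of the fibers becomes, by the equality of
   joint laws, the martingale identity of X on the event that X starts in B and passes the test,
   which belongs to its past. *)
have key i k i' k' r B : dyadic i k <= dyadic i' k' :> R -> measurable B ->
    \int[nu]_(x in B) (\int[U]_v H i k i' k' r (x, F (x, v))) = 0.
  move=> ii mB; have q0 := @dyadic_ge0 R i k; set q := dyadic i k in ii q0.
  have bh : bmf (fun x => \int[U]_v H i k i' k' r (x, F (x, v))).
    exact: (@bmf_Rint _ _ _ _ R U _ measurableT (prob_lty U measurableT) _ (bHF i k i' k' r)).
  rewrite -[B]setTI -(Rint_indic nu setT mB bh).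
  have bK : bmf (fun z : borel_rV R n * R => \1_B z.1 * H i k i' k' r z).
    by apply: bmfM => //; exact: (bmf_comp (bmf_indic R mB) measurable_fst).
  have bKF : bmf (fun z : borel_rV R n * R => \1_B z.1 * H i k i' k' r (z.1, F z)).
    exact: (bmf_comp bK mG).
  transitivity (\int[(nu \x U)%E]_z (\1_B z.1 * H i k i' k' r (z.1, F z))).
    rewrite (Rint_prod nu U bKF); apply: eq_Rintegral => x _ /=.
    rewrite RintZ //; first exact: prob_lty.
    exact: (bmf_xsection (bHF i k i' k' r) x).
  transitivity (\int[P]_w (\1_B (X 0 w) * H i k i' k' r (X 0 w, xi w))).
    have mXxi : measurable_fun setT (fun w => (X 0 w, xi w) : borel_rV R n * R).
      by apply: measurable_fun_pair => //; exact: mX.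
    exact: (joint_law_image mG mXxi hF bK).
  have ZX w t : 0 <= t -> Z t (X 0 w, xi w) = X t w by move=> t0; exact: (start_code (w := X^~ w) (DX w) erefl t0).
  pose S := X 0 @^-1` B `&` [set w | path_test q r (X^~ w)].
  have FS : natural_filtration X q S.
    have FT := @path_test_adapted d T X q r q0.
    rewrite /natural_filtration; set G := [set S | _].
    have mS1 : @measurable _ (g_sigma_algebraType G) (X 0 @^-1` B).
      by apply: sub_sigma_algebra; exists 0, B; split=> //; rewrite lexx.
    exact: (@measurableI _ (g_sigma_algebraType G) _ _ mS1 FT).
  have mS := natural_filtration_measurable mX FS.
  have bM t : 0 <= t -> bmf (fun w => mg u f (X^~ w) t) by exact: mg_bmf.
  have bMM : bmf (fun w => mg u f (X^~ w) (dyadic i' k') - mg u f (X^~ w) q).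
    by apply: bmfB; [apply: bM; exact: dyadic_ge0|exact: bM].
  transitivity (\int[P]_w (\1_S w * (mg u f (X^~ w) (dyadic i' k') - mg u f (X^~ w) q))).
    apply: eq_Rintegral => w _; rewrite /H mulrA.
    rewrite (mg_eq_path u f (ZX w) (dyadic_ge0 i' k')) (mg_eq_path u f (ZX w) q0); congr (_ * _).
    have pt : path_test q r (Z^~ (X 0 w, xi w)) <-> path_test q r (X^~ w).
      by apply: path_test_eq => s /andP[s0 _]; exact: ZX.
    rewrite /S !indicE; have [hB|hB] := pselect (B (X 0 w)); last first.
      by rewrite [X 0 w \in _]memNset // mul0r memNset // => -[].
    rewrite [X 0 w \in _]mem_set // mul1r; have [ht|ht] := pselect (path_test q r (X^~ w)).
      rewrite (@mem_set _ [set z | path_test q r (Z^~ z)] _ (pt.2 ht)).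
      by rewrite (@mem_set _ (X 0 @^-1` B `&` [set w | path_test q r (X^~ w)]) w (conj hB ht)).
    rewrite (@memNset _ [set z | path_test q r (Z^~ z)] _ (fun h => ht (pt.1 h))).
    by rewrite (@memNset _ (X 0 @^-1` B `&` [set w | path_test q r (X^~ w)]) w (fun h => ht h.2)).
  rewrite (Rint_indic P setT mS bMM) setTI.
  have oo := prob_lty P mS.
  rewrite (RintB mS oo (bM _ (dyadic_ge0 i' k')) (bM q q0)).
  by rewrite (hX _ _ S q0 ii FS) subrr.
have bh i k i' k' r : bmf (fun x => \int[U]_v H i k i' k' r (x, F (x, v))).
  exact: (@bmf_Rint _ _ _ _ R U _ measurableT (prob_lty U measurableT) _ (bHF i k i' k' r)).
(* Since B is arbitrary, each test equation holds for almost every starting point; there are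
   countably many tests. *)
have [p|N nN hN] := @null_countable _ _ _ nu (nat * nat * (nat * nat) * option rat)%type
    (fun p x => dyadic p.1.1.1 p.1.1.2 <= dyadic p.1.2.1 p.1.2.2 :> R ->
      \int[U]_v H p.1.1.1 p.1.1.2 p.1.2.1 p.1.2.2 p.2 (x, F (x, v)) = 0).
  case: (boolP (dyadic p.1.1.1 p.1.1.2 <= dyadic p.1.2.1 p.1.2.2 :> R)) => hp; last first.
    by exists set0 => //; exact: null_set0.
  have [N nN hN] := Rint0_null (bh p.1.1.1 p.1.1.2 p.1.2.1 p.1.2.2 p.2) (fun B mB => key _ _ _ _ p.2 B hp mB).
  by exists N; [exact: nN|move=> x /hN h _; exact: h].
exists N; [exact: nN|move=> x /hN hx].
have mFx : measurable_fun setT (fun v : R => (x, F (x, v)) : borel_rV R n * R).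
  apply: measurable_fun_pair; first exact: measurable_cst.
  by apply: (measurableT_comp mF); exact: pair1_measurable.
have mZx t : 0 <= t -> measurable_fun setT ((fun v => start_path x (F (x, v)) t) : R -> borel_rV R n).
  by move=> t0; exact: (measurableT_comp (mZ t t0) mFx).
have bM t : 0 <= t -> bmf (fun v => mg u f (start_path x (F (x, v))) t).
  by move=> t0; apply: (mg_bmf mZx _ bu bf t0) => v s s0; exact: start_rc.
apply: (mg_test_martingale mZx _ cu bu bf); first by move=> v t t0; exact: start_rc.
move=> i k i' k' r ii.
have mt := path_test_measurable mZx (dyadic i k) r.
have bMM := bmfB (bM _ (dyadic_ge0 i' k')) (bM _ (dyadic_ge0 i k)).
etransitivity; last exact: (hx (i, k, (i', k'), r) ii).
by rewrite (Rint_indic U setT mt bMM) setTI.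
Qed.

End Fibers.
End Kernel.

(** * Translation of Lebesgue measure and the exponential law *)

Section Translation.
Context {R : realType}.
Local Notation mu := (@lebesgue_measure R).

Lemma shift_measurable (a : R) : measurable_fun setT (fun x : R => x + a).
Proof. by apply: measurable_funD. Qed.

Lemma lebesgue_shift (a : R) (B : set R) : measurable B ->
  mu B = mu ((fun x : R => x + a) @^-1` B).
Proof.
move=> mB.
have sm : measurable_fun setT ((fun x : R => x + a) : measurableTypeR R -> measurableTypeR R).
  exact: shift_measurable.
pose nu := measure_function_pushforward__canonical__measure_function_Measure mu sm.
suff h X : ocitv X -> mu X = nu X by have := @lebesgue_measure_unique R nu h B mB; rewrite /nu.
move=> [[p q] _ <-] /=; rewrite /nu /= /pushforward /=.
rewrite (_ : (fun x : R => x + a) @^-1` `]p, q] = `]p - a, q - a]%classic); last first.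
  apply/seteqP; split=> x /=; rewrite !in_itv /= => /andP[h1 h2]; apply/andP; split; lra.
rewrite !lebesgue_measure_itv /= !lte_fin ltrD2r; case: ifP => // _.
by rewrite -!EFinB; congr (_%:E); lra.
Qed.

Lemma Rint_shift (h : R -> R) (a p q : R) : bmf h ->
  \int[mu]_(r in `[p, q]) h r = \int[mu]_(r in `[p - a, q - a]) h (r + a).
Proof.
move=> bh; have sm := shift_measurable a.
have e : (fun x : R => x + a) @^-1` `[p, q]%classic = `[p - a, q - a]%classic.
  apply/seteqP; split=> x /=; rewrite !in_itv /= => /andP[h1 h2]; apply/andP; split; lra.
have sm' : measurable_fun setT ((fun x : R => x + a) : measurableTypeR R -> measurableTypeR R).
  exact: shift_measurable.
pose nu := measure_function_pushforward__canonical__measure_function_Measure mu sm'.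
congr fine; transitivity (\int[nu]_(y in `[p, q]) (h y)%:E)%E.
  apply: (eq_measure_integral nu) => B mB _.
  exact: lebesgue_shift.
rewrite /nu integral_pushforward // ?e //.
- by apply/measurable_EFinP; case: bh.
- exact: (bmf_integrable _ (itv_lty _ _) (bmf_comp bh sm)).
Qed.

End Translation.

Section Exponential.
Context {R : realType}.
Local Notation mu := (@lebesgue_measure R).
Variable lam : R.
Hypothesis lam0 : 0 < lam.
Local Notation Q := (exponential_distribution_exponential_prob__canonical__probability_measure_Probability lam0).

Lemma exponential_dom : exponential_prob lam `<< mu.
Proof.
apply/null_content_dominatesP => B mB B0; rewrite /exponential_prob.
apply: null_set_integral => //.
apply: measurable_funTS; apply/measurable_EFinP; exact: measurable_exponential_pdf.
Qed.

(** The Radon-Nikodym derivative of the exponential law is almost everywhere its density, since both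
    have the same integrals over measurable sets. *)
Lemma Rint_exponential (h : R -> R) (b : R) : bmf h ->
  \int[Q]_(r in `[0, b]) h r = \int[mu]_(r in `[0, b]) (h r * exponential_pdf lam r).
Proof.
move=> bh; congr fine.
have mD : measurable (`[0, b]%classic : set (measurableTypeR R)) by [].
have ih : Q.-integrable `[0, b]%classic (EFin \o h).
  exact: (@bmf_integrable _ (measurableTypeR R) R Q _ mD (prob_lty Q mD) h bh).
rewrite -(Radon_Nikodym_change_of_variables exponential_dom mD ih).
transitivity (\int[mu]_(r in `[0%R, b]) ((h r)%:E * (exponential_pdf lam r)%:E))%E; last first.
  by apply: eq_integral => r _; rewrite EFinM.
apply: ae_eq_integral => //.
- apply: emeasurable_funM => //.
    by apply: measurable_funTS; apply/measurable_EFinP; case: bh.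
  apply: (measurable_int mu); apply: (integrableS _ _ (@subsetT _ _)) => //=.
  by apply: Radon_Nikodym_integrable; exact: exponential_dom.
- apply: emeasurable_funM => //; apply: measurable_funTS; apply/measurable_EFinP; first by case: bh.
  exact: measurable_exponential_pdf.
- apply: ae_eqe_mul2l => /=.
  rewrite Radon_NikodymE//=; first exact: exponential_dom.
  move=> abmu; case: cid => /= g [h1 h2 h3].
  apply: integral_ae_eq => //=.
  + exact: integrableS h2.
  + by apply: measurable_funTS; apply/measurable_EFinP; exact: measurable_exponential_pdf.
  + by move=> B _ mB; rewrite -h3.
Qed.

End Exponential.

Section ExponentialIdentity.
Context {R : realType} d (Om : measurableType d) (P : probability Om R).
Local Notation mu := (@lebesgue_measure R).
Variables (lam : R) (D : Om -> R).
Hypothesis lam0 : 0 < lam.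
Local Notation Q := (exponential_distribution_exponential_prob__canonical__probability_measure_Probability lam0).
Hypothesis mD : measurable_fun setT D.
Hypothesis D0 : forall w, 0 <= D w.
Hypothesis lawD : forall B : set R, measurable B -> P (D @^-1` B) = exponential_prob lam B.

Lemma exponential_tail (y : R) : 0 < y ->
  fine (P [set w | y <= D w]) = expR (- (lam * y)).
Proof.
move=> y0; have mS : measurable [set w | D w < y] by exact: set_lt_measurable.
rewrite (_ : [set w | y <= D w] = ~` [set w | D w < y]); last first.
  by apply/seteqP; split=> w /=; [move=> h; apply/negP; rewrite -leNgt|move/negP; rewrite -leNgt].
rewrite probability_setC //.
have -> : P [set w | D w < y] = (1 - expR (- (lam * y)))%:E.
  rewrite -(exponential_prob_ray lam y0) -lawD; last exact: measurable_itv.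
  by congr (P _); apply/seteqP; split=> w /=; rewrite in_itv.
by rewrite -EFinB /= opprB addrC subrK.
Qed.

Lemma pdf_bmf : bmf (exponential_pdf lam).
Proof.
split; first exact: measurable_exponential_pdf.
exists lam => x; have [x0|x0] := ltP x 0; first by rewrite lt0_exponential_pdf // normr0 ltW.
rewrite exponential_pdfE // ger0_norm; last by rewrite mulr_ge0 ?expR_ge0 // ltW.
by rewrite ler_piMr //; [exact: ltW|rewrite -expR0 ler_expR mulNr oppr_le0 mulr_ge0 // ltW].
Qed.

(** The density of the waiting time at r - a equals lambda times the probability of waiting at least
    r - a; exchanging the integrals on the right turns it into the left. This makes lambda times
    elapsed time the compensator of the jump. *)
Lemma exponential_identity (h : R -> R) (a t : R) : bmf h -> 0 <= a ->
  \int[P]_w (\1_[set x | x <= t] (a + D w) * h (a + D w)) =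
  lam * \int[P]_w \int[mu]_(r in `[0, t]) (\1_[set z : Om * R | a < z.2 <= a + D z.1] (w, r) * h r).
Proof.
move=> bh a0; have [ta|at_] := ltP t a.
  transitivity (\int[P]_w (0 : R)).
    apply: eq_Rintegral => w _; rewrite indicE memNset ?mul0r //= => h1.
    by have := D0 w; lra.
  rewrite Rint_cst // mul0r; apply/esym/eqP; rewrite mulf_eq0 gt_eqF //=; apply/eqP.
  transitivity (\int[P]_w (0 : R)); last by rewrite Rint_cst // mul0r.
  apply: eq_Rintegral => w _; transitivity (\int[mu]_(r in `[0, t]) (0 : R)); last first.
    by rewrite Rint_cst // ?mul0r.
  apply: eq_Rintegral => r; rewrite inE /= in_itv /= => rt.
  by rewrite indicE memNset ?mul0r //= => h1; lra.
pose b := t - a.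
have bK : bmf (fun x : R => \1_(`[0, b]%classic : set R) x * h (x + a)).
  apply: bmfM; first exact: bmf_indic.
  exact: (bmf_comp bh (shift_measurable a)).
have bp := pdf_bmf.
transitivity (\int[mu]_(x in `[0, b]) (h (x + a) * exponential_pdf lam x)).
  rewrite -(Rint_exponential lam0); last exact: (bmf_comp bh (shift_measurable a)).
  transitivity (\int[Q]_x (\1_(`[0, b]%classic : set R) x * h (x + a))); last first.
    rewrite (@Rint_indic _ (measurableTypeR R) R Q setT) ?setTI //.
    exact: (bmf_comp bh (shift_measurable a)).
  have iD : has_image P Q (D : Om -> measurableTypeR R) by split.
  rewrite (Rint_image iD bK); apply: eq_Rintegral => w _.
  rewrite [a + _]addrC; congr (_ * _); rewrite !indicE; congr (nat_of_bool _)%:R.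
  by apply/idP/idP; rewrite !inE /= in_itv /= D0 /b; lra.
have mA : measurable [set z : Om * R | a < z.2 <= a + D z.1].
  have m2 : measurable_fun setT (fun z : Om * R => a + D z.1).
    by apply: measurable_funD => //; exact: (measurableT_comp mD measurable_fst).
  have h1 : measurable [set z : Om * R | a < z.2].
    by apply: set_lt_measurable => //; exact: measurable_snd.
  have h2 : measurable [set z : Om * R | z.2 <= a + D z.1].
    by apply: set_le_measurable => //; exact: measurable_snd.
  rewrite (_ : mkset _ = [set z : Om * R | a < z.2] `&` [set z : Om * R | z.2 <= a + D z.1]).
    exact: measurableI.
  by apply/seteqP; split=> z /= => [/andP[]|[-> ->]].
have bF : bmf (fun z : Om * R => \1_[set z : Om * R | a < z.2 <= a + D z.1] z * h z.2).
  by apply: bmfM; [exact: bmf_indic|exact: (bmf_comp bh measurable_snd)].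
have mI (p q : R) : measurable (`[p, q]%classic : set R) by [].
rewrite (Rint_fubini (m1 := P) (m2 := mu) measurableT (mI 0 t) (prob_lty P measurableT) (itv_lty 0 t) bF).
have bg : bmf (fun r : R => h r * exponential_pdf lam (r - a)).
  by apply: bmfM => //; exact: (bmf_comp bp (shift_measurable (- a))).
have bi : bmf (fun r : R => \1_(`[a, t]%classic : set R) r * (h r * exponential_pdf lam (r - a))).
  by apply: bmfM => //; exact: bmf_indic.
rewrite -RintZ //; [|exact: itv_lty|]; last first.
  exact: (bmf_Rint (m2 := P) measurableT (prob_lty P measurableT) (bmf_swap bF)).
transitivity (\int[mu]_(r in `[0, t]) (\1_(`[a, t]%classic : set R) r * (h r * exponential_pdf lam (r - a)))).
  rewrite Rint_indic // (_ : `[0, t]%classic `&` `[a, t]%classic = `[a, t]%classic); last first.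
    by apply/seteqP; split=> r /=; rewrite !in_itv /=; [move=> []|move=> h1; split=> //; lra].
  rewrite (Rint_shift a a t bg) subrr; apply: eq_Rintegral => r _.
  by rewrite addrK.
apply: Rint_ae => //.
- by case: bi.
- have [m _] := bmfZ lam (bmf_Rint (m2 := P) measurableT (prob_lty P measurableT) (bmf_swap bF)).
  exact: m.
(* The integrands may differ at r = a only, where one interval is closed and the other open. *)
exists [set a]; first exact: measurable_set1.
split; first exact: lebesgue_measure_set1.
move=> r; rewrite /= in_itv /= => /andP[r0 rt] ra.
have [ar|ra'] := ltP a r; last first.
  have ra2 : r < a by rewrite lt_neqAle ra' andbT; apply/eqP.
  rewrite indicE memNset ?mul0r; last by rewrite /= in_itv /=; lra.
  rewrite (_ : (fun w => _) = (fun=> 0)); first by rewrite Rint_cst // mul0r mulr0.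
  by apply/funext => w; rewrite indicE memNset ?mul0r //= => h1; lra.
rewrite indicE mem_set ?mul1r; last by rewrite /= in_itv /=; lra.
rewrite (_ : (fun w => _) = (fun w => h r * \1_[set w | r - a <= D w] w)); last first.
  apply/funext => w; rewrite mulrC; congr (_ * _); rewrite !indicE; congr (nat_of_bool _)%:R.
  by apply/idP/idP; rewrite !inE /=; lra.
have mt : measurable [set w | r - a <= D w] by exact: set_le_measurable.
rewrite (RintZ measurableT (prob_lty P measurableT) (h r) (bmf_indic R mt)).
rewrite (_ : \int[P]_w \1_[set w | r - a <= D w] w = expR (- (lam * (r - a)))).
  rewrite exponential_pdfE; last lra.
  by rewrite mulNr; ring.
rewrite -exponential_tail; last lra.
rewrite (_ : (fun w => _) = (fun w => \1_[set w | r - a <= D w] w * 1)).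
  rewrite Rint_indic //; last exact: bmf_cst.
  by rewrite Rint_cst ?mul1r ?setTI //; exact: measurableI.
by apply/funext => w; rewrite mulr1.
Qed.

End ExponentialIdentity.

(** * Arrival times and the counting process *)

Section Arrivals.
Context {R : realType} d (Om : measurableType d).
Variables (D : nat -> Om -> R) (N : R -> Om -> nat).
Hypothesis mD : forall k, measurable_fun setT (D k).
Hypothesis D0 : forall k w, 0 < D k w.
Hypothesis hN : counting_process D N.
Local Notation tau := (arrival D).

Lemma arrival0 w : tau 0 w = 0.
Proof. by rewrite /arrival big_ord0. Qed.

Lemma arrivalS k w : tau k.+1 w = tau k w + D k w.
Proof. by rewrite /arrival big_ord_recr. Qed.

Lemma arrival_lt k w : tau k w < tau k.+1 w.
Proof. by rewrite arrivalS ltrDl. Qed.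

Lemma arrival_le j k w : (j <= k)%N -> tau j w <= tau k w.
Proof.
move=> /subnKC <-; elim: (k - j)%N => [|i IH]; first by rewrite addn0.
by rewrite addnS; apply: le_trans IH _; exact/ltW/arrival_lt.
Qed.

Lemma arrival_ge0 k w : 0 <= tau k w.
Proof. by rewrite -(arrival0 w) arrival_le. Qed.

Lemma counting_eq k w t : tau k w <= t < tau k.+1 w -> N t w = k.
Proof.
move=> /andP[h1 h2]; have t0 : 0 <= t := le_trans (arrival_ge0 k w) h1.
have /andP[h3 h4] := hN w t0; apply/eqP; rewrite eqn_leq; apply/andP; split; rewrite leqNgt.
  by apply/negP => h; have := arrival_le w h; lra.
by apply/negP => h; have := arrival_le w h; lra.
Qed.

Lemma arrival_measurable k : measurable_fun setT (tau k).
Proof. by rewrite /arrival; apply: measurable_sum => i; exact: mD. Qed.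

Lemma counting_measurable t k : 0 <= t -> measurable [set w | N t w = k].
Proof.
move=> t0; rewrite (_ : mkset _ = [set w | tau k w <= t] `&` [set w | t < tau k.+1 w]).
  apply: measurableI; [apply: set_le_measurable|apply: set_lt_measurable] => //;
    exact: arrival_measurable.
apply/seteqP; split=> w /=; last by move=> [h1 h2]; apply: counting_eq; rewrite h1.
by move=> <-; have /andP[h1 h2] := hN w t0.
Qed.

Lemma arrival_unbounded w t : 0 <= t -> exists K, forall k, (K <= k)%N -> t < tau k w.
Proof.
move=> t0; have /andP[_ h] := hN w t0; exists (N t w).+1 => k hk.
exact: lt_le_trans h (arrival_le w hk).
Qed.

End Arrivals.

(** * Martingale property of a process glued from pieces at exponential times *)

Section Glue.
Context {R : realType} {n : nat} d (Om : measurableType d) (P : probability Om R).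
Local Notation V := 'rV[R]_n.
Local Notation mu := (@lebesgue_measure R).
Variables (D : nat -> Om -> R) (N : R -> Om -> nat).
Hypothesis mD : forall k, measurable_fun setT (D k).
Hypothesis D0 : forall k w, 0 < D k w.
Hypothesis hN : counting_process D N.
Local Notation tau := (arrival D).
Variables (z : nat -> R -> Om -> V) (sig : V -> V).
Hypothesis mz : forall k,
  measurable_fun setT ((fun p => z k (Num.max p.1 0) p.2) : R * Om -> borel_rV R n).
Hypothesis rz : forall k w t, tau k w <= t -> z k s w @[s --> t^'+] --> z k t w.
Hypothesis glue : forall k w, z k.+1 (tau k.+1 w) w = sig (z k (tau k.+1 w) w).
Hypothesis msig : measurable_fun setT (sig : borel_rV R n -> borel_rV R n).

(** Pieces run in absolute time. Both processes of the theorem have this form: for the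
    concatenation, piece k is the k-th path started at the k-th arrival; for the second one it is
    the k-th iterate of the reflection applied to X. *)
Definition glued (t : R) (w : Om) : V := z (N t w) t w.

Lemma glued_on k r w : tau k w <= r < tau k.+1 w -> glued r w = z k r w.
Proof. by move=> h; rewrite /glued (counting_eq D0 hN h). Qed.

Lemma piece_measurable k t : 0 <= t -> measurable_fun setT (z k t : Om -> borel_rV R n).
Proof.
move=> t0; have := measurableT_comp (mz k) (@pair1_measurable _ _ R Om t).
by rewrite (_ : _ \o _ = z k t) //; apply/funext => w /=; rewrite max_l.
Qed.

Lemma glued_measurable t : 0 <= t -> measurable_fun setT (glued t : Om -> borel_rV R n).
Proof.
move=> t0; apply: (measurable_fun_select (N := N t) (f := fun k => z k t : Om -> borel_rV R n)).
  by move=> k; exact: (counting_measurable mD D0 hN).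
by move=> k; exact: piece_measurable.
Qed.

Lemma glued_rc w t : 0 <= t -> glued s w @[s --> t^'+] --> glued t w.
Proof.
move=> t0; have /andP[h1 h2] := hN w t0.
rewrite {2}/glued; set k := N t w in h1 h2 *.
have /right_epsP h := rz h1; apply/right_epsP => e e0; have [d0 d00 hd] := h e e0.
exists (Num.min d0 (tau k.+1 w - t)); first by rewrite lt_min d00 subr_gt0.
move=> s /andP[ts]; rewrite -ltrBlDl lt_min => /andP[s1 s2].
rewrite (@glued_on k); last by lra.
by apply: hd; lra.
Qed.

Lemma piece_path_measurable k w :
  measurable_fun setT ((fun r : R => z k (Num.max r 0) w) : R -> borel_rV R n).
Proof. exact: (measurableT_comp (mz k) (@pair2_measurable _ _ R Om w)). Qed.

Lemma glued_path_measurable w :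
  measurable_fun setT ((fun r : R => glued (Num.max r 0) w) : R -> borel_rV R n).
Proof. exact: (@rc_measurable R n (glued^~ w) (@glued_rc w)). Qed.

Section Increments.
Variables s t : R.
Hypotheses (s0 : 0 <= s) (st : s <= t).
(** Clamping the arrival times to [s, t] cuts this interval into pieces, all but finitely many of
    them degenerate, and avoids distinguishing where s and t fall. *)
Definition clamp (y : R) : R := Num.max s (Num.min t y).
Local Notation c k w := (clamp (tau k w)).

Lemma clamp_itv y : s <= clamp y <= t.
Proof. by rewrite /clamp le_max lexx /= ge_max st ge_min lexx. Qed.

Lemma clamp_le x y : x <= y -> clamp x <= clamp y.
Proof. by move=> xy; rewrite /clamp; case: (ltP t x) => ?; case: (ltP t y) => ?;
  rewrite ge_max !le_max lexx //=; apply/orP; right; lra. Qed.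

Lemma clamp_measurable d' (T' : measurableType d') (f : T' -> R) :
  measurable_fun setT f -> measurable_fun setT (fun w => clamp (f w)).
Proof. by move=> mf; apply: measurable_maxr => //; exact: measurable_minr. Qed.

Lemma clamp_between k w r : c k w <= r < c k.+1 w -> tau k w <= r < tau k.+1 w.
Proof.
rewrite /clamp ge_max ge_min lt_max lt_min.
by move=> /andP[/andP[h1 /orP[h2|h2]] /orP[h3|/andP[h3 h4]]]; lra.
Qed.

Definition int_piece (F : V -> R) k w : R := \int[mu]_(r in `[c k w, c k.+1 w]) F (z k r w).

Lemma clampS k w : c k w <= c k.+1 w.
Proof. by apply: clamp_le; exact/ltW/arrival_lt. Qed.

Lemma clamp_ge0 y : 0 <= clamp y.
Proof. by have /andP[h _] := clamp_itv y; exact: le_trans h. Qed.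

Lemma int_glued (F : V -> R) k w : bmf (F : borel_rV R n -> R) ->
  \int[mu]_(r in `[c k w, c k.+1 w]) F (glued r w) = int_piece F k w.
Proof.
move=> bF; have c0 := clamp_ge0 (tau k w).
rewrite /int_piece (drift_max F (z k ^~ w) (c k.+1 w) c0).
rewrite (drift_max F (glued ^~ w) (c k.+1 w) c0).
have mI : measurable (`[c k w, c k.+1 w]%classic : set R) by [].
apply: Rint_ae; first exact: mI.
- exact: (drift_bmf (w := glued^~ w) bF (glued_path_measurable w)).1.
- exact: (drift_bmf (w := z k ^~ w) bF (piece_path_measurable k w)).1.
exists [set c k.+1 w]; first exact: measurable_set1.
split; first exact: lebesgue_measure_set1.
move=> r; rewrite /= in_itv /= => /andP[r1 r2] /eqP r3.
rewrite max_l; last exact: le_trans c0 r1.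
by rewrite (@glued_on k) //; apply: clamp_between; rewrite r1 /= lt_neqAle r3.
Qed.

Lemma piece_at_bmf (F : V -> R) k (q : Om -> R) : bmf (F : borel_rV R n -> R) ->
  measurable_fun setT q -> (forall w, 0 <= q w) -> bmf (fun w => F (z k (q w) w)).
Proof.
move=> bF mq q0; rewrite (_ : (fun w => _) = fun w => F (z k (Num.max (q w) 0) w)); last first.
  by apply/funext => w; rewrite max_l.
apply: (bmf_comp (g := (fun w => z k (Num.max (q w) 0) w) : Om -> borel_rV R n) bF).
apply: (measurableT_comp (mz k) (g := fun w => (q w, w))).
by apply: measurable_fun_pair.
Qed.

Lemma int_piece_bmf (F : V -> R) k : bmf (F : borel_rV R n -> R) -> bmf (int_piece F k).
Proof.
move=> bF; rewrite /int_piece.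
rewrite (_ : (fun w => _) = fun w => \int[mu]_(r in `[0, t])
    (\1_[set p : Om * R | c k p.1 <= p.2 <= c k.+1 p.1] (w, r) * F (z k (Num.max r 0) w))); last first.
  apply/funext => w; have /andP[_ ct] := clamp_itv (tau k.+1 w).
  rewrite (drift_indic (w := z k ^~ w) bF (piece_path_measurable k w) (clamp_ge0 _) (clampS k w) ct).
  apply: eq_Rintegral => r _; congr (_ * _); rewrite !indicE.
have mI : measurable (`[0, t]%classic : set R) by [].
have mc j : measurable_fun setT (fun p : Om * R => c j p.1).
  apply: (measurableT_comp (f := fun w => c j w)) => //.
  by apply: clamp_measurable; exact: arrival_measurable.
have mS : measurable [set p : Om * R | c k p.1 <= p.2 <= c k.+1 p.1].
  rewrite (_ : mkset _ = [set p : Om * R | c k p.1 <= p.2] `&` [set p : Om * R | p.2 <= c k.+1 p.1]).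
    by apply: measurableI; apply: set_le_measurable => //; exact: measurable_snd.
  by apply/seteqP; split=> p /= => [/andP[]|[-> ->]].
have b2 : bmf (fun p : Om * R => \1_[set p : Om * R | c k p.1 <= p.2 <= c k.+1 p.1] p
    * F (z k (Num.max p.2 0) p.1)).
  apply: bmfM; first exact: bmf_indic.
  apply: (bmf_comp (g := (fun p => z k (Num.max p.2 0) p.1) : Om * R -> borel_rV R n) bF).
  apply: (measurableT_comp (mz k) (g := fun p : Om * R => (p.2, p.1))).
  by apply: measurable_fun_pair; [exact: measurable_snd|exact: measurable_fst].
exact: (@bmf_Rint _ Om _ _ R mu _ mI (itv_lty 0 t) _ b2).
Qed.

Variables u f : V -> R.
Hypothesis bu : bmf (u : borel_rV R n -> R).
Hypothesis bf : bmf (f : borel_rV R n -> R).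
Variable lam : R.
Definition jump (x : V) : R := u (sig x) - u x.
Definition jump_gen (x : V) : R := f x + lam * jump x.

Lemma jump_bmf : bmf (jump : borel_rV R n -> R).
Proof. by apply: bmfB => //; exact: (bmf_comp bu msig). Qed.

Lemma jump_gen_bmf : bmf (jump_gen : borel_rV R n -> R).
Proof. by apply: bmfD => //; apply: bmfZ; exact: jump_bmf. Qed.

Definition motion_part k w : R :=
  u (z k (c k.+1 w) w) - u (z k (c k w) w) - int_piece f k w.
Definition jump_part k w : R :=
  \1_[set w | s < tau k.+1 w <= t] w * jump (z k (tau k.+1 w) w).

Lemma motion_bmf k : bmf (motion_part k).
Proof.
have mc j : measurable_fun setT (fun w => c j w).
  by apply: clamp_measurable; exact: arrival_measurable.
apply: bmfB; last exact: int_piece_bmf.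
by apply: bmfB; apply: piece_at_bmf => // w; exact: clamp_ge0.
Qed.

Lemma jump_part_bmf k : bmf (jump_part k).
Proof.
apply: bmfM; last first.
  apply: piece_at_bmf; [exact: jump_bmf|exact: arrival_measurable|].
  by move=> w; exact: (arrival_ge0 D0).
apply: bmf_indic.
rewrite (_ : mkset _ = [set w | s < tau k.+1 w] `&` [set w | tau k.+1 w <= t]).
  apply: measurableI; [apply: set_lt_measurable|apply: set_le_measurable] => //;
    exact: arrival_measurable.
by apply/seteqP; split=> w /= => [/andP[]|[-> ->]].
Qed.

(** On its clamped interval the glued process follows piece k up to the right end point, where it
    may already have jumped; the drift integral does not see that point. *)
Lemma glued_increment k w :
  mg u jump_gen (glued^~ w) (c k.+1 w) - mg u jump_gen (glued^~ w) (c k w) =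
  motion_part k w + (jump_part k w - lam * int_piece jump k w).
Proof.
rewrite (@mg_increment _ _ _ _ _ glued_rc u _ jump_gen_bmf w _ _ (clamp_ge0 _) (clampS k w)).
rewrite (int_glued k w jump_gen_bmf).
have -> : int_piece jump_gen k w = int_piece f k w + lam * int_piece jump k w.
  rewrite /int_piece; have c0 := clamp_ge0 (tau k w).
  have mI : measurable (`[c k w, c k.+1 w]%classic : set R) by [].
  have oo := itv_lty (c k w) (c k.+1 w).
  have pm := piece_path_measurable k w.
  rewrite (drift_max f (z k ^~ w) (c k.+1 w) c0) (drift_max jump (z k ^~ w) (c k.+1 w) c0) (drift_max jump_gen (z k ^~ w) (c k.+1 w) c0).
  have b1 := drift_bmf (w := z k ^~ w) bf pm.
  have b2 := drift_bmf (w := z k ^~ w) jump_bmf pm.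
  by rewrite -(@RintZ _ _ R mu _ mI oo lam _ b2) -(@RintD _ _ R mu _ mI oo _ _ b1 (bmfZ lam b2)).
rewrite /motion_part /jump_part.
suff e : u (glued (c k.+1 w) w) - u (glued (c k w) w) =
    u (z k (c k.+1 w) w) - u (z k (c k w) w) +
    \1_[set w | s < tau k.+1 w <= t] w * jump (z k (tau k.+1 w) w) by rewrite e; ring.
have lt1 := arrival_lt D0 k w; have lt2 := arrival_lt D0 k.+1 w.
(* On a degenerate interval the terminal jump is not in ]s, t], and both sides vanish. *)
have [ce|cl] := eqVneq (c k w) (c k.+1 w).
  rewrite ce !subrr indicE memNset ?mul0r ?addr0 //= => h.
  have h2 : c k w < tau k.+1 w by rewrite /clamp gt_max gt_min lt1 orbT andbT; lra.
  have h3 : tau k.+1 w <= c k.+1 w by rewrite /clamp le_max le_min lexx andbT; apply/orP; right; lra.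
  by rewrite ce in h2; lra.
have cl' : c k w < c k.+1 w by rewrite lt_neqAle cl clampS.
have /andP[k1 k2] : tau k w <= c k w < tau k.+1 w by apply: clamp_between; rewrite lexx.
have gk : glued (c k w) w = z k (c k w) w by apply: glued_on; rewrite k1.
rewrite gk indicE.
(* Either the piece is cut off at t before its jump, or its jump time lies in ]s, t] and the gluing
   relation applies there. *)
have [ct|ct] := ltP (c k.+1 w) (tau k.+1 w).
  have gk1 : glued (c k.+1 w) w = z k (c k.+1 w) w by apply: glued_on; rewrite ct andbT; lra.
  rewrite gk1.
  rewrite memNset ?mul0r ?addr0 //= => h.
  move: ct; rewrite /clamp (_ : Num.min t (tau k.+1 w) = tau k.+1 w); last by rewrite min_r //; lra.
  by rewrite max_r; lra.
have c1 : s < tau k.+1 w <= t.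
  by have /andP[h1 _] := clamp_itv (tau k w); have /andP[_ h2] := clamp_itv (tau k.+1 w); lra.
have -> : c k.+1 w = tau k.+1 w.
  by rewrite /clamp min_r ?max_r //; lra.
have gk1 : glued (tau k.+1 w) w = z k.+1 (tau k.+1 w) w by apply: glued_on; rewrite lexx.
by rewrite gk1 glue mem_set // mul1r /jump; ring.
Qed.

Hypothesis lam0 : 0 < lam.
Hypothesis lawD : forall k (B : set R), measurable B -> P (D k @^-1` B) = exponential_prob lam B.
Hypothesis resample : forall k, exists2 mix : Om -> Om -> Om, mixing P P mix &
  forall w w', [/\ tau k (mix w w') = tau k w, D k (mix w w') = D k w',
    forall r, z k r (mix w w') = z k r w &
    forall r, 0 <= r < tau k w -> glued r (mix w w') = glued r w].

(** The exponential identity along a frozen path, with h restricted to times after s and a. The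
    interval up to a + D is the clamped one except possibly for its left end point. *)
Lemma compensated_jump (zeta : R -> V) k (a : R) : 0 <= a ->
  measurable_fun setT ((fun r => zeta (Num.max r 0)) : R -> borel_rV R n) ->
  \int[P]_w (\1_[set y | s < y <= t] (a + D k w) * jump (zeta (a + D k w))) =
  lam * \int[P]_w \int[mu]_(r in `[clamp a, clamp (a + D k w)]) jump (zeta r).
Proof.
move=> a0 mzeta; have bj := drift_bmf jump_bmf mzeta.
have mr : measurable [set r : R | s < r /\ a < r].
  by apply: measurableI; apply: set_lt_measurable.
pose h r : R := \1_[set r : R | s < r /\ a < r] r * jump (zeta (Num.max r 0)).
have bh : bmf h by apply: bmfM => //; exact: bmf_indic.
have D0' w : 0 <= D k w by exact/ltW.
transitivity (\int[P]_w (\1_[set x | x <= t] (a + D k w) * h (a + D k w))).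
  apply: eq_Rintegral => w _; rewrite /h; have Dw := D0 k w.
  rewrite (_ : Num.max (a + D k w) 0 = a + D k w); last by rewrite max_l //; lra.
  rewrite mulrA; congr (_ * _); rewrite !indicE.
  have [h1|h1] := boolP (s < a + D k w <= t).
    have h2 : [set x | x <= t] (a + D k w) by rewrite /=; lra.
    have h3 : [set r : R | s < r /\ a < r] (a + D k w) by split; lra.
    have h4 : [set y | s < y <= t] (a + D k w) by [].
    by rewrite (mem_set h4) (mem_set h2) (mem_set h3) mulr1.
  rewrite memNset; last by apply/negP.
  have [h2|h2] := boolP (a + D k w <= t); last by rewrite memNset ?mul0r //; apply/negP.
  by rewrite [X in _ * X](_ : _ = 0) ?mulr0 // memNset //= => -[h3 _]; move: h1; rewrite h2 h3.
rewrite (exponential_identity lam0 (mD k) D0' (@lawD k) t bh a0); congr (_ * _).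
apply: eq_Rintegral => w _; have Dw := D0 k w.
have cl : clamp a <= clamp (a + D k w) by apply: clamp_le; lra.
have /andP[_ ct] := clamp_itv (a + D k w).
rewrite (drift_indic jump_bmf mzeta (clamp_ge0 _) cl ct).
have mI (p q : R) : measurable (`[p, q]%classic : set R) by [].
have mA : measurable [set r | a < r <= a + D k w].
  by rewrite (_ : mkset _ = `]a, a + D k w]%classic) //; apply/seteqP; split=> r /=; rewrite in_itv.
have bR : bmf (fun r => \1_[set r | a < r <= a + D k w] r * h r) by apply: bmfM => //; exact: bmf_indic.
have bL : bmf (fun r => \1_(`[clamp a, clamp (a + D k w)]%classic : set R) r * jump (zeta (Num.max r 0))).
  by apply: bmfM => //; exact: bmf_indic.
rewrite (_ : (fun r => \1__ (w, r) * h r) = (fun r => \1_[set r | a < r <= a + D k w] r * h r)); last first.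
  by apply/funext => r; congr (_ * _); rewrite !indicE.
apply: Rint_ae; [exact: mI|by case: bR|by case: bL|].
exists [set clamp a]; first exact: measurable_set1.
split; first exact: lebesgue_measure_set1.
move=> r; rewrite /= in_itv /= => /andP[r0 rt] /eqP r1.
have indI (A B : set R) x : \1_A x * \1_B x = \1_(A `&` B) x :> R by rewrite indicI.
rewrite /h mulrA; congr (_ * _); rewrite indI !indicE; congr (nat_of_bool _)%:R.
apply/idP/idP; rewrite !inE /= in_itv /=.
  move=> [/andP[h1 h2] [h3 h4]]; rewrite /clamp ge_max ge_min le_max le_min rt h2 orbT andbT.
  by apply/andP; split; [exact: ltW|apply/orP; right; exact: ltW].
move=> /andP[p1 p2]; have : clamp a < r by rewrite lt_neqAle eq_sym r1.
rewrite /clamp gt_max gt_min => /andP[q1 q2].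
have q3 : a < r by case/orP: q2 => // q2; lra.
move: p2; rewrite /clamp le_max le_min => /orP[p2|/andP[_ p2]]; first lra.
by rewrite q3 p2.
Qed.

Lemma jump_part_mean0 k S : natural_filtration glued s S ->
  \int[P]_(w in S) (jump_part k w - lam * int_piece jump k w) = 0.
Proof.
move=> FS; have mS := natural_filtration_measurable glued_measurable FS.
have [mix hmix hm] := resample k.
pose X w := jump_part k w - lam * int_piece jump k w.
have bX : bmf X by apply: bmfB; [exact: jump_part_bmf|exact: bmfZ (int_piece_bmf _ jump_bmf)].
have bSX : bmf (fun w => \1_S w * X w) by apply: bmfM => //; exact: bmf_indic.
rewrite -[S]setTI -(Rint_indic P setT mS bX) (Rint_image hmix bSX).
have mmix := hmix.1.
rewrite (Rint_prod P P (bmf_comp bSX mmix)).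
transitivity (\int[P]_w (0 : R)); last by rewrite Rint_cst // mul0r.
apply: eq_Rintegral => w _ /=.
have tS w' : tau k.+1 (mix w w') = tau k w + D k w'.
  by rewrite arrivalS; have [-> -> _ _] := hm w w'.
have same w1 w2 : s < tau k w + D k w1 -> s < tau k w + D k w2 -> S (mix w w1) <-> S (mix w w2).
  move=> h1 h2; apply: (gen_agree _ FS) => _ [r [B [/andP[r0 rs] mB ->]]] /=.
  suff -> : glued r (mix w w1) = glued r (mix w w2) by [].
  have [t1 _ z1 y1] := hm w w1; have [t2 _ z2 y2] := hm w w2.
  have [rt|tr] := ltP r (tau k w); first by rewrite y1 ?y2 ?r0.
  rewrite (@glued_on k r (mix w w1)); last by rewrite tS t1 tr /=; lra.
  by rewrite (@glued_on k r (mix w w2)) ?z1 ?z2 //; rewrite tS t2 tr /=; lra.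
have small w' : tau k w + D k w' <= s -> X (mix w w') = 0.
  move=> hs; have [t1 _ _ _] := hm w w'; have Dw := D0 k w'.
  rewrite /X /jump_part /int_piece tS t1 indicE memNset /=; last by rewrite tS => h; lra.
  have -> : clamp (tau k w) = s by rewrite /clamp max_l // ge_min; apply/orP; right; lra.
  have -> : clamp (tau k w + D k w') = s by rewrite /clamp max_l // ge_min hs orbT.
  by rewrite set_itv1 Rintegral_set1 mulr0 mul0r subr0.
(* The common value of the indicator of S over all waiting times with jump after s; when there is
   none, X vanishes throughout. *)
pose c0 : R := (`[< exists2 w', s < tau k w + D k w' & S (mix w w') >])%:R.
have eX w' : \1_S (mix w w') * X (mix w w') = c0 * X (mix w w').
  have [hs|hs] := leP (tau k w + D k w') s; first by rewrite small // !mulr0.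
  congr (_ * _); rewrite indicE /c0; congr (nat_of_bool _)%:R; apply/idP/idP.
    by rewrite inE => h; apply/asboolP; exists w'.
  by move=> /asboolP[w2 h1 h2]; rewrite inE; exact/(same _ _ h1 hs).
have bm : bmf (fun w' => X (mix w w')) by exact: (bmf_xsection (bmf_comp bX mmix) w).
have b1 : bmf (fun w' => jump_part k (mix w w')).
  exact: (bmf_xsection (bmf_comp (jump_part_bmf k) mmix) w).
have b2 : bmf (fun w' => int_piece jump k (mix w w')).
  exact: (bmf_xsection (bmf_comp (int_piece_bmf k jump_bmf) mmix) w).
transitivity (\int[P]_w' (c0 * X (mix w w'))); first by apply: eq_Rintegral => w' _; exact: eX.
have oo := prob_lty P measurableT.
rewrite (RintZ measurableT oo c0 bm) (RintB measurableT oo b1 (bmfZ lam b2)) (RintZ measurableT oo lam b2).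
apply/eqP; rewrite mulf_eq0 subr_eq0; apply/orP; right; apply/eqP.
have := compensated_jump (zeta := z k ^~ w) k (arrival_ge0 D0 k w) (piece_path_measurable k w).
have e1 w' : jump_part k (mix w w') =
    \1_[set y | s < y <= t] (tau k w + D k w') * jump (z k (tau k w + D k w') w).
  rewrite /jump_part tS; have [_ _ -> _] := hm w w'; congr (_ * _).
  by rewrite !indicE; congr (nat_of_bool _)%:R; apply/idP/idP; rewrite !inE /= tS.
have e2 w' : int_piece jump k (mix w w') =
    \int[mu]_(r in `[clamp (tau k w), clamp (tau k w + D k w')]) jump (z k r w).
  rewrite /int_piece tS; have [-> _ h _] := hm w w'.
  by apply: eq_Rintegral => r _; rewrite h.
by rewrite (funext e1) (funext e2).
Qed.

Hypothesis motion : forall k S, natural_filtration glued s S ->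
  \int[P]_(w in S) motion_part k w = 0.
Hypothesis cu : continuous u.

(** The contributions of the pieces telescope to the functional at the clamped K-th arrival. Each
    has mean zero on S, and the partial sums are bounded uniformly in K. *)
Lemma glued_martingale_step S : natural_filtration glued s S ->
  \int[P]_(w in S) mg u jump_gen (glued^~ w) t = \int[P]_(w in S) mg u jump_gen (glued^~ w) s.
Proof.
move=> FS; have mS := natural_filtration_measurable glued_measurable FS.
have oo := prob_lty P mS; have t0 := le_trans s0 st.
have bM r : 0 <= r -> bmf (fun w => mg u jump_gen (glued^~ w) r).
  by move=> r0; exact: (mg_bmf glued_measurable glued_rc bu jump_gen_bmf r0).
apply/eqP; rewrite -subr_eq0 -(RintB mS oo (bM t t0) (bM s s0)); apply/eqP.
pose X k w := motion_part k w + (jump_part k w - lam * int_piece jump k w).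
have bJ k : bmf (fun w => jump_part k w - lam * int_piece jump k w).
  by apply: bmfB; [exact: jump_part_bmf|exact: bmfZ (int_piece_bmf _ jump_bmf)].
have bX k : bmf (X k) by apply: bmfD; [exact: motion_bmf|exact: bJ].
have sumX K w : \sum_(k < K) X k w =
    mg u jump_gen (glued^~ w) (c K w) - mg u jump_gen (glued^~ w) s.
  elim: K => [|K IH].
    rewrite big_ord0 arrival0 (_ : clamp 0 = s) ?subrr //.
    by rewrite /clamp max_l // ge_min s0 orbT.
  by rewrite big_ord_recr /= IH /X -glued_increment; ring.
have bS K : bmf (fun w => \sum_(k < K) X k w).
  elim: K => [|K IH].
    by rewrite (_ : (fun w => _) = fun=> 0); [exact: bmf_cst|apply/funext => w; rewrite big_ord0].
  rewrite (_ : (fun w => _) = fun w => \sum_(k < K) X k w + X K w); first exact: bmfD.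
  by apply/funext => w; rewrite big_ord_recr.
have zero K : \int[P]_(w in S) (\sum_(k < K) X k w) = 0.
  elim: K => [|K IH].
    rewrite (_ : (fun w => _) = fun=> 0); first by rewrite Rint_cst // mul0r.
    by apply/funext => w; rewrite big_ord0.
  rewrite (_ : (fun w => _) = fun w => \sum_(k < K) X k w + X K w); last first.
    by apply/funext => w; rewrite big_ord_recr.
  rewrite (RintD mS oo (bS K) (bX K)) IH add0r /X.
  by rewrite (RintD mS oo (motion_bmf K) (bJ K)) motion // jump_part_mean0 // addr0.
have [_ [Cu hu]] := bu; have [_ [Cf hf]] := jump_gen_bmf.
have Cf0 : 0 <= Cf by apply: le_trans (normr_ge0 _) (hf 0).
have bd r w : 0 <= r <= t -> `|mg u jump_gen (glued^~ w) r| <= Cu + Cu + Cf * t.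
  move=> /andP[r0 rt]; apply: le_trans (mg_bound glued_rc jump_gen_bmf w hu hf r0) _.
  by rewrite lerD2l ler_wpM2l.
have cv : \int[P]_(w in S) (\sum_(k < K) X k w) @[K --> \oo] -->
    \int[P]_(w in S) (mg u jump_gen (glued^~ w) t - mg u jump_gen (glued^~ w) s).
  apply: (Rint_cvg mS oo (c := (Cu + Cu + Cf * t) + (Cu + Cu + Cf * t))).
  - by move=> K; case: (bS K).
  - move=> K w; rewrite sumX; apply: le_trans (ler_normB _ _) _; apply: lerD.
      by apply: bd; rewrite clamp_ge0 /=; have /andP[] := clamp_itv (tau K w).
    by apply: bd; rewrite s0.
  (* For a fixed outcome the arrivals eventually pass t, and the sum is then the whole increment. *)
  - move=> w; have [K hK] := arrival_unbounded D0 hN w t0.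
    apply: cvg_near_cst; exists K => // k /= /hK hk; rewrite sumX.
    rewrite (_ : c k w = t) //.
    by rewrite /clamp min_l ?max_r //; exact: ltW.
rewrite (funext zero) in cv.
by apply: (cvg_unique (@norm_hausdorff _ R^o) cv); exact: cvg_cst.
Qed.

End Increments.
End Glue.

Lemma counting_exists (R : realType) d (Om : measurableType d) (D : nat -> Om -> R) :
  (forall k w, 0 < D k w) -> (forall w c, exists k, c < arrival D k w) ->
  exists N, counting_process D N.
Proof.
move=> D0 hD; suff /choice[N hN] : forall t, exists Nt : Om -> nat, forall w, 0 <= t ->
    arrival D (Nt w) w <= t < arrival D (Nt w).+1 w by exists N.
move=> t; suff /choice[N hN] : forall w, exists k, 0 <= t ->
    arrival D k w <= t < arrival D k.+1 w by exists N.
move=> w; have hex := hD w t; have [m hm hmin] := ex_minnP hex.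
(* The first index m whose arrival is after t is the successor of the count; it is 0 only for
   negative t, as arrivals start at 0. *)
case: m hm hmin => [|k] hm hmin; first by exists 0%N => t0; move: hm; rewrite arrival0; lra.
exists k => t0; rewrite hm andbT leNgt; apply/negP => /hmin; by rewrite ltnn.
Qed.

(** * Solutions, reflections and glued paths *)

Section Solutions.
Context {R : realType} {n : nat}.
Local Notation V := 'rV[R]_n.
Variables Phi C : set V.
Local Notation E := (regular_set Phi).
Local Notation proj := (chamber_proj Phi C).
Hypothesis hPhi : root_system Phi.
Hypothesis projC : forall x, E x -> C (proj x).
Hypothesis projc : forall x, E x -> {for x, continuous proj}.
Variables (dom : set (V -> R)) (A : (V -> R) -> (V -> R)).

Lemma dom_facts u : linear_operator E dom A -> dom u ->
  [/\ continuous u, bmf (u : borel_rV R n -> R) & bmf (A u : borel_rV R n -> R)].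
Proof.
move=> hA du.
have [s1 c1 _] := dom_CKoo hA du; have [s2 c2 _] := range_CKoo hA du.
have cu : continuous u := (s1 0%N).1.
split=> //; apply: cbound_bmf; apply: compact_support_bounded => //.
exact: (s2 0%N).1.
Qed.

Lemma solution_Rint d (T : measurableType d) (P : probability T R) (Z : R -> T -> V) u s t S :
  Dpi_solution Phi C dom A P Z -> dom u -> 0 <= s -> s <= t -> natural_filtration Z s S ->
  \int[P]_(w in S) mg u (A u) (Z^~ w) t = \int[P]_(w in S) mg u (A u) (Z^~ w) s.
Proof.
move=> [_ _ h] /h[_ _ hm] s0 st FS; exact: (f_equal (@fine R) (hm s t s0 st S FS)).
Qed.

Lemma Dpi_rc w t : Dpi_path Phi C w -> 0 <= t -> w s @[s --> t^'+] --> w t.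
Proof. by move=> [_ h _ _ _]; exact: h. Qed.

Lemma solution_intro d (T : measurableType d) (P : probability T R) (Z : R -> T -> V) :
  (forall t, 0 <= t -> measurable_fun setT (Z t : T -> borel_rV R n)) ->
  (forall w, Dpi_path Phi C (Z^~ w)) ->
  (forall u, dom u -> [/\ bmf (u : borel_rV R n -> R), bmf (A u : borel_rV R n -> R) &
    forall s t S, 0 <= s -> s <= t -> natural_filtration Z s S ->
    \int[P]_(w in S) mg u (A u) (Z^~ w) t = \int[P]_(w in S) mg u (A u) (Z^~ w) s]) ->
  Dpi_solution Phi C dom A P Z.
Proof.
move=> mZ DZ hm; split; [exact: mZ|exact: DZ|move=> u /hm[bu bf hid]].
have rZ w t : 0 <= t -> Z s w @[s --> t^'+] --> Z t w by move=> t0; exact: (Dpi_rc (DZ w) t0).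
have bM t : 0 <= t -> bmf (fun w => mg u (A u) (Z^~ w) t) by exact: mg_bmf.
split.
- by move=> t t0 B mB; exact: (mg_adapted rZ bu bf t0 mB).
- by move=> t t0; exact: (bmf_integrable measurableT (prob_lty P measurableT) (bM t t0)).
- move=> s t s0 st S FS; have mS := natural_filtration_measurable mZ FS.
  have oo := prob_lty P mS.
  have e1 := Rint_EFin mS oo (bM t (le_trans s0 st)).
  have e2 := Rint_EFin mS oo (bM s s0).
  exact: (etrans e1 (etrans (f_equal EFin (hid s t S s0 st FS)) (esym e2))).
Qed.

Variable a : V.
Hypothesis ha : Phi a.

Lemma reflection_Dpi w : Dpi_path Phi C w -> Dpi_path Phi C (fun t => reflection a (w t)).
Proof.
move=> /(Dpi_char projC projc)[h1 h2 h3]; apply/(Dpi_char projC projc).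
have cr := @reflection_continuous R n a; split.
- by move=> t /h1 Et; exact: reg_refl.
- move=> t /h2 /rlimP rt; apply/rlimP; apply: (cvg_comp w (reflection a) rt); exact: cr.
- move=> t t0; have [l [El ll pl]] := h3 t t0; exists (reflection a l); split.
  + exact: reg_refl.
  + apply/llimP => //; move/(llimP _ _ t0) in ll.
    apply: (cvg_comp w (reflection a) ll); exact: cr.
  + by rewrite !(proj_refl C hPhi).
Qed.

Lemma iter_reflection_Dpi k w : Dpi_path Phi C w ->
  Dpi_path Phi C (fun t => iter k (reflection a) (w t)).
Proof. by move=> hw; elim: k => // k IH; exact: (reflection_Dpi IH). Qed.

Section GluedPath.
Context d (Om : measurableType d).
Variables (D : nat -> Om -> R) (N : R -> Om -> nat) (z : nat -> R -> Om -> V).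
Hypothesis D0 : forall k w, 0 < D k w.
Hypothesis hN : counting_process D N.
Local Notation tau := (arrival D).
Hypothesis rz : forall k w t, tau k w <= t -> z k s w @[s --> t^'+] --> z k t w.
Hypothesis zE : forall k w t, tau k w <= t -> E (z k t w).
Hypothesis zl : forall k w t, tau k w < t ->
  exists l, [/\ E l, llim (z k ^~ w) t l & proj l = proj (z k t w)].
Hypothesis glue : forall k w, z k.+1 (tau k.+1 w) w = reflection a (z k (tau k.+1 w) w).

(** Only jump times matter: there the left limit comes from the preceding piece, and the new value
    is the reflection of where that piece arrives, so the projections agree. *)
Lemma glued_Dpi w : Dpi_path Phi C ((glued N z)^~ w).
Proof.
apply/(Dpi_char projC projc); split.
- by move=> t t0; rewrite /glued; apply: zE; have /andP[] := hN w t0.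
- by move=> t t0; apply/rlimP; exact: (glued_rc D0 hN rz).
- move=> t t0; have /andP[h1 h2] := hN w (ltW t0).
  set k := N t w in h1 h2; have gt : glued N z t w = z k t w by [].
  rewrite gt; move: h1; rewrite le_eqVlt => /orP[/eqP e|h1].
    case: k e h2 {gt} => [|k] e h2; first by move: e; rewrite arrival0 => e; lra.
    have kt : tau k w < t by rewrite -e; exact: arrival_lt.
    have [l [El ll pl]] := zl kt; exists l; split=> //; last first.
      by rewrite pl -e glue (proj_refl C hPhi).
    move=> eps e0; have [d0 d00 hd] := ll eps e0.
    exists (Num.min d0 (t - tau k w)); first by rewrite lt_min d00 subr_gt0.
    move=> s s0 /andP[]; rewrite ltrBlDr -ltrBlDl lt_min => /andP[s1 s2] s3.
    rewrite (glued_on D0 hN z (k := k)); last by rewrite e s3 andbT; lra.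
    by apply: hd => //; lra.
  have [l [El ll pl]] := zl h1; exists l; split=> //.
  move=> eps e0; have [d0 d00 hd] := ll eps e0.
  exists (Num.min d0 (t - tau k w)); first by rewrite lt_min d00 subr_gt0.
  move=> s s0 /andP[]; rewrite ltrBlDr -ltrBlDl lt_min => /andP[s1 s2] s3.
  rewrite (glued_on D0 hN z (k := k)); last by lra.
  by apply: hd => //; lra.
Qed.

End GluedPath.
End Solutions.

Lemma preimage_sigma_algebra T T' (F : set (set T)) (f : T' -> T) :
  sigma_algebra setT F -> sigma_algebra setT [set S | exists2 B, F B & S = f @^-1` B].
Proof.
move=> [F0 FC FU]; split.
- by exists set0; rewrite ?preimage_set0.
- move=> _ [B FB ->]; exists (setT `\` B); first exact: FC.
  by rewrite !setTD preimage_setC.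
- move=> S hS; have /choice[B hB] : forall i, exists B, F B /\ S i = f @^-1` B.
    by move=> i; have [B h1 h2] := hS i; exists B.
  exists (\bigcup_i B i); first by apply: FU => i; case: (hB i).
  by rewrite preimage_bigcup; apply: eq_bigcupr => i _; case: (hB i).
Qed.

Lemma gen_sigma_algebra T (G : set (set T)) : sigma_algebra setT <<s G >>.
Proof. exact: smallest_sigma_algebra. Qed.

Lemma Rint_prob d (T : measurableType d) (R : realType) (P : probability T R) S :
  measurable S -> \int[P]_w \1_S w = fine (P S).
Proof.
move=> mS; rewrite (_ : (fun w => _) = (fun w => \1_S w * 1)); last first.
  by apply/funext => w; rewrite mulr1.
rewrite (Rint_indic P setT mS (bmf_cst T 1)) setTI.
by rewrite Rint_cst ?mul1r.
Qed.

Lemma Rint_prob_cst d (T : measurableType d) (R : realType) (P : probability T R) (c : R) :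
  \int[P]_w c = c.
Proof. by rewrite Rint_cst // (f_equal (@fine R) (probability_setT P)) mulr1. Qed.

Lemma mixing_Rint0 d (Om : measurableType d) (R : realType) (P : probability Om R)
    (mix : Om -> Om -> Om) (S N : set Om) (g : Om -> R) :
  mixing P P mix -> measurable S -> bmf g -> null P N ->
  (forall w, ~ N w -> \int[P]_w' (\1_S (mix w w') * g (mix w w')) = 0) ->
  \int[P]_(w in S) g w = 0.
Proof.
move=> hmix mS bg [mN N0] h; have bS : bmf (fun w => \1_S w * g w) by apply: bmfM => //; exact: bmf_indic.
have bm := bmf_comp bS hmix.1.
rewrite -[S]setTI -(Rint_indic P setT mS bg) (Rint_image hmix bS) (Rint_prod P P bm).
transitivity (\int[P]_w (0 : R)); last by rewrite Rint_cst // mul0r.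
apply: Rint_ae; [exact: measurableT| |exact: measurable_cst|].
  exact: (bmf_Rint (m2 := P) measurableT (prob_lty P measurableT) bm).1.
by exists N => //; split=> // w _ /h.
Qed.

(** Disintegration over a constant conditioning variable, applied to the code of a vector. *)
Lemma uniform_sampler (R : realType) n (U : probability R R) (nu : probability (borel_rV R n) R) :
  uniform01 U -> exists2 phi : R -> borel_rV R n, measurable_fun setT phi & has_image U nu phi.
Proof.
move=> hU; pose xi (x : borel_rV R n) : R := vencode (fun _ _ => x).
have mxi : measurable_fun setT xi by apply: vencode_measurable => i k; exact: measurable_id.
have xi01 x : 0 <= xi x <= 1 by exact: encode_itv.
have mc : measurable_fun setT (fun _ : borel_rV R n => 0 : R) by exact: measurable_cst.
have [Q hQ] := image_prob nu mc.
have hG : has_image nu Q (fun _ => 0 : R) by split=> // B mB; rewrite hQ.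
have [F mF hF] := disintegration hG mxi xi01 hU.
pose phi v : borel_rV R n := vdecode (F (0, v)) 0 0.
have mphi : measurable_fun setT phi.
  apply: (measurableT_comp (vdecode_measurable 0 0)).
  by apply: (measurableT_comp mF); exact: pair1_measurable.
exists phi => //; split=> // B mB.
have mz : measurable_fun setT (fun z : R * R => (z.1, F z)).
  by apply: measurable_fun_pair => //; exact: measurable_fst.
have mx : measurable_fun setT (fun x : borel_rV R n => (0 : R, xi x)).
  by apply: measurable_fun_pair.
pose g (z : R * R) : R := \1_B (vdecode z.2 0 0 : borel_rV R n).
have bg : bmf g.
  apply: (bmf_comp (f := \1_B) (g := (fun z : R * R => vdecode z.2 0 0) : _ -> borel_rV R n)).
    exact: bmf_indic.
  exact: (measurableT_comp (vdecode_measurable 0 0) measurable_snd).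
have e1 := joint_law_image mz mx hF bg.
rewrite (Rint_prod Q U (bmf_comp bg mz)) in e1.
have b1 : bmf (fun x => \int[U]_v g (x, F (x, v))).
  exact: (bmf_Rint (m2 := U) measurableT (prob_lty U measurableT) (bmf_comp bg mz)).
rewrite (Rint_image hG b1) /= Rint_prob_cst in e1.
have mPB : measurable (phi @^-1` B) by exact: fun_preimage_measurable.
have e2 : \int[U]_v g (0, F (0, v)) = fine (U (phi @^-1` B)).
  by rewrite -Rint_prob.
have e3 : \int[nu]_x g (0, xi x) = fine (nu B).
  rewrite -Rint_prob //; apply: eq_Rintegral => x _.
  by rewrite /g /xi /= vencodeK.
rewrite e2 e3 in e1.
by rewrite -[LHS]fineK ?e1 ?fineK //; exact: prob_fin.
Qed.

Lemma regular_sampler (R : realType) n (Phi : set 'rV[R]_n) (U : probability R R)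
    (nu : probability (borel_rV R n) R) (p0 : 'rV[R]_n) :
  root_system Phi -> uniform01 U -> nu (regular_set Phi) = 1%E -> regular_set Phi p0 ->
  exists2 phi : R -> borel_rV R n, has_image U nu phi & forall v, regular_set Phi (phi v).
Proof.
move=> hPhi hU nuE Ep0; have [phi mphi [_ hphi]] := uniform_sampler nu hU.
have mE : measurable (regular_set Phi : set (borel_rV R n)) by apply: borel_open; exact: open_regular.
pose psi v : borel_rV R n := if `[< regular_set Phi (phi v) >] then phi v else p0.
have mpsi : measurable_fun setT psi.
  apply: (measurable_fun_if_set (A := phi @^-1` regular_set Phi) (f := phi) (g := (fun=> p0) : _ -> borel_rV R n)) => //.
  exact: fun_preimage_measurable.
exists psi; last by move=> v; rewrite /psi; case: asboolP.
split=> // B mB; rewrite -hphi //.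
have nN : null U (~` (phi @^-1` regular_set Phi)).
  have m1 : measurable (phi @^-1` regular_set Phi) by exact: fun_preimage_measurable.
  split; first exact: measurableC.
  have h : (U (~` (phi @^-1` regular_set Phi)) = 1 - U (phi @^-1` regular_set Phi))%E.
    exact: probability_setC.
  by rewrite hphi // nuE subee in h.
apply: (measure_eq_off_null nN).
- exact: fun_preimage_measurable.
- exact: fun_preimage_measurable.
- by move=> v /contrapT hv; rewrite /preimage /= /psi asboolT.
Qed.

(** * Construction of the concatenation from the uniform sequence *)

Section Construction.
Context {R : realType} {n : nat}.
Local Notation V := 'rV[R]_n.
Local Notation mu := (@lebesgue_measure R).
Variables Phi C : set V.
Local Notation E := (regular_set Phi).
Local Notation proj := (chamber_proj Phi C).
Hypothesis hPhi : root_system Phi.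
Hypothesis projC : forall x, E x -> C (proj x).
Hypothesis projc : forall x, E x -> {for x, continuous proj}.
Variables (p0 a : V) (lam : R).
Hypotheses (Ep0 : E p0) (ha : Phi a) (lam0 : 0 < lam).
Variables (dom : set (V -> R)) (A : (V -> R) -> (V -> R)).
Hypothesis hA : linear_operator E dom A.
Variable U : probability R R.
Hypothesis hU : uniform01 U.
Context d (Om : measurableType d) (P : probability Om R).
Variables (W : nat -> Om -> R) (mixf : pred nat -> Om -> Om -> Om).
Hypothesis hW : forall i, has_image P U (W i).
Hypothesis hmix : forall K, eventually_const K -> mixing P P (mixf K).
Hypothesis Wmix : forall K, eventually_const K -> forall w w' i,
  W i (mixf K w w') = if K i then W i w else W i w'.
Hypothesis divW : forall w c, exists k, c < \sum_(i < k) expo lam (W i.*2.+1 w).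
Variable x0 : Om -> borel_rV R n.
Hypotheses (mx0 : measurable_fun setT x0) (Ex0 : forall w, E (x0 w)).
Hypothesis x0_dep : forall w w', W 0 w' = W 0 w -> x0 w' = x0 w.

(** The null set may depend on u. This suffices, as each martingale property involves a single u and
    the domain need not be countable. *)
Definition kernel_prop (x : Om -> borel_rV R n) (F : borel_rV R n * R -> R) : Prop :=
  measurable_fun setT F /\ forall u, dom u -> exists2 N, null P N & forall w, ~ N w ->
    forall s t S, 0 <= s -> s <= t ->
    natural_filtration (fun r v => start_path Phi C p0 (x w) (F (x w, v)) r) s S ->
    \int[U]_(v in S) mg u (A u) (start_path Phi C p0 (x w) (F (x w, v))) t =
    \int[U]_(v in S) mg u (A u) (start_path Phi C p0 (x w) (F (x w, v))) s.

Variable Kf : (Om -> borel_rV R n) -> (borel_rV R n * R -> R).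
Hypothesis hKf : forall x : Om -> borel_rV R n, measurable_fun setT x -> (forall w, E (x w)) -> kernel_prop x (Kf x).

Definition wait k w : R := expo lam (W k.*2.+1 w).
Local Notation tau := (arrival wait).

(** The kernel of each cycle is the one chosen for its own random starting point. The next start is
    the reflected end point for every outcome, not only almost surely. *)
Fixpoint origin k : Om -> borel_rV R n :=
  if k is k'.+1 then fun w => reflection a
    (start_path Phi C p0 (origin k' w) (Kf (origin k') (origin k' w, W k'.*2.+2 w)) (wait k' w))
  else x0.

Definition cycle_proc k (t : R) w : V :=
  start_path Phi C p0 (origin k w) (Kf (origin k) (origin k w, W k.*2.+2 w)) (Num.max t 0).

Lemma wait_gt0 k w : 0 < wait k w.
Proof. exact: expo_gt0. Qed.

Lemma wait_measurable k : measurable_fun setT (wait k).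
Proof. by apply: (measurableT_comp (@expo_measurable R lam)); case: (hW k.*2.+1). Qed.

Lemma originS k w : origin k.+1 w = reflection a (cycle_proc k (wait k w) w).
Proof. by rewrite /cycle_proc max_l //; exact/ltW/wait_gt0. Qed.

Lemma start_joint d' (T' : measurableType d') (x : T' -> borel_rV R n) (v : T' -> R)
    (F : borel_rV R n * R -> R) :
  measurable_fun setT x -> measurable_fun setT v -> measurable_fun setT F ->
  measurable_fun setT ((fun p : R * T' =>
    start_path Phi C p0 (x p.2) (F (x p.2, v p.2)) (Num.max p.1 0)) : _ -> borel_rV R n).
Proof.
move=> mx mv mF.
have m1 : measurable_fun setT (fun w => (x w, F (x w, v w)) : borel_rV R n * R).
  apply: measurable_fun_pair => //; apply: (measurableT_comp mF).
  by apply: measurable_fun_pair.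
apply: (@joint_measurable R n _ T' (fun t w => start_path Phi C p0 (x w) (F (x w, v w)) t)).
  move=> t t0; exact: (measurableT_comp (start_measurable hPhi projc p0 t0) m1).
by move=> w t t0; exact: (start_rc projC projc Ep0).
Qed.

Lemma path_joint (x : Om -> borel_rV R n) (F : borel_rV R n * R -> R) i :
  measurable_fun setT x -> measurable_fun setT F ->
  measurable_fun setT ((fun p : R * Om =>
    start_path Phi C p0 (x p.2) (F (x p.2, W i p.2)) (Num.max p.1 0)) : _ -> borel_rV R n).
Proof. by move=> mx mF; have [mW _] := hW i; exact: (start_joint mx mW mF). Qed.

Lemma origin_ok k : measurable_fun setT (origin k) /\ forall w, E (origin k w).
Proof.
elim: k => [|k [mk Ek]]; first by split; [exact: mx0|exact: Ex0].
have [mF _] := hKf mk Ek.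
have mw : measurable_fun setT (fun w => (wait k w, w)).
  by apply: measurable_fun_pair; [exact: wait_measurable|exact: measurable_id].
have mc : measurable_fun setT ((fun w => cycle_proc k (wait k w) w) : Om -> borel_rV R n).
  exact: (measurableT_comp (path_joint k.*2.+2 mk mF) mw).
split.
  rewrite (funext (originS k)).
  have mr : measurable_fun setT (reflection a : borel_rV R n -> borel_rV R n).
    by apply: continuous_borelV; exact: reflection_continuous.
  exact: (measurableT_comp mr mc).
move=> w; rewrite originS; apply: (reg_refl hPhi ha).
have [h _ _ _ _] := start_Dpi projC projc Ep0 (Kf (origin k) (origin k w, W k.*2.+2 w)) (Ek w).
by apply: h; rewrite le_max lexx orbT.
Qed.

Lemma origin_measurable k : measurable_fun setT (origin k).
Proof. by case: (origin_ok k). Qed.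

Lemma origin_reg k w : E (origin k w).
Proof. by case: (origin_ok k). Qed.

Lemma kernelP k : kernel_prop (origin k) (Kf (origin k)).
Proof. by apply: hKf; [exact: origin_measurable|exact: origin_reg]. Qed.

Lemma cycle_start k t w : 0 <= t -> cycle_proc k t w =
  start_path Phi C p0 (origin k w) (Kf (origin k) (origin k w, W k.*2.+2 w)) t.
Proof. by move=> t0; rewrite /cycle_proc max_l. Qed.

Lemma cycle_joint k : measurable_fun setT ((fun p : R * Om => cycle_proc k p.1 p.2) : _ -> borel_rV R n).
Proof. by apply: path_joint; [exact: origin_measurable|case: (kernelP k)]. Qed.

Lemma cycle_measurable k t : measurable_fun setT (cycle_proc k t : Om -> borel_rV R n).
Proof.
have := measurableT_comp (cycle_joint k) (@pair1_measurable _ _ R Om t).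
by rewrite (_ : _ \o _ = cycle_proc k t).
Qed.

Lemma cycle0 k w : cycle_proc k 0 w = origin k w.
Proof. by rewrite cycle_start // start_path0. Qed.

Lemma cycle_Dpi k w : Dpi_path Phi C (cycle_proc k ^~ w).
Proof.
have := start_Dpi projC projc Ep0 (Kf (origin k) (origin k w, W k.*2.+2 w)) (@origin_reg k w).
have := @cycle_start k ^~ w; set v := start_path _ _ _ _ _ => cs.
move=> /(Dpi_char projC projc)[h1 h2 h3]; apply/(Dpi_char projC projc); split.
- by move=> t t0; rewrite (cs t t0); exact: h1.
- move=> t t0 e e0; have [d0 d00 hd] := h2 t t0 e e0; exists d0; [exact: d00|move=> s ts].
  have s0 : 0 <= s by lra.
  by rewrite (cs t t0) (cs s s0); exact: hd.
- move=> t t0; have [l [El ll pl]] := h3 t t0; exists l; split.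
  + exact: El.
  + move=> e e0; have [d0 d00 hd] := ll e e0; exists d0; [exact: d00|move=> s s0 ts].
    by rewrite (cs s s0); exact: hd.
  + by rewrite (cs t (ltW t0)).
Qed.

Lemma cycle_rc k w t : 0 <= t -> cycle_proc k s w @[s --> t^'+] --> cycle_proc k t w.
Proof. by move=> t0; have [_ h _ _ _] := cycle_Dpi k w; exact: h. Qed.

(** The k-th start uses neither the k-th waiting time nor the variable driving the k-th path. The
    independence claims rest on this bookkeeping. *)
Lemma origin_dep k w w' : (forall i, (i <= k.*2)%N -> W i w' = W i w) ->
  origin k w' = origin k w.
Proof.
elim: k => [|k IH] h; first exact: x0_dep (h 0%N _).
have e : origin k w' = origin k w by apply: IH => i ik; apply: h; lia.
rewrite /= e /wait !h //; lia.
Qed.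

Lemma cycle_dep k t w w' : (forall i, (i <= k.*2)%N -> W i w' = W i w) ->
  W k.*2.+2 w' = W k.*2.+2 w -> cycle_proc k t w' = cycle_proc k t w.
Proof. by move=> h1 h2; rewrite /cycle_proc (origin_dep h1) h2. Qed.

Lemma arrival_dep k w w' : (forall i, (i < k)%N -> W i.*2.+1 w' = W i.*2.+1 w) ->
  tau k w' = tau k w.
Proof. by move=> h; apply: eq_bigr => i _; rewrite /wait h. Qed.

Definition but (j : nat) : pred nat := fun i => i != j.

Lemma but_eventually j : eventually_const (but j).
Proof. by exists j.+1 => i ij; rewrite /but !gtn_eqF. Qed.

Lemma but_mix j w w' i : i != j -> W i (mixf (but j) w w') = W i w.
Proof. by move=> ij; rewrite Wmix ?/but ?ij //; exact: but_eventually. Qed.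

Lemma but_mix_at j w w' : W j (mixf (but j) w w') = W j w'.
Proof. by rewrite Wmix ?/but ?eqxx //; exact: but_eventually. Qed.

(* Conditionally on everything but W k.*2.+2, the k-th cycle_proc is a path of the
   kernel started at its origin. *)
Definition fiber k w (v : R) : R -> V :=
  start_path Phi C p0 (origin k w) (Kf (origin k) (origin k w, v)).

Lemma cycle_mix k w w' t : 0 <= t ->
  cycle_proc k t (mixf (but k.*2.+2) w w') = fiber k w (W k.*2.+2 w') t.
Proof.
move=> t0; rewrite cycle_start // /fiber but_mix_at.
by rewrite (@origin_dep k w) // => i ik; apply: but_mix; lia.
Qed.

Lemma fiber_measurable k w t : 0 <= t ->
  measurable_fun setT ((fun v => fiber k w v t) : R -> borel_rV R n).
Proof.
move=> t0; have [mF _] := kernelP k.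
have m1 : measurable_fun setT (fun v => (origin k w, Kf (origin k) (origin k w, v)) : borel_rV R n * R).
  apply: measurable_fun_pair; first exact: measurable_cst.
  by apply: (measurableT_comp mF); exact: pair1_measurable.
exact: (measurableT_comp (start_measurable hPhi projc p0 t0) m1).
Qed.

Lemma fiber_rc k w v t : 0 <= t -> fiber k w v s @[s --> t^'+] --> fiber k w v t.
Proof. by move=> t0; exact: (start_rc projC projc Ep0). Qed.

Lemma fiber_martingale k u : dom u -> exists2 N, null P N & forall w, ~ N w ->
  forall s t S, 0 <= s -> s <= t -> natural_filtration (fun r v => fiber k w v r) s S ->
  \int[P]_w' (\1_(W k.*2.+2 @^-1` S) w' *
    (mg u (A u) (fiber k w (W k.*2.+2 w')) t - mg u (A u) (fiber k w (W k.*2.+2 w')) s)) = 0.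
Proof.
move=> du; have [_ /(_ u du)[N nN hN]] := kernelP k; have [cu bu bf] := dom_facts hA du.
exists N => // w /hN {}hN s t S s0 st FS.
have mS := natural_filtration_measurable (fiber_measurable k w) FS.
have bM r : 0 <= r -> bmf (fun v => mg u (A u) (fiber k w v) r).
  by move=> r0; exact: (mg_bmf (fiber_measurable k w) (@fiber_rc k w) bu bf r0).
have bX := bmfB (bM t (le_trans s0 st)) (bM s s0).
have bSX : bmf (fun v => \1_S v * (mg u (A u) (fiber k w v) t - mg u (A u) (fiber k w v) s)).
  by apply: bmfM => //; exact: bmf_indic.
transitivity (\int[U]_v (\1_S v * (mg u (A u) (fiber k w v) t - mg u (A u) (fiber k w v) s))).
  by rewrite (Rint_image (hW k.*2.+2) bSX).
rewrite (Rint_indic U setT mS bX) setTI.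
rewrite (RintB mS (prob_lty U mS) (bM t (le_trans s0 st)) (bM s s0)).
by rewrite (hN s t S s0 st FS) subrr.
Qed.

(** Redraw only the variable driving the k-th path: for almost every choice of the others the cycle
    is a path of the kernel, and an event of its past is an event of the past of the fiber. *)
Lemma cycle_solution k : Dpi_solution Phi C dom A P (cycle_proc k).
Proof.
apply: solution_intro; [by move=> t _; exact: cycle_measurable|exact: cycle_Dpi|].
move=> u du; have [cu bu bf] := dom_facts hA du; split; [exact: bu|exact: bf|move=> s t S s0 st FS].
have mC t' : 0 <= t' -> measurable_fun setT (cycle_proc k t' : Om -> borel_rV R n).
  by move=> _; exact: cycle_measurable.
have mS := natural_filtration_measurable mC FS.
have bM r : 0 <= r -> bmf (fun w => mg u (A u) (cycle_proc k ^~ w) r).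
  by move=> r0; exact: (mg_bmf mC (@cycle_rc k) bu bf r0).
apply/eqP; rewrite -subr_eq0 -(RintB mS (prob_lty P mS) (bM t (le_trans s0 st)) (bM s s0)); apply/eqP.
have [N nN hN] := fiber_martingale k du.
apply: (mixing_Rint0 (hmix (but_eventually k.*2.+2)) mS _ nN).
  exact: (bmfB (bM t (le_trans s0 st)) (bM s s0)).
move=> w /hN {}hN.
have [B FB eB] : [set S' | exists2 B, natural_filtration (fun r v => fiber k w v r) s B &
    S' = W k.*2.+2 @^-1` B] ((fun w' => mixf (but k.*2.+2) w w') @^-1` S).
  apply: (gen_preimage _ _ FS); first by apply: preimage_sigma_algebra; exact: gen_sigma_algebra.
  move=> _ [r [B [/andP[r0 rs] mB ->]]].
  exists ((fun v => fiber k w v r) @^-1` B).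
    by apply: sub_sigma_algebra; exists r, B; rewrite r0.
  by apply/seteqP; split=> w' /=; rewrite cycle_mix.
etransitivity; last exact: (hN s t B s0 st FB).
apply: eq_Rintegral => w' _.
have em r : 0 <= r -> mg u (A u) (cycle_proc k ^~ (mixf (but k.*2.+2) w w')) r =
    mg u (A u) (fiber k w (W k.*2.+2 w')) r.
  by apply: mg_eq_path => q q0; exact: cycle_mix.
have e1 : \1_S (mixf (but k.*2.+2) w w') = \1_(W k.*2.+2 @^-1` B) w' :> R.
  by rewrite -eB !indicE.
by rewrite (em t (le_trans s0 st)) (em s s0) e1.
Qed.

Lemma wait_law k (B : set R) : measurable B -> P (wait k @^-1` B) = exponential_prob lam B.
Proof.
move=> mB; have [_ h] := hW k.*2.+1; rewrite -(expo_law hU lam0 mB) -h //.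
exact: (fun_preimage_measurable (@expo_measurable R lam) mB).
Qed.

Variable N : R -> Om -> nat.
Hypothesis hN : counting_process wait N.

Definition piece k (t : R) w : V := cycle_proc k (t - tau k w) w.

Let tauS k w : tau k.+1 w = tau k w + wait k w.
Proof. exact: arrivalS. Qed.

Let tau_measurable k : measurable_fun setT (tau k).
Proof. by apply: arrival_measurable => j; exact: wait_measurable. Qed.

Lemma piece_joint k :
  measurable_fun setT ((fun p => piece k (Num.max p.1 0) p.2) : R * Om -> borel_rV R n).
Proof.
apply: (measurableT_comp (cycle_joint k) (g := fun p : R * Om => (Num.max p.1 0 - tau k p.2, p.2))).
apply: measurable_fun_pair; last exact: measurable_snd.
apply: measurable_funB; first by apply: measurable_maxr => //; exact: measurable_fst.
exact: (measurableT_comp (tau_measurable k) measurable_snd).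
Qed.

Lemma piece_rc k w t : tau k w <= t -> piece k s w @[s --> t^'+] --> piece k t w.
Proof.
move=> h; have h0 : 0 <= t - tau k w by rewrite subr_ge0.
have /rlimP hr := @cycle_rc k w _ h0; apply/rlimP => e e0.
have [d0 d00 hd] := hr e e0; exists d0; [exact: d00|move=> s ts].
by apply: hd; lra.
Qed.

Lemma piece_glue k w : piece k.+1 (tau k.+1 w) w = reflection a (piece k (tau k.+1 w) w).
Proof.
by rewrite /piece subrr cycle0 originS tauS [tau k w + _]addrC addrK.
Qed.

Lemma piece_reg k w t : tau k w <= t -> E (piece k t w).
Proof.
move=> h; have [hE _ _ _ _] := cycle_Dpi k w; apply: hE.
by rewrite subr_ge0.
Qed.

Lemma piece_left k w t : tau k w < t ->
  exists l, [/\ E l, llim (piece k ^~ w) t l & proj l = proj (piece k t w)].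
Proof.
move=> h; have /(Dpi_char projC projc)[_ _ h3] := cycle_Dpi k w.
have t0 : 0 < t - tau k w by rewrite subr_gt0.
have [l [El ll pl]] := h3 _ t0; exists l; split; [exact: El| |exact: pl].
move=> e e0; have [d0 d00 hd] := ll e e0.
exists (Num.min d0 (t - tau k w)); first by rewrite lt_min d00.
move=> s s0 /andP[]; rewrite ltrBlDr -ltrBlDl lt_min => /andP[s1 s2] s3.
by apply: hd; lra.
Qed.

Local Notation Y := (glued N piece).

Lemma concat_Dpi w : Dpi_path Phi C (Y ^~ w).
Proof.
apply: (glued_Dpi hPhi projC projc ha _ hN).
- exact: wait_gt0.
- exact: piece_rc.
- exact: piece_reg.
- exact: piece_left.
- exact: piece_glue.
Qed.

Lemma concat_measurable t : 0 <= t -> measurable_fun setT (Y t : Om -> borel_rV R n).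
Proof.
move=> t0; apply: (glued_measurable wait_measurable wait_gt0 hN piece_joint t0).
Qed.

(** Before the k-th arrival only cycles of index below k are visible, and they use coordinates of
    index at most 2k. *)
Lemma concat_eq k r w w' : 0 <= r < tau k w ->
  (forall i, (i < k.*2.+1)%N -> W i w' = W i w) -> Y r w' = Y r w.
Proof.
move=> /andP[r0 rk] hw; have /andP[h1 h2] := hN w r0; set j := N r w in h1 h2.
have jk : (j < k)%N.
  rewrite ltnNge; apply/negP => kj; have := arrival_le wait_gt0 w kj; lra.
have tj i : (i <= k)%N -> tau i w' = tau i w.
  by move=> ik; apply: arrival_dep => i' i'i; apply: hw; lia.
have e : Y r w' = piece j r w'.
  by apply: (glued_on wait_gt0 hN); rewrite (tj j (ltnW jk)) (tj j.+1 jk) h1.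
rewrite e /glued -/j /piece (tj j (ltnW jk)); apply: cycle_dep.
  by move=> i ij; apply: hw; lia.
by apply: hw; lia.
Qed.

Lemma concat_resample k : exists2 mix : Om -> Om -> Om, mixing P P mix &
  forall w w', [/\ tau k (mix w w') = tau k w, wait k (mix w w') = wait k w',
    forall r, piece k r (mix w w') = piece k r w &
    forall r, 0 <= r < tau k w -> Y r (mix w w') = Y r w].
Proof.
exists (mixf (but k.*2.+1)); first exact: (hmix (but_eventually _)).
move=> w w'; have te : tau k (mixf (but k.*2.+1) w w') = tau k w.
  by apply: arrival_dep => i ik; apply: but_mix; lia.
split.
- exact: te.
- by rewrite /wait but_mix_at.
- move=> r; rewrite /piece te; apply: cycle_dep => [i ik|]; apply: but_mix; lia.
- by move=> r hr; apply: (concat_eq hr) => i ik; apply: but_mix; lia.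
Qed.

(** * The motion inside a cycle has mean zero on events of the past *)

Section Motion.
Variables (s t : R) (k : nat) (w : Om).
Hypotheses (s0 : 0 <= s) (st : s <= t).
Local Notation mix := (mixf (but k.*2.+2) w).
Local Notation c j := (clamp s t (tau j w)).

Let tau_mix j w' : tau j (mix w') = tau j w.
Proof. by apply: arrival_dep => i ij; apply: but_mix; lia. Qed.

(** With all but the driving variable frozen, the clamped arrivals are numbers; shifting time by the
    k-th arrival turns the contribution into an increment of the functional of the fiber. *)
Lemma motion_part_mix u w' : bmf (A u : borel_rV R n -> R) ->
  c k < c k.+1 ->
  motion_part wait piece s t u (A u) k (mix w') =
  mg u (A u) (fiber k w (W k.*2.+2 w')) (c k.+1 - tau k w) -
  mg u (A u) (fiber k w (W k.*2.+2 w')) (c k - tau k w).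
Proof.
move=> bf cl; have /andP[k1 _] : tau k w <= c k < tau k.+1 w.
  by apply: (@clamp_between R _ Om wait s t); rewrite lexx.
set Z := fun r (_ : unit) => fiber k w (W k.*2.+2 w') r.
have rZ (x : unit) r : 0 <= r -> Z q x @[q --> r^'+] --> Z r x by exact: fiber_rc.
have p0' : 0 <= c k - tau k w by rewrite subr_ge0.
have pq : c k - tau k w <= c k.+1 - tau k w by rewrite lerD2r ltW.
have := @mg_increment R n _ unit Z rZ u (A u) bf tt _ _ p0' pq.
rewrite /Z => ->.
have pm r : tau k w <= r -> piece k r (mix w') = fiber k w (W k.*2.+2 w') (r - tau k w).
  by move=> hr; rewrite /piece tau_mix cycle_mix // subr_ge0.
rewrite /motion_part !tau_mix (pm _ k1) (pm (c k.+1)); last exact: le_trans k1 (ltW cl).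
congr (_ - _); rewrite /int_piece !tau_mix.
have rp := @rc_measurable R n (fiber k w (W k.*2.+2 w')) (@fiber_rc k w (W k.*2.+2 w')).
have bd := drift_bmf bf rp.
rewrite (drift_max (A u) (fiber k w (W k.*2.+2 w')) (c k.+1 - tau k w) p0').
have bs := bmf_comp bd (shift_measurable (- tau k w)).
rewrite -[RHS](_ : \int[mu]_(r in `[c k, c k.+1]) A u (fiber k w (W k.*2.+2 w') (Num.max (r - tau k w) 0)) = _).
  apply: eq_Rintegral => r; rewrite inE /= in_itv /= => /andP[r1 _].
  have r2 : tau k w <= r := le_trans k1 r1.
  by rewrite (pm r r2) max_l // subr_ge0.
rewrite (Rint_shift (tau k w) (c k) (c k.+1) bs); apply: eq_Rintegral => r _.
by rewrite /= addrK.
Qed.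

(** Up to time s the process shows frozen values before the k-th arrival and the fiber afterwards,
    the latter for a duration at most [c k - tau k w], because s <= [c k]. *)
Lemma section_filtration S : c k < c k.+1 -> natural_filtration Y s S ->
  exists2 B, natural_filtration (fun r v => fiber k w v r) (c k - tau k w) B &
    mix @^-1` S = W k.*2.+2 @^-1` B.
Proof.
move=> cl FS; have hk : forall r, c k <= r < c k.+1 -> tau k w <= r < tau k.+1 w.
  by move=> r; exact: (@clamp_between R _ Om wait s t).
have /andP[k1 k2] : tau k w <= c k < tau k.+1 w by apply: hk; rewrite lexx.
have sk : s <= c k by have /andP[] := clamp_itv st (tau k w).
suff : [set S' | exists2 B, natural_filtration (fun r v => fiber k w v r) (c k - tau k w) B &
    S' = W k.*2.+2 @^-1` B] (mix @^-1` S) by [].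
apply: (gen_preimage _ _ FS); first by apply: preimage_sigma_algebra; exact: gen_sigma_algebra.
move=> _ [r [B [/andP[r0 rs] mB ->]]].
(* Before the k-th arrival the value is frozen, so the section of the event is everything or
   nothing. *)
have [rk|kr] := ltP r (tau k w).
  have e w' : Y r (mix w') = Y r w.
    by apply: (@concat_eq k); [rewrite r0|move=> i ik; apply: but_mix; lia].
  have [hB|hB] := pselect (B (Y r w)).
    exists setT; last by apply/seteqP; split=> w' //= _; rewrite e.
    by rewrite /natural_filtration; exact: (@measurableT _ (g_sigma_algebraType _)).
  exists set0; first by rewrite /natural_filtration; exact: (@measurable0 _ (g_sigma_algebraType _)).
  by apply/seteqP; split=> w' //=; rewrite e.
exists ((fun v => fiber k w v (r - tau k w)) @^-1` B).
  apply: sub_sigma_algebra; exists (r - tau k w), B; split=> //.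
  by rewrite subr_ge0 kr /= lerD2r; lra.
have e w' : Y r (mix w') = fiber k w (W k.*2.+2 w') (r - tau k w).
  rewrite (glued_on wait_gt0 hN piece (k := k)); last by rewrite !tau_mix kr /=; lra.
  by rewrite /piece tau_mix cycle_mix // subr_ge0.
by apply/seteqP; split=> w' /=; rewrite e.
Qed.

End Motion.

Lemma motion_mean0 s t u k S : 0 <= s -> s <= t -> dom u -> natural_filtration Y s S ->
  \int[P]_(w in S) motion_part wait piece s t u (A u) k w = 0.
Proof.
move=> s0 st du FS; have [cu bu bf] := dom_facts hA du.
have mS := natural_filtration_measurable concat_measurable FS.
have bX := motion_bmf wait_measurable wait_gt0 piece_joint s0 st bu bf k.
have [N0 nN hN0] := fiber_martingale k du.
apply: (mixing_Rint0 (hmix (but_eventually k.*2.+2)) mS bX nN).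
move=> w /hN0 {}hN0; have ck := clampS wait_gt0 s t k w.
have tm j w' : tau j (mixf (but k.*2.+2) w w') = tau j w.
  by apply: arrival_dep => i ij; apply: but_mix; lia.
(* If the cycle does not meet [s, t] in an interval, its contribution is zero. *)
have [cl|cl] := ltP (clamp s t (tau k w)) (clamp s t (tau k.+1 w)); last first.
  transitivity (\int[P]_w' (0 : R)); last by rewrite Rint_prob_cst.
  apply: eq_Rintegral => w' _; have e : clamp s t (tau k.+1 w) = clamp s t (tau k w).
    by apply/eqP; rewrite eq_le cl ck.
  by rewrite /motion_part /int_piece !tm e set_itv1 Rintegral_set1 subrr subr0 mulr0.
have [B FB eB] := section_filtration s0 st cl FS.
have p0' : 0 <= clamp s t (tau k w) - tau k w.
  rewrite subr_ge0; have /andP[h _] : tau k w <= clamp s t (tau k w) < tau k.+1 w.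
    by apply: (@clamp_between R _ Om wait s t); rewrite lexx.
  exact: h.
have pq : clamp s t (tau k w) - tau k w <= clamp s t (tau k.+1 w) - tau k w.
  by rewrite lerD2r ltW.
etransitivity; last exact: (hN0 _ _ B p0' pq FB).
apply: eq_Rintegral => w' _.
have e1 : \1_S (mixf (but k.*2.+2) w w') = \1_(W k.*2.+2 @^-1` B) w' :> R.
  by rewrite -eB !indicE.
by rewrite (motion_part_mix s0 st w' bf cl) e1.
Qed.

Lemma concat_solution : Dpi_solution Phi C dom (jump_operator A lam a) P (concatenation cycle_proc wait N).
Proof.
apply: solution_intro; [exact: concat_measurable|exact: concat_Dpi|].
move=> u du; have [cu bu bf] := dom_facts hA du.
have msig : measurable_fun setT (reflection a : borel_rV R n -> borel_rV R n).
  by apply: continuous_borelV; exact: reflection_continuous.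
split; [exact: bu|exact: (jump_gen_bmf msig bu bf lam)|move=> s t S s0 st FS].
apply: (glued_martingale_step wait_measurable wait_gt0 hN piece_joint piece_rc piece_glue msig
  s0 st bu bf lam0 wait_law concat_resample _ FS).
by move=> k S' FS'; exact: motion_mean0.
Qed.

(** * Independence and the Markov property of the cycles *)

Lemma wait_exponential k : exponential_rv P lam (wait k).
Proof.
split; [exact: wait_measurable|by move=> w; exact/ltW/wait_gt0|].
by move=> B mB; exact: wait_law.
Qed.

Definition only (j : nat) : pred nat := fun i => i == j.

Lemma only_eventually j : eventually_const (only j).
Proof. by exists j.+1 => i ij; rewrite /only !gtn_eqF. Qed.

Lemma only_mix j w w' i : i != j -> W i (mixf (only j) w w') = W i w'.
Proof. by move=> ij; rewrite Wmix ?/only ?(negbTE ij) //; exact: only_eventually. Qed.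

Lemma only_mix_at j w w' : W j (mixf (only j) w w') = W j w.
Proof. by rewrite Wmix ?/only ?eqxx //; exact: only_eventually. Qed.

Lemma wait_independent (K : seq nat) (B : nat -> set R) : uniq K ->
  (forall k, measurable (B k)) ->
  P (\bigcap_(k in [set` K]) wait k @^-1` B k) = (\prod_(k <- K) P (wait k @^-1` B k))%E.
Proof.
move=> uK mB; have mw k : measurable (wait k @^-1` B k).
  exact: (fun_preimage_measurable (wait_measurable k)).
elim: K uK => [_|k K IH /= /andP[kK uK]].
  by rewrite big_nil set_nil bigcap_set0; exact: probability_setT.
have -> : [set` k :: K] = k |` [set` K].
  apply/seteqP; split=> i /=; rewrite inE; first by move=> /orP[/eqP ->|]; [left|right].
  by move=> [->|->]; rewrite ?eqxx ?orbT.
rewrite big_cons -IH // bigcap_setU1.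
apply: (mixing_indep (hmix (only_eventually k.*2.+1))) => //.
- by apply: bigcap_measurableType => i _; exact: mw.
- by move=> w w'; rewrite /preimage /= /wait only_mix_at.
- move=> w w'; have e i : i \in K -> wait i (mixf (only k.*2.+1) w w') = wait i w'.
    move=> iK; rewrite /wait only_mix //; apply/eqP => h.
    by move: kK; rewrite (_ : k = i) ?iK //; lia.
  by split=> h i /= iK; have := h i iK; rewrite /preimage /= e.
Qed.

Lemma wait_poisson : poisson_process P lam N.
Proof.
exists wait; split; [exact: wait_exponential| |exact: hN].
by move=> K B; exact: wait_independent.
Qed.

Lemma family_measurable (I J : set nat) S : sigma_family cycle_proc wait I J S -> measurable S.
Proof.
move: S; apply: gen_measurable => S [[l [t [B [_ _ mB ->]]]]|[l [B [_ mB ->]]]].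
  exact: (fun_preimage_measurable (cycle_measurable l t)).
exact: (fun_preimage_measurable (wait_measurable l)).
Qed.

Lemma family_agree (I J : set nat) S w w' : sigma_family cycle_proc wait I J S ->
  (forall l t, I l -> cycle_proc l t w' = cycle_proc l t w) -> (forall l, J l -> wait l w' = wait l w) ->
  S w' <-> S w.
Proof.
move=> FS hX hD; apply: (gen_agree _ FS) => _ [[l [t [B [Il _ mB ->]]]]|[l [B [Jl mB ->]]]] /=.
  by rewrite hX.
by rewrite hD.
Qed.

(** Keep the single coordinate 2k+1 and redraw all others: the first event sees only what is kept,
    the second only what is redrawn. *)
Lemma cycle_independent k : independent P (sigma_family cycle_proc wait set0 [set k])
  (sigma_family cycle_proc wait [set l | (l <= k)%N] [set l | (l < k)%N]).
Proof.
move=> S1 S2 F1 F2; apply: (mixing_indep (hmix (only_eventually k.*2.+1))).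
- exact: family_measurable F1.
- exact: family_measurable F2.
- move=> w w'; apply: (family_agree F1) => // l /= ->; by rewrite /wait only_mix_at.
- move=> w w'; apply: (family_agree F2) => [l t /= lk|l /= lk].
    by apply: cycle_dep => [i il|]; apply: only_mix; lia.
  by rewrite /wait only_mix //; lia.
Qed.

(* The cycles from the m-th on, as a function of their initial point and of an
   independent copy of the randomness. *)
Fixpoint later m j (p : borel_rV R n * Om) : borel_rV R n :=
  if j is j'.+1 then reflection a (start_path Phi C p0 (later m j' p)
    (Kf (origin (m + j')) (later m j' p, W (m + j').*2.+2 p.2)) (Num.max (wait (m + j') p.2) 0))
  else p.1.

Definition later_cycle m j t (p : borel_rV R n * Om) : V := start_path Phi C p0 (later m j p)
    (Kf (origin (m + j)) (later m j p, W (m + j).*2.+2 p.2)) (Num.max t 0).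

Lemma later_joint m j : measurable_fun setT (later m j) -> measurable_fun setT
  ((fun q : R * (borel_rV R n * Om) => later_cycle m j q.1 q.2) : _ -> borel_rV R n).
Proof.
move=> ml; have [mF _] := kernelP (m + j); have [mW _] := hW (m + j).*2.+2.
exact: (start_joint ml (measurableT_comp mW measurable_snd) mF).
Qed.

Lemma later_measurable m j : measurable_fun setT (later m j).
Proof.
elim: j => [|j IH]; first exact: measurable_fst.
have mw : measurable_fun setT (fun p : borel_rV R n * Om => (wait (m + j) p.2, p)).
  apply: measurable_fun_pair; last exact: measurable_id.
  exact: (measurableT_comp (wait_measurable (m + j)) measurable_snd).
have mr : measurable_fun setT (reflection a : borel_rV R n -> borel_rV R n).
  by apply: continuous_borelV; exact: reflection_continuous.
exact: (measurableT_comp mr (measurableT_comp (later_joint IH) mw)).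
Qed.

Definition upto (k : nat) : pred nat := fun i => (i <= k)%N.

Lemma upto_eventually k : eventually_const (upto k).
Proof. by exists k.+1 => i ik; rewrite /upto ltnn; apply/negbTE; rewrite -ltnNge. Qed.

Section Markov.
Variable k : nat.
Local Notation mix := (mixf (upto k.*2.+2)).

Lemma upto_mix w w' i : (i <= k.*2.+2)%N -> W i (mix w w') = W i w.
Proof. by move=> h; rewrite Wmix ?/upto ?h //; exact: upto_eventually. Qed.

Lemma upto_mix' w w' i : (k.*2.+2 < i)%N -> W i (mix w w') = W i w'.
Proof. by move=> h; rewrite Wmix ?/upto ?(leqNgt i) ?h //; exact: upto_eventually. Qed.

Lemma origin_later j w w' : origin (k.+1 + j) (mix w w') = later k.+1 j (origin k.+1 w, w').
Proof.
elim: j => [|j IH].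
  by rewrite addn0; apply: origin_dep => i ik; apply: upto_mix; lia.
rewrite addnS originS /cycle_proc IH /wait.
have i1 : (k.*2.+2 < (k.+1 + j).*2.+1)%N by lia.
have i2 : (k.*2.+2 < (k.+1 + j).*2.+2)%N by lia.
by rewrite (upto_mix' w w' i1) (upto_mix' w w' i2).
Qed.

Lemma cycle_later j t w w' :
  cycle_proc (k.+1 + j) t (mix w w') = later_cycle k.+1 j t (origin k.+1 w, w').
Proof.
have i2 : (k.*2.+2 < (k.+1 + j).*2.+2)%N by lia.
by rewrite /cycle_proc origin_later (upto_mix' w w' i2).
Qed.

(** When the coordinates after 2k+2 are redrawn, the cycles after the k-th become functions of the
    next starting point and of the fresh randomness. *)
Lemma future_section S :
  sigma_family cycle_proc wait [set l | (k < l)%N] [set l | (k < l)%N] S ->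
  exists2 B, measurable B & forall w w', S (mix w w') <-> B (origin k.+1 w, w').
Proof.
move=> FS; pose f (p : Om * Om) := mix p.1 p.2.
pose g (p : Om * Om) : borel_rV R n * Om := (origin k.+1 p.1, p.2).
suff [B mB e] : [set S' | exists2 B, measurable B & S' = g @^-1` B] (f @^-1` S).
  by exists B => // w w'; have := f_equal (fun S0 => S0 (w, w')) e; rewrite /f /g /preimage /= => ->.
apply: (gen_preimage _ _ FS); first by apply: preimage_sigma_algebra; exact: measurable_sigma.
move=> _ [[l [t [B [/= kl _ mB ->]]]]|[l [B [/= kl mB ->]]]]; rewrite -(subnKC kl).
  exists ((fun p => later_cycle k.+1 (l - k.+1) t p) @^-1` B).
    have m1 := measurableT_comp (later_joint (later_measurable k.+1 (l - k.+1)))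
      (@pair1_measurable _ _ R (borel_rV R n * Om)%type t).
    exact: (fun_preimage_measurable m1 mB).
  by apply/funext => -[w w']; rewrite /f /g /preimage /= cycle_later.
exists ((fun p => wait (k.+1 + (l - k.+1)) p.2) @^-1` B).
  exact: (fun_preimage_measurable (measurableT_comp (wait_measurable _) measurable_snd) mB).
by apply/funext => -[w w']; rewrite /f /g /preimage /= /wait upto_mix' //; lia.
Qed.

(** H is the probability, in the fresh randomness, of the section obtained in [future_section]: a
    regular version of the conditional probability of the future given the next start. *)
Lemma conditional_on_origin S2 : 
  sigma_family cycle_proc wait [set l | (k < l)%N] [set l | (k < l)%N] S2 ->
  exists2 H : borel_rV R n -> R, bmf H & forall S, measurable S ->
    (forall w w', S (mix w w') <-> S w) ->
    P (S `&` S2) = (\int[P]_(w in S) (H (origin k.+1 w))%:E)%E.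
Proof.
move=> F2; have m2 := family_measurable F2; have [B mB hB] := future_section F2.
have b1 : bmf (\1_B : borel_rV R n * Om -> R) by exact: bmf_indic.
have bH : bmf (fun x : borel_rV R n => \int[P]_w' \1_B (x, w') : R).
  exact: (bmf_Rint (m2 := P) measurableT (prob_lty P measurableT) b1).
exists (fun x => \int[P]_w' \1_B (x, w')) => // S mS hS.
have hm := hmix (upto_eventually k.*2.+2).
have bHo := bmf_comp bH (origin_measurable k.+1).
rewrite (Rint_EFin mS (prob_lty P mS) bHo).
have mSS := measurableI _ _ mS m2.
rewrite -[LHS]fineK; last exact: prob_fin.
rewrite -(Rint_prob P mSS); congr (_%:E).
have b2 : bmf (\1_(S `&` S2) : Om -> R) by exact: bmf_indic.
rewrite (Rint_image hm b2) (Rint_prod P P (bmf_comp b2 hm.1)) -[in RHS](setTI S) -(Rint_indic P setT mS bHo).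
apply: eq_Rintegral => w _; rewrite -RintZ //; last first.
- exact: (bmf_xsection b1).
- exact: prob_lty.
apply: eq_Rintegral => w' _ /=; rewrite indicI /=; congr (_ * _); rewrite !indicE; congr (nat_of_bool _)%:R.
  by apply/idP/idP; rewrite !inE => h; apply/(hS w w').
by apply/idP/idP; rewrite !inE => h; apply/(hB w w').
Qed.

(** The identity holds for the version H above. Any other version agrees with H almost everywhere
    for the law of the next start, and the reflected end point has the value of that start for every
    outcome. *)
Lemma cycle_markov S1 S2 (h : V -> R) :
  sigma_family cycle_proc wait [set l | (l <= k)%N] [set l | (l <= k)%N] S1 ->
  sigma_family cycle_proc wait [set l | (k < l)%N] [set l | (k < l)%N] S2 ->
  cond_prob_version P S2 (cycle_proc k.+1 0) h ->
  P (S1 `&` S2) = (\int[P]_(w in S1) (h (reflection a (cycle_proc k (wait k w) w)))%:E)%E.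
Proof.
move=> F1 F2; have -> : cycle_proc k.+1 0 = origin k.+1 by apply/funext => w; exact: cycle0.
move=> [mh ih hh]; have [H bH hH] := conditional_on_origin F2.
have m1 := family_measurable F1; have mo := origin_measurable k.+1.
have dep1 w w' : S1 (mix w w') <-> S1 w.
  apply: (family_agree F1) => [l t /= lk|l /= lk].
    by apply: cycle_dep => [i il|]; apply: upto_mix; lia.
  by rewrite /wait upto_mix //; lia.
rewrite hH //.
pose nu := measure_function_pushforward__canonical__measure_function_Measure P mo.
have inu : nu.-integrable setT (EFin \o h).
  apply: integrable_pushforward => //; first exact/measurable_EFinP.
have bHo := bmf_comp bH mo.
have iH : P.-integrable setT (EFin \o (H \o origin k.+1)).
  exact: (bmf_integrable measurableT (prob_lty P measurableT) bHo).
(* [conditional_on_origin] on preimages of Borel sets shows that h and H have the same integrals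
   against the law of the start. *)
have aeq : ae_eq nu setT (EFin \o h) (EFin \o H).
  apply: integral_ae_eq => //; first by apply/measurable_EFinP; case: bH.
  move=> B _ mB.
  have mBo : measurable (origin k.+1 @^-1` B) by exact: fun_preimage_measurable.
  have i1 : P.-integrable (origin k.+1 @^-1` B) ((EFin \o h) \o origin k.+1).
    exact: (integrableS measurableT mBo (@subsetT _ _) ih).
  have i2 : P.-integrable (origin k.+1 @^-1` B) ((EFin \o H) \o origin k.+1).
    exact: (integrableS measurableT mBo (@subsetT _ _) iH).
  have mh' : measurable_fun setT (EFin \o h : borel_rV R n -> \bar R) by exact/measurable_EFinP.
  have mH' : measurable_fun setT (EFin \o H : borel_rV R n -> \bar R).
    by apply/measurable_EFinP; case: bH.
  rewrite /nu (integral_pushforward mo mh' i1 mB) (integral_pushforward mo mH' i2 mB).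
  rewrite [LHS](hh B mB) setIC hH //.
  move=> w w'; have e : origin k.+1 (mix w w') = origin k.+1 w.
    by apply: origin_dep => i ik; apply: upto_mix; lia.
  by change (B (origin k.+1 (mix w w')) <-> B (origin k.+1 w)); rewrite e.
have [N0 [mN N00] hN0] := null_ae aeq.
apply: ae_eq_integral => //.
- by apply: measurable_funTS; apply/measurable_EFinP; case: bHo.
- apply: measurable_funTS; apply/measurable_EFinP.
  rewrite (_ : (fun w => _) = h \o origin k.+1); first exact: (measurableT_comp mh mo).
  by apply/funext => w; exact: (f_equal h (esym (originS k w))).
exists (origin k.+1 @^-1` N0); split=> //; first exact: fun_preimage_measurable.
move=> w /= nw; apply: contrapT => nN; apply: nw => _.
have e := hN0 (origin k.+1 w) nN I.
exact: (etrans (esym e) (f_equal (fun x => (h x)%:E) (originS k w))).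
Qed.

End Markov.

Lemma cycle_concatenable (nu : probability (borel_rV R n) R) : has_law P x0 nu ->
  concatenable P Phi C dom A nu lam a cycle_proc wait.
Proof.
move=> h0; split.
- exact: cycle_solution.
- by move=> B mB; rewrite -h0 //; congr (P _); apply/funext => w; rewrite /preimage /= cycle0.
- exact: wait_exponential.
- exact: cycle_independent.
- by move=> k S1 S2 h; exact: cycle_markov.
Qed.

End Construction.

(** * Consequences of solvability, and the first assertion *)

Section Solvable.
Context {R : realType} {n : nat}.
Local Notation V := 'rV[R]_n.
Variables Phi C : set V.
Local Notation E := (regular_set Phi).
Local Notation proj := (chamber_proj Phi C).
Hypothesis hPhi : root_system Phi.
Variables (dom : set (V -> R)) (A : (V -> R) -> (V -> R)).
Hypothesis hA : linear_operator E dom A.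
Hypothesis hsol : forall nu : probability (borel_rV R n) R, nu E = 1%E ->
  exists (d : measure_display) (T : measurableType d) (P : probability T R) (X : R -> T -> V),
    Dpi_solution_from Phi C dom A nu P X.

Lemma borel_regular : measurable (E : set (borel_rV R n)).
Proof. by apply: borel_open; exact: open_regular. Qed.

(** A solution whose initial law is the point mass at x has an outcome starting at x. An admissible
    path has its projection in C, so this also gives [solvable_projC]. *)
Lemma path_from x : E x -> exists2 w, Dpi_path Phi C w & w 0 = x.
Proof.
move=> Ex; have [U _] := @uniform01_exists R.
have mc : measurable_fun setT ((fun _ => x) : R -> borel_rV R n) by exact: measurable_cst.
have [nu hnu] := image_prob U mc.
have nu1 (B : set (borel_rV R n)) : measurable B -> B x -> nu B = 1%E.
  move=> mB Bx; rewrite hnu // (_ : _ @^-1` B = setT); first exact: probability_setT.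
  by apply/seteqP; split=> v.
have nuE : nu E = 1%E by apply: nu1 => //; exact: borel_regular.
have [d [T [P [X [[_ DX _] law]]]]] := hsol nuE.
have mx : measurable ([set x] : set (borel_rV R n)).
  by apply: borel_closed; apply: accessible_closed_set1; apply: hausdorff_accessible; exact: norm_hausdorff.
have hx : P (X 0 @^-1` [set x]) = 1%E by rewrite law // nu1.
have [w hw] : X 0 @^-1` [set x] !=set0.
  apply/set0P/eqP => h0; rewrite h0 measure0 in hx.
  by have : (0 : R)%:E = 1%:E := hx; move=> [] /eqP; rewrite eq_sym oner_eq0.
by exists (X^~ w); [exact: DX|exact: hw].
Qed.

Lemma solvable_projC x : E x -> C (proj x).
Proof. by move=> /path_from[w [_ _ _ _ h] <-]; exact: h. Qed.

Hypothesis projc : forall x, E x -> {for x, continuous proj}.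
Variable p0 : V.
Hypothesis Ep0 : E p0.
Variable U : probability R R.
Hypothesis hU : uniform01 U.
Context d (Om : measurableType d) (P : probability Om R).

(** Solvability is applied to the law of the random start x, and the solution obtained is
    disintegrated; choice is made over the functions x. *)
Lemma kernel_family : exists Kf : (Om -> borel_rV R n) -> (borel_rV R n * R -> R),
  forall x : Om -> borel_rV R n, measurable_fun setT x -> (forall w, E (x w)) ->
    kernel_prop Phi C p0 dom A U P x (Kf x).
Proof.
suff /choice[Kf hKf] : forall x : Om -> borel_rV R n, exists F : borel_rV R n * R -> R,
    measurable_fun setT x -> (forall w, E (x w)) -> kernel_prop Phi C p0 dom A U P x F.
  by exists Kf.
move=> x; have [[mx Ex]|h] := pselect (measurable_fun setT x /\ forall w, E (x w)); last first.
  by exists (fun=> 0) => mx Ex; exfalso; apply: h.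
have [nu hnu] := image_prob P mx.
have nuE : nu E = 1%E.
  rewrite hnu; last exact: borel_regular.
  rewrite (_ : x @^-1` E = setT); first exact: probability_setT.
  by apply/seteqP; split=> w // _; exact: Ex.
have [d' [T [P' [X [sol law]]]]] := hsol nuE; have [mX DX _] := sol.
have [F [mF hF]] := kernel_exists hPhi solvable_projC projc Ep0 mX DX law hU.
exists F => _ _; split=> // u du; have [cu bu bf] := dom_facts hA du.
have [N [mN N0] hN] := hF u (A u) cu bu bf
  (fun s t S s0 st FS => solution_Rint sol du s0 st FS).
exists (x @^-1` N); last by move=> w; exact: hN.
split; first exact: fun_preimage_measurable.
exact: (etrans (esym (hnu N mN)) N0).
Qed.

End Solvable.

Section PartOne.
Context {R : realType} {n : nat}.
Local Notation V := 'rV[R]_n.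

Lemma concatenation_exists (Phi C : set V) (lam : R) (a : V) (dom : set (V -> R))
    (A : (V -> R) -> (V -> R)) :
  root_system Phi -> weyl_chamber Phi C -> 0 < lam -> Phi a ->
  linear_operator (regular_set Phi) dom A ->
  (forall nu : probability (borel_rV R n) R, nu (regular_set Phi) = 1%E ->
    exists (d : measure_display) (T : measurableType d) (P : probability T R) (X : R -> T -> V),
      Dpi_solution_from Phi C dom A nu P X) ->
  forall nu : probability (borel_rV R n) R, nu (regular_set Phi) = 1%E ->
  exists (d : measure_display) (T : measurableType d) (P : probability T R)
    (X : nat -> R -> T -> V) (D : nat -> T -> R) (N : R -> T -> nat),
    [/\ concatenable P Phi C dom A nu lam a X D, counting_process D N, poisson_process P lam N &
      Dpi_solution_from Phi C dom (jump_operator A lam a) nu P (concatenation X D N)].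
Proof.
move=> hPhi hC lam0 ha hA hsol nu nuE.
have projC := solvable_projC hPhi hsol.
have projc := chamber_proj_continuous hPhi hC projC (ex_intro _ a ha).
have [p0 Ep0 _] := hC.
have [U hU] := @uniform01_exists R.
have [d [Om [P [W [mixf [hW hmix Wmix divW]]]]]] := iid_exists hU lam0.
have [Kf hKf] := kernel_family hPhi hA hsol projc Ep0 hU P.
have [phi [mphi hphi] Ephi] := regular_sampler hPhi hU nuE Ep0.
pose x0 w := phi (W 0%N w).
have [mW0 hW0] := hW 0%N.
have mx0 : measurable_fun setT x0 by exact: (measurableT_comp mphi mW0).
have Ex0 w : regular_set Phi (x0 w) by exact: Ephi.
have x0_dep w w' : W 0%N w' = W 0%N w -> x0 w' = x0 w by move=> e; rewrite /x0 e.
have law0 : has_law P x0 nu.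
  move=> B mB; rewrite -hphi // -hW0 //.
  exact: fun_preimage_measurable.
have [N hN] := counting_exists (wait_gt0 lam0 W) divW.
exists d, Om, P, (cycle_proc Phi C p0 a lam W x0 Kf), (wait lam W), N; split.
- exact: (cycle_concatenable hPhi projC projc Ep0 ha lam0 hA hU hW hmix Wmix mx0 Ex0 x0_dep hKf law0).
- exact: hN.
- exact: (wait_poisson lam0 hU hW hmix Wmix hN).
split.
  exact: (concat_solution hPhi projC projc Ep0 ha lam0 hA hU hW hmix Wmix mx0 Ex0 x0_dep hKf hN).
move=> B mB; rewrite -law0 //; congr (P _); apply/funext => w.
rewrite /preimage /concatenation /=.
have -> : N 0 w = 0%N.
  by apply: (counting_eq (wait_gt0 lam0 W) hN); rewrite arrival0 lexx arrivalS arrival0 add0r wait_gt0.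
by rewrite arrival0 subrr cycle0.
Qed.

End PartOne.

(** * Products of probability spaces *)

Section ProductSpace.
Context {R : realType} d1 (T : measurableType d1) d2 (Om : measurableType d2).
Variables (P1 : probability T R) (P2 : probability Om R).
Local Notation PP := (P1 \x P2)%E.

Lemma fst_image : has_image PP P1 (fst : T * Om -> T).
Proof.
split; first exact: measurable_fst.
move=> B mB; rewrite (_ : fst @^-1` B = B `*` setT); last first.
  by apply/seteqP; split=> -[x w] //= [].
apply: (etrans (product_measure1E P1 P2 mB measurableT)).
exact: (etrans (f_equal (fun x => P1 B * x)%E (probability_setT P2)) (mule1 _)).
Qed.

Lemma snd_image : has_image PP P2 (snd : T * Om -> Om).
Proof.
split; first exact: measurable_snd.
move=> B mB; rewrite (_ : snd @^-1` B = setT `*` B); last first.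
  by apply/seteqP; split=> -[x w] //= [].
apply: (etrans (product_measure1E P1 P2 measurableT mB)).
exact: (etrans (f_equal (fun x => x * P2 B)%E (probability_setT P1)) (mul1e _)).
Qed.

Lemma product_independent S1 S2 : measurable S1 -> measurable S2 ->
  PP (fst @^-1` S1 `&` snd @^-1` S2) = (PP (fst @^-1` S1) * PP (snd @^-1` S2))%E.
Proof.
move=> m1 m2; rewrite fst_image.2 // snd_image.2 // -(product_measure1E P1 P2 m1 m2).
by congr (_ _); apply/seteqP; split=> -[x w].
Qed.

(** The first coordinate of the copy is integrated out, and what remains is the mixing property of
    the second factor. *)
Lemma mixing_snd (mix : Om -> Om -> Om) : mixing P2 P2 mix ->
  mixing PP PP (fun z z' => (z.1, mix z.2 z'.2)).
Proof.
move=> [mm hm]; pose f (q : (T * Om) * (T * Om)) := (q.1.1, mix q.1.2 q.2.2).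
have mf : measurable_fun setT f.
  apply: measurable_fun_pair.
    exact: (measurableT_comp measurable_fst measurable_fst).
  apply: (measurableT_comp mm (g := fun q : (T * Om) * (T * Om) => (q.1.2, q.2.2))).
  apply: measurable_fun_pair.
    exact: (measurableT_comp measurable_snd measurable_fst).
  exact: (measurableT_comp measurable_snd measurable_snd).
split=> [|B mB]; first exact: mf.
have mfB : measurable (f @^-1` B) by exact: fun_preimage_measurable.
have b1 : bmf (\1_B : T * Om -> R) by exact: bmf_indic.
rewrite -[LHS]fineK; last exact: prob_fin.
rewrite -[RHS]fineK; last exact: prob_fin.
rewrite -(Rint_prob _ mfB) -(Rint_prob _ mB); congr (_%:E).
have bf1 : bmf (fun q => \1_B (f q) : R) := bmf_comp b1 mf.
pose Q : probability (T * Om)%type R := PP.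
transitivity (\int[(Q \x Q)%E]_q \1_B (f q)).
  by apply: eq_Rintegral => q _; rewrite !indicE.
rewrite (Rint_prod Q Q bf1).
have bw x : bmf (fun w : Om => \1_B (x, w) : R) by exact: (bmf_xsection b1 x).
have bi : bmf (fun z : T * Om => \int[P2]_w' \1_B (z.1, mix z.2 w') : R).
  have bq : bmf (fun q : (T * Om) * Om => \1_B (q.1.1, mix q.1.2 q.2) : R).
    apply: (bmf_comp (g := fun q : (T * Om) * Om => (q.1.1, mix q.1.2 q.2)) b1).
    apply: measurable_fun_pair.
      exact: (measurableT_comp measurable_fst measurable_fst).
    apply: (measurableT_comp mm (g := fun q : (T * Om) * Om => (q.1.2, q.2))).
    apply: measurable_fun_pair; last exact: measurable_snd.
    exact: (measurableT_comp measurable_snd measurable_fst).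
  exact: (bmf_Rint (m2 := P2) measurableT (prob_lty P2 measurableT) bq).
transitivity (\int[Q]_z (\int[P2]_w' \1_B (z.1, mix z.2 w') : R)).
  apply: eq_Rintegral => z _.
  have bz : bmf (fun w' : Om => \1_B (z.1, mix z.2 w') : R).
    apply: (bmf_comp (bw z.1)); apply: (measurableT_comp mm (g := fun w' => (z.2, w'))).
    exact: pair1_measurable.
  by rewrite (Rint_image snd_image bz).
rewrite (Rint_prod P1 P2 bi) (Rint_prod P1 P2 b1); apply: eq_Rintegral => x _.
rewrite (Rint_image (conj mm hm) (bw x)) (Rint_prod P2 P2 (bmf_comp (bw x) mm)).
by [].
Qed.

End ProductSpace.

Lemma natural_filtration_mono (R : realType) n (T : Type) (Z : R -> T -> 'rV[R]_n) s t :
  s <= t -> natural_filtration Z s `<=` natural_filtration Z t.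
Proof.
move=> st; apply: gen_mono => S [r [B [/andP[r0 rs] mB ->]]].
by apply: sub_sigma_algebra; exists r, B; rewrite r0 (le_trans rs st).
Qed.

(** * The second assertion: reflecting one solution at the jumps of an independent Poisson
    process *)

Section PartTwo.
Context {R : realType} {n : nat}.
Local Notation V := 'rV[R]_n.
Variables Phi C : set V.
Local Notation E := (regular_set Phi).
Local Notation proj := (chamber_proj Phi C).
Hypothesis hPhi : root_system Phi.
Hypothesis projC : forall x, E x -> C (proj x).
Hypothesis projc : forall x, E x -> {for x, continuous proj}.
Variables (a : V) (lam : R).
Hypotheses (ha : Phi a) (lam0 : 0 < lam).
Variables (dom : set (V -> R)) (A : (V -> R) -> (V -> R)).
Hypothesis hA : linear_operator E dom A.
Hypothesis invariant : forall u, dom u -> dom (u \o reflection a) /\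
  forall x, E x -> A (u \o reflection a) x = A u (reflection a x).
Context d1 (T : measurableType d1) (PT : probability T R) (X : R -> T -> V).
Hypothesis solX : Dpi_solution Phi C dom A PT X.
Variable U : probability R R.
Hypothesis hU : uniform01 U.
Context d2 (Om : measurableType d2) (PO : probability Om R).
Variables (W : nat -> Om -> R) (mixf : pred nat -> Om -> Om -> Om) (N : R -> Om -> nat).
Hypothesis hW : forall i, has_image PO U (W i).
Hypothesis hmix : forall K, eventually_const K -> mixing PO PO (mixf K).
Hypothesis Wmix : forall K, eventually_const K -> forall w w' i,
  W i (mixf K w w') = if K i then W i w else W i w'.
Hypothesis hN : counting_process (wait lam W) N.
Local Notation TT := (T * Om)%type.
Local Notation PP := (PT \x PO)%E.
Local Notation D := (fun k (z : TT) => wait lam W k z.2).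
Local Notation NN := (fun t (z : TT) => N t z.2).
Local Notation XX := (fun t (z : TT) => X t z.1).
Local Notation sig k := (iter k (reflection a)).

Let mX t (t0 : 0 <= t) : measurable_fun setT (X t : T -> borel_rV R n).
Proof. by have [h _ _] := solX; exact: h. Qed.

Let DX w : Dpi_path Phi C (X^~ w).
Proof. by have [_ h _] := solX; exact: h. Qed.

Let rX w t : 0 <= t -> X s w @[s --> t^'+] --> X t w.
Proof. by move=> t0; exact: (Dpi_rc (DX w) t0). Qed.

Let XE w t : 0 <= t -> E (X t w).
Proof. by move=> t0; have [h _ _ _ _] := DX w; exact: h. Qed.

(** The commutation is assumed on E only; it can be iterated because reflections preserve E. *)
Lemma iter_invariant k u : dom u -> dom (u \o sig k) /\
  forall x, E x -> A (u \o sig k) x = A u (sig k x).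
Proof.
elim: k u => [|k IH] u du; first by split.
have [du1 h1] := invariant du; have [du2 h2] := IH _ du1; split; first exact: du2.
move=> x Ex; rewrite [LHS](h2 x Ex) h1 //.
by elim: k {IH du2 h2} => // k IH; exact: (reg_refl hPhi ha IH).
Qed.

Lemma iter_reflection_measurable k :
  measurable_fun setT (sig k : borel_rV R n -> borel_rV R n).
Proof.
have mr : measurable_fun setT (reflection a : borel_rV R n -> borel_rV R n).
  by apply: continuous_borelV; exact: reflection_continuous.
elim: k => [|k IH]; first exact: measurable_id.
exact: (measurableT_comp mr IH).
Qed.

Lemma lift_solution : Dpi_solution Phi C dom A PP XX.
Proof.
have mXX t : 0 <= t -> measurable_fun setT (XX t : TT -> borel_rV R n).
  by move=> t0; exact: (measurableT_comp (mX t0) measurable_fst).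
apply: solution_intro; [exact: mXX|by move=> z; exact: DX|].
move=> u du; have [cu bu bf] := dom_facts hA du; split; [exact: bu|exact: bf|].
move=> s t S s0 st FS.
have [S0 F0 ->] : [set S' | exists2 S0, natural_filtration X s S0 & S' = fst @^-1` S0] S.
  have := gen_preimage (f := idfun) (preimage_sigma_algebra (fst : TT -> T) (@gen_sigma_algebra T
    [set S | exists s' (B : set (borel_rV R n)), [/\ 0 <= s' <= s, measurable B & S = X s' @^-1` B]])) _ FS.
  apply => _ [r [B [/andP[r0 rs] mB ->]]]; exists (X r @^-1` B) => //.
  by apply: sub_sigma_algebra; exists r, B; rewrite r0.
have m0 := natural_filtration_measurable mX F0.
have mS : measurable ((fst : TT -> T) @^-1` S0) by exact: (fun_preimage_measurable measurable_fst m0).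
have e r : 0 <= r -> \int[PP]_(z in fst @^-1` S0) mg u (A u) (X^~ z.1) r =
    \int[PT]_(w in S0) mg u (A u) (X^~ w) r.
  move=> r0; have bM : bmf (fun w => mg u (A u) (X^~ w) r) := mg_bmf mX rX bu bf r0.
  have bSM : bmf (fun w => \1_S0 w * mg u (A u) (X^~ w) r) by apply: bmfM => //; exact: bmf_indic.
  have bMM := bmf_comp bM (@measurable_fst _ _ T Om).
  rewrite -[X in Rintegral _ X]setTI -(Rint_indic PP setT mS bMM).
  rewrite -[S0 in RHS]setTI -(Rint_indic PT setT m0 bM).
  rewrite (Rint_image (fst_image PT PO) bSM).
  by apply: eq_Rintegral => z _; congr (_ * _); rewrite !indicE.
by rewrite (e t (le_trans s0 st)) (e s s0); exact: (solution_Rint solX).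
Qed.

Lemma lift_poisson : poisson_process PP lam NN.
Proof.
exists D; have [_ h2] := snd_image PT PO; split.
- move=> k; have [m1 m2 m3] := wait_exponential lam0 hU hW k; split.
  + exact: (measurableT_comp m1 measurable_snd).
  + by move=> z; exact: m2.
  + move=> B mB; rewrite -m3 // -h2 //; exact: fun_preimage_measurable.
- move=> K B uK mB.
  have mw k : measurable (wait lam W k @^-1` B k).
    exact: (fun_preimage_measurable (wait_measurable lam hW k)).
  have := wait_independent lam0 hW hmix Wmix uK mB.
  rewrite -h2; last by apply: bigcap_measurableType => k _; exact: mw.
  move=> h; apply: (etrans h); apply: eq_bigr => k _; rewrite -h2 //.
- by move=> t z t0; exact: hN.
Qed.

Lemma lift_independent : independent PP (sigma_process XX) (sigma_counting NN).
Proof.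
move=> S1 S2 F1 F2.
have [B1 m1 ->] : [set S' | exists2 B, measurable B & S' = (fst : TT -> T) @^-1` B] S1.
  apply: (gen_preimage (f := idfun) _ _ F1); first by apply: preimage_sigma_algebra; exact: measurable_sigma.
  move=> _ [t [B [t0 mB ->]]]; exists (X t @^-1` B) => //.
  exact: (fun_preimage_measurable (mX t0) mB).
have [B2 m2 ->] : [set S' | exists2 B, measurable B & S' = (snd : TT -> Om) @^-1` B] S2.
  apply: (gen_preimage (f := idfun) _ _ F2); first by apply: preimage_sigma_algebra; exact: measurable_sigma.
  move=> _ [t [B [t0 ->]]]; exists (N t @^-1` B) => //.
  rewrite (_ : _ @^-1` B = [set w | exists k, B k /\ N t w = k]).
    apply: set_exists_measurable => k; have [Bk|nB] := pselect (B k).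
      rewrite (_ : (fun w => _) = [set w | N t w = k]).
        exact: (counting_measurable (wait_measurable lam hW) (wait_gt0 lam0 W) hN).
      by apply/seteqP; split=> w /=; [move=> []|split].
    by rewrite (_ : (fun w => _) = set0) //; apply/seteqP; split=> w // [].
  by apply/seteqP; split=> w /=; [exists (N t w)|move=> [k [Bk ->]]].
exact: product_independent.
Qed.

Definition reflected k (t : R) (z : TT) : V := sig k (X t z.1).

Let DD0 k (z : TT) : 0 < D k z. Proof. exact: wait_gt0. Qed.

Let mDD k : measurable_fun setT (D k).
Proof. exact: (measurableT_comp (wait_measurable lam hW k) measurable_snd). Qed.

Let hNN : counting_process D NN. Proof. by move=> t z t0; exact: hN. Qed.

Local Notation tau := (arrival D).

Lemma reflected_joint k : measurable_fun setT
  ((fun p => reflected k (Num.max p.1 0) p.2) : R * TT -> borel_rV R n).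
Proof.
have m2 : measurable_fun setT (fun p : R * TT => (p.1, p.2.1)).
  apply: measurable_fun_pair; first exact: measurable_fst.
  exact: (measurableT_comp measurable_fst measurable_snd).
exact: (measurableT_comp (iter_reflection_measurable k) (measurableT_comp (joint_measurable mX rX) m2)).
Qed.

Let tau_ge0 k z : 0 <= tau k z. Proof. exact: (arrival_ge0 DD0). Qed.

Let DR k z : Dpi_path Phi C (reflected k ^~ z).
Proof. exact: (iter_reflection_Dpi hPhi projC projc ha k (DX z.1)). Qed.

Lemma reflected_rc k z t : tau k z <= t -> reflected k s z @[s --> t^'+] --> reflected k t z.
Proof. by move=> h; apply: (Dpi_rc (DR k z)); exact: le_trans h. Qed.

Local Notation Y := (glued NN reflected).

Lemma reflected_Dpi z : Dpi_path Phi C (Y ^~ z).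
Proof.
apply: (glued_Dpi hPhi projC projc ha DD0 hNN reflected_rc).
- move=> k w t h; have [hE _ _ _ _] := DR k w; apply: hE; exact: le_trans h.
- move=> k w t h; have /(Dpi_char projC projc)[_ _ h3] := DR k w.
  have [l [El ll pl]] := h3 t (le_lt_trans (tau_ge0 k w) h).
  by exists l.
- by [].
Qed.

Lemma reflected_measurable t : 0 <= t -> measurable_fun setT (Y t : TT -> borel_rV R n).
Proof. exact: (glued_measurable mDD DD0 hNN reflected_joint). Qed.

Lemma reflected_resample k : exists2 mix : TT -> TT -> TT, mixing PP PP mix &
  forall z z', [/\ tau k (mix z z') = tau k z, D k (mix z z') = D k z',
    forall r, reflected k r (mix z z') = reflected k r z &
    forall r, 0 <= r < tau k z -> Y r (mix z z') = Y r z].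
Proof.
exists (fun z z' => (z.1, mixf (but k.*2.+1) z.2 z'.2)).
  by apply: mixing_snd; exact: (hmix (but_eventually _)).
move=> z z'; set m := mixf _ _ _.
have te j : (j <= k)%N -> arrival D j (z.1, m) = arrival D j z.
  move=> jk; apply: eq_bigr => i _; rewrite /wait /m (but_mix Wmix) //.
  by have := ltn_ord i; lia.
split=> //.
- exact: te.
- by rewrite /wait /m (but_mix_at Wmix).
- move=> r /andP[r0 rk]; have /andP[h1 h2] := hNN z r0; set j := N r z.2 in h1 h2.
  have jk : (j < k)%N.
    by rewrite ltnNge; apply/negP => kj; have := arrival_le DD0 z kj; lra.
  rewrite (glued_on DD0 hNN reflected (k := j)); last by rewrite (te j (ltnW jk)) (te j.+1 jk) h1.
  by [].
Qed.

(** For a fixed outcome of the Poisson factor the clamped arrivals are numbers and sections of the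
    past of Y are in the past of X. The contribution is then an increment of the martingale of X for
    u composed with the k-th iterate of the reflection. *)
Lemma reflected_motion s t u k S : 0 <= s -> s <= t -> dom u -> natural_filtration Y s S ->
  \int[PP]_(z in S) motion_part D reflected s t u (A u) k z = 0.
Proof.
move=> s0 st du FS; have [cu bu bf] := dom_facts hA du.
have mS := natural_filtration_measurable reflected_measurable FS.
have bX := motion_bmf mDD DD0 reflected_joint s0 st bu bf k.
have bSX : bmf (fun z => \1_S z * motion_part D reflected s t u (A u) k z).
  by apply: bmfM => //; exact: bmf_indic.
rewrite -[S]setTI -(Rint_indic PP setT mS bX) (Rint_prod PT PO bSX).
rewrite (Rint_fubini (m1 := PT) (m2 := PO) measurableT measurableT (prob_lty PT measurableT)
  (prob_lty PO measurableT) bSX).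
transitivity (\int[PO]_w (0 : R)); last by rewrite Rint_prob_cst.
apply: eq_Rintegral => w _.
pose S0 := (fun x : T => (x, w)) @^-1` S.
pose tw j := arrival (wait lam W) j w.
have F0 : natural_filtration X s S0.
  apply: (gen_preimage _ _ FS); first exact: gen_sigma_algebra.
  move=> _ [r [B [/andP[r0 rs] mB ->]]]; apply: sub_sigma_algebra.
  exists r, (sig (N r w) @^-1` B); rewrite r0; split=> //.
  exact: (fun_preimage_measurable (iter_reflection_measurable (N r w)) mB).
pose c1 := clamp s t (tw k); pose c2 := clamp s t (tw k.+1).
have c12 : c1 <= c2 by exact: (clampS (wait_gt0 lam0 W) s t k w).
have sc1 : s <= c1 by have /andP[] := clamp_itv st (tw k).
have c10 : 0 <= c1 := le_trans s0 sc1.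
have Fc := natural_filtration_mono sc1 F0.
have [duk hk] := iter_invariant k du; have [_ buk bfk] := dom_facts hA duk.
have mS0 := natural_filtration_measurable mX F0.
have bM r : 0 <= r -> bmf (fun x => mg (u \o sig k) (A (u \o sig k)) (X^~ x) r).
  by move=> r0; exact: (mg_bmf mX rX buk bfk r0).
transitivity (\int[PT]_x (\1_S0 x * (mg (u \o sig k) (A (u \o sig k)) (X^~ x) c2 -
    mg (u \o sig k) (A (u \o sig k)) (X^~ x) c1))).
  apply: eq_Rintegral => x _; rewrite (mg_increment rX (u \o sig k) bfk x c10 c12).
  rewrite /motion_part /int_piece /reflected.
  have -> : \1_S (x, w) = \1_S0 x :> R by rewrite !indicE.
  congr (_ * (_ - _)).
  apply: eq_Rintegral => r; rewrite inE /= in_itv /= => /andP[r1 _].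
  (* The commutation is used at points of the path, which lie in E at nonnegative times. *)
  by rewrite -hk //; apply: XE; exact: le_trans c10 r1.
have bMM := bmfB (bM c2 (le_trans c10 c12)) (bM c1 c10).
rewrite (Rint_indic PT setT mS0 bMM) setTI.
rewrite (RintB mS0 (prob_lty PT mS0) (bM c2 (le_trans c10 c12)) (bM c1 c10)).
by rewrite (solution_Rint solX duk c10 c12 Fc) subrr.
Qed.

Lemma reflected_solution : Dpi_solution Phi C dom (jump_operator A lam a) PP
  (fun t z => sig (N t z.2) (X t z.1)).
Proof.
apply: solution_intro; [exact: reflected_measurable|exact: reflected_Dpi|].
move=> u du; have [cu bu bf] := dom_facts hA du.
have msig : measurable_fun setT (reflection a : borel_rV R n -> borel_rV R n).
  by apply: continuous_borelV; exact: reflection_continuous.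
have lawD k (B : set R) : measurable B -> PP (D k @^-1` B) = exponential_prob lam B.
  have [D' [hD _ _]] := lift_poisson.
  have [m1 _ m3] := wait_exponential lam0 hU hW k; have [_ h2] := snd_image PT PO.
  by move=> mB; rewrite -m3 // -h2 //; exact: fun_preimage_measurable.
split; [exact: bu|exact: (jump_gen_bmf msig bu bf lam)|move=> s t S s0 st FS].
apply: (glued_martingale_step mDD DD0 hNN reflected_joint reflected_rc _ msig
  s0 st bu bf lam0 lawD reflected_resample _ FS); first by [].
by move=> k S' FS'; exact: reflected_motion.
Qed.

Lemma reflected_start z : sig (N 0 z.2) (X 0 z.1) = X 0 z.1.
Proof.
have -> : N 0 z.2 = 0%N; last by [].
apply: (counting_eq (wait_gt0 lam0 W) hN).
by rewrite arrival0 lexx arrivalS arrival0 add0r wait_gt0.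
Qed.

End PartTwo.

Theorem lemma17 (R : realType) (n : nat) (Phi Rp C : set 'rV[R]_n)
    (lam : R) (a : 'rV[R]_n)
    (dom : set ('rV[R]_n -> R)) (A : ('rV[R]_n -> R) -> ('rV[R]_n -> R))
    (hPhi : root_system Phi) (hRp : positive_subsystem Phi Rp)
    (hC : weyl_chamber Phi C) (hlam : 0 < lam) (ha : Rp a)
    (hA : linear_operator (regular_set Phi) dom A)
    (hsol : forall nu : probability (borel_rV R n) R,
       nu (regular_set Phi) = 1%E ->
       exists (d : measure_display) (T : measurableType d)
         (P : probability T R) (X : R -> T -> 'rV[R]_n),
         Dpi_solution_from Phi C dom A nu P X) :
  (forall nu : probability (borel_rV R n) R,
     nu (regular_set Phi) = 1%E ->
     exists (d : measure_display) (T : measurableType d)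
       (P : probability T R) (X : nat -> R -> T -> 'rV[R]_n)
       (D : nat -> T -> R) (N : R -> T -> nat),
       [/\ concatenable P Phi C dom A nu lam a X D,
           counting_process D N,
           poisson_process P lam N &
           Dpi_solution_from Phi C dom (jump_operator A lam a) nu P
             (concatenation X D N)])
  /\
  ((forall u, dom u ->
      dom (u \o reflection a) /\
      forall x, regular_set Phi x ->
        A (u \o reflection a) x = A u (reflection a x)) ->
   forall nu : probability (borel_rV R n) R,
     nu (regular_set Phi) = 1%E ->
     exists (d : measure_display) (T : measurableType d)
       (P : probability T R) (X : R -> T -> 'rV[R]_n) (N : R -> T -> nat),
       [/\ Dpi_solution_from Phi C dom A nu P X,
           poisson_process P lam N,
           independent P (sigma_process X) (sigma_counting N) &
           Dpi_solution_from Phi C dom (jump_operator A lam a) nu P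
             (fun t w => iter (N t w) (reflection a) (X t w))]).
Proof.
have Pa : Phi a by move: ha; case: hRp => b _ -> [].
split; first exact: (concatenation_exists hPhi hC hlam Pa hA hsol).
move=> hinv nu nuE; have projC := solvable_projC hPhi hsol.
have projc := chamber_proj_continuous hPhi hC projC (ex_intro _ a Pa).
have [U hU] := @uniform01_exists R.
have [d2 [Om [PO [W [mixf [hW hmix Wmix divW]]]]]] := iid_exists hU hlam.
have [N hN] := counting_exists (wait_gt0 hlam W) divW.
have [d1 [T [PT [X [solX lawX]]]]] := hsol nu nuE.
pose P : probability (T * Om)%type R := (PT \x PO)%E.
have lawP : has_law P (fun z => X 0 z.1) nu.
  move=> B mB; rewrite -lawX //; apply: (fst_image PT PO).2.
  by have [mX _ _] := solX; exact: (fun_preimage_measurable (mX 0 (lexx 0)) mB).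
exists _, (T * Om)%type, P, (fun t z => X t z.1), (fun t z => N t z.2); split.
- split; [exact: lift_solution|exact: lawP].
- exact: (lift_poisson hlam PT hU hW hmix Wmix hN).
- exact: (lift_independent hlam solX hW hN).
split.
  exact: (reflected_solution hPhi projC projc Pa hlam hA hinv solX hU hW hmix Wmix hN).
move=> B mB; rewrite -lawP //; congr (P _); apply/funext => z.
by rewrite /preimage /= (reflected_start _ hlam _ hN).
Qed.
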